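(* The metric space $(\mathbb{H}^+, d_H/2)$ is a metric cone over $(\mathbb{P}, d_{FR}/2)$, where $\mathbb{H}^+$ is identified with the cone $\mathfrak C(\mathbb{P})$ via $G\simeq [G/r^2,r]$, with $r=r(G):=\sqrt{\operatorname{tr} G(\Omega)}$ (and the zero measure $G=0$ is identified with the apex of the cone).
   Context: Fix $d\ge 1$ and a separable, locally compact, metrizable space $\Omega$. On $\mathbb{C}^{d\times d}$ use the real Frobenius product $\Phi:\Psi=\operatorname{Re}\operatorname{tr}(\Phi^*\Psi)$ and norm $|\Phi|_2=\sqrt{\Phi:\Phi}$; $A^{Sym}=\frac12(A+A^* )$; $I$ is the identity matrix; $\mathcal H$ is the real vector space of Hermitian $d\times d$ matrices, $\mathcal H^+$ the positive-semidefinite ones. For an $\mathcal H$-valued Radon measure $G$ on $\Omega$, $\|G\|_{TV}=\sup\{|\int_\Omega dG:\Psi| : \Psi\in C_b(\Omega;\mathcal H),\ \sup_x|\Psi(x)|_2\le 1\}$. $\mathbb{H}^+$ is the set of $\mathcal H^+$-valued Radon measures with finite TV norm, and $\mathbb{P}=\{G\in\mathbb{H}^+:\ \operatorname{tr}G(\Omega)=1\}$. For $G\in\mathbb{H}^+$ with trace measure $\gamma=\operatorname{tr}G$ and density $g=\frac{dG}{d\gamma}$, write $\int_\Omega dG\,U:V=\int_\Omega (gU):V\,d\gamma$; $L^2(dG;\mathcal H)$ is the space of measurable $\mathcal H$-valued $U$ with $\|U\|^2_{L^2(dG)}=\int_\Omega dG\,U:U<\infty$. For a curve $G$, $L^2(0,1;L^2(dG_t;\mathcal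 H))$ is defined by the norm squared $\int_0^1\int_\Omega dG_t\,U_t:U_t\,dt$. The equation $\partial_tG_t=(G_tU_t)^{Sym}$ holds in the weak sense if for all $\Psi\in C^1([0,1];C_b(\Omega;\mathcal H))$ and all $s,t\in[0,1]$, $\int_\Omega\Psi_t:dG_t-\int_\Omega\Psi_s:dG_s=\int_s^t\big(\int_\Omega dG_\tau:\partial_\tau\Psi_\tau+dG_\tau U_\tau:\Psi_\tau\big)d\tau$. Hellinger distance: for $G_0,G_1\in\mathbb{H}^+$, $d_H^2(G_0,G_1)=\inf\int_0^1\int_\Omega dG_t\,U_t:U_t\,dt$ over all pairs $(G_t,U_t)_{t\in[0,1]}$ with $G\in C([0,1];\mathbb{H}^+)$ (TV-continuous), endpoints $G_0,G_1$, $U\in L^2(0,1;L^2(dG_t;\mathcal H))$ and $\partial_tG_t=(G_tU_t)^{Sym}$ weakly. Fisher-Rao distance: for $G_0,G_1\in\mathbb{P}$, $d_{FR}^2(G_0,G_1)$ is the same infimum restricted to curves with $G_t\in\mathbb{P}$ for all $t$. Metric cone: given a metric space $(X,d_X)$ of diameter $\le\pi$, the cone over $X$ is $\mathfrak C(X)=X\times[0,\infty)/X\times\{0\}$ (all points $[x,0]$ identified to one point, the apex) with the metric $d_{\mathfrak C(X)}^2([x_0,r_0],[x_1,r_1])=r_0^2+r_1^2-2r_0r_1\cos(d_X(x_0,x_1))$. *)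

(* Defs.v *)
From HB Require Import structures.
From mathcomp Require Import all_boot all_order all_algebra.
From mathcomp Require Import all_classical all_reals all_analysis.
From mathcomp Require Import complex.

Set Implicit Arguments.
Unset Strict Implicit.
Unset Printing Implicit Defensive.

Import Order.TTheory GRing.Theory Num.Def Num.Theory.
Import numFieldNormedType.Exports.

Local Open Scope classical_set_scope.
Local Open Scope ring_scope.
Local Open Scope complex_scope.
Local Open Scope sesquilinear_scope.
Local Open Scope quotient_scope.

Section Matrices.
Context {R : realType} {d : nat}.
Implicit Types A B : 'M[R[i]]_d.

Definition frob A B : R := complex.Re (\tr (A ^t* *m B)).

Definition frobn A : R := Num.sqrt (frob A A).

(* The order of R[i] is partial: [0 <= z] says that z is real and nonnegative. *)
Definition psdmx A : Prop :=
  A \is hermsymmx /\ forall v : 'cV[R[i]]_d, 0 <= (v ^t* *m A *m v) 0 0.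

Lemma psdmx_diag A i : psdmx A -> 0 <= complex.Re (A i i).
Proof.
case=> _ /(_ (delta_mx i 0)).
have -> : (delta_mx i 0 : 'cV[R[i]]_d) ^t* = delta_mx 0 i.
  by apply/matrixP => k l; rewrite !mxE andbC rmorph_nat.
rewrite -rowE -colE !mxE.
by case: (A i i) => a b; rewrite lecE /= => /andP[].
Qed.

End Matrices.

Notation borel Omega := (g_sigma_algebraType (@open Omega)).

Section Measures.
Context {R : realType} {Omega : ptopologicalType} {d : nat}.

(* Elements of H^+.  Taking values in matrices makes the TV norm automatically
   finite.  The value 0 on non-Borel sets is a normalisation which makes
   Leibniz equality coincide with equality of measures.  The last field is
   inner regularity of the trace measure, i.e. the Radon property. *)
Record hpm := Hpm {
  hpm_val :> set (borel Omega) -> 'M[R[i]]_d ;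
  hpm_psd : forall A, psdmx (hpm_val A) ;
  hpm_set0 : hpm_val set0 = 0 ;
  hpm_sigma_Re : forall i j,
    semi_sigma_additive (fun A => (complex.Re (hpm_val A i j))%:E) ;
  hpm_sigma_Im : forall i j,
    semi_sigma_additive (fun A => (complex.Im (hpm_val A i j))%:E) ;
  hpm_out : forall A, ~ measurable A -> hpm_val A = 0 ;
  hpm_radon : forall (A : set (borel Omega)) (e : R), measurable A -> 0 < e ->
    exists K : set Omega, [/\ compact K, K `<=` A &
      complex.Re (\tr (hpm_val A)) < complex.Re (\tr (hpm_val K)) + e] }.

Implicit Types G H : hpm.

Definition entry_Re G i j (A : set (borel Omega)) : \bar R :=
  (complex.Re (G A i j))%:E.

Definition entry_Im G i j (A : set (borel Omega)) : \bar R :=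
  (complex.Im (G A i j))%:E.

Definition trmeas G (A : set (borel Omega)) : \bar R :=
  (complex.Re (\tr (G A)))%:E.

Section Instances.
Variable G : hpm.

Let entry_Re0 i j : entry_Re G i j set0 = 0%E.
Proof. by rewrite /entry_Re hpm_set0 mxE. Qed.

Let entry_Re_fin i j A : measurable A -> entry_Re G i j A \is a fin_num.
Proof. by []. Qed.

HB.instance Definition _ i j := isCharge.Build _ _ _ (entry_Re G i j)
  (entry_Re0 i j) (@entry_Re_fin i j) (@hpm_sigma_Re G i j).

Let entry_Im0 i j : entry_Im G i j set0 = 0%E.
Proof. by rewrite /entry_Im hpm_set0 mxE. Qed.

Let entry_Im_fin i j A : measurable A -> entry_Im G i j A \is a fin_num.
Proof. by []. Qed.

HB.instance Definition _ i j := isCharge.Build _ _ _ (entry_Im G i j)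
  (entry_Im0 i j) (@entry_Im_fin i j) (@hpm_sigma_Im G i j).

Let trmeas0 : trmeas G set0 = 0%E.
Proof. by rewrite /trmeas hpm_set0 mxtrace0. Qed.

Let trmeasE A : trmeas G A = (\sum_i entry_Re G i i A)%E.
Proof. by rewrite /trmeas /entry_Re sumEFin /mxtrace raddf_sum. Qed.

Let trmeas_ge0 A : (0 <= trmeas G A)%E.
Proof.
rewrite trmeasE; apply: sume_ge0 => i _.
by rewrite lee_fin; apply: psdmx_diag; exact: hpm_psd.
Qed.

Let trmeas_sigma : semi_sigma_additive (trmeas G).
Proof.
move=> F mF tF mUF.
have -> : (fun n => \sum_(0 <= k < n) trmeas G (F k))%E =
    (fun n => \sum_i \sum_(0 <= k < n) entry_Re G i i (F k))%E.
  apply/funext => n; under eq_bigr do rewrite trmeasE.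
  by rewrite exchange_big.
rewrite trmeasE; apply: cvg_nnesum => [i _|i _].
  near=> n; apply: sume_ge0 => k _.
  by rewrite lee_fin; apply: psdmx_diag; exact: hpm_psd.
exact: hpm_sigma_Re.
Unshelve. all: by end_near. Qed.

HB.instance Definition _ := isMeasure.Build _ _ _ (trmeas G)
  trmeas0 trmeas_ge0 trmeas_sigma.

Let trmeas_fin : fin_num_fun (trmeas G).
Proof. by []. Qed.

HB.instance Definition _ := Measure_isFinite.Build _ _ _ (trmeas G) trmeas_fin.

End Instances.

Definition hpm_mass G : R := complex.Re (\tr (G setT)).

Definition hpm_radius G : {nonneg R} := NngNum (sqrtr_ge0 (hpm_mass G)).

(* dG/dgamma for gamma = tr G: each real or imaginary part of an entry of G is
   a charge dominated by gamma, since G is positive semidefinite. *)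
Definition density G (x : borel Omega) : 'M[R[i]]_d :=
  \matrix_(i, j) (fine (Radon_Nikodym (entry_Re G i j) (trmeas G) x)
               +i* fine (Radon_Nikodym (entry_Im G i j) (trmeas G) x)).

(* The integral of dG : Psi against the Hermitian-valued test function Psi. *)
Definition pairing G (Psi : Omega -> 'M[R[i]]_d) : R :=
  \int[trmeas G]_x (frob (density G x) (Psi x)).

Definition pairing_mul G (U V : Omega -> 'M[R[i]]_d) : R :=
  \int[trmeas G]_x (frob (density G x *m U x) (V x)).

(* The integral of dG U : U, kept extended-real so that +oo is not lost. *)
Definition L2norm2 G (U : Omega -> 'M[R[i]]_d) : \bar R :=
  (\int[trmeas G]_x (frob (density G x *m U x) (U x))%:E)%E.

Definition supn (Psi : Omega -> 'M[R[i]]_d) : \bar R :=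
  ereal_sup [set (frobn (Psi x))%:E | x in [set: Omega]].

Definition Cb (Psi : Omega -> 'M[R[i]]_d) : Prop :=
  [/\ forall x, Psi x \is hermsymmx,
      (supn Psi < +oo)%E &
      forall x : Omega, frobn (Psi y - Psi x) @[y --> x] --> (0 : R)].

(* The TV norm of the Hermitian-valued measure G - H, whose action on C_b is
   Psi |-> pairing G Psi - pairing H Psi. *)
Definition tv_dist G H : \bar R :=
  ereal_sup [set `|pairing G Psi - pairing H Psi|%:E
            | Psi in [set Psi | Cb Psi /\ (supn Psi <= 1)%E]].

Definition tv_continuous (G : R -> hpm) : Prop :=
  forall t, t \in `[0, 1] ->
    tv_dist (G s) (G t) @[s --> within `[0, 1] (nbhs t)] --> 0%E.

(* Psi is in C^1([0,1]; C_b) with derivative dPsi (one-sided at 0 and 1) *)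
Definition C1_Cb (Psi dPsi : R -> Omega -> 'M[R[i]]_d) : Prop :=
  forall t, t \in `[0, 1] ->
  [/\ Cb (Psi t), Cb (dPsi t),
      supn (fun x => ((s - t)^-1)%:C *: (Psi s x - Psi t x) - dPsi t x)
        @[s --> within `[0, 1] t^'] --> 0%E &
      supn (fun x => dPsi s x - dPsi t x)
        @[s --> within `[0, 1] (nbhs t)] --> 0%E].

Definition oriented_integral (s t : R) (f : R -> R) : R :=
  if s <= t then \int[lebesgue_measure]_(tau in `[s, t]) f tau
  else - \int[lebesgue_measure]_(tau in `[t, s]) f tau.

(* the weak form of  d/dt G_t = (G_t U_t)^Sym *)
Definition weak_equation (G : R -> hpm) (U : R -> Omega -> 'M[R[i]]_d) : Prop :=
  forall Psi dPsi : R -> Omega -> 'M[R[i]]_d, C1_Cb Psi dPsi ->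
  forall s t, s \in `[0, 1] -> t \in `[0, 1] ->
    pairing (G t) (Psi t) - pairing (G s) (Psi s) =
    oriented_integral s t (fun tau =>
      pairing (G tau) (dPsi tau) + pairing_mul (G tau) (U tau) (Psi tau)).

Definition energy (G : R -> hpm) (U : R -> Omega -> 'M[R[i]]_d) : \bar R :=
  (\int[lebesgue_measure]_(t in `[0%R, 1%R]) L2norm2 (G t) (U t))%E.

Definition unit_cylinder : set (measurableTypeR R * borel Omega) :=
  [set p | (p.1 : R) \in `[0, 1]].

(* U is in L^2(0,1; L^2(dG_t; H)); measurability is joint in (t, x). *)
Definition L2L2 (G : R -> hpm) (U : R -> Omega -> 'M[R[i]]_d) : Prop :=
  [/\ forall t x, t \in `[0, 1] -> U t x \is hermsymmx,
      forall i j, measurable_fun unit_cylinder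
        (fun p => complex.Re (U p.1 p.2 i j)),
      forall i j, measurable_fun unit_cylinder
        (fun p => complex.Im (U p.1 p.2 i j)) &
      (energy G U < +oo)%E].

Definition admissible (G0 G1 : hpm) (G : R -> hpm)
    (U : R -> Omega -> 'M[R[i]]_d) : Prop :=
  [/\ tv_continuous G, G 0 = G0, G 1 = G1, L2L2 G U & weak_equation G U].

Definition hellinger (G0 G1 : hpm) : \bar R :=
  sqrte (ereal_inf [set e | exists (G : R -> hpm) U,
    admissible G0 G1 G U /\ e = energy G U]).

Definition hpm1 : Type := {G : hpm | hpm_mass G == 1}.

Definition fisher_rao (P0 P1 : hpm1) : \bar R :=
  sqrte (ereal_inf [set e | exists (G : R -> hpm) U,
    [/\ admissible (sval P0) (sval P1) G U,
        forall t, t \in `[0, 1] -> hpm_mass (G t) = 1 & e = energy G U]]).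

End Measures.

Arguments hpm : clear implicits.
Arguments hpm1 : clear implicits.
Arguments hpm_sigma_Re {R Omega d} h i j.
Arguments hpm_sigma_Im {R Omega d} h i j.

Section MetricCone.
Context {R : realType}.

Definition is_metric {X : Type} (dX : X -> X -> R) : Prop :=
  [/\ forall x y, 0 <= dX x y,
      forall x y, dX x y = 0 <-> x = y,
      forall x y, dX x y = dX y x &
      forall x y z, dX x z <= dX x y + dX y z].

Section Cone.
Variable X : Type.

Definition cone_rel (p q : {classic X} * {nonneg R}) : bool :=
  (p.2 == q.2) && ((p.2%:num == 0) || (p.1 == q.1)).

Lemma cone_rel_refl : reflexive cone_rel.
Proof. by move=> p; rewrite /cone_rel !eqxx orbT. Qed.

Lemma cone_rel_sym : symmetric cone_rel.
Proof.
move=> p q; rewrite /cone_rel eq_sym (eq_sym p.1).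
by case: eqP => //= ->.
Qed.

Lemma cone_rel_trans : transitive cone_rel.
Proof.
move=> q p r; rewrite /cone_rel => /andP[/eqP-> pq] /andP[/eqP<- qr].
rewrite eqxx /=; case: eqP pq qr => //= _ /eqP-> /eqP->.
by rewrite eqxx.
Qed.

Canonical cone_equiv :=
  EquivRel cone_rel cone_rel_refl cone_rel_sym cone_rel_trans.

(* X * [0, +oo) with X * {0} collapsed to a point *)
Definition cone : Type := {eq_quot cone_equiv}.

Definition cone_pt (x : X) (r : {nonneg R}) : cone :=
  \pi_({eq_quot cone_equiv}) ((x : {classic X}), r).

(* independent of the representatives: x0 and x1 are determined unless
   r0 = 0 or r1 = 0, in which case the cosine has coefficient 0 *)
Definition cone_dist (dX : X -> X -> R) (c0 c1 : cone) : R :=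
  let: (x0, r0) := repr (c0 : {eq_quot cone_equiv}) in
  let: (x1, r1) := repr (c1 : {eq_quot cone_equiv}) in
  Num.sqrt (r0%:num ^+ 2 + r1%:num ^+ 2
            - 2 * r0%:num * r1%:num * cos (dX x0 x1)).

End Cone.

(* (Y, dY) is the metric cone over (X, dX) through the identification phi *)
Definition metric_cone_via {X Y : Type} (dX : X -> X -> R) (dY : Y -> Y -> R)
    (phi : Y -> cone X) : Prop :=
  [/\ is_metric dX /\ (forall x y, dX x y <= pi),
      is_metric dY,
      bijective phi &
      forall y0 y1, dY y0 y1 = cone_dist dX (phi y0) (phi y1)].

Definition metrizable (T : topologicalType) : Prop :=
  exists2 dT : T -> T -> R, is_metric dT &
    forall (x : T) (A : set T),
      nbhs x A <-> exists2 e : R, 0 < e & [set y | dT x y < e] `<=` A.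

End MetricCone.

Arguments metrizable : clear implicits.

Definition separable_space (T : topologicalType) : Prop :=
  exists2 D : set T, countable D & dense D.

(* Main.v *)
Require Import Defs.
From HB Require Import structures.
From mathcomp Require Import all_boot all_order all_algebra.
From mathcomp Require Import all_classical all_reals all_analysis.
From mathcomp Require Import measurable_realfun complex.
From mathcomp Require Import ring lra.

Set Implicit Arguments.
Unset Strict Implicit.
Unset Printing Implicit Defensive.

Import Order.TTheory GRing.Theory Num.Def Num.Theory.
Import numFieldNormedType.Exports.

Local Open Scope classical_set_scope.
Local Open Scope ring_scope.
Local Open Scope complex_scope.
Local Open Scope sesquilinear_scope.

(** One quantity governs both distances: [fidelity G H], half the infimum of [dual_cost G H B] over
    bounded, continuous, uniformly positive definite fields [B], where [dual_cost] is the integral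
    of [dG : B] plus that of [dH : B^-1]. It is the dual form of Uhlmann's fidelity, integrated over
    the space. Write F for it. Two exact formulas carry the proof: [hellingerE] says d_H^2 / 4 = m0
    + m1 - 2 F, with m0, m1 the total traces, and [fisher_raoE] says d_FR / 2 = arccos F on measures
    of trace 1. Since F scales by r0 r1 when the measures are multiplied by r0^2 and r1^2
    ([fidelity_scale]), inserting G_i = r_i^2 P_i gives d_H^2 / 4 = r0^2 + r1^2 - 2 r0 r1 cos (d_FR
    (P0, P1) / 2), which is the cone law ([to_cone_dist]).

    Lower bounds on the energy. Let Y = a I + b B with a'' = - q a and b'' = - q b. The field Psi =
    2 Y' Y^-1 solves the Riccati equation Psi' = - 2 q I - Psi^2 / 2. In the weak equation tested
    against Psi, Young's inequality bounds G U : Psi by half of G U : U plus half of G : Psi^2, the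
    quadratic terms cancel, and the increment of the pairing of G with Psi is at most half the
    energy minus 2 q ([riccati_lower]). With Y(0) = I and Y(1) = B the boundary terms form the dual
    cost of B. Linear coefficients (q = 0) give [hellinger_lower]; sine coefficients (q = w^2), for
    curves of constant mass 1, give [fisher_rao_lower].

    Upper bounds. Let k0, k1 be densities of the endpoints with respect to a common measure. The
    regularised optimality equation C (k0 + e I) C = k1 has an explicit measurable positive
    solution, the integral of k0 : C nearly reaches F ([fidelity_optimal]), and k1 - C k0 C is
    positive. The curve with density (a I + b C) k0 (a I + b C) + b^2 (k1 - C k0 C) + s^2 I joins k0
    to k1; the small bump s makes it invertible at interior times, so a velocity is obtained from a
    Lyapunov equation, and its action is at most four times an explicit speed ([curve_U_action],
    [geodesic_curve]). Linear a, b give [hellinger_upper]; an arc of great circle, tilted slightly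
    towards I so that the mass stays exactly 1, gives [fisher_rao_upper].

    Metric structure. arccos F separates points by a first variation at B = I ([fidelity_eq1]) and
    satisfies the triangle inequality by splitting a test field along the sine interpolation
    ([fidelity_triangle]). It is at most pi / 2, so two angles add up to at most pi and the cone
    distance is a metric by unfolding two sectors into the plane ([cone_metric]). Half the Hellinger
    distance inherits the axioms through the bijection [to_cone].

    The action is used without measurability in time: its integral is treated as a lower integral,
    which is monotone and superadditive, and this suffices. *)

(** * Frobenius product, Hermitian and positive matrices, Loewner bounds *)

Section FrobeniusProduct.
Context {R : realType} {d : nat}.
Notation M := 'M[R[i]]_d.
Implicit Types A B X Y Z g : M.

Lemma conjCE (z : R[i]) : (z^*)%R = conjc z.
Proof. by []. Qed.

Lemma frobE A B : frob A B = \sum_i \sum_j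
  (complex.Re (A i j) * complex.Re (B i j) + complex.Im (A i j) * complex.Im (B i j)).
Proof.
rewrite /frob /mxtrace raddf_sum exchange_big; apply: eq_bigr => j _.
rewrite mxE raddf_sum; apply: eq_bigr => i _.
by rewrite !mxE conjCE; case: (A i j) => a b; case: (B i j) => c e /=; lra.
Qed.

Lemma frobC A B : frob A B = frob B A.
Proof. by rewrite !frobE; do 2![apply: eq_bigr => ? _]; lra. Qed.

Lemma frobDr A B X : frob A (B + X) = frob A B + frob A X.
Proof. by rewrite /frob mulmxDr mxtraceD raddfD. Qed.

Lemma frobDl A B X : frob (A + B) X = frob A X + frob B X.
Proof. by rewrite !(frobC _ X) frobDr. Qed.

Lemma Re_rmul (a : R) (z : R[i]) : complex.Re (a%:C * z) = a * complex.Re z.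
Proof. by case: z => x y /=; lra. Qed.

Lemma Im_rmul (a : R) (z : R[i]) : complex.Im (a%:C * z) = a * complex.Im z.
Proof. by case: z => x y /=; lra. Qed.

Lemma frobZr (a : R) A B : frob A (a%:C *: B) = a * frob A B.
Proof. by rewrite /frob -scalemxAr mxtraceZ Re_rmul. Qed.

Lemma frobZl (a : R) A B : frob (a%:C *: A) B = a * frob A B.
Proof. by rewrite !(frobC _ B) frobZr. Qed.

Lemma frobNr A B : frob A (- B) = - frob A B.
Proof. by rewrite /frob mulmxN !raddfN. Qed.

Lemma frobNl A B : frob (- A) B = - frob A B.
Proof. by rewrite !(frobC _ B) frobNr. Qed.

Lemma frobBr A B X : frob A (B - X) = frob A B - frob A X.
Proof. by rewrite frobDr frobNr. Qed.

Lemma frobBl A B X : frob (A - B) X = frob A X - frob B X.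
Proof. by rewrite frobDl frobNl. Qed.

Lemma frob0r A : frob A 0 = 0.
Proof. by rewrite /frob mulmx0 mxtrace0. Qed.

Lemma frob0l A : frob 0 A = 0.
Proof. by rewrite frobC frob0r. Qed.

Lemma adj_mul A B : (A *m B)^t* = B^t* *m A^t*.
Proof. by rewrite trmx_mul map_mxM. Qed.

Lemma frob_mull X A B : frob (X *m A) B = frob A (X^t* *m B).
Proof. by rewrite /frob adj_mul mulmxA. Qed.

Lemma frob_mulr A X B : frob (A *m X) B = frob A (B *m X^t*).
Proof. by rewrite /frob adj_mul -mulmxA mxtrace_mulC -mulmxA. Qed.

Lemma frob_adj A B : frob (A^t*) (B^t*) = frob A B.
Proof.
rewrite !frobE exchange_big; do 2![apply: eq_bigr => ? _].
by rewrite !mxE !conjCE; case: (A _ _) => a b; case: (B _ _) => c e /=; lra.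
Qed.

Lemma frob_ge0 A : 0 <= frob A A.
Proof. by rewrite frobE; do 2![apply: sumr_ge0 => ? _]; rewrite addr_ge0// -expr2 sqr_ge0. Qed.

Lemma frob_eq0 A : frob A A = 0 -> A = 0.
Proof.
rewrite frobE => /eqP; rewrite psumr_eq0 => [/allP A0|i _]; last first.
  by apply: sumr_ge0 => ? _; rewrite addr_ge0// -expr2 sqr_ge0.
apply/matrixP => i j; rewrite mxE.
have := A0 i (mem_index_enum _); rewrite psumr_eq0 => [/allP/(_ j (mem_index_enum _))|k _]; last first.
  by rewrite addr_ge0// -expr2 sqr_ge0.
case: (A i j) => a b /=; rewrite -!expr2 paddr_eq0 ?sqr_ge0// !sqrf_eq0.
by move=> /andP[/eqP-> /eqP->].
Qed.

Lemma frob1r A : frob A 1%:M = complex.Re (\tr A).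
Proof.
by rewrite frobC /frob trmx1 map_mx1 mul1mx.
Qed.

Lemma frobn_ge0 A : 0 <= frobn A.
Proof. exact: sqrtr_ge0. Qed.

Lemma sqr_frobn A : frobn A ^+ 2 = frob A A.
Proof. by rewrite sqr_sqrtr// frob_ge0. Qed.

Lemma hermP A : A \is hermsymmx <-> A^t* = A.
Proof.
split=> [/is_hermitianmxP|AE]; first by rewrite expr0 scale1r => {2}->.
by apply/is_hermitianmxP; rewrite expr0 scale1r AE.
Qed.

Lemma adjD A B : (A + B)^t* = A^t* + B^t*.
Proof. by rewrite linearD /= map_mxD. Qed.

Lemma adjN A : (- A)^t* = - A^t*.
Proof. by rewrite linearN /= map_mxN. Qed.

Lemma adj_scalemx (a : R) A : (a%:C *: A)^t* = a%:C *: A^t*.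
Proof. by apply/matrixP => i j; rewrite !mxE !conjCE rmorphM /= oppr0. Qed.

Lemma adj_one : (1%:M : M)^t* = 1%:M.
Proof. by rewrite trmx1 map_mx1. Qed.

Lemma adj_zero : (0 : M)^t* = 0.
Proof. by rewrite trmx0 map_mx0. Qed.

Lemma adjK A : (A^t*)^t* = A.
Proof. exact: trmxCK. Qed.

Lemma hermD A B : A \is hermsymmx -> B \is hermsymmx -> A + B \is hermsymmx.
Proof. by move=> /hermP hA /hermP hB; apply/hermP; rewrite adjD hA hB. Qed.

Lemma hermN A : A \is hermsymmx -> - A \is hermsymmx.
Proof. by move=> /hermP hA; apply/hermP; rewrite adjN hA. Qed.

Lemma hermB A B : A \is hermsymmx -> B \is hermsymmx -> A - B \is hermsymmx.
Proof. by move=> hA hB; exact/hermD/hermN. Qed.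

Lemma hermZ (a : R) A : A \is hermsymmx -> a%:C *: A \is hermsymmx.
Proof. by move=> /hermP hA; apply/hermP; rewrite adj_scalemx hA. Qed.

Lemma herm1 : (1%:M : M) \is hermsymmx.
Proof. exact/hermP/adj_one. Qed.

Lemma herm0 : (0 : M) \is hermsymmx.
Proof. exact/hermP/adj_zero. Qed.

Lemma herm_conj A X : A \is hermsymmx -> X *m A *m X^t* \is hermsymmx.
Proof. by move=> /hermP hA; apply/hermP; rewrite !adj_mul adjK hA mulmxA. Qed.

Lemma herm_sym A B : A \is hermsymmx -> B \is hermsymmx -> A *m B + B *m A \is hermsymmx.
Proof. by move=> /hermP hA /hermP hB; apply/hermP; rewrite adjD !adj_mul hA hB addrC. Qed.

Lemma herm_comm A B : A \is hermsymmx -> B \is hermsymmx ->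
  A *m B = B *m A -> A *m B \is hermsymmx.
Proof. by move=> /hermP hA /hermP hB AB; apply/hermP; rewrite adj_mul hA hB. Qed.

(** Testing with square matrices instead of column vectors keeps positivity inside the real
    Frobenius calculus; [psdmxP] shows the equivalence with the vector form. *)
Definition posmx A := A \is hermsymmx /\ forall Z, 0 <= frob (A *m Z) Z.

Lemma quad_diag A Z j : (Z^t* *m A *m Z) j j = ((col j Z)^t* *m A *m col j Z) 0 0.
Proof.
rewrite [LHS]mxE [RHS]mxE; apply: eq_bigr => k _; rewrite [col _ _ _ _]mxE.
congr (_ * _); rewrite [LHS]mxE [RHS]mxE; apply: eq_bigr => l _.
by rewrite !mxE.
Qed.

Lemma psdmxP A : psdmx A <-> posmx A.
Proof.
split=> -[hA pA]; split=> //.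
  move=> Z.
  rewrite frob_mull (hermP A).1// /frob mulmxA /mxtrace raddf_sum.
  apply: sumr_ge0 => j _; rewrite quad_diag.
  by have := pA (col j Z); rewrite lecE => /andP[].
(* Nonnegativity in the partial order of [R[i]] includes being real, which comes from
   hermiticity. *)
move=> v; set z := _ 0 0; have zz : z = conjc z.
  have -> : conjc z = ((v^t* *m A *m v)^t*) 0 0 by rewrite [RHS]mxE [in RHS]mxE conjCE.
  by rewrite /z !trmx_mul !map_mxM trmxCK (hermP A).1// mulmxA.
rewrite lecE /=; apply/andP; split.
  apply/eqP; have := congr1 (@complex.Im R) zz; case: (z) => a b /=; lra.
have [d0|d0] := posnP d.
  by rewrite /z mxE big1// => k _; have := ltn_ord k; rewrite [X in (_ < X)%N]d0.
(* All columns equal [v], so the matrix form is [d] copies of the vector form, with [d] positive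
   here. *)
pose Z : M := \matrix_(i, j) v i 0.
have := pA Z; rewrite frob_mull (hermP A).1// /frob mulmxA /mxtrace raddf_sum.
rewrite (eq_bigr (fun=> complex.Re z)) => [|j _]; last first.
  rewrite quad_diag; congr (complex.Re ((_^t* *m A *m _) 0 0));
    by apply/colP => k; rewrite !mxE.
by rewrite sumr_const card_ord pmulrn_lge0.
Qed.

(** A nonnegative quadratic polynomial has nonpositive discriminant; every Cauchy-Schwarz inequality
    below is derived from it. *)
Lemma discriminant_le (a b c : R) : 0 <= c ->
  (forall t, 0 <= a + 2 * t * b + t ^+ 2 * c) -> b ^+ 2 <= a * c.
Proof.
rewrite le_eqVlt => /predU1P[<-|c0] H.
  rewrite mulr0; have [->|b0] := eqVneq b 0; first by rewrite expr0n.
  (* In the degenerate case the polynomial is affine, and this argument gives it the value -1. *)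
  have := H (- (a + 1) / (2 * b)).
  have -> : a + 2 * (- (a + 1) / (2 * b)) * b + (- (a + 1) / (2 * b)) ^+ 2 * 0 = -1.
    by field.
  by rewrite oppr_ge0 ler10.
have := H (- b / c).
have -> : a + 2 * (- b / c) * b + (- b / c) ^+ 2 * c = (a * c - b ^+ 2) / c.
  by field; rewrite gt_eqF.
by rewrite pmulr_lge0 ?invr_gt0// subr_ge0.
Qed.

Lemma frob_quadD g U V (t : R) : g \is hermsymmx ->
  frob (g *m (U + t%:C *: V)) (U + t%:C *: V) =
  frob (g *m U) U + 2 * t * frob (g *m U) V + t ^+ 2 * frob (g *m V) V.
Proof.
move=> hg; rewrite mulmxDr -scalemxAr !frobDl !frobDr !frobZl !frobZr.
have -> : frob (g *m V) U = frob (g *m U) V.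
  by rewrite frob_mull (hermP _).1// frobC.
by ring.
Qed.

Lemma pos_CS g U V : posmx g ->
  frob (g *m U) V ^+ 2 <= frob (g *m U) U * frob (g *m V) V.
Proof.
move=> [hg pg]; apply: discriminant_le => // t.
by rewrite -frob_quadD//; exact: pg.
Qed.

(** Positivity at [U - V]. This is the inequality that cancels the quadratic terms of the Riccati
    equation. *)
Lemma pos_young g U V : posmx g ->
  2 * frob (g *m U) V <= frob (g *m U) U + frob (g *m V) V.
Proof.
move=> [hg pg]; have := pg (U + (-1)%:C *: V); rewrite frob_quadD//; lra.
Qed.

Lemma pos1 : posmx 1%:M.
Proof. by split; [exact: herm1|move=> Z; rewrite mul1mx frob_ge0]. Qed.

Lemma pos0 : posmx 0.
Proof. by split; [exact: herm0|move=> Z; rewrite mul0mx frob0l]. Qed.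

Lemma posD A B : posmx A -> posmx B -> posmx (A + B).
Proof.
move=> [hA pA] [hB pB]; split; first exact: hermD.
by move=> Z; rewrite mulmxDl frobDl addr_ge0.
Qed.

Lemma posZ (a : R) A : 0 <= a -> posmx A -> posmx (a%:C *: A).
Proof.
move=> a0 [hA pA]; split; first exact: hermZ.
by move=> Z; rewrite -scalemxAl frobZl mulr_ge0.
Qed.

Lemma pos_conj A X : posmx A -> posmx (X *m A *m X^t*).
Proof.
move=> [hA pA]; split; first exact: herm_conj.
move=> Z; rewrite -!mulmxA frob_mull; exact: pA.
Qed.

Lemma pos_sqr X : posmx (X *m X^t*).
Proof. by have := pos_conj X pos1; rewrite mulmx1. Qed.

Lemma frob_CS A B : frob A B ^+ 2 <= frob A A * frob B B.
Proof. by have := pos_CS A B pos1; rewrite !mul1mx. Qed.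

Lemma frob_le A B : `|frob A B| <= frobn A * frobn B.
Proof.
rewrite -(@ler_pXn2r _ 2) ?nnegrE ?mulr_ge0 ?frobn_ge0//.
by rewrite exprMn !sqr_frobn real_normK ?num_real// frob_CS.
Qed.

Lemma frob_ler A B : frob A B <= frobn A * frobn B.
Proof. exact: le_trans (ler_norm _) (frob_le _ _). Qed.

Lemma frobnD A B : frobn (A + B) <= frobn A + frobn B.
Proof.
rewrite -(@ler_pXn2r _ 2) ?nnegrE ?addr_ge0 ?frobn_ge0//.
rewrite sqrrD !sqr_frobn frobDl !frobDr (frobC B A).
have := frob_ler A B; rewrite mulr2n; lra.
Qed.

Lemma frobnZ (a : R) A : frobn (a%:C *: A) = `|a| * frobn A.
Proof. by rewrite /frobn frobZl frobZr mulrA -expr2 sqrtrM ?sqr_ge0// sqrtr_sqr. Qed.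

Lemma frobnN A : frobn (- A) = frobn A.
Proof. by rewrite /frobn frobNl frobNr opprK. Qed.

Lemma frobnB A B : frobn (A - B) <= frobn A + frobn B.
Proof. by rewrite -(frobnN B) frobnD. Qed.

Lemma frobn0 : frobn (0 : M) = 0.
Proof. by rewrite /frobn frob0l sqrtr0. Qed.

Lemma frobn_eq0 A : frobn A = 0 -> A = 0.
Proof. by move=> A0; apply: frob_eq0; rewrite -sqr_frobn A0 expr0n. Qed.

Lemma frobn_adj A : frobn (A^t*) = frobn A.
Proof. by rewrite /frobn frob_adj. Qed.

Lemma sum_CS (I : finType) (a b : I -> R) :
  (\sum_i a i * b i) ^+ 2 <= (\sum_i a i ^+ 2) * (\sum_i b i ^+ 2).
Proof.
apply: discriminant_le => [|t]; first by apply: sumr_ge0 => i _; exact: sqr_ge0.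
rewrite !mulr_sumr -!big_split /=; apply: sumr_ge0 => i _.
have -> : a i ^+ 2 + 2 * t * (a i * b i) + t ^+ 2 * b i ^+ 2 = (a i + t * b i) ^+ 2 by ring.
exact: sqr_ge0.
Qed.

Lemma frob_normc A : frob A A = \sum_i \sum_j Normc.normc (A i j) ^+ 2.
Proof.
rewrite frobE; do 2![apply: eq_bigr => ? _].
case: (A _ _) => a b /=; rewrite sqr_sqrtr ?addr_ge0 ?sqr_ge0//; lra.
Qed.

Lemma normc_ge0 (z : R[i]) : 0 <= Normc.normc z.
Proof. by case: z => a b; exact: sqrtr_ge0. Qed.

Lemma normc_sum (I : finType) (z : I -> R[i]) :
  Normc.normc (\sum_i z i) <= \sum_i Normc.normc (z i).
Proof.
elim/big_ind2: _ => //; first by rewrite Normc.normc0.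
by move=> x1 x2 y1 y2 h1 h2; apply: (le_trans (le_normcD _ _)); exact: lerD.
Qed.

Lemma frobn_mul A B : frobn (A *m B) <= frobn A * frobn B.
Proof.
rewrite -(@ler_pXn2r _ 2) ?nnegrE ?mulr_ge0 ?frobn_ge0//.
rewrite exprMn !sqr_frobn !frob_normc mulr_suml; apply: ler_sum => i _.
rewrite [X in _ <= _ * X]exchange_big mulr_sumr; apply: ler_sum => j _.
rewrite mxE; apply: le_trans (sum_CS _ _).
rewrite ler_pXn2r ?nnegrE.
- apply: le_trans (normc_sum _) _; apply: ler_sum => k _.
  by rewrite Normc.normcM.
- by [].
- exact: normc_ge0.
- by apply: sumr_ge0 => k _; rewrite mulr_ge0 ?normc_ge0.
Qed.

Lemma frob_quad_le A Z : frob (A *m Z) Z <= frobn A * frob Z Z.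
Proof.
apply: le_trans (frob_ler _ _) _; rewrite -sqr_frobn expr2 mulrA.
by rewrite ler_wpM2r ?frobn_ge0// frobn_mul.
Qed.

(** Positive definiteness with an explicit constant, so that inverses are bounded uniformly in space
    and time. *)
Definition lowb (c : R) B := posmx (B - c%:C%:M).

Lemma herm_scal (c : R) : (c%:C%:M : M) \is hermsymmx.
Proof. by rewrite -scalemx1; exact/hermZ/herm1. Qed.

Lemma lowb_herm c B : lowb c B -> B \is hermsymmx.
Proof.
by move=> [hB _]; rewrite -(subrK (c%:C%:M) B); exact/hermD/herm_scal.
Qed.

Lemma lowbP c B : lowb c B <->
  B \is hermsymmx /\ forall Z, c * frob Z Z <= frob (B *m Z) Z.
Proof.
split=> [BH|[hB H]].
  split; first exact: lowb_herm BH.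
  by move=> Z; case: BH => _ /(_ Z); rewrite mulmxBl frobBl mul_scalar_mx frobZl subr_ge0.
split; first exact/hermB/herm_scal.
by move=> Z; rewrite mulmxBl frobBl mul_scalar_mx frobZl subr_ge0.
Qed.

Lemma lowb_pos c B : 0 <= c -> lowb c B -> posmx B.
Proof.
move=> c0 /lowbP[hB H]; split=> // Z.
by apply: le_trans (H Z); rewrite mulr_ge0 ?frob_ge0.
Qed.

Lemma lowb_unit c B : 0 < c -> lowb c B -> B \in unitmx.
Proof.
move=> c0 /lowbP[hB H]; rewrite -row_free_unit -kermx_eq0.
have K0 : kermx B *m B = 0 by exact: mulmx_ker.
have := H ((kermx B)^t*).
have -> : B *m (kermx B)^t* = 0 by rewrite -[X in X *m _](hermP _).1// -adj_mul K0 adj_zero.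
rewrite frob0l pmulr_rle0// frob_adj => k0; apply/eqP/frob_eq0.
by apply/eqP; rewrite eq_le k0 frob_ge0.
Qed.

Lemma adj_inv A : (invmx A)^t* = invmx (A^t*).
Proof. by rewrite trmx_inv map_invmx. Qed.

Lemma herm_inv A : A \is hermsymmx -> invmx A \is hermsymmx.
Proof. by move=> /hermP hA; apply/hermP; rewrite adj_inv hA. Qed.

Lemma lowb_inv_frobn c B : 0 < c -> lowb c B -> c * frobn (invmx B) <= frobn (1%:M : M).
Proof.
move=> c0 lB; have [->|n0] := eqVneq (frobn (invmx B)) 0.
  by rewrite mulr0 frobn_ge0.
rewrite -(ler_pM2r (x := frobn (invmx B))); last by rewrite lt0r n0 frobn_ge0.
rewrite -mulrA -expr2 sqr_frobn; apply: le_trans (frob_ler _ _).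
have /lowbP[_ /(_ (invmx B))] := lB.
by rewrite mulmxV ?(lowb_unit c0).
Qed.

(** Cauchy-Schwarz for the form of [B] between [W] and [B *m W], then one factor is cancelled.
    Taking [W = invmx B *m Z] bounds the inverse from below. *)
Lemma pos_frob_sqr (m : R) B W : posmx B -> frobn B <= m ->
  frob (B *m W) (B *m W) <= m * frob (B *m W) W.
Proof.
move=> pB Bm; have := pos_CS W (B *m W) pB.
set x := frob (B *m W) (B *m W); set q := frob (B *m W) W => H.
have q0 : 0 <= q by case: pB => _; exact.
have x0 : 0 <= x by exact: frob_ge0.
have m0 : 0 <= m by exact: le_trans (frobn_ge0 _) Bm.
move: x0; rewrite le_eqVlt => /predU1P[<-|x0]; first by rewrite mulr_ge0.
rewrite -(ler_pM2r x0) -expr2; apply: le_trans H _.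
rewrite [leRHS]mulrAC (mulrC q) ler_wpM2r//.
apply: le_trans (frob_quad_le _ _) _.
by rewrite ler_wpM2r ?frob_ge0.
Qed.

Lemma lowb_inv c m B : 0 < c -> lowb c B -> 0 < m -> frobn B <= m ->
  lowb m^-1 (invmx B).
Proof.
move=> c0 lB m0 Bm; apply/lowbP; split; first exact/herm_inv/lowb_herm/lB.
move=> Z; have := @pos_frob_sqr m B (invmx B *m Z) (lowb_pos (ltW c0) lB) Bm.
rewrite !mulmxA mulmxV ?(lowb_unit c0)// mul1mx -(ler_pM2l (x := m^-1)) ?invr_gt0//.
by rewrite mulrA mulVf ?gt_eqF// mul1r (frobC Z (invmx B *m Z)).
Qed.

End FrobeniusProduct.

Lemma cvg_sumr {R : realType} {T : Type} (F : set_system T) {FF : Filter F} (I : Type)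
    (r : seq I) (f : I -> T -> R) (l : I -> R) :
  (forall i, f i x @[x --> F] --> l i) ->
  \sum_(i <- r) f i x @[x --> F] --> \sum_(i <- r) l i.
Proof.
move=> fl; elim: r => [|i r IH].
  by under eq_fun do rewrite big_nil; rewrite big_nil; exact: cvg_cst.
by under eq_fun do rewrite big_cons; rewrite big_cons; exact: cvgD.
Qed.

(** * Spectral decomposition and square roots as limits of polynomials *)

Section SquareRoot.
Context {R : realType} {d : nat}.
Notation M := 'M[R[i]]_d.
Implicit Types A B X Y Z g : M.

(** Functional calculus in a fixed unitary frame: products and sums of such matrices act on the
    eigenvalues alone. *)
Definition conj_diag (P : M) (l : 'I_d -> R) : M :=
  P^t* *m diag_mx (\row_j (l j)%:C) *m P.

Lemma conj_diagE P l i j : conj_diag P l i j =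
  \sum_k (l k)%:C * (conjc (P k i) * P k j).
Proof.
rewrite /conj_diag -mulmxA mxE; apply: eq_bigr => k _.
by rewrite mul_diag_mx !mxE conjCE mulrCA.
Qed.

Lemma conj_diagM P l m : P \is unitarymx ->
  conj_diag P l *m conj_diag P m = conj_diag P (fun k => l k * m k).
Proof.
move=> /unitarymxP PP; rewrite /conj_diag -!mulmxA (mulmxA P) PP mul1mx (mulmxA (diag_mx _)) mulmx_diag.
by congr (_ *m (diag_mx _ *m _)); apply/rowP => k; rewrite !mxE rmorphM.
Qed.

Lemma conj_diagD P l m :
  conj_diag P l + conj_diag P m = conj_diag P (fun k => l k + m k).
Proof.
apply/matrixP => i j; rewrite mxE !conj_diagE -big_split; apply: eq_bigr => k _ /=.
by rewrite rmorphD mulrDl.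
Qed.

Lemma conj_diagZ (a : R) P l : a%:C *: conj_diag P l = conj_diag P (fun k => a * l k).
Proof.
apply/matrixP => i j; rewrite mxE !conj_diagE mulr_sumr; apply: eq_bigr => k _ /=.
by rewrite rmorphM mulrA.
Qed.

Lemma conj_diag_herm P l : conj_diag P l \is hermsymmx.
Proof.
apply/hermP/matrixP => i j; rewrite mxE [in LHS]mxE conjCE !conj_diagE rmorph_sum /=.
apply: eq_bigr => k _; rewrite !rmorphM /= oppr0 conjcK.
by rewrite (mulrC (P k j)).
Qed.

Lemma conj_diag_pos P l : P \is unitarymx -> (forall k, 0 <= l k) -> posmx (conj_diag P l).
Proof.
move=> uP l0; have -> : conj_diag P l =
    conj_diag P (fun k => Num.sqrt (l k)) *m (conj_diag P (fun k => Num.sqrt (l k)))^t*.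
  rewrite (hermP _).1 ?conj_diag_herm// conj_diagM//; congr conj_diag.
  by apply/funext => k; rewrite -expr2 sqr_sqrtr.
exact: pos_sqr.
Qed.

Lemma pos_spectral A : posmx A -> exists P l,
  [/\ P \is unitarymx, forall k, 0 <= l k & A = conj_diag P l].
Proof.
move=> [hA pA]; set P := spectralmx A; set sp := spectral_diag A.
have uP : P \is unitarymx by exact: spectral_unitarymx.
have AE : A = P^t* *m diag_mx sp *m P.
  rewrite -invmx_unitary//.
  by apply/orthomx_spectralP/hermitian_normalmx.
have spE : diag_mx sp = diag_mx (\row_j (complex.Re (sp 0 j))%:C).
  congr diag_mx; apply/rowP => k; rewrite mxE RRe_real//.
  by have /mxOverP := hermitian_spectral_diag_real hA; exact.
exists P, (fun j => complex.Re (sp 0 j)); split=> // [k|]; last by rewrite /conj_diag -spE.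
have := pA (P^t* *m delta_mx k k).
rewrite {1}AE -!mulmxA (mulmxA P) (unitarymxP uP) mul1mx.
rewrite frob_mull trmxCK (mulmxA P) (unitarymxP uP) mul1mx.
rewrite frobE (bigD1 k)//= [X in _ + X]big1 ?addr0 => [|i ik]; last first.
  rewrite big1// => j _; rewrite mul_diag_mx !mxE (negbTE ik) /=.
  by rewrite !mulr0 addr0.
rewrite (bigD1 k)//= [X in _ + X]big1 ?addr0 => [|j jk]; last first.
  rewrite mul_diag_mx !mxE (negbTE jk) andbF /=.
  by rewrite !mulr0 addr0.
by rewrite mul_diag_mx !mxE !eqxx /= mulr1; case: (sp 0 k) => a b /=; lra.
Qed.

Lemma conj_diag_tr P l : P \is unitarymx -> complex.Re (\tr (conj_diag P l)) = \sum_k l k.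
Proof.
move=> /unitarymxP PP; rewrite /conj_diag -mulmxA mxtrace_mulC -mulmxA PP mulmx1.
by rewrite mxtrace_diag raddf_sum; apply: eq_bigr => k _; rewrite mxE.
Qed.

(** Every iterate is a polynomial in [A], so for a measurable field of matrices the limit is a
    measurable square root. Convergence holds when the spectrum lies in [0, 1]. *)
Fixpoint sqrt_iter (n : nat) A : M :=
  if n is n'.+1 then sqrt_iter n' A + (2^-1)%:C *: (A - sqrt_iter n' A *m sqrt_iter n' A)
  else 0.

Fixpoint sqrtr_iter (n : nat) (s : R) : R :=
  if n is n'.+1 then sqrtr_iter n' s + 2^-1 * (s - sqrtr_iter n' s * sqrtr_iter n' s)
  else 0.

Lemma sqrt_iter_conj_diag n P l : P \is unitarymx ->
  sqrt_iter n (conj_diag P l) = conj_diag P (fun k => sqrtr_iter n (l k)).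
Proof.
move=> uP; elim: n => [|n IH] /=.
  by apply/matrixP => i j; rewrite conj_diagE mxE big1// => k _; rewrite rmorph0 mul0r.
rewrite IH conj_diagM//.
have -> A : - A = (-1)%:C *: A by rewrite rmorphN scaleN1r.
rewrite conj_diagZ conj_diagD conj_diagZ conj_diagD; congr conj_diag.
by apply/funext => k; rewrite mulN1r.
Qed.

(** With r the root and p the iterate, the next error is (1 - (r + p) / 2) (r - p); as 0 <= p <= r
    <= 1 this contracts by at least 1 - r / 2 and keeps its sign. *)
Lemma sqrtr_iterP n (s : R) : 0 <= s <= 1 ->
  0 <= Num.sqrt s - sqrtr_iter n s <= (1 - Num.sqrt s / 2) ^+ n * Num.sqrt s /\
  0 <= sqrtr_iter n s.
Proof.
move=> /andP[s0 s1]; set r := Num.sqrt s.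
have r0 : 0 <= r by exact: sqrtr_ge0.
have r1 : r <= 1 by rewrite -sqrtr1 ler_sqrt.
have sE : s = r ^+ 2 by rewrite sqr_sqrtr.
elim: n => [|n [/andP[h1 h2] h3]] /=.
  by rewrite subr0 expr0 mul1r r0 lexx.
set p := sqrtr_iter n s in h1 h2 h3 *.
have E : r - (p + 2^-1 * (s - p * p)) = (1 - (r + p) / 2) * (r - p) by rewrite sE; field.
split; last first.
  apply: addr_ge0 => //; apply: mulr_ge0 => //.
  by rewrite subr_ge0 sE -expr2 ler_pXn2r ?nnegrE// -subr_ge0.
have pr : p <= r by rewrite -subr_ge0.
rewrite E; apply/andP; split; first by rewrite mulr_ge0//; lra.
rewrite exprS -mulrA; apply: le_trans (_ : (1 - r / 2) * (r - p) <= _).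
  by apply: ler_wpM2r => //; lra.
by apply: ler_wpM2l => //; lra.
Qed.

Lemma sqrtr_iter_cvg (s : R) : 0 <= s <= 1 ->
  sqrtr_iter n s @[n --> \oo] --> Num.sqrt s.
Proof.
move=> s01; have [s0|s0] := eqVneq (Num.sqrt s) 0.
  have -> : (fun n => sqrtr_iter n s) = fun=> 0.
    apply/funext => n; have [/andP[h1 h2] h3] := sqrtr_iterP n s01.
    by apply/eqP; rewrite eq_le h3 andbT; move: h1; rewrite s0; lra.
  by rewrite s0; exact: cvg_cst.
have r0 : 0 < Num.sqrt s by rewrite lt_neqAle eq_sym s0 sqrtr_ge0.
have r1 : Num.sqrt s <= 1 by rewrite -sqrtr1 ler_sqrt//; case/andP: s01.
have geo : (1 - Num.sqrt s / 2) ^+ n * Num.sqrt s @[n --> \oo] --> (0 : R).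
  rewrite -[X in _ --> X](mul0r (Num.sqrt s)); apply: cvgMl.
  by apply: cvg_expr; rewrite ger0_norm; lra.

have H : (fun n => Num.sqrt s - sqrtr_iter n s) @ \oo --> (0 : R).
  apply: (@squeeze_cvgr _ _ _ _ (fun=> 0) (fun n => (1 - Num.sqrt s / 2) ^+ n * Num.sqrt s)) => //.
    by near=> n; have [] := sqrtr_iterP n s01.
  exact: cvg_cst.
have -> : (fun n => sqrtr_iter n s) = (fun n => Num.sqrt s - (Num.sqrt s - sqrtr_iter n s)).
  by apply/funext => n; lra.
rewrite -[X in _ --> X](subr0 (Num.sqrt s)).
by apply: cvgB => //; exact: cvg_cst.
Unshelve. all: by end_near. Qed.

Lemma sqrt_iter_cvg A : posmx A -> complex.Re (\tr A) <= 1 ->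
  exists S : M, [/\ posmx S, S *m S = A,
    forall i j, complex.Re (sqrt_iter n A i j) @[n --> \oo] --> complex.Re (S i j) &
    forall i j, complex.Im (sqrt_iter n A i j) @[n --> \oo] --> complex.Im (S i j)].
Proof.
move=> /pos_spectral[P [l [uP l0 ->]]]; rewrite conj_diag_tr// => tr1.
(* Each eigenvalue is at most the trace, the others being nonnegative. *)
have l01 k : 0 <= l k <= 1.
  rewrite l0/= (le_trans _ tr1)// (bigD1 k)//= lerDl.
  by apply: sumr_ge0.
exists (conj_diag P (fun k => Num.sqrt (l k))); split.
- by apply: conj_diag_pos => // k; exact: sqrtr_ge0.
- by rewrite conj_diagM//; congr conj_diag; apply/funext => k; rewrite -expr2 sqr_sqrtr.
- move=> i j; under eq_fun do rewrite sqrt_iter_conj_diag// conj_diagE raddf_sum.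
  rewrite conj_diagE raddf_sum; apply: cvg_sumr => k.
  under eq_fun do rewrite /= Re_rmul.
  by rewrite /= Re_rmul; apply: cvgMl; exact: sqrtr_iter_cvg.
- move=> i j; under eq_fun do rewrite sqrt_iter_conj_diag// conj_diagE raddf_sum.
  rewrite conj_diagE raddf_sum; apply: cvg_sumr => k.
  under eq_fun do rewrite /= Im_rmul.
  by rewrite /= Im_rmul; apply: cvgMl; exact: sqrtr_iter_cvg.
Qed.

Lemma pos_sqrt A : posmx A -> exists S, posmx S /\ S *m S = A.
Proof.
move=> /pos_spectral[P [l [uP l0 ->]]].
exists (conj_diag P (fun k => Num.sqrt (l k))); split.
  by apply: conj_diag_pos => // k; exact: sqrtr_ge0.
by rewrite conj_diagM//; congr conj_diag; apply/funext => k; rewrite -expr2 sqr_sqrtr.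
Qed.

(** Writing [B] as a square moves one root to the other side, leaving the form of [A] at that
    root. *)
Lemma pos_frob_ge0 A B : posmx A -> posmx B -> 0 <= frob A B.
Proof.
move=> [_ pA] /pos_sqrt[S [[hS _] <-]].
by have := pA S; rewrite frob_mulr (hermP _).1.
Qed.

Lemma pos_tr_ge0 A : posmx A -> 0 <= complex.Re (\tr A).
Proof. by move=> pA; rewrite -frob1r pos_frob_ge0//; exact: pos1. Qed.

Lemma pos_frob_le A B : posmx A -> frob A B <= frobn B * complex.Re (\tr A).
Proof.
move=> /pos_sqrt[S [[hS _] <-]]; rewrite -frob1r.
have -> : frob (S *m S) B = frob (B *m S) S by rewrite frob_mulr frobC (hermP _).1.
apply: le_trans (frob_quad_le _ _) _.
by rewrite frob_mulr (hermP _).1// mul1mx.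
Qed.

Lemma pos_frob_abs A B : posmx A -> `|frob A B| <= frobn B * complex.Re (\tr A).
Proof.
move=> pA; rewrite ler_norml pos_frob_le// andbT lerNl -frobNr.
by apply: le_trans (pos_frob_le _ pA) _; rewrite frobnN.
Qed.

Lemma pos_frobn_le A : posmx A -> frobn A <= complex.Re (\tr A).
Proof.
move=> pA; have := pos_frob_le A pA; rewrite -sqr_frobn expr2.
have := frobn_ge0 A; rewrite le_eqVlt => /predU1P[<-|A0]; first by move=> _; exact: pos_tr_ge0.
by rewrite ler_pM2l.
Qed.

End SquareRoot.

(** * Measurability of complex and matrix-valued functions *)

Section MeasurableComplex.
Context {R : realType} {d0 : measure_display} {T : measurableType d0} (D : set T).
Implicit Types (f g : T -> R[i]) (h : T -> R).

Definition cmeas f := measurable_fun D (fun x => complex.Re (f x)) /\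
  measurable_fun D (fun x => complex.Im (f x)).

Lemma measurable_invr h : measurable_fun D h -> measurable_fun D (fun x => (h x)^-1).
Proof.
move=> mh; rewrite (_ : (fun x => _) = (fun x => h x * (h x ^+ 2) `^ (-1))); last first.
  apply/funext => x; rewrite powR_inv1 ?sqr_ge0//.
  have [->|h0] := eqVneq (h x) 0; first by rewrite invr0 mul0r.
  by field.
apply: measurable_funM => //.
have m2 : measurable_fun D (fun x => h x ^+ 2) by exact: measurable_funX.
exact: (measurableT_comp (measurable_powR (-1)) m2).
Qed.

Lemma cmeas_cst (c : R[i]) : cmeas (fun=> c).
Proof. by split; exact: measurable_cst. Qed.

Lemma cmeasD f g : cmeas f -> cmeas g -> cmeas (fun x => f x + g x).
Proof.
move=> [fr fi] [gr gi]; split; [under eq_fun do rewrite raddfD|under eq_fun do rewrite raddfD];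
 exact: measurable_funD.
Qed.

Lemma cmeasN f : cmeas f -> cmeas (fun x => - f x).
Proof.
move=> [fr fi]; split; [under eq_fun do rewrite raddfN|under eq_fun do rewrite raddfN];
 exact: measurableT_comp.
Qed.

Lemma cmeasM f g : cmeas f -> cmeas g -> cmeas (fun x => f x * g x).
Proof.
move=> [fr fi] [gr gi]; split.
  rewrite (_ : (fun x => _) = (fun x => complex.Re (f x) * complex.Re (g x)
     - complex.Im (f x) * complex.Im (g x))).
    by apply: measurable_funB; exact: measurable_funM.
  by apply/funext => x; case: (f x) (g x) => a b [].
rewrite (_ : (fun x => _) = (fun x => complex.Re (f x) * complex.Im (g x)
     + complex.Im (f x) * complex.Re (g x))).
  by apply: measurable_funD; exact: measurable_funM.
by apply/funext => x; case: (f x) (g x) => a b [].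
Qed.

Lemma cmeas_conj f : cmeas f -> cmeas (fun x => conjc (f x)).
Proof.
move=> [fr fi]; split.
  by rewrite (_ : (fun x => _) = (fun x => complex.Re (f x)))//; apply/funext => x; case: (f x).
rewrite (_ : (fun x => _) = (fun x => - complex.Im (f x))); first exact: measurableT_comp.
by apply/funext => x; case: (f x).
Qed.

Lemma cmeas_real h : measurable_fun D h -> cmeas (fun x => (h x)%:C).
Proof. by move=> mh; split=> //=; exact: measurable_cst. Qed.

Lemma cmeas_inv f : cmeas f -> cmeas (fun x => (f x)^-1).
Proof.
move=> [fr fi].
have mi : measurable_fun D (fun x => (complex.Re (f x) ^+ 2 + complex.Im (f x) ^+ 2)^-1).
  by apply: measurable_invr; apply: measurable_funD; exact: measurable_funX.
split.
  rewrite (_ : (fun x => _) = (fun x => complex.Re (f x) *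
      (complex.Re (f x) ^+ 2 + complex.Im (f x) ^+ 2)^-1)); first exact: measurable_funM.
  by apply/funext => x; case: (f x).
rewrite (_ : (fun x => _) = (fun x => - complex.Im (f x) *
    (complex.Re (f x) ^+ 2 + complex.Im (f x) ^+ 2)^-1)).
  by apply: measurable_funM => //; exact: measurableT_comp.
by apply/funext => x; case: (f x) => a b /=; rewrite mulNr.
Qed.

Lemma cmeas_sum (I : Type) (r : seq I) (P : pred I) (F : I -> T -> R[i]) :
  (forall i, cmeas (F i)) -> cmeas (fun x => \sum_(i <- r | P i) F i x).
Proof.
move=> mF; elim: r => [|i r IH].
  by under eq_fun do rewrite big_nil; exact: cmeas_cst.
under eq_fun do rewrite big_cons.
by case: (P i) => //; exact: cmeasD.
Qed.

Lemma cmeas_prod (I : Type) (r : seq I) (P : pred I) (F : I -> T -> R[i]) :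
  (forall i, cmeas (F i)) -> cmeas (fun x => \prod_(i <- r | P i) F i x).
Proof.
move=> mF; elim: r => [|i r IH].
  by under eq_fun do rewrite big_nil; exact: cmeas_cst.
under eq_fun do rewrite big_cons.
by case: (P i) => //; exact: cmeasM.
Qed.

Definition mxmeas m n (A : T -> 'M[R[i]]_(m, n)) := forall i j, cmeas (fun x => A x i j).

Lemma mxmeas_cst m n (A : 'M[R[i]]_(m, n)) : mxmeas (fun=> A).
Proof. by move=> i j; exact: cmeas_cst. Qed.

Lemma mxmeasD m n (A B : T -> 'M[R[i]]_(m, n)) :
  mxmeas A -> mxmeas B -> mxmeas (fun x => A x + B x).
Proof. by move=> mA mB i j; under eq_fun do rewrite mxE; exact: cmeasD. Qed.

Lemma mxmeasN m n (A : T -> 'M[R[i]]_(m, n)) : mxmeas A -> mxmeas (fun x => - A x).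
Proof. by move=> mA i j; under eq_fun do rewrite mxE; exact: cmeasN. Qed.

Lemma mxmeasB m n (A B : T -> 'M[R[i]]_(m, n)) :
  mxmeas A -> mxmeas B -> mxmeas (fun x => A x - B x).
Proof. by move=> mA mB; apply: mxmeasD => //; exact: mxmeasN. Qed.

Lemma mxmeasM m n p (A : T -> 'M[R[i]]_(m, n)) (B : T -> 'M[R[i]]_(n, p)) :
  mxmeas A -> mxmeas B -> mxmeas (fun x => A x *m B x).
Proof.
move=> mA mB i j; under eq_fun do rewrite mxE.
by apply: cmeas_sum => k; exact: cmeasM.
Qed.

Lemma mxmeasZ m n h (A : T -> 'M[R[i]]_(m, n)) :
  measurable_fun D h -> mxmeas A -> mxmeas (fun x => (h x)%:C *: A x).
Proof.
move=> mh mA i j; under eq_fun do rewrite mxE.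
by apply: cmeasM => //; exact: cmeas_real.
Qed.

Lemma mxmeas_adj n (A : T -> 'M[R[i]]_n) : mxmeas A -> mxmeas (fun x => (A x)^t*).
Proof. by move=> mA i j; under eq_fun do rewrite !mxE conjCE; exact: cmeas_conj. Qed.

Lemma cmeas_det n (A : T -> 'M[R[i]]_n) : mxmeas A -> cmeas (fun x => \det (A x)).
Proof.
move=> mA; rewrite /determinant; apply: cmeas_sum => s; apply: cmeasM; first exact: cmeas_cst.
by apply: cmeas_prod => i; exact: mA.
Qed.

(** By Cramer's rule the inverse is rational in the entries. *)
Lemma mxmeas_inv n (A : T -> 'M[R[i]]_n) : (forall x, A x \in unitmx) ->
  mxmeas A -> mxmeas (fun x => invmx (A x)).
Proof.
move=> uA mA i j; under eq_fun do rewrite /invmx uA !mxE.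
apply: cmeasM; first by apply: cmeas_inv; exact: cmeas_det.
rewrite /cofactor; apply: cmeasM; first exact: cmeas_cst.
by apply: cmeas_det => k l; under eq_fun do rewrite !mxE; exact: mA.
Qed.

Lemma measurable_tr n (A : T -> 'M[R[i]]_n) : mxmeas A ->
  measurable_fun D (fun x => complex.Re (\tr (A x))).
Proof. by move=> mA; have [] : cmeas (fun x => \tr (A x)) by exact: cmeas_sum. Qed.

Lemma measurable_frob n (A B : T -> 'M[R[i]]_n) : mxmeas A -> mxmeas B ->
  measurable_fun D (fun x => frob (A x) (B x)).
Proof.
by move=> mA mB; apply: measurable_tr; apply: mxmeasM => //; exact: mxmeas_adj.
Qed.

Lemma mxmeas_cvg m n (A : nat -> T -> 'M[R[i]]_(m, n)) (B : T -> 'M[R[i]]_(m, n)) :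
  (forall k, mxmeas (A k)) ->
  (forall x i j, complex.Re (A k x i j) @[k --> \oo] --> complex.Re (B x i j)) ->
  (forall x i j, complex.Im (A k x i j) @[k --> \oo] --> complex.Im (B x i j)) ->
  mxmeas B.
Proof.
move=> mA cR cI i j; split.
  apply: (measurable_fun_cvg (fun k => (mA k i j).1)) => x _; exact: cR.
apply: (measurable_fun_cvg (fun k => (mA k i j).2)) => x _; exact: cI.
Qed.

(** Dividing by one plus the trace brings the spectrum into [0, 1], where the polynomial iteration
    converges; the root is then scaled back. *)
Lemma mxmeas_sqrt n (A : T -> 'M[R[i]]_n) : (forall x, posmx (A x)) -> mxmeas A ->
  exists S : T -> 'M[R[i]]_n,
    [/\ mxmeas S, forall x, posmx (S x) & forall x, S x *m S x = A x].
Proof.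
move=> pA mA; pose c x := 1 + complex.Re (\tr (A x)).
have c0 x : 0 < c x by rewrite ltr_pwDl// pos_tr_ge0.
have mc : measurable_fun D c by apply: measurable_funD => //; exact: measurable_tr.
pose A' x := ((c x)^-1)%:C *: A x.
have pA' x : posmx (A' x) by apply: posZ => //; rewrite invr_ge0 ltW.
have tA' x : complex.Re (\tr (A' x)) <= 1.
  by rewrite mxtraceZ Re_rmul mulrC ler_pdivrMr// mul1r lerDr.
have mA' : mxmeas A' by apply: mxmeasZ => //; exact: measurable_invr.
pose S x := sval (cid (sqrt_iter_cvg (pA' x) (tA' x))).
have SP x : [/\ posmx (S x), S x *m S x = A' x,
    forall i j, complex.Re (sqrt_iter k (A' x) i j) @[k --> \oo] --> complex.Re (S x i j) &
    forall i j, complex.Im (sqrt_iter k (A' x) i j) @[k --> \oo] --> complex.Im (S x i j)].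
  exact: (svalP (cid (sqrt_iter_cvg (pA' x) (tA' x)))).
have mS : mxmeas S.
  apply: (@mxmeas_cvg _ _ (fun k x => sqrt_iter k (A' x))) => [|x i j|x i j].
  - elim=> [|k IH] /=; first exact: mxmeas_cst.
    apply: mxmeasD => //; apply: mxmeasZ; first exact: measurable_cst.
    by apply: mxmeasB => //; exact: mxmeasM.
  - by have [_ _ + _] := SP x; exact.
  - by have [_ _ _] := SP x; exact.
exists (fun x => (Num.sqrt (c x))%:C *: S x); split.
- apply: mxmeasZ => //.
  exact: (measurableT_comp (continuous_measurable_fun (@sqrt_continuous R)) mc).
- by move=> x; apply: posZ; [exact: sqrtr_ge0|have [] := SP x].
- move=> x; rewrite -scalemxAl -scalemxAr scalerA -rmorphM -expr2 sqr_sqrtr ?ltW//.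
  have [_ -> _ _] := SP x; rewrite scalerA -rmorphM mulfV ?gt_eqF//.
  by rewrite scale1r.
Qed.

End MeasurableComplex.

(** * Integrals of bounded scalar and matrix fields *)

Section BoundedIntegrals.
Context {R : realType} {d0 : measure_display} {T : measurableType d0}.
Variable gam : {finite_measure set T -> \bar R}.

Lemma bounded_integrable (A : set T) (h : T -> R) (C : R) : measurable A ->
  measurable_fun setT h -> (forall x, `|h x| <= C) -> gam.-integrable A (EFin \o h).
Proof.
move=> mA mh hC; apply: measurable_bounded_integrable => //.
- by rewrite -ge0_fin_numE ?fin_num_measure.
- exact: measurable_funTS.
- exists C; split; first exact: num_real.
  by move=> M CM x _ /=; apply: le_trans (hC x) (ltW CM).
Qed.

(** On the set where [h] is negative, integrals over subsets are both nonnegative and nonpositive,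
    so [h] vanishes almost everywhere there. *)
Lemma ae_ge0_of_integral (h : T -> R) : gam.-integrable setT (EFin \o h) ->
  (forall A, measurable A -> 0 <= \int[gam]_(x in A) h x) ->
  {ae gam, forall x, 0 <= h x}.
Proof.
move=> ih H; have mh : measurable_fun setT h by apply/measurable_EFinP/(measurable_int gam).
pose N := [set x | h x < 0].
have mN : measurable N.
  rewrite [N](_ : _ = h @^-1` `]-oo, 0[%classic).
    by rewrite -[X in measurable X]setTI; apply: mh => //; exact: measurable_itv.
  by apply/seteqP; split=> x /=; rewrite in_itv.
have : ae_eq gam N (EFin \o h) (cst 0%E).
  apply: integral_ae_eq => //; first exact: integrableS ih.
  move=> E EN mE; rewrite integral_cst// mul0e.
  have iE : gam.-integrable E (EFin \o h) by exact: (integrableS measurableT).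
  apply/eqP; rewrite eq_le; apply/andP; split.
    rewrite -oppe_ge0 -integralN; last exact: integrable_add_def.
    by apply: integral_ge0 => x /EN hx /=; rewrite lee_fin oppr_ge0 ltW.
  by have := H E mE; rewrite -lee_fin /Rintegral fineK//; exact: integrable_fin_num.
apply: filterS => x /= h0; rewrite leNgt; apply/negP => hx.
by have /eqP := h0 hx; rewrite eqe lt_eqF.
Qed.

Lemma integrable_sumr (A : set T) (I : Type) (r : seq I) (h : I -> T -> R) : measurable A ->
  (forall i, gam.-integrable A (EFin \o h i)) ->
  gam.-integrable A (EFin \o (fun x => \sum_(i <- r) h i x)).
Proof.
move=> mA ih.
rewrite (_ : EFin \o _ = (fun x => \sum_(i <- r) (EFin \o h i) x)%E); last first.
  by apply/funext => x /=; rewrite sumEFin.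
exact: integrable_sum.
Qed.

Lemma Rint_sum (A : set T) (I : Type) (r : seq I) (h : I -> T -> R) : measurable A ->
  (forall i, gam.-integrable A (EFin \o h i)) ->
  \int[gam]_(x in A) (\sum_(i <- r) h i x) = \sum_(i <- r) \int[gam]_(x in A) h i x.
Proof.
move=> mA ih; elim: r => [|i r IH].
  by under eq_Rintegral do rewrite big_nil; rewrite big_nil Rintegral_cst// mul0r.
under eq_Rintegral do rewrite big_cons.
by rewrite big_cons RintegralD ?IH//; exact: integrable_sumr.
Qed.

Variable d : nat.
Notation M := 'M[R[i]]_d.
Implicit Types (k F : T -> M).

Definition bmx k (C : R) := mxmeas setT k /\ forall x, frobn (k x) <= C.

Lemma bmx_frob k F C C' : bmx k C -> bmx F C' ->
  measurable_fun setT (fun x => frob (k x) (F x)) /\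
  forall x, `|frob (k x) (F x)| <= C * C'.
Proof.
move=> [mk kC] [mF FC]; split; first exact: measurable_frob.
move=> x; apply: le_trans (frob_le _ _) _.
by apply: ler_pM => //; exact: frobn_ge0.
Qed.

Lemma frob_integrable A k F C C' : measurable A -> bmx k C -> bmx F C' ->
  gam.-integrable A (EFin \o (fun x => frob (k x) (F x))).
Proof.
by move=> mA bk bF; have [m b] := bmx_frob bk bF; exact: bounded_integrable m b.
Qed.

Lemma bmx_cst (X : M) : bmx (fun=> X) (frobn X).
Proof. by split=> //; exact: mxmeas_cst. Qed.

Definition mint k (A : set T) : M := \matrix_(i, j)
  ((\int[gam]_(x in A) complex.Re (k x i j)) +i* (\int[gam]_(x in A) complex.Im (k x i j))).

(** Entries are Frobenius tests against matrix units (times [i] for imaginary parts), so entrywise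
    statements and statements about all tests [frob _ X] are interchangeable. *)
Lemma Re_frob (A : M) i j : complex.Re (A i j) = frob A (delta_mx i j).
Proof.
rewrite frobE (bigD1 i)//= [X in _ + X]big1 ?addr0 => [|k ki]; last first.
  by rewrite big1// => l _; rewrite !mxE (negbTE ki) /= !mulr0 addr0.
rewrite (bigD1 j)//= [X in _ + X]big1 ?addr0 => [|l lj]; last first.
  by rewrite !mxE (negbTE lj) andbF /= !mulr0 addr0.
by rewrite mxE !eqxx /= mulr1 mulr0 addr0.
Qed.

Lemma Im_frob (A : M) i j : complex.Im (A i j) = frob A ((Complex 0 1) *: delta_mx i j).
Proof.
rewrite frobE (bigD1 i)//= [X in _ + X]big1 ?addr0 => [|k ki]; last first.
  by rewrite big1// => l _; rewrite !mxE (negbTE ki) mulr0 /= !mulr0 addr0.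
rewrite (bigD1 j)//= [X in _ + X]big1 ?addr0 => [|l lj]; last first.
  by rewrite !mxE (negbTE lj) andbF mulr0 /= !mulr0 addr0.
by rewrite !mxE !eqxx mulr1 /= mulr0 mulr1 add0r.
Qed.

Lemma bmx_entries k C i j : bmx k C ->
  (forall A, measurable A -> gam.-integrable A (EFin \o (fun x => complex.Re (k x i j)))) /\
  (forall A, measurable A -> gam.-integrable A (EFin \o (fun x => complex.Im (k x i j)))).
Proof.
move=> bk; split=> A mA.
  rewrite (_ : EFin \o _ = EFin \o (fun x => frob (k x) (delta_mx i j))).
    exact: frob_integrable mA bk (bmx_cst _).
  by apply/funext => x /=; rewrite Re_frob.
rewrite (_ : EFin \o _ = EFin \o (fun x => frob (k x) ((Complex 0 1) *: delta_mx i j))).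
  exact: frob_integrable mA bk (bmx_cst _).
by apply/funext => x /=; rewrite Im_frob.
Qed.

Lemma frob_mint_entries k (A : set T) X : measurable A ->
  (forall i j, gam.-integrable A (EFin \o (fun x => complex.Re (k x i j))) /\
    gam.-integrable A (EFin \o (fun x => complex.Im (k x i j)))) ->
  gam.-integrable A (EFin \o (fun x => frob (k x) X)) /\
  frob (mint k A) X = \int[gam]_(x in A) frob (k x) X.
Proof.
move=> mA ik.
have ir i j : gam.-integrable A (EFin \o (fun x => complex.Re (k x i j) * complex.Re (X i j))).
  exact: (integrableZr mA _ (ik i j).1).
have ii i j : gam.-integrable A (EFin \o (fun x => complex.Im (k x i j) * complex.Im (X i j))).
  exact: (integrableZr mA _ (ik i j).2).
have iri i j : gam.-integrable A (EFin \o (fun x => complex.Re (k x i j) * complex.Re (X i j)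
    + complex.Im (k x i j) * complex.Im (X i j))).
  exact: (integrableD mA (ir i j) (ii i j)).
have irow i : gam.-integrable A (EFin \o (fun x => \sum_j (complex.Re (k x i j) * complex.Re (X i j)
    + complex.Im (k x i j) * complex.Im (X i j)))).
  exact: integrable_sumr.
split.
  rewrite (_ : EFin \o _ = EFin \o (fun x => \sum_i \sum_j (complex.Re (k x i j) * complex.Re (X i j)
    + complex.Im (k x i j) * complex.Im (X i j)))); first exact: integrable_sumr.
  by apply/funext => x /=; rewrite frobE.
under [RHS]eq_Rintegral do rewrite frobE.
rewrite frobE Rint_sum//; apply: eq_bigr => i _; rewrite Rint_sum//; apply: eq_bigr => j _.
rewrite RintegralD// !mxE /= RintegralZr ?RintegralZr//; exact: (ik i j).2 || exact: (ik i j).1.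
Qed.

Lemma frob_mint k C (A : set T) X : measurable A -> bmx k C ->
  frob (mint k A) X = \int[gam]_(x in A) frob (k x) X.
Proof.
move=> mA bk; apply: (frob_mint_entries X mA _).2 => i j.
by have [h1 h2] := bmx_entries i j bk; split; [exact: h1|exact: h2].
Qed.

Lemma frob_eqP (A B : M) : (forall X, frob A X = frob B X) -> A = B.
Proof. by move=> AB; apply/eqP; rewrite -subr_eq0; apply/eqP/frob_eq0; rewrite {1}frobBl AB subrr. Qed.

End BoundedIntegrals.

(** * Matrix measures given by bounded densities with respect to a reference measure *)

Section Representation.
Context {R : realType} {Omega : ptopologicalType} {d : nat}.
Notation M := 'M[R[i]]_d.
Notation T := (borel Omega).
Notation hpm := (hpm R Omega d).
Implicit Types (G H : hpm) (k F : T -> M).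

Lemma open_borel (A : set Omega) : open A -> measurable (A : set T).
Proof. by move=> oA; exact: sub_sigma_algebra. Qed.

Lemma closed_borel (A : set Omega) : closed A -> measurable (A : set T).
Proof.
move=> cA; rewrite -(setCK A); apply: measurableC; apply: open_borel.
exact: closed_openC.
Qed.

(** Values off the Borel sets are normalised to 0, and the remaining fields of the record are
    proofs. *)
Lemma hpm_ext G H : (forall A, measurable A -> G A = H A) -> G = H.
Proof.
move=> GH; have {}GH : hpm_val G = hpm_val H.
  apply/funext => A; have [mA|nmA] := pselect (measurable A); first exact: GH.
  by rewrite !hpm_out.
case: G H GH => [v p s r i o ra] [v' p' s' r' i' o' ra'] /= E; subst v'.
by congr Hpm; exact: Prop_irrelevance.
Qed.

Definition radon (gam : set T -> \bar R) := forall (A : set T) (e : R), measurable A -> 0 < e ->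
  exists K : set Omega, [/\ compact K, K `<=` A & (gam A < gam (K : set T) + e%:E)%E].

Lemma trmeas_radon G : radon (trmeas G).
Proof.
move=> A e mA e0; have [K [cK KA H]] := hpm_radon G mA e0.
by exists K; split=> //; rewrite /trmeas -EFinD lte_fin.
Qed.

Lemma hpm_pos G A : posmx (G A).
Proof. by apply/psdmxP; exact: hpm_psd. Qed.

Section WithMeasure.
Variable gam : {finite_measure set T -> \bar R}.

Definition bpos k (C : R) := [/\ mxmeas setT k, forall x, posmx (k x) &
  forall x, complex.Re (\tr (k x)) <= C].

(** [G] is [k] times [gam]. Leaving the reference measure free lets several measures share one, so
    that inequalities and curves of measures can be built pointwise on densities. *)
Definition rep k G := (exists C, bpos k C) /\
  forall A, measurable A -> forall X, frob (G A) X = \int[gam]_(x in A) frob (k x) X.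

Lemma bpos_bmx k C : bpos k C -> bmx k C.
Proof. by move=> [mk pk tk]; split=> // x; exact: le_trans (pos_frobn_le (pk x)) (tk x). Qed.

Lemma mint_pos k C A : measurable A -> bpos k C -> posmx (mint gam k A).
Proof.
move=> mA bk; have [mk pk tk] := bk; have bm := bpos_bmx bk; split.
  apply/hermP/frob_eqP => X; rewrite -frob_adj adjK !(frob_mint _ _ mA bm).
  by apply: eq_Rintegral => x _; rewrite -[LHS]frob_adj adjK (hermP _).1//; case: (pk x).
move=> Z; rewrite frob_mulr (frob_mint _ _ mA bm); apply: Rintegral_ge0 => x _.
by rewrite -frob_mulr; case: (pk x) => _; exact.
Qed.

Lemma mint_set0 k : mint gam k set0 = 0.
Proof. by apply/matrixP => i j; rewrite !mxE !Rintegral_set0. Qed.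

Lemma Rint_sigma_additive (h : T -> R) : gam.-integrable setT (EFin \o h) ->
  semi_sigma_additive (fun A => (\int[gam]_(x in A) h x)%:E).
Proof.
move=> ih F mF tF mUF.
have E A : measurable A -> (\int[gam]_(x in A) h x)%:E = (\int[gam]_(x in A) (h x)%:E)%E.
  move=> mA; rewrite /Rintegral fineK//; apply: integrable_fin_num => //.
  exact: (integrableS measurableT).
rewrite E//; under eq_fun do under eq_bigr do rewrite E//.
exact: (charge_semi_sigma_additive (s := induced_charge ih)).
Qed.

Lemma gam_finE A : measurable A -> gam A = (fine (gam A))%:E.
Proof. by move=> mA; rewrite fineK// fin_num_measure. Qed.

(** Entries are integrated one by one; inner regularity passes from [gam] because the trace of the
    density is at most [C], so a compact set missing little [gam]-mass misses little trace. *)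
Lemma hpm_of k C : hausdorff_space Omega -> radon gam -> bpos k C -> exists G, rep k G.
Proof.
move=> hO rg bk; have bm := bpos_bmx bk; have [mk pk tk] := bk.
have C0 : 0 <= C by exact: le_trans (pos_tr_ge0 (pk point)) (tk point).
pose v (A : set T) : M := if pselect (measurable A) then mint gam k A else 0.
have vE A : measurable A -> v A = mint gam k A by rewrite /v; case: pselect.
have vN A : ~ measurable A -> v A = 0 by rewrite /v; case: pselect.
have v1 A : forall (mA : measurable A), complex.Re (\tr (v A)) = \int[gam]_(x in A) complex.Re (\tr (k x)).
  move=> mA; rewrite vE// -frob1r (frob_mint _ _ mA bm).
  by apply: eq_Rintegral => x _; rewrite frob1r.
have ik A : measurable A -> gam.-integrable A (EFin \o (fun x => complex.Re (\tr (k x)))).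
  move=> mA; apply: (@bounded_integrable _ _ _ _ _ _ C) => //; first exact: measurable_tr.
  by move=> x; rewrite ger0_norm ?pos_tr_ge0.
have psdv A : psdmx (v A).
  apply/psdmxP; have [mA|nmA] := pselect (measurable A).
    by rewrite vE//; exact: mint_pos mA bk.
  by rewrite vN//; exact: pos0.
have v0 : v set0 = 0 by rewrite vE// mint_set0.
have sR i j : semi_sigma_additive (fun A => (complex.Re (v A i j))%:E).
  move=> F mF tF mUF; have [iR _] := bmx_entries gam i j bm.
  have := Rint_sigma_additive (iR _ measurableT) mF tF mUF.
  rewrite vE// mxE /=; under [X in _ -> X @ _ --> _]eq_fun do
    (under eq_bigr do rewrite vE// mxE /=).
  by [].
have sI i j : semi_sigma_additive (fun A => (complex.Im (v A i j))%:E).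
  move=> F mF tF mUF; have [_ iI] := bmx_entries gam i j bm.
  have := Rint_sigma_additive (iI _ measurableT) mF tF mUF.
  rewrite vE// mxE /=; under [X in _ -> X @ _ --> _]eq_fun do
    (under eq_bigr do rewrite vE// mxE /=).
  by [].
have rv (A : set T) (e : R) : measurable A -> 0 < e -> exists K : set Omega,
    [/\ compact K, K `<=` A & complex.Re (\tr (v A)) < complex.Re (\tr (v K)) + e].
  move=> mA e0; have e1 : 0 < e / (C + 1) by rewrite divr_gt0// ltr_wpDl.
  have [K [cK KA H]] := rg A _ mA e1.
  have mK : measurable (K : set T) := closed_borel (compact_closed hO cK).
  exists K; split=> //; rewrite !v1// -ltrBlDl.
  have -> : \int[gam]_(x in A) complex.Re (\tr (k x)) =
      \int[gam]_(x in K) complex.Re (\tr (k x)) + \int[gam]_(x in A `\` K) complex.Re (\tr (k x)).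
    rewrite -Rintegral_setU ?setDUK//.
    - exact: measurableD.
    - exact: ik.
    - by apply/disj_setPS => x [Kx []].
  rewrite addrAC subrr add0r.
  have mD : measurable (A `\` K : set T) by exact: measurableD.
  apply: (@le_lt_trans _ _ (C * fine (gam (A `\` K)))).
    rewrite -Rintegral_cst//; apply: le_Rintegral => //; first exact: ik.
    by apply: (@bounded_integrable _ _ _ _ _ _ `|C|).
  apply: (@le_lt_trans _ _ (C * (e / (C + 1)))).
    apply: ler_wpM2l => //; rewrite -lee_fin -gam_finE// measureD//; last first.
      by rewrite -ge0_fin_numE ?fin_num_measure.
    rewrite (setIidr KA) leeBlDl ?fin_num_measure//.
    exact: ltW.
  by rewrite mulrA ltr_pdivrMr ?ltr_wpDl// mulrC ltr_pM2l// ltrDl.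
pose G := Hpm psdv v0 sR sI vN rv.
exists G; split; first by exists C.
by move=> A mA X; rewrite /= vE// (frob_mint _ _ mA bm).
Qed.

End WithMeasure.
End Representation.

(** * Change of reference measure for pairings and actions *)

Section Transfer.
Context {R : realType} {Omega : ptopologicalType} {d : nat}.
Notation M := 'M[R[i]]_d.
Notation T := (borel Omega).
Notation hpm := (hpm R Omega d).
Implicit Types (G H : hpm) (k F : T -> M).
Variable gam : {finite_measure set T -> \bar R}.

Lemma trmeas_rep k G A : rep gam k G -> measurable A ->
  trmeas G A = (\int[gam]_(x in A) (complex.Re (\tr (k x)))%:E)%E.
Proof.
move=> [[C bk] GA] mA; have [mk pk tk] := bk.
rewrite /trmeas -frob1r GA// /Rintegral fineK.
  by apply: eq_integral => x _; rewrite frob1r.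
apply: integrable_fin_num => //.
exact: (frob_integrable gam mA (bpos_bmx bk) (bmx_cst _)).
Qed.

Lemma trmeas_dominates k G : rep gam k G -> trmeas G `<< gam.
Proof.
move=> rk; apply/null_content_dominatesP => A mA A0.
rewrite (trmeas_rep rk mA); apply: null_set_integral => //.
have [[C [mk _ _]] _] := rk.
by apply/measurable_EFinP/measurable_funTS/measurable_tr.
Qed.

Let mtr k G : rep gam k G -> measurable_fun setT (fun x => complex.Re (\tr (k x))).
Proof. by move=> [[C [mk pk tk]] _]; exact: measurable_tr. Qed.

Let tr_ge0 k G : rep gam k G -> forall x, 0 <= complex.Re (\tr (k x)).
Proof. by move=> [[C [mk pk tk]] _] x; exact: pos_tr_ge0. Qed.

Lemma transfer_ge0 k G A (f : T -> \bar R) : rep gam k G -> measurable A ->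
  (forall x, 0 <= f x)%E -> measurable_fun setT f ->
  (\int[trmeas G]_(x in A) f x = \int[gam]_(x in A) (f x * (complex.Re (\tr (k x)))%:E))%E.
Proof.
move=> rk mA f0 mf; have dom := trmeas_dominates rk.
rewrite -(Radon_Nikodym_SigmaFinite.change_of_variables dom)//; last exact: measurable_funTS.
have mE : measurable_fun setT (fun x => (complex.Re (\tr (k x)))%:E).
  by apply/measurable_EFinP; exact: mtr rk.
have mRN : measurable_fun setT (Radon_Nikodym_SigmaFinite.f (trmeas G) gam).
  exact: measurable_int (Radon_Nikodym_SigmaFinite.f_integrable dom).
apply: ae_eq_integral => //.
- by apply: measurable_funTS; exact: emeasurable_funM.
- by apply: measurable_funTS; exact: emeasurable_funM.
apply: ae_eqe_mul2l; apply: integral_ae_eq => //.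
- apply: (integrableS measurableT) => //.
  exact: Radon_Nikodym_SigmaFinite.f_integrable.
- exact: measurable_funTS.
- move=> E _ mE'; rewrite -(trmeas_rep rk mE').
  by rewrite -Radon_Nikodym_SigmaFinite.f_integral.
Qed.

Lemma transfer k G A (f : T -> R) : rep gam k G -> measurable A ->
  measurable_fun setT f ->
  (\int[trmeas G]_(x in A) (f x)%:E =
   \int[gam]_(x in A) (f x * complex.Re (\tr (k x)))%:E)%E.
Proof.
move=> rk mA mf; have mfE : measurable_fun setT (EFin \o f) by exact/measurable_EFinP.
rewrite integralE [in RHS]integralE.
rewrite (transfer_ge0 rk mA) ?(transfer_ge0 rk mA)//; last 2 first.
- exact: measurable_funeneg.
- exact: measurable_funepos.
congr (_ - _)%E; apply: eq_integral => x _.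
  by rewrite !funeposE -!EFin_max -EFinM maxr_pMl ?mul0r// (tr_ge0 rk).
by rewrite !funenegE -!EFinN -!EFin_max -EFinM maxr_pMl ?mul0r ?mulNr// (tr_ge0 rk).
Qed.

(** For a positive matrix the Frobenius norm is at most the trace, so trace zero forces the whole
    matrix to vanish. *)
Lemma entry_Re_dominates G i j : entry_Re G i j `<< trmeas G.
Proof.
apply/null_content_dominatesP => A mA; rewrite /trmeas /entry_Re => -[A0].
suff -> : G A = 0 by rewrite mxE.
apply: frobn_eq0; apply/eqP; rewrite eq_le frobn_ge0 andbT -A0.
exact/pos_frobn_le/hpm_pos.
Qed.

Lemma entry_Im_dominates G i j : entry_Im G i j `<< trmeas G.
Proof.
apply/null_content_dominatesP => A mA; rewrite /trmeas /entry_Im => -[A0].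
suff -> : G A = 0 by rewrite mxE.
apply: frobn_eq0; apply/eqP; rewrite eq_le frobn_ge0 andbT -A0.
exact/pos_frobn_le/hpm_pos.
Qed.

Let RN_fin (nu : {charge set T -> \bar R}) G (x : T) : nu `<< trmeas G ->
  Radon_Nikodym nu (trmeas G) x = (fine (Radon_Nikodym nu (trmeas G) x))%:E.
Proof. by move=> dom; rewrite fineK// Radon_Nikodym_fin_num. Qed.

Lemma mxmeas_density G : mxmeas setT (density G).
Proof.
move=> i j; split; under eq_fun do rewrite mxE /=.
  apply/measurable_EFinP; rewrite (_ : EFin \o _ = Radon_Nikodym (entry_Re G i j) (trmeas G)).
    by apply: measurable_int; apply: Radon_Nikodym_integrable; exact: entry_Re_dominates.
  by apply/funext => x /=; rewrite -RN_fin//; exact: entry_Re_dominates.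
apply/measurable_EFinP; rewrite (_ : EFin \o _ = Radon_Nikodym (entry_Im G i j) (trmeas G)).
  by apply: measurable_int; apply: Radon_Nikodym_integrable; exact: entry_Im_dominates.
by apply/funext => x /=; rewrite -RN_fin//; exact: entry_Im_dominates.
Qed.

Let ae_entry G k (nu : {charge set T -> \bar R}) (h : T -> R) : rep gam k G -> nu `<< trmeas G ->
  gam.-integrable setT (EFin \o h) ->
  (forall A, measurable A -> nu A = (\int[gam]_(x in A) h x)%:E) ->
  {ae gam, forall x, h x = fine (Radon_Nikodym nu (trmeas G) x) * complex.Re (\tr (k x))}.
Proof.
move=> rk dom ih nuE.
have mRN : measurable_fun setT (fun x => fine (Radon_Nikodym nu (trmeas G) x)).
  apply/measurable_EFinP; rewrite (_ : EFin \o _ = Radon_Nikodym nu (trmeas G)).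
    by apply: measurable_int; exact: Radon_Nikodym_integrable.
  by apply/funext => x /=; rewrite -RN_fin.
have : ae_eq gam setT (EFin \o h)
    (EFin \o (fun x => fine (Radon_Nikodym nu (trmeas G) x) * complex.Re (\tr (k x)))).
  apply: integral_ae_eq => //.
    by apply/measurable_EFinP; apply: measurable_funM => //; exact: mtr rk.
  move=> E _ mE; have := nuE E mE; rewrite /Rintegral fineK; last first.
    by apply: integrable_fin_num => //; exact: (integrableS measurableT).
  move=> <-; rewrite -(transfer rk mE mRN) (Radon_Nikodym_integral dom mE).
  by apply: eq_integral => x _; exact: RN_fin.
by apply: filterS => x /= /(_ I) [].
Qed.

(** Both sides integrate to the entries of [G] over every Borel set. This links an arbitrary density
    to the one relative to the trace measure, which the definitions use. *)
Lemma rep_density k G : rep gam k G ->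
  {ae gam, forall x, k x = (complex.Re (\tr (k x)))%:C *: density G x}.
Proof.
move=> rk; have [[C bk] GA] := rk; have bm := bpos_bmx bk.
have H : {ae gam, forall x, forall i j,
    complex.Re (k x i j) = fine (Radon_Nikodym (entry_Re G i j) (trmeas G) x) * complex.Re (\tr (k x)) /\
    complex.Im (k x i j) = fine (Radon_Nikodym (entry_Im G i j) (trmeas G) x) * complex.Re (\tr (k x))}.
  apply: filter_forall => i; apply: filter_forall => j.
  have [iR iI] := bmx_entries gam i j bm.
  apply: filterI.
    apply: ae_entry => //; [exact: entry_Re_dominates|exact: iR|].
    move=> A mA; rewrite [LHS](_ : _ = (complex.Re (G A i j))%:E)// Re_frob GA//; congr EFin.
    by apply: eq_Rintegral => x _; rewrite Re_frob.
  apply: ae_entry => //; [exact: entry_Im_dominates|exact: iI|].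
  move=> A mA; rewrite [LHS](_ : _ = (complex.Im (G A i j))%:E)// Im_frob GA//; congr EFin.
  by apply: eq_Rintegral => x _; rewrite Im_frob.
move: H; apply: filterS => x H; apply/matrixP => i j; rewrite !mxE.
have [h1 h2] := H i j; move: h1 h2; case: (k x i j) => a b /= -> ->.
by congr (_ +i* _); rewrite mulrC mul0r ?subr0 ?addr0.
Qed.

(** The gateway between the definitions and pointwise computation: pairings, actions and masses may
    all be computed with any density. *)
Lemma integral_rep k G (U V : T -> M) : rep gam k G -> mxmeas setT U -> mxmeas setT V ->
  (\int[trmeas G]_x (frob (density G x *m U x) (V x))%:E =
   \int[gam]_x (frob (k x *m U x) (V x))%:E)%E.
Proof.
move=> rk mU mV; have [[C [mk _ _]] _] := rk.
have mdU : measurable_fun setT (fun x => frob (density G x *m U x) (V x)).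
  by apply: measurable_frob => //; apply: mxmeasM => //; exact: mxmeas_density.
rewrite (transfer rk)//; apply: ae_eq_integral => //.
- by apply/measurable_EFinP; apply: measurable_funM => //; exact: mtr rk.
- by apply/measurable_EFinP; apply: measurable_frob => //; exact: mxmeasM.
have := rep_density rk; apply: filterS => x /= kE _; congr EFin.
by rewrite [in RHS]kE -scalemxAl frobZl mulrC.
Qed.

Lemma pairing_mul_rep k G (U V : T -> M) : rep gam k G -> mxmeas setT U -> mxmeas setT V ->
  pairing_mul G U V = \int[gam]_x frob (k x *m U x) (V x).
Proof. by move=> rk mU mV; rewrite /pairing_mul /Rintegral (integral_rep rk). Qed.

Lemma L2norm2_rep k G (U : T -> M) : rep gam k G -> mxmeas setT U ->
  (L2norm2 G U = \int[gam]_x (frob (k x *m U x) (U x))%:E)%E.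
Proof. by move=> rk mU; rewrite /L2norm2 (integral_rep rk). Qed.

Lemma pairing_rep k G (F : T -> M) : rep gam k G -> mxmeas setT F ->
  pairing G F = \int[gam]_x frob (k x) (F x).
Proof.
move=> rk mF; transitivity (pairing_mul G (fun=> 1%:M) F).
  by rewrite /pairing /pairing_mul; apply: eq_Rintegral => x _; rewrite mulmx1.
rewrite (pairing_mul_rep rk (mxmeas_cst _ _) mF).
by apply: eq_Rintegral => x _; rewrite mulmx1.
Qed.

Lemma mass_rep k G : rep gam k G -> hpm_mass G = \int[gam]_x complex.Re (\tr (k x)).
Proof.
move=> [_ GA]; rewrite /hpm_mass -frob1r GA//.
by apply: eq_Rintegral => x _; rewrite frob1r.
Qed.

End Transfer.

(** * Existence of bounded positive densities *)

Section RationalApproximation.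
Context {R : realType} {d : nat}.
Notation M := 'M[R[i]]_d.

Definition rat_mx (Q : 'M[rat * rat]_d) : M :=
  \matrix_(i, j) ((ratr (Q i j).1) +i* (ratr (Q i j).2)).

Lemma rat_mx_dense (Z : M) (e : R) : 0 < e -> exists Q, frobn (rat_mx Q - Z) <= e.
Proof.
move=> e0; pose N : R := (d * d * 2).+1%:R.
have N0 : 0 < N by rewrite ltr0n.
have N1 : 1 <= N by rewrite ler1n.
have H (r : R) : exists q : rat, r < ratr q < r + e / N.
  have HH : r < r + e / N by rewrite ltrDl divr_gt0.
  have [q] := @rat_in_itvoo R r (r + e / N) HH.
  by rewrite in_itv /=; exists q.
pose q r := sval (cid (H r)).
have qP r : (ratr (q r) - r) ^+ 2 <= e ^+ 2 / N.
  rewrite /q; case: cid => s /= /andP[s1 s2].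
  apply: (@le_trans _ _ ((e / N) ^+ 2)).
    by rewrite ler_pXn2r ?nnegrE ?divr_ge0 ?(ltW e0) ?(ltW N0)// ?subr_ge0 ?lerBlDl ltW.
  rewrite expr_div_n ler_wpM2l ?sqr_ge0// lef_pV2 ?posrE ?exprn_gt0//.
  by rewrite ler_eXnr.
exists (\matrix_(i, j) (q (complex.Re (Z i j)), q (complex.Im (Z i j)))).
rewrite -(@ler_pXn2r _ 2) ?nnegrE ?frobn_ge0 ?(ltW e0)// sqr_frobn frobE.
apply: (@le_trans _ _ (\sum_(i < d) \sum_(j < d) (e ^+ 2 / N + e ^+ 2 / N))).
  apply: ler_sum => i _; apply: ler_sum => j _; rewrite !mxE.
  have := qP (complex.Re (Z i j)); have := qP (complex.Im (Z i j)).
  by case: (Z i j) => a b /= h1 h2; rewrite -!expr2; exact: lerD.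
rewrite !sumr_const !card_ord -!mulrnA -mulr2n -mulrnA.
rewrite -mulr_natr -mulrA ler_piMr ?sqr_ge0// mulrC ler_pdivrMr// mul1r /N ler_nat.
by rewrite mulnC leqnSn.
Qed.

(** An inequality known almost everywhere for each test matrix holds simultaneously only for
    countably many of them; rational matrices suffice by density. *)
Lemma posmx_rational (A : M) : A \is hermsymmx ->
  (forall Q, 0 <= frob (A *m rat_mx Q) (rat_mx Q)) -> posmx A.
Proof.
move=> hA H; split=> // Z.
pose K := frobn A * (2 * frobn Z + 1).
have K0 : 0 <= K by rewrite mulr_ge0 ?addr_ge0 ?mulr_ge0 ?frobn_ge0.
apply/ler_addgt0Pr => e e0.
pose e' := Num.min 1 (e / (K + 1)).
have e'0 : 0 < e' by rewrite lt_min ltr01 divr_gt0// ltr_wpDl.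
have [Q QZ] := rat_mx_dense Z e'0.
set W := rat_mx Q - Z in QZ.
have QE : rat_mx Q = Z + 1%:C *: W by rewrite scale1r addrC subrK.
have := H Q; rewrite QE frob_quadD// => h.
have h1 : frob (A *m Z) W <= frobn A * frobn Z * e'.
  apply: le_trans (frob_ler _ _) _.
  by apply: ler_pM => //; [exact: frobn_ge0|exact: frobn_ge0|exact: frobn_mul].
have h2 : frob (A *m W) W <= frobn A * e'.
  apply: le_trans (frob_quad_le _ _) _; apply: ler_wpM2l; first exact: frobn_ge0.
  rewrite -sqr_frobn expr2 -[leRHS]mul1r; apply: ler_pM => //; try exact: frobn_ge0.
  by apply: le_trans QZ _; rewrite ge_min lexx.
have h3 : K * e' <= e.
  apply: (@le_trans _ _ (K * (e / (K + 1)))).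
    by rewrite ler_wpM2l// ge_min lexx orbT.
  by rewrite mulrA ler_pdivrMr ?ltr_wpDl// mulrC ler_pM2l// lerDl.
rewrite /K in h3; nra.
Qed.

End RationalApproximation.

Section Existence.
Context {R : realType} {Omega : ptopologicalType} {d : nat}.
Notation M := 'M[R[i]]_d.
Notation T := (borel Omega).
Notation hpm := (hpm R Omega d).
Variable gam : {finite_measure set T -> \bar R}.

(** Entrywise Radon-Nikodym derivatives are Hermitian, positive and of trace at most 1 almost
    everywhere, and are replaced by 0 on the exceptional null set. *)
Lemma rep_exists (G : hpm) : (forall A, measurable A -> (trmeas G A <= gam A)%E) ->
  exists k, rep gam k G /\ forall x, complex.Re (\tr (k x)) <= 1.
Proof.
move=> domG.
have dom : trmeas G `<< gam.
  apply/null_content_dominatesP => A mA A0; apply/eqP.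
  by rewrite eq_le measure_ge0 andbT -A0 domG.
have domR i j : entry_Re G i j `<< gam := null_dominates_trans (entry_Re_dominates (G := G) i j) dom.
have domI i j : entry_Im G i j `<< gam := null_dominates_trans (entry_Im_dominates (G := G) i j) dom.
pose k0 (x : T) : M := \matrix_(i, j) (fine (Radon_Nikodym (entry_Re G i j) gam x)
   +i* fine (Radon_Nikodym (entry_Im G i j) gam x)).
have RE i j : EFin \o (fun x => complex.Re (k0 x i j)) = Radon_Nikodym (entry_Re G i j) gam.
  by apply: funext => x /=; rewrite mxE /= fineK// (Radon_Nikodym_fin_num _ (domR i j)).
have IE i j : EFin \o (fun x => complex.Im (k0 x i j)) = Radon_Nikodym (entry_Im G i j) gam.
  by apply: funext => x /=; rewrite mxE /= fineK// (Radon_Nikodym_fin_num _ (domI i j)).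
have iRI A i j : measurable A -> gam.-integrable A (EFin \o (fun x => complex.Re (k0 x i j))) /\
    gam.-integrable A (EFin \o (fun x => complex.Im (k0 x i j))).
  move=> mA; split; (apply: (integrableS measurableT) => //).
    by rewrite RE; apply: Radon_Nikodym_integrable; exact: domR.
  by rewrite IE; apply: Radon_Nikodym_integrable; exact: domI.
have mk0 : mxmeas setT k0.
  move=> i j; have [h1 h2] := iRI _ i j measurableT.
  by split; apply/measurable_EFinP; [exact: measurable_int h1|exact: measurable_int h2].
have GE A : measurable A -> G A = mint gam k0 A.
  move=> mA; apply/matrixP => i j; rewrite mxE /Rintegral.
  rewrite [X in fine X +i* _](_ : _ = entry_Re G i j A); last first.
    by rewrite [RHS](Radon_Nikodym_integral (domR i j) mA); apply: eq_integral => x _; rewrite -RE.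
  rewrite [X in _ +i* fine X](_ : _ = entry_Im G i j A); last first.
    by rewrite [RHS](Radon_Nikodym_integral (domI i j) mA); apply: eq_integral => x _; rewrite -IE.
  by rewrite /entry_Re /entry_Im /=; case: (G A i j).
have GX A X : measurable A -> gam.-integrable A (EFin \o (fun x => frob (k0 x) X)) /\
    frob (G A) X = \int[gam]_(x in A) frob (k0 x) X.
  by move=> mA; rewrite GE//; apply: frob_mint_entries => // i j; exact: iRI.
(* All three pointwise properties are instances: [c = 1] and [X = - 1] for the trace, [X] a Gram
   matrix for positivity, and both signs of [X] minus its adjoint for hermiticity. *)
have test (c : R) X : (forall A, measurable A -> 0 <= c * fine (gam A) + frob (G A) X) ->
    {ae gam, forall x, 0 <= c + frob (k0 x) X}.
  move=> H.
  have ic A : measurable A -> gam.-integrable A (EFin \o (fun=> c)).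
    by move=> mA; exact: (@bounded_integrable _ _ _ _ _ _ `|c|).
  apply: ae_ge0_of_integral => [|A mA].
    exact: (integrableD measurableT (ic _ measurableT) (GX _ X measurableT).1).
  rewrite RintegralD//; [|exact: ic|exact: (GX _ X mA).1].
  by rewrite Rintegral_cst// -(GX _ X mA).2 H.
have tr1 : {ae gam, forall x, complex.Re (\tr (k0 x)) <= 1}.
  have := test 1 (- 1%:M); case=> [A mA|N [mN N0 sN]].
    rewrite frobNr frob1r mul1r subr_ge0 -lee_fin -gam_finE//; exact: domG.
  exists N; split=> //; apply: subset_trans sN => x /= h; apply: contra_not h.
  by rewrite frobNr frob1r subr_ge0.
have aepos : {ae gam, forall x, forall n : nat,
    if @unpickle 'M[rat * rat]_d n is Some Q then (0 <= frob (k0 x *m rat_mx Q) (rat_mx Q))%R else true}.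
  apply: ae_foralln => n; case: unpickle => [Q|]; last exact: aeW.
  have := test 0 (rat_mx Q *m (rat_mx Q)^t*); case=> [A mA|N [mN N0 sN]].
    by rewrite mul0r add0r -frob_mulr; case: (hpm_pos G A) => _; exact.
  exists N; split=> //; apply: subset_trans sN => x /= h; apply: contra_not h.
  by rewrite add0r -frob_mulr.
have aeherm : {ae gam, forall x, k0 x \is hermsymmx}.
  have H X : {ae gam, forall x, frob (k0 x) X = frob (k0 x) (X^t*)}.
    have hG A : frob (G A) (X - X^t*) = 0.
      rewrite frobBr -[X in X - _]frob_adj (hermP _).1 ?subrr//.
      by case: (hpm_pos G A).
    have t1 : {ae gam, forall x, 0 <= 0 + frob (k0 x) (X - X^t*)}.
      by apply: test => A mA; rewrite hG mul0r addr0.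
    have t2 : {ae gam, forall x, 0 <= 0 + frob (k0 x) (- (X - X^t*))}.
      by apply: test => A mA; rewrite frobNr hG mul0r oppr0 addr0.
    apply: filterS2 t1 t2 => x; rewrite !add0r frobNr frobBr => h1 h2.
    by apply/eqP; rewrite -subr_eq0 eq_le h1 andbT -oppr_ge0.
  have HR : {ae gam, forall x, forall i j, frob (k0 x) (delta_mx i j) = frob (k0 x) ((delta_mx i j)^t*) /\
     frob (k0 x) ((Complex 0 1) *: delta_mx i j) = frob (k0 x) (((Complex 0 1) *: delta_mx i j)^t*)}.
    by apply: filter_forall => i; apply: filter_forall => j; apply: filterI; exact: H.
  move: HR; apply: filterS => x h; apply/hermP/matrixP => i j; have [h1 h2] := h i j.
  have adjE X : frob (k0 x) (X^t*) = frob ((k0 x)^t*) X by rewrite -frob_adj adjK.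
  by apply/eqP; rewrite eq_complex !Re_frob !Im_frob h1 h2 !adjE !eqxx.
have [N [mN N0 sN]] : {ae gam, forall x, posmx (k0 x) /\ complex.Re (\tr (k0 x)) <= 1}.
  apply: (filterS _ (filterI tr1 (filterI aeherm aepos))) => x [t1 [hx px]]; split=> //.
  by apply: posmx_rational => // Q; have := px (pickle Q); rewrite pickleK.
(* The null set is discarded so that the bounds hold at every point. *)
pose k x := (\1_(~` N) x : R)%:C *: k0 x.
have kN x : N x -> k x = 0.
  by move=> Nx; rewrite /k indicE memNset ?scale0r//; exact: contra_not.
have kNN x : ~ N x -> k x = k0 x.
  by move=> Nx; rewrite /k indicE mem_set ?scale1r.
have tk x : complex.Re (\tr (k x)) <= 1.
  have [Nx|Nx] := pselect (N x); first by rewrite kN// mxtrace0.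
  rewrite kNN//; have [] : posmx (k0 x) /\ complex.Re (\tr (k0 x)) <= 1 by apply: contrapT => h; apply/Nx/sN.
  by [].
exists k; split=> //; split.
  exists 1; split=> //.
    by apply: mxmeasZ => //; apply: measurable_indic; exact: measurableC.
  move=> x; have [Nx|Nx] := pselect (N x); first by rewrite kN//; exact: pos0.
  by rewrite kNN//; have [] : posmx (k0 x) /\ complex.Re (\tr (k0 x)) <= 1 by apply: contrapT => h; apply/Nx/sN.
move=> A mA X.
transitivity (\int[gam]_(x in A) frob (k0 x) X).
  exact: (GX A X mA).2.
rewrite /Rintegral.
apply: (congr1 (@fine R)).
have mk : mxmeas setT k.
  by apply: mxmeasZ mk0; apply: measurable_indic; exact: measurableC.
have m1 : measurable_fun A (fun x => (frob (k0 x) X)%:E) := measurable_int _ (GX A X mA).1.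
have m2 : measurable_fun A (fun x => (frob (k x) X)%:E).
  by apply/measurable_EFinP; apply: measurable_funTS; apply: measurable_frob mk _; exact: mxmeas_cst.
apply: (ae_eq_integral _ _ mA m1 m2).
exists N; split=> // x /= h; apply: contrapT => Nx; apply: h => _.
by rewrite kNN.
Qed.

End Existence.

(** * Urysohn functions and approximation in mean by continuous functions *)

Section Metrizable.
Context {R : realType} {Omega : ptopologicalType}.
Notation T := (borel Omega).
Variable dT : Omega -> Omega -> R.
Hypothesis mT : is_metric dT.
Hypothesis nT : forall (x : Omega) (A : set Omega),
  nbhs x A <-> exists2 e : R, 0 < e & [set y | dT x y < e] `<=` A.

Lemma metric_hausdorff : hausdorff_space Omega.
Proof.
move=> x y xy; have [d0 d1 ds dt] := mT; apply/d1/eqP; apply: contrapT => /negP xney.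
have e0 : 0 < dT x y / 2 by rewrite divr_gt0// lt_neqAle eq_sym xney d0.
have nx : nbhs x [set z | dT x z < dT x y / 2] by apply/nT; exists (dT x y / 2).
have ny : nbhs y [set z | dT y z < dT x y / 2] by apply/nT; exists (dT x y / 2).
have [z [/= xz yz]] := xy _ _ nx ny.
have := dt x z y; rewrite (ds z y); lra.
Qed.

Lemma lipschitz_continuous (f : Omega -> R) :
  (forall x y, f x - f y <= dT x y) -> continuous f.
Proof.
move=> fl x; apply/cvgrPdist_lt => e e0; apply/nT; exists e => // y /= xy.
rewrite ltr_norml; have [d0 d1 ds dt] := mT.
have := fl x y; have := fl y x; rewrite (ds y x); lra.
Qed.

Definition set_dist (K : set Omega) (x : Omega) : R := inf [set dT x y | y in K].

Lemma set_dist_has_inf K x : K !=set0 -> has_inf [set dT x y | y in K].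
Proof.
move=> [y Ky]; split; first by exists (dT x y), y.
by exists 0 => _ [z _ <-]; have [d0 _ _ _] := mT.
Qed.

Lemma set_dist_ge0 K x : K !=set0 -> 0 <= set_dist K x.
Proof.
move=> K0; apply: lb_le_inf; first by have [] := set_dist_has_inf x K0.
by move=> _ [z _ <-]; have [d0 _ _ _] := mT.
Qed.

Lemma set_dist_eq0 K x : K x -> set_dist K x = 0.
Proof.
move=> Kx; apply/eqP; rewrite eq_le set_dist_ge0 ?andbT; last by exists x.
have [d0 d1 ds dt] := mT.
have -> : 0 = dT x x by apply/esym/d1.
by apply: ge_inf; [have [] := set_dist_has_inf x (ex_intro _ x Kx)|exists x].
Qed.

Lemma set_dist_gt0 K x : K !=set0 -> closed K -> ~ K x -> 0 < set_dist K x.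
Proof.
move=> K0 cK nKx; have : nbhs x (~` K) by apply: open_nbhs_nbhs; split=> //; exact: closed_openC.
move=> /nT[e e0 H]; apply: lt_le_trans e0 _.
apply: lb_le_inf; first by have [] := set_dist_has_inf x K0.
by move=> _ [z Kz <-]; rewrite leNgt; apply/negP => /H.
Qed.

Lemma set_dist_continuous K : K !=set0 -> continuous (set_dist K).
Proof.
move=> K0; apply: lipschitz_continuous => x y; rewrite lerBlDr -lerBlDl.
have [d0 d1 ds dt] := mT.
apply: lb_le_inf; first by have [] := set_dist_has_inf y K0.
move=> _ [z Kz <-]; rewrite lerBlDl; apply: le_trans (dt x y z).
by apply: ge_inf; [have [] := set_dist_has_inf x K0|exists z].
Qed.

(** The quotient of the distance to [L] by the sum of the distances to [K] and [L]; the sum is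
    positive since a point off a closed nonempty set has positive distance to it. *)
Lemma metric_urysohn (K L : set Omega) : closed K -> closed L -> K `&` L = set0 ->
  exists f : Omega -> R, [/\ continuous f, forall x, 0 <= f x <= 1,
    forall x, K x -> f x = 1 & forall x, L x -> f x = 0].
Proof.
move=> cK cL KL.
(* The distance to an empty set is meaningless, so empty sets are treated with constant
   functions. *)
have [L0|L0] := pselect (L !=set0); last first.
  exists (fun=> 1); split=> //; [exact: cst_continuous|by move=> x; rewrite ler01 lexx|].
  by move=> x Lx; exfalso; apply: L0; exists x.
have [K0|K0] := pselect (K !=set0); last first.
  exists (fun=> 0); split=> //; [exact: cst_continuous|by move=> x; rewrite ler01 lexx|].
  by move=> x Kx; exfalso; apply: K0; exists x.
pose a := set_dist K; pose b := set_dist L.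
have ab x : 0 < a x + b x.
  have [Kx|Kx] := pselect (K x); last by rewrite ltr_pwDl ?set_dist_gt0 ?set_dist_ge0.
  rewrite ltr_wpDl ?set_dist_ge0 ?set_dist_gt0// => Lx.
  by have : (K `&` L) x by []; rewrite KL.
exists (fun x => b x / (a x + b x)); split.
- move=> x; apply: cvgM; first exact: set_dist_continuous.
  apply: cvgV; first by rewrite gt_eqF.
  by apply: cvgD; exact: set_dist_continuous.
- move=> x; apply/andP; split; first by rewrite divr_ge0 ?set_dist_ge0// ltW.
  by rewrite ler_pdivrMr// mul1r lerDr; exact: set_dist_ge0.
- move=> x Kx; have := ab x; rewrite /a (set_dist_eq0 Kx) add0r => b0.
  by rewrite divff// gt_eqF.
- by move=> x Lx; rewrite /b (set_dist_eq0 Lx) mul0r.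
Qed.

End Metrizable.

Lemma continuous_borel {R : realType} {Omega : ptopologicalType} (f : Omega -> R) :
  continuous f -> measurable_fun setT (f : borel Omega -> R).
Proof.
move=> /continuousP cf; apply: (measurability _ (RGenOpens.measurableE R)).
move=> _ [_ [a [b ->] <-]]; rewrite setTI; apply: sub_sigma_algebra.
exact/cf/interval_open.
Qed.

Section Density.
Context {R : realType} {Omega : ptopologicalType}.
Notation T := (borel Omega).
Hypothesis metO : metrizable R Omega.
Variable gam : {finite_measure set T -> \bar R}.
Hypothesis rgam : radon gam.

Lemma metrizable_hausdorff : hausdorff_space Omega.
Proof. by case: metO => dT mT nT; exact: metric_hausdorff mT nT. Qed.

(** Separate a compact subset of [A] from a compact subset of its complement; the error is at most 1
    and lives on the two small remainders. *)
Lemma indic_approx (A : set T) (e : R) : measurable A -> 0 < e ->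
  exists f : Omega -> R, [/\ continuous f, forall x, 0 <= f x <= 1 &
    \int[gam]_x `|f x - \1_A x| <= e].
Proof.
move=> mA e0; have e2 : 0 < e / 2 by rewrite divr_gt0.
have [K [cK KA HK]] := rgam mA e2.
have [L [cL LA HL]] := rgam (measurableC mA) e2.
have hO := metrizable_hausdorff.
have clK := compact_closed hO cK; have clL := compact_closed hO cL.
have mK : measurable (K : set T) := closed_borel clK.
have mL : measurable (L : set T) := closed_borel clL.
have KL : K `&` L = set0.
  by apply/seteqP; split=> x // [/KA Ax /LA].
have [f [cf f01 fK fL]] : exists f : Omega -> R, [/\ continuous f, forall x, 0 <= f x <= 1,
    forall x, K x -> f x = 1 & forall x, L x -> f x = 0].
  by case: metO => dT mT nT; exact: metric_urysohn mT nT _ _ clK clL KL.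
exists f; split=> //.
pose D1 : set T := A `\` K; pose D2 : set T := (~` A) `\` L.
have mD1 : measurable D1 by exact: measurableD.
have mD2 : measurable D2 by apply: measurableD => //; exact: measurableC.
have gD1 : fine (gam D1) <= e / 2.
  rewrite -lee_fin -gam_finE// measureD//; last by rewrite -ge0_fin_numE ?fin_num_measure.
  by rewrite (setIidr KA) leeBlDl ?fin_num_measure//; exact: ltW.
have gD2 : fine (gam D2) <= e / 2.
  have mC := measurableC mA.
  rewrite -lee_fin -gam_finE// measureD//; last by rewrite -ge0_fin_numE ?fin_num_measure.
  by rewrite (setIidr LA) leeBlDl ?fin_num_measure//; exact: ltW.
have ii (B : set T) : measurable B -> gam.-integrable setT (EFin \o \1_B).
  move=> mB; apply: (@bounded_integrable _ _ _ _ _ _ 1) => // x.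
  by rewrite indicE; case: (_ \in _); rewrite ?normr1 ?normr0.
have mf := continuous_borel cf.
apply: (@le_trans _ _ (\int[gam]_x (\1_D1 x + \1_D2 x))).
  apply: le_Rintegral => //.
  - apply: (@bounded_integrable _ _ _ _ _ _ 1) => //.
      by apply: measurableT_comp => //; apply: measurable_funB => //; exact: measurable_indic.
    move=> x; rewrite normr_id indicE ler_norml; have /andP[] := f01 x.
    by case: (_ \in _) => /=; lra.
  - exact: (integrableD measurableT (ii _ mD1) (ii _ mD2)).
  - move=> x _; have /andP[f0 f1] := f01 x; rewrite !indicE.
    have [Ax|Ax] := pselect (A x).
      rewrite [x \in A]mem_set//; have [Kx|Kx] := pselect (K x).
        by rewrite fK// subrr normr0 addr_ge0.
      rewrite [x \in D1]mem_set// ler_norml; case: (_ \in D2) => /=; lra.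
    rewrite [x \in A]memNset//; have [Lx|Lx] := pselect (L x).
      by rewrite fL// subrr normr0 addr_ge0.
    rewrite [x \in D2]mem_set// ler_norml; case: (_ \in D1) => /=; lra.
rewrite RintegralD//; [|exact: ii|exact: ii].
by rewrite /Rintegral !integral_indic// !setIT; lra.
Qed.

(** Binary expansion: with [A] the set where [h >= 1/2], one has [h = (\1_A + h') / 2] with [h']
    again valued in [0, 1]. Approximating the indicator halves the remaining error at each step. *)
Lemma unit_approx (n : nat) : forall (h : T -> R) (e : R), measurable_fun setT h ->
  (forall x, 0 <= h x <= 1) -> 0 < e ->
  exists f : Omega -> R, [/\ continuous f, forall x, 0 <= f x <= 1 &
    \int[gam]_x `|f x - h x| <= 2^-1 ^+ n * fine (gam setT) + e].
Proof.
have bi (h f : T -> R) : measurable_fun setT h -> measurable_fun setT f ->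
    (forall x, 0 <= h x <= 1) -> (forall x, 0 <= f x <= 1) ->
    gam.-integrable setT (EFin \o (fun x => `|f x - h x|)).
  move=> mh mf h01 f01; apply: (@bounded_integrable _ _ _ _ _ _ 1) => //.
    by apply: measurableT_comp => //; exact: measurable_funB.
  by move=> x; rewrite normr_id ler_norml; have /andP[] := f01 x; have /andP[] := h01 x; lra.
elim: n => [|n IH] h e mh h01 e0.
  exists (fun=> 0); split; [exact: cst_continuous|by move=> x; rewrite lexx ler01|].
  rewrite expr0 mul1r; apply: (@le_trans _ _ (fine (gam setT))); last by rewrite lerDl ltW.
  rewrite -[leRHS]mul1r -Rintegral_cst//; apply: le_Rintegral => //.
  - by apply: bi => // x; rewrite lexx ler01.
  - by apply: (@bounded_integrable _ _ _ _ _ _ 1) => // x; rewrite normr1.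
  - by move=> x _; rewrite sub0r normrN ler_norml; have /andP[] := h01 x; lra.
pose A : set T := [set x | 2^-1 <= h x].
have mA : measurable A.
  rewrite [A](_ : _ = h @^-1` `[2^-1, +oo[%classic).
    by rewrite -[X in measurable X]setTI; apply: mh => //; exact: measurable_itv.
  by apply/seteqP; split=> x /=; rewrite in_itv /= andbT.
pose h' x := 2 * h x - \1_A x.
have mh' : measurable_fun setT h'.
  apply: measurable_funB; last exact: measurable_indic.
  by apply: measurable_funM => //; exact: measurable_cst.
have h'01 x : 0 <= h' x <= 1.
  rewrite /h' indicE; have /andP[h0 h1] := h01 x.
  have [Ax|Ax] := pselect (A x).
    by rewrite mem_set//=; move: Ax; rewrite /A /= => Ax; lra.
  rewrite memNset//=; move/negP: Ax; rewrite /A /= -ltNge => Ax; lra.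
have e2 : 0 < e / 2 by rewrite divr_gt0.
have [f1 [cf1 f101 H1]] := indic_approx mA e2.
have [f2 [cf2 f201 H2]] := IH h' (e / 2) mh' h'01 e2.
have m1 := continuous_borel cf1; have m2 := continuous_borel cf2.
exists (fun x => 2^-1 * f1 x + 2^-1 * f2 x); split.
- move=> x; apply: cvgD; apply: cvgM; by [exact: cvg_cst|exact: cf1|exact: cf2].
- by move=> x; have /andP[] := f101 x; have /andP[] := f201 x; lra.
have I1 : gam.-integrable setT (EFin \o (fun x => `|f1 x - \1_A x|)).
  by apply: bi => // x; rewrite indicE; case: (_ \in _); rewrite /= ?lexx ler01.
have I2 : gam.-integrable setT (EFin \o (fun x => `|f2 x - h' x|)) by exact: bi.
have J1 : gam.-integrable setT (EFin \o (fun x => 2^-1 * `|f1 x - \1_A x|)).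
  exact: (integrableZl measurableT _ I1).
have J2 : gam.-integrable setT (EFin \o (fun x => 2^-1 * `|f2 x - h' x|)).
  exact: (integrableZl measurableT _ I2).
apply: (@le_trans _ _ (\int[gam]_x (2^-1 * `|f1 x - \1_A x| + 2^-1 * `|f2 x - h' x|))).
  apply: le_Rintegral => //.
  - apply: bi => //.
      by apply: measurable_funD; apply: measurable_funM => //; exact: measurable_cst.
    by move=> x; have /andP[] := f101 x; have /andP[] := f201 x; lra.
  - exact: (integrableD measurableT J1 J2).
  - move=> x _; have -> : 2^-1 * f1 x + 2^-1 * f2 x - h x =
       2^-1 * (f1 x - \1_A x) + 2^-1 * (f2 x - h' x) by rewrite /h'; field.
    apply: le_trans (ler_normD _ _) _; rewrite !normrM ger0_norm//.
rewrite RintegralD// !RintegralZl// exprS -mulrA.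
move: H1 H2; set w := 2^-1 ^+ n * _; lra.
Qed.

Lemma bounded_approx (h : T -> R) (C e : R) : measurable_fun setT h -> 0 < C ->
  (forall x, `|h x| <= C) -> 0 < e ->
  exists f : Omega -> R, [/\ continuous f, forall x, `|f x| <= C &
    \int[gam]_x `|f x - h x| <= e].
Proof.
move=> mh C0 hC e0.
(* Affine rescaling of [-C, C] to [0, 1]. *)
pose g x := (h x + C) / (2 * C).
have g01 x : 0 <= g x <= 1.
  have := hC x; rewrite ler_norml => /andP[h1 h2]; rewrite /g; apply/andP; split.
    by rewrite divr_ge0//; lra.
  by rewrite ler_pdivrMr ?mulr_gt0//; lra.
have mg : measurable_fun setT g.
  apply: measurable_funM; last exact: measurable_cst.
  by apply: measurable_funD => //; exact: measurable_cst.
pose v := fine (gam setT).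
have v0 : 0 <= v by rewrite fine_ge0.
have e1 : 0 < e / (4 * C) by rewrite divr_gt0// mulr_gt0.
have [n Hn] : exists n, 2^-1 ^+ n * v <= e / (4 * C).
  have cv : 2^-1 ^+ n * v @[n --> \oo] --> (0 : R).
    rewrite -[X in _ --> X](mul0r v); apply: cvgMl.
    by apply: cvg_expr; rewrite ger0_norm; lra.
  have /cvgrPdist_le/(_ _ e1)[n _ /(_ n (leqnn n))] := cv.
  by rewrite sub0r normrN => H; exists n; apply: le_trans (ler_norm _) H.
have [f [cf f01 H]] := unit_approx n mg g01 e1.
exists (fun x => (2 * C) * f x - C); split.
- move=> x; apply: cvgB; last exact: cvg_cst.
  by apply: cvgM; [exact: cvg_cst|exact: cf].
- move=> x; have /andP[f0 f1] := f01 x; rewrite ler_norml; apply/andP; split; nra.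
have If : gam.-integrable setT (EFin \o (fun x => `|f x - g x|)).
  apply: (@bounded_integrable _ _ _ _ _ _ 1) => //.
    by apply: measurableT_comp => //; apply: measurable_funB mg; exact: continuous_borel.
  by move=> x; rewrite normr_id ler_norml; have /andP[] := f01 x; have /andP[] := g01 x; lra.
rewrite [leLHS](_ : _ = \int[gam]_x ((2 * C) * `|f x - g x|)); last first.
  apply: eq_Rintegral => x _; rewrite -[X in _ = X * _]gtr0_norm ?mulr_gt0// -normrM; congr `|_|.
  by rewrite /g; field; rewrite gt_eqF.
rewrite RintegralZl//.
apply: (@le_trans _ _ (2 * C * (e / (4 * C) + e / (4 * C)))).
  by rewrite ler_wpM2l ?mulr_ge0 ?(ltW C0)//; apply: le_trans H _; rewrite lerD2r.
by rewrite le_eqVlt; apply/orP; left; apply/eqP; field; rewrite gt_eqF.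
Qed.

End Density.

#[local] Opaque frob frobn invmx mulmx addmx oppmx scalemx.

Lemma product_bound (R : realType) (C a b c u v : R) : u <= C * b -> v <= a * c ->
  0 <= C -> 0 <= a -> 0 <= b -> 0 <= c -> u + v <= (C + c) * (a + b).
Proof. by move=> *; nra. Qed.

Lemma inv_bound (R : realType) (K u x y q : R) : u <= x * q -> 0 <= x -> x <= K ->
  0 <= y -> y <= K -> 0 <= q -> u * y <= K * K * (q + q).
Proof.
move=> uxq x0 xK y0 yK q0; have K0 : 0 <= K by exact: le_trans xK.
apply: (@le_trans _ _ (K * q * K)); last by rewrite mulrAC ler_wpM2l ?mulr_ge0// lerDl.
apply: (@le_trans _ _ (x * q * y)); first exact: ler_wpM2r.
by apply: ler_pM => //; rewrite ?mulr_ge0// ler_wpM2r.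
Qed.

(** * Continuous matrix fields and their inverses *)

Section ContinuousFields.
Context {R : realType} {Omega : ptopologicalType} {d : nat}.
Notation M := 'M[R[i]]_d.
Notation T := (borel Omega).
Implicit Types (F A B : Omega -> M).

Definition mcont F := forall x : Omega, frobn (F y - F x) @[y --> x] --> (0 : R).

Lemma mcont_le A B F : mcont A -> mcont B ->
  (forall x, exists2 C, 0 <= C & forall y,
    frobn (F y - F x) <= C * (frobn (A y - A x) + frobn (B y - B x))) -> mcont F.
Proof.
move=> cA cB H x; have [C C0 HC] := H x.
apply: (@squeeze_cvgr _ _ _ _ (fun=> 0)
  (fun y => C * (frobn (A y - A x) + frobn (B y - B x)))).
- by apply: nearW => y; rewrite frobn_ge0 HC.
- exact: cvg_cst.
- rewrite -[X in _ --> X](mulr0 C); apply: cvgMr.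
  by rewrite -[X in _ --> X](addr0 0); apply: cvgD; [exact: cA|exact: cB].
Qed.

Lemma mcont_cst (X : M) : mcont (fun=> X).
Proof. by move=> x; under eq_fun do rewrite subrr frobn0; exact: cvg_cst. Qed.

Lemma mcontD A B : mcont A -> mcont B -> mcont (fun x => A x + B x).
Proof.
move=> cA cB; apply: (mcont_le cA cB) => x; exists 1 => // y.
by rewrite mul1r opprD addrACA frobnD.
Qed.

Lemma mcontZ (a : R) A : mcont A -> mcont (fun x => a%:C *: A x).
Proof.
move=> cA; apply: (mcont_le cA cA) => x; exists `|a| => // y.
by rewrite -scalerBr frobnZ mulrDr lerDl mulr_ge0 ?frobn_ge0.
Qed.

Lemma mcontN A : mcont A -> mcont (fun x => - A x).
Proof.
move=> cA; apply: (mcont_le cA cA) => x; exists 1 => // y.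
by rewrite -opprD frobnN mul1r lerDl frobn_ge0.
Qed.

Lemma mcont_adj A : mcont A -> mcont (fun x => (A x)^t*).
Proof.
move=> cA; apply: (mcont_le cA cA) => x; exists 1 => // y.
by rewrite -adjN -adjD frobn_adj mul1r lerDl frobn_ge0.
Qed.

Definition bounded_mx F := exists C, forall x, frobn (F x) <= C.

Lemma bounded_mxM A B : bounded_mx A -> bounded_mx B -> bounded_mx (fun x => A x *m B x).
Proof.
move=> [C HC] [C' HC']; exists (C * C') => x; apply: le_trans (frobn_mul _ _) _.
by apply: ler_pM => //; exact: frobn_ge0.
Qed.

Lemma bounded_mxD A B : bounded_mx A -> bounded_mx B -> bounded_mx (fun x => A x + B x).
Proof.
move=> [C HC] [C' HC']; exists (C + C') => x; apply: le_trans (frobnD _ _) _.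
exact: lerD.
Qed.

Lemma bounded_mxZ (a : R) A : bounded_mx A -> bounded_mx (fun x => a%:C *: A x).
Proof. by move=> [C HC]; exists (`|a| * C) => x; rewrite frobnZ ler_wpM2l. Qed.

Lemma bounded_mx_cst (X : M) : bounded_mx (fun=> X).
Proof. by exists (frobn X). Qed.

Lemma mcontM A B : bounded_mx A -> mcont A -> mcont B -> mcont (fun x => A x *m B x).
Proof.
move=> [C HC] cA cB; apply: (mcont_le cA cB) => x.
have C0 : 0 <= C by exact: le_trans (frobn_ge0 _) (HC point).
exists (C + frobn (B x)); first by rewrite addr_ge0 ?frobn_ge0.
move=> y; have -> : A y *m B y - A x *m B x = A y *m (B y - B x) + (A y - A x) *m B x.
  by rewrite mulmxBr mulmxBl addrA subrK.
apply: le_trans (frobnD _ _) _.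
have h1 : frobn (A y *m (B y - B x)) <= C * frobn (B y - B x).
  by apply: le_trans (frobn_mul _ _) _; rewrite ler_wpM2r ?frobn_ge0.
have h2 := frobn_mul (A y - A x) (B x).
by apply: product_bound; rewrite ?frobn_ge0.
Qed.

Lemma inv_diff (X Y : M) : X \in unitmx -> Y \in unitmx ->
  invmx Y - invmx X = invmx Y *m (X - Y) *m invmx X.
Proof.
move=> uX uY; rewrite mulmxBr mulmxBl mulVmx// -mulmxA mulmxV// mulmx1 mul1mx.
by [].
Qed.

(** The dual variables of the fidelity. The class is stable under inversion, positive scaling and
    sums, which is what symmetry, scaling and the triangle inequality require. *)
Definition pcont B := [/\ exists2 c, 0 < c & forall x, lowb c (B x), bounded_mx B & mcont B].

Lemma pcont_herm B x : pcont B -> B x \is hermsymmx.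
Proof. by case=> -[c c0 lB] _ _; exact: lowb_herm (lB x). Qed.

Lemma pcont_unit B x : pcont B -> B x \in unitmx.
Proof. by case=> -[c c0 lB] _ _; exact: lowb_unit c0 (lB x). Qed.

Lemma pcont_inv B : pcont B -> pcont (fun x => invmx (B x)).
Proof.
move=> pB; have [[c c0 lB] [m Bm] cB] := pB.
have bI : forall x, frobn (invmx (B x)) <= c^-1 * frobn (1%:M : M).
  by move=> x; rewrite mulrC ler_pdivlMr// mulrC; exact: lowb_inv_frobn.
split.
- have m1 : 0 < m + 1 by rewrite ltr_wpDl//; exact: le_trans (frobn_ge0 _) (Bm point).
  exists (m + 1)^-1; first by rewrite invr_gt0.
  by move=> x; apply: (lowb_inv c0 (lB x) m1); apply: le_trans (Bm x) _; rewrite lerDl.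
- by exists (c^-1 * frobn (1%:M : M)).
- apply: (mcont_le cB cB) => x.
  exists (c^-1 * frobn (1%:M : M) * (c^-1 * frobn (1%:M : M))).
    by rewrite !mulr_ge0 ?invr_ge0 ?(ltW c0) ?frobn_ge0.
  move=> y; rewrite inv_diff ?(pcont_unit _ pB)//.
  apply: le_trans (frobn_mul _ _) _.
  have h1 := frobn_mul (invmx (B y)) (B x - B y).
  have -> : frobn (B y - B x) = frobn (B x - B y) by rewrite -frobnN opprB.
  have hy := bI y; have hx := bI x; set K := c^-1 * _ in hy hx *.
  exact: (inv_bound h1 (frobn_ge0 _) hy (frobn_ge0 _) hx (frobn_ge0 _)).
Qed.

Lemma pcontZ (a : R) B : 0 < a -> pcont B -> pcont (fun x => a%:C *: B x).
Proof.
move=> a0 [[c c0 lB] bB cB]; split; [|exact: bounded_mxZ|exact: mcontZ].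
exists (a * c); first exact: mulr_gt0.
move=> x; have /lowbP[hB H] := lB x; apply/lowbP; split; first exact: hermZ.
by move=> Z; rewrite -scalemxAl frobZl -mulrA ler_wpM2l// ltW.
Qed.

Lemma pcontD B B' : pcont B -> pcont B' -> pcont (fun x => B x + B' x).
Proof.
move=> [[c c0 lB] bB cB] [[c' c'0 lB'] bB' cB']; split;
  [|exact: bounded_mxD|exact: mcontD].
exists (c + c'); first exact: addr_gt0.
move=> x; have /lowbP[hB H] := lB x; have /lowbP[hB' H'] := lB' x.
apply/lowbP; split; first exact: hermD.
by move=> Z; rewrite mulmxDl frobDl mulrDl lerD.
Qed.

Lemma lowb1 : lowb 1 (1%:M : M).
Proof. by apply/lowbP; split; [exact: herm1|move=> Z; rewrite mul1mx mul1r]. Qed.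

Lemma pcont1 : pcont (fun=> 1%:M).
Proof.
split; [|exact: bounded_mx_cst|exact: mcont_cst].
by exists 1 => // x; exact: lowb1.
Qed.

Lemma supn_le F C : (supn F <= C%:E)%E <-> forall x, frobn (F x) <= C.
Proof.
split=> [H x|H].
  by rewrite -lee_fin; apply: le_trans H; apply: ereal_sup_ubound; exists x.
by apply: ge_ereal_sup => _ [x _ <-]; rewrite lee_fin.
Qed.

Lemma supn_ge0 F : (0 <= supn F)%E.
Proof.
apply: (@le_trans _ _ (frobn (F point))%:E); first by rewrite lee_fin frobn_ge0.
by apply: ereal_sup_ubound; exists point.
Qed.

Lemma supn_ltyP F : (supn F < +oo)%E <-> bounded_mx F.
Proof.
split=> [H|[C /supn_le H]]; last exact: le_lt_trans H (ltry _).
exists (fine (supn F)); apply/supn_le; rewrite fineK// ge0_fin_numE//.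
exact: supn_ge0.
Qed.

Lemma CbP F : Cb F <-> [/\ forall x, F x \is hermsymmx, bounded_mx F & mcont F].
Proof. by split=> -[h b c]; split=> //; exact/supn_ltyP. Qed.

Lemma pcont_Cb B : pcont B -> Cb B.
Proof. by move=> pB; have [_ bB cB] := pB; apply/CbP; split=> // x; exact: pcont_herm. Qed.

Lemma frobn_le_entries (X : M) : frobn X <= \sum_i \sum_j
  (`|complex.Re (X i j)| + `|complex.Im (X i j)|).
Proof.
have S0 i : 0 <= \sum_j (`|complex.Re (X i j)| + `|complex.Im (X i j)|).
  by apply: sumr_ge0 => j _; rewrite addr_ge0.
rewrite -(@ler_pXn2r _ 2) ?nnegrE ?frobn_ge0 ?sumr_ge0// sqr_frobn frobE.
have sq (I : finType) (f : I -> R) : (forall i, 0 <= f i) -> \sum_i f i ^+ 2 <= (\sum_i f i) ^+ 2.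
  move=> f0; rewrite [leRHS]expr2 mulr_suml; apply: ler_sum => i _.
  rewrite expr2 ler_wpM2l// (bigD1 i)//= lerDl; apply: sumr_ge0 => k _; exact: f0.
apply: le_trans (sq _ _ S0); apply: ler_sum => i _.
apply: le_trans (sq _ _ _); last by move=> j; rewrite addr_ge0.
apply: ler_sum => j _; rewrite sqrrD !real_normK ?num_real// -!expr2 addrAC lerDl.
by rewrite mulrn_wge0// mulr_ge0.
Qed.

Lemma Re_le_frobn (X : M) i j : `|complex.Re (X i j)| <= frobn X.
Proof.
rewrite Re_frob; apply: le_trans (frob_le _ _) _; rewrite ler_piMr ?frobn_ge0//.
by rewrite -[frobn _]ger0_norm ?frobn_ge0// -(expr_le1 (n:=2)) ?normr_ge0// real_normK ?num_real// sqr_frobn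
  -Re_frob mxE !eqxx.
Qed.

Lemma Im_le_frobn (X : M) i j : `|complex.Im (X i j)| <= frobn X.
Proof.
rewrite Im_frob; apply: le_trans (frob_le _ _) _; rewrite ler_piMr ?frobn_ge0//.
rewrite -[frobn _]ger0_norm ?frobn_ge0// -(expr_le1 (n:=2)) ?normr_ge0// real_normK ?num_real// sqr_frobn.
by rewrite -Im_frob !mxE !eqxx mulr1.
Qed.

Lemma mcont_of_entries F :
  (forall i j, continuous (fun x => complex.Re (F x i j))) ->
  (forall i j, continuous (fun x => complex.Im (F x i j))) -> mcont F.
Proof.
move=> cR cI x.
apply: (@squeeze_cvgr _ _ _ _ (fun=> 0) (fun y => \sum_i \sum_j
  (`|complex.Re (F y i j) - complex.Re (F x i j)| +
   `|complex.Im (F y i j) - complex.Im (F x i j)|))).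
- apply: nearW => y; rewrite frobn_ge0 /=; apply: le_trans (frobn_le_entries _) _.
  by apply: ler_sum => i _; apply: ler_sum => j _; rewrite !mxE !raddfB.
- exact: cvg_cst.
- have nc (f : Omega -> R) : continuous f -> `|f y - f x| @[y --> x] --> (0 : R).
    move=> cf; have -> : (0 : R) = `|f x - f x| by rewrite subrr normr0.
    by apply: cvg_norm; apply: cvgB; [exact: cf|exact: cvg_cst].
  have c2 i j : `|complex.Re (F y i j) - complex.Re (F x i j)| +
      `|complex.Im (F y i j) - complex.Im (F x i j)| @[y --> x] --> (0 : R).
    have -> : (0 : R) = 0 + 0 by rewrite addr0.
    exact: (cvgD (nc _ (cR i j)) (nc _ (cI i j))).
  have := @cvg_sumr R _ _ _ _ (index_enum 'I_d) _ _
    (fun i => @cvg_sumr R _ _ _ _ (index_enum 'I_d) _ _ (c2 i)).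
  have -> : \sum_(i < d) \sum_(j < d) (0 : R) = 0 by rewrite big1// => i _; rewrite big1.
  exact.
Qed.

Lemma mcont_entries F i j : mcont F ->
  continuous (fun x => complex.Re (F x i j)) /\ continuous (fun x => complex.Im (F x i j)).
Proof.
move=> cF; split=> x.
  apply/cvgrPdist_le => e e0; have /cvgrPdist_le/(_ _ e0) := cF x.
  apply: filterS => y; rewrite sub0r normrN ger0_norm ?frobn_ge0// => h.
  rewrite distrC; apply: le_trans h; rewrite -raddfB.
  by have := Re_le_frobn (F y - F x) i j; rewrite !mxE.
apply/cvgrPdist_le => e e0; have /cvgrPdist_le/(_ _ e0) := cF x.
apply: filterS => y; rewrite sub0r normrN ger0_norm ?frobn_ge0// => h.
rewrite distrC; apply: le_trans h; rewrite -raddfB.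
by have := Im_le_frobn (F y - F x) i j; rewrite !mxE.
Qed.

Lemma mcont_mxmeas F : mcont F -> mxmeas setT (F : T -> M).
Proof.
by move=> cF i j; have [cR cI] := mcont_entries i j cF; split; exact: continuous_borel.
Qed.

End ContinuousFields.

Section MatrixDensity.
Context {R : realType} {Omega : ptopologicalType} {d : nat}.
Notation M := 'M[R[i]]_d.
Notation T := (borel Omega).
Hypothesis metO : metrizable R Omega.
Variable gam : {finite_measure set T -> \bar R}.
Hypothesis rgam : radon gam.

Lemma measurable_frobn (X : T -> M) : mxmeas setT X -> measurable_fun setT (fun x => frobn (X x)).
Proof.
move=> mX.
exact: (measurableT_comp (continuous_measurable_fun (@sqrt_continuous R)) (measurable_frob mX mX)).
Qed.

(** The uniform bound [C'] does not depend on the accuracy [e]; hence a Lipschitz constant can be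
    fixed before the accuracy is chosen. *)
Lemma matrix_approx (X : T -> M) (C : R) : mxmeas setT X -> 0 < C ->
  (forall x, frobn (X x) <= C) -> exists C', forall e, 0 < e ->
  exists X' : Omega -> M, [/\ mcont X', forall x, frobn (X' x) <= C' &
    \int[gam]_x frobn (X' x - X x) <= e].
Proof.
move=> mX C0 XC; exists (\sum_(i < d) \sum_(j < d) (C + C)) => e e0.
pose n : R := (d * d * 2).+1%:R.
have n0 : 0 < n by rewrite ltr0n.
have en : 0 < e / n by rewrite divr_gt0.
have aR i j : exists f : Omega -> R, [/\ continuous f, forall x, `|f x| <= C &
    \int[gam]_x `|f x - complex.Re (X x i j)| <= e / n].
  apply: bounded_approx => //; first exact: (mX i j).1.
  by move=> x; apply: le_trans (Re_le_frobn _ _ _) (XC x).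
have aI i j : exists f : Omega -> R, [/\ continuous f, forall x, `|f x| <= C &
    \int[gam]_x `|f x - complex.Im (X x i j)| <= e / n].
  apply: bounded_approx => //; first exact: (mX i j).2.
  by move=> x; apply: le_trans (Im_le_frobn _ _ _) (XC x).
pose f i j := sval (cid (aR i j)); pose g i j := sval (cid (aI i j)).
have fP i j : [/\ continuous (f i j), forall x, `|f i j x| <= C &
    \int[gam]_x `|f i j x - complex.Re (X x i j)| <= e / n] := svalP (cid (aR i j)).
have gP i j : [/\ continuous (g i j), forall x, `|g i j x| <= C &
    \int[gam]_x `|g i j x - complex.Im (X x i j)| <= e / n] := svalP (cid (aI i j)).
pose X' x : M := \matrix_(i, j) (f i j x +i* g i j x).
have cX' : mcont X'.
  apply: mcont_of_entries => i j; under eq_fun do rewrite mxE /=.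
    by have [] := fP i j.
  by have [] := gP i j.
have bX' x : frobn (X' x) <= \sum_(i < d) \sum_(j < d) (C + C).
  apply: le_trans (frobn_le_entries _) _; apply: ler_sum => i _; apply: ler_sum => j _.
  rewrite mxE /=; apply: lerD; [by have [] := fP i j|by have [] := gP i j].
exists X'; split=> //.
have iR i j : gam.-integrable setT (EFin \o (fun x => `|f i j x - complex.Re (X x i j)|)).
  have [cf fC _] := fP i j.
  apply: (@bounded_integrable _ _ _ _ _ _ (C + C)) => //.
    apply: measurableT_comp => //; apply: measurable_funB; first exact: continuous_borel.
    exact: (mX i j).1.
  move=> x; rewrite normr_id; apply: le_trans (ler_normB _ _) _; apply: lerD => //.
  by apply: le_trans (Re_le_frobn _ _ _) (XC x).
have iI i j : gam.-integrable setT (EFin \o (fun x => `|g i j x - complex.Im (X x i j)|)).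
  have [cf fC _] := gP i j.
  apply: (@bounded_integrable _ _ _ _ _ _ (C + C)) => //.
    apply: measurableT_comp => //; apply: measurable_funB; first exact: continuous_borel.
    exact: (mX i j).2.
  move=> x; rewrite normr_id; apply: le_trans (ler_normB _ _) _; apply: lerD => //.
  by apply: le_trans (Im_le_frobn _ _ _) (XC x).
have iRI i j : gam.-integrable setT (EFin \o (fun x => `|f i j x - complex.Re (X x i j)| +
    `|g i j x - complex.Im (X x i j)|)) := integrableD measurableT (iR i j) (iI i j).
have irow i : gam.-integrable setT (EFin \o (fun x => \sum_j (`|f i j x - complex.Re (X x i j)| +
    `|g i j x - complex.Im (X x i j)|))) by exact: integrable_sumr.
apply: (@le_trans _ _ (\int[gam]_x (\sum_i \sum_j (`|f i j x - complex.Re (X x i j)| +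
    `|g i j x - complex.Im (X x i j)|)))).
  apply: le_Rintegral => //; last 2 first.
  - exact: integrable_sumr.
  - move=> x _; apply: le_trans (frobn_le_entries _) _.
    by apply: ler_sum => i _; apply: ler_sum => j _; rewrite !mxE !raddfB.
  apply: (@bounded_integrable _ _ _ _ _ _ (\sum_(i < d) \sum_(j < d) (C + C) + C)) => //.
    by apply: measurable_frobn; apply: mxmeasB mX; exact: mcont_mxmeas.
  move=> x; rewrite ger0_norm ?frobn_ge0//; apply: le_trans (frobnB _ _) _.
  by apply: lerD.
rewrite Rint_sum//.
apply: (@le_trans _ _ (\sum_(i < d) \sum_(j < d) (e / n + e / n))).
  apply: ler_sum => i _; rewrite Rint_sum//; apply: ler_sum => j _.
  by rewrite RintegralD//; apply: lerD; [have [] := fP i j|have [] := gP i j].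
rewrite !sumr_const !card_ord -!mulrnA -mulr2n -mulrnA.
rewrite -mulr_natr mulrAC ler_pdivrMr// ler_wpM2l ?(ltW e0)// ler_nat.
by rewrite mulnC leqnSn.
Qed.

End MatrixDensity.

#[local] Opaque mxmeas mcont.

(** * Linearity, positivity and bounds of the pairing *)

Section PairingLinear.
Context {R : realType} {Omega : ptopologicalType} {d : nat}.
Notation M := 'M[R[i]]_d.
Notation T := (borel Omega).
Notation hpm := (hpm R Omega d).
Implicit Types (F A B : Omega -> M) (G : hpm).

Definition bfield F := mxmeas setT (F : T -> M) /\ bounded_mx F.

Lemma Cb_bfield F : Cb F -> bfield F.
Proof. by move=> /CbP[_ bF cF]; split; [exact: mcont_mxmeas cF|exact: bF]. Qed.

Lemma pcont_bfield B : pcont B -> bfield B.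
Proof. by move=> pB; exact/Cb_bfield/pcont_Cb. Qed.

Lemma bfieldD A B : bfield A -> bfield B -> bfield (fun x => A x + B x).
Proof. by move=> [mA bA] [mB bB]; split; [exact: mxmeasD mA mB|exact: bounded_mxD bA bB]. Qed.

Lemma bfieldZ (a : R) A : bfield A -> bfield (fun x => a%:C *: A x).
Proof.
move=> [mA bA]; split; last exact: bounded_mxZ bA.
by apply: (mxmeasZ _ mA); exact: measurable_cst.
Qed.

Lemma bfield_cst (X : M) : bfield (fun=> X).
Proof. by split; [exact: mxmeas_cst|exact: bounded_mx_cst]. Qed.

Lemma bfieldM A B : bfield A -> bfield B -> bfield (fun x => A x *m B x).
Proof. by move=> [mA bA] [mB bB]; split; [exact: mxmeasM mA mB|exact: bounded_mxM bA bB]. Qed.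

(** The trace measure serves as its own reference, so properties of [pairing] reduce to properties
    of an honest integral of a density positive at every point. *)
Lemma rep_self G : exists k, rep (trmeas G) k G.
Proof. by have [k [rk _]] := rep_exists (gam := trmeas G) (G := G) (fun S _ => lexx _); exists k. Qed.

Section WithRep.
Variables (gam : {finite_measure set T -> \bar R}) (G : hpm) (k : T -> M).
Hypothesis rk : rep gam k G.

Lemma rep_integrable F : bfield F -> gam.-integrable setT (EFin \o (fun x => frob (k x) (F x))).
Proof.
move=> [mF [C FC]]; have [[C' bk] _] := rk.
exact: (frob_integrable gam measurableT (bpos_bmx bk) (conj mF FC)).
Qed.

Lemma rep_tr_integrable : gam.-integrable setT (EFin \o (fun x => complex.Re (\tr (k x)))).
Proof.
have := rep_integrable (bfield_cst 1%:M).
by rewrite (_ : (fun x => frob _ _) = (fun x => complex.Re (\tr (k x))))//; apply/funext => x; rewrite frob1r.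
Qed.

Lemma rep_pos x : posmx (k x).
Proof. by have [[C [_ pk _]] _] := rk. Qed.

End WithRep.

Lemma pairingD G A B : bfield A -> bfield B ->
  pairing G (fun x => A x + B x) = pairing G A + pairing G B.
Proof.
move=> bA bB; have [k rk] := rep_self G.
rewrite (pairing_rep rk bA.1) (pairing_rep rk bB.1) (pairing_rep rk (bfieldD bA bB).1).
rewrite -(RintegralD measurableT (rep_integrable rk bA) (rep_integrable rk bB)).
by apply: eq_Rintegral => x _; rewrite frobDr.
Qed.

Lemma pairingZ G (a : R) A : bfield A -> pairing G (fun x => a%:C *: A x) = a * pairing G A.
Proof.
move=> bA; have [k rk] := rep_self G.
rewrite (pairing_rep rk bA.1) (pairing_rep rk (bfieldZ a bA).1).
rewrite -(RintegralZl _ measurableT (rep_integrable rk bA)).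
by apply: eq_Rintegral => x _; rewrite frobZr.
Qed.

Lemma pairing_eq G A B : (forall x, A x = B x) -> pairing G A = pairing G B.
Proof. by move=> AB; congr pairing; exact/funext. Qed.

Lemma pairingB G A B : bfield A -> bfield B ->
  pairing G (fun x => A x - B x) = pairing G A - pairing G B.
Proof.
move=> bA bB; rewrite -mulN1r -(pairingZ _ _ bB) -(pairingD _ bA (bfieldZ _ bB)).
by apply: pairing_eq => x; rewrite rmorphN scaleN1r.
Qed.

Lemma pairing1 G : pairing G (fun=> 1%:M) = hpm_mass G.
Proof.
have [k rk] := rep_self G.
rewrite (pairing_rep rk (bfield_cst _).1) (mass_rep rk).
by apply: eq_Rintegral => x _; rewrite frob1r.
Qed.

Lemma pairing_ge0 G A : mxmeas setT (A : T -> M) -> (forall x, posmx (A x)) -> 0 <= pairing G A.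
Proof.
move=> mA pA; have [k rk] := rep_self G.
rewrite (pairing_rep rk mA); apply: Rintegral_ge0 => x _.
exact: (pos_frob_ge0 (rep_pos rk x) (pA x)).
Qed.

Lemma pairing_le G A B : bfield A -> bfield B -> (forall x, posmx (B x - A x)) ->
  pairing G A <= pairing G B.
Proof.
move=> bA bB pAB; rewrite -subr_ge0 -(pairingB _ bB bA); apply: pairing_ge0 => //.
by apply: mxmeasB; [exact: bB.1|exact: bA.1].
Qed.

Lemma mass_ge0 G : 0 <= hpm_mass G.
Proof. by rewrite /hpm_mass; exact/pos_tr_ge0/hpm_pos. Qed.

Lemma pairing_bound G A C : mxmeas setT (A : T -> M) -> (forall x, frobn (A x) <= C) ->
  `|pairing G A| <= C * hpm_mass G.
Proof.
move=> mA AC; have bA : bfield A by split=> //; exists C.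
have [k rk] := rep_self G.
rewrite (pairing_rep rk mA) (mass_rep rk).
rewrite -(RintegralZl _ measurableT (rep_tr_integrable rk)).
apply: le_trans (le_normr_Rintegral measurableT (rep_integrable rk bA)) _.
apply: le_Rintegral => //.
- exact: (integrable_abse (rep_integrable rk bA)).
- exact: (integrableZl measurableT _ (rep_tr_integrable rk)).
- move=> x _; apply: le_trans (pos_frob_abs _ (rep_pos rk x)) _.
  by apply: ler_wpM2r; [exact/pos_tr_ge0/(rep_pos rk x)|exact: AC].
Qed.

End PairingLinear.

Lemma determined_bound {R : realType} (p a b n i e : R) : `|p - a| <= n * i -> `|p - b| <= n * i ->
  i <= e / (2 * (n + 1)) -> 0 <= n -> 0 < e -> `|a - b| <= e.
Proof.
move=> h1 h2 ie n0 e0.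
have -> : a - b = (p - b) - (p - a) by ring.
apply: le_trans (ler_normB _ _) _; apply: (@le_trans _ _ (2 * (n * i))).
  by rewrite mulr2n mulrDl mul1r; exact: lerD.
apply: (@le_trans _ _ (2 * (n * (e / (2 * (n + 1)))))).
  by rewrite ler_wpM2l// ler_wpM2l.
have -> : 2 * (n * (e / (2 * (n + 1)))) = e * (n / (n + 1)) by field; rewrite gt_eqF// ltr_wpDl.
by rewrite ler_piMr ?(ltW e0)// ler_pdivrMr ?ltr_wpDl// mul1r lerDl.
Qed.

(** * A matrix measure is determined by its pairings with continuous fields *)

Section Determination.
Context {R : realType} {Omega : ptopologicalType} {d : nat}.
Notation M := 'M[R[i]]_d.
Notation T := (borel Omega).
Notation hpm := (hpm R Omega d).
Hypothesis metO : metrizable R Omega.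
Implicit Types (G H : hpm).

(** A Radon measure dominating both [G] and [H]: the common reference for every construction
    involving two measures. *)
Definition sum_trmeas G H : set T -> \bar R := measure_add (trmeas G) (trmeas H).

HB.instance Definition _ G H := Measure.on (sum_trmeas G H).

Lemma sum_trmeasE G H A : sum_trmeas G H A = (trmeas G A + trmeas H A)%E.
Proof. by rewrite /sum_trmeas measure_addE. Qed.

Let sum_trmeas_fin G H : fin_num_fun (sum_trmeas G H).
Proof. by move=> A mA; rewrite sum_trmeasE. Qed.

HB.instance Definition _ G H := Measure_isFinite.Build _ _ _ (sum_trmeas G H) (@sum_trmeas_fin G H).

Lemma sum_trmeas_radon G H : radon (sum_trmeas G H).
Proof.
move=> A e mA e0; have e2 : 0 < e / 2 by rewrite divr_gt0.
have hO := metrizable_hausdorff metO.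
have [K [cK KA HK]] := trmeas_radon G mA e2.
have [L [cL LA HL]] := trmeas_radon H mA e2.
exists (K `|` L); split; [exact: compactU|by move=> x [/KA|/LA]|].
have mK : measurable (K : set T) := closed_borel (compact_closed hO cK).
have mL : measurable (L : set T) := closed_borel (compact_closed hO cL).
have mU : measurable (K `|` L : set T) by exact: measurableU.
have h1 : (trmeas G (K : set T) <= trmeas G (K `|` L : set T))%E.
  by apply: le_measure; rewrite ?inE//; exact: subsetUl.
have h2 : (trmeas H (L : set T) <= trmeas H (K `|` L : set T))%E.
  by apply: le_measure; rewrite ?inE//; exact: subsetUr.
rewrite !sum_trmeasE.
have -> : e%:E = ((e / 2)%:E + (e / 2)%:E)%E by rewrite -EFinD; congr EFin; field.
rewrite addeACA; apply: lteD; first exact: lt_le_trans HK (leeD2r _ h1).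
exact: lt_le_trans HL (leeD2r _ h2).
Qed.

Lemma rep_sumL G H : exists k, rep (sum_trmeas G H) k G /\ forall x, complex.Re (\tr (k x)) <= 1.
Proof.
by apply: (rep_exists (gam := sum_trmeas G H)) => A mA; rewrite [leRHS](sum_trmeasE G H A) leeDl.
Qed.

Lemma rep_sumR G H : exists k, rep (sum_trmeas G H) k H /\ forall x, complex.Re (\tr (k x)) <= 1.
Proof.
by apply: (rep_exists (gam := sum_trmeas G H)) => A mA; rewrite [leRHS](sum_trmeasE G H A) leeDr.
Qed.

Lemma rep_approx (gam : {finite_measure set T -> \bar R}) k G (A : set T) (X : M) (f : Omega -> R) :
  rep gam k G -> (forall x, complex.Re (\tr (k x)) <= 1) -> measurable A ->
  continuous f -> (forall x, 0 <= f x <= 1) ->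
  `|pairing G (fun x => (f x)%:C *: X) - frob (G A) X| <= frobn X * \int[gam]_x `|f x - \1_A x|.
Proof.
move=> rk k1 mA cf f01; have [[C bk] GA] := rk; have [mk pk _] := bk.
have mf := continuous_borel cf.
have mfX : mxmeas setT (fun x : T => (f x)%:C *: X).
  by apply: (mxmeasZ mf); exact: mxmeas_cst.
have bfX : bfield (fun x => (f x)%:C *: X).
  split=> //; exists (frobn X) => x; rewrite frobnZ ger0_norm; last by case/andP: (f01 x).
  by rewrite ler_piMl ?frobn_ge0//; case/andP: (f01 x).
rewrite (pairing_rep rk mfX) GA// [X in `|_ - X|]Rintegral_mkcond.
have iX := rep_integrable rk (bfield_cst X).
have iXA : gam.-integrable setT (EFin \o ((fun x => frob (k x) X) \_ A)).
  rewrite (_ : EFin \o _ = (EFin \o (fun x => frob (k x) X)) \_ A); last by rewrite restrict_EFin.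
  apply: (integrable_mkcond _ mA).1; exact: (integrableS measurableT mA (@subsetT _ _) iX).
have ifX := rep_integrable rk bfX.
rewrite -(RintegralB measurableT ifX iXA).
have ifA : gam.-integrable setT (EFin \o (fun x => `|f x - \1_A x|)).
  apply: (@bounded_integrable _ _ _ _ _ _ 1) => //.
    apply: measurableT_comp => //; apply: measurable_funB => //; exact: measurable_indic.
  move=> x; rewrite normr_id indicE ler_norml; have /andP[] := f01 x.
  by case: (_ \in _) => /=; lra.
rewrite -(RintegralZl _ measurableT ifA).
have iB := integrableB measurableT ifX iXA.
apply: le_trans (le_normr_Rintegral measurableT iB) _.
apply: (le_Rintegral measurableT (integrable_abse iB) (integrableZl measurableT _ ifA)) => x _.
have -> : frob (k x) ((f x)%:C *: X) - ((fun x => frob (k x) X) \_ A) x =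
    (f x - \1_A x) * frob (k x) X.
  rewrite frobZr mulrBl patchE indicE; congr (_ - _).
  by case: (_ \in _); rewrite /= ?mul1r ?mul0r.
rewrite normrM mulrC; apply: ler_wpM2r => //.
apply: le_trans (pos_frob_abs _ (pk x)) _.
by rewrite ler_piMr ?frobn_ge0.
Qed.

(** Test with [f] times the constant Hermitian matrix [X = G A - H A], where [f] is continuous and
    close to the indicator of [A]; in the limit the squared norm of [X] is 0. *)
Lemma hpm_determined G H : (forall F, Cb F -> pairing G F = pairing H F) -> G = H.
Proof.
move=> GH; apply: hpm_ext => A mA.
have [k [rk k1]] := rep_sumL G H; have [l [rl l1]] := rep_sumR G H.
set X := G A - H A.
have hX : X \is hermsymmx by apply: hermB; [case: (hpm_pos G A)|case: (hpm_pos H A)].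
apply/eqP; rewrite -subr_eq0 -/X; apply/eqP/frob_eq0.
rewrite {1}/X frobBl; apply/eqP; rewrite -normr_le0.
apply/ler_addgt0Pr => e e0; rewrite add0r.
have e1 : 0 < e / (2 * (frobn X + 1)).
  by rewrite divr_gt0// mulr_gt0// ltr_wpDl// frobn_ge0.
have [f [cf f01 If]] := indic_approx metO (@sum_trmeas_radon G H) mA e1.
have cbf : Cb (fun x => (f x)%:C *: X).
  apply/CbP; split.
  - by move=> x; exact: hermZ.
  - exists (frobn X) => x; rewrite frobnZ ger0_norm; last by case/andP: (f01 x).
    by rewrite ler_piMl ?frobn_ge0//; case/andP: (f01 x).
  - move=> x; under eq_fun do rewrite -scalerBl -rmorphB frobnZ.
    have -> : (0 : R) = `|f x - f x| * frobn X by rewrite subrr normr0 mul0r.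
    by apply: cvgMl; apply: cvg_norm; apply: cvgB; [exact: cf|exact: cvg_cst].
have h1 := rep_approx X rk k1 mA cf f01.
have h2 := rep_approx X rl l1 mA cf f01.
rewrite (GH _ cbf) in h1.
apply: (determined_bound h1 h2 If (frobn_ge0 _) e0).
Qed.

End Determination.

(** * The fidelity: symmetry, bounds and diagonal values *)

Section Fidelity.
Context {R : realType} {Omega : ptopologicalType} {d : nat}.
Notation M := 'M[R[i]]_d.
Notation T := (borel Omega).
Notation hpm := (hpm R Omega d).
Implicit Types (F A B : Omega -> M) (G H : hpm).

Definition dual_cost G H B : R := pairing G B + pairing H (fun x => invmx (B x)).

(** For scalar densities g, h the infimum of (g b + h / b) / 2 is the square root of g h; the matrix
    version is the dual form of Uhlmann's fidelity. An infimum of affine costs is convenient for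
    both energy bounds. *)
Definition fidelity G H : R := inf [set dual_cost G H B / 2 | B in pcont].

Lemma pcont_pos B x : pcont B -> posmx (B x).
Proof. by case=> -[c c0 lB] _ _; exact: lowb_pos (ltW c0) (lB x). Qed.

Lemma dual_cost_ge0 G H B : pcont B -> 0 <= dual_cost G H B.
Proof.
move=> pB; apply: addr_ge0; apply: pairing_ge0.
- exact: (pcont_bfield pB).1.
- by move=> x; exact: pcont_pos pB.
- exact: (pcont_bfield (pcont_inv pB)).1.
- by move=> x; exact: pcont_pos (pcont_inv pB).
Qed.

Let has_inf_cost G H : has_inf [set dual_cost G H B / 2 | B in pcont].
Proof.
split; first by exists (dual_cost G H (fun=> 1%:M) / 2), (fun=> 1%:M) => //; exact: pcont1.
by exists 0 => _ [B pB <-]; rewrite divr_ge0// dual_cost_ge0.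
Qed.

Lemma fidelity_le G H B : pcont B -> 2 * fidelity G H <= dual_cost G H B.
Proof.
move=> pB; rewrite mulrC -ler_pdivlMr//; apply: ge_inf; first by have [] := has_inf_cost G H.
by exists B.
Qed.

Lemma fidelity_ge G H c : (forall B, pcont B -> 2 * c <= dual_cost G H B) -> c <= fidelity G H.
Proof.
move=> H0; apply: lb_le_inf; first by have [] := has_inf_cost G H.
by move=> _ [B pB <-]; rewrite ler_pdivlMr// mulrC; exact: H0.
Qed.

Lemma fidelity_ge0 G H : 0 <= fidelity G H.
Proof. by apply: fidelity_ge => B pB; rewrite mulr0 dual_cost_ge0. Qed.

Lemma dual_cost_inv G H B : dual_cost H G (fun x => invmx (B x)) = dual_cost G H B.
Proof.
rewrite /dual_cost addrC; congr (_ + _); apply: pairing_eq => x; exact: invmxK.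
Qed.

(** Replacing [B] by its inverse exchanges the two terms of the cost. *)
Lemma fidelity_sym G H : fidelity G H = fidelity H G.
Proof.
apply/eqP; rewrite eq_le; apply/andP; split; apply: fidelity_ge => B pB;
  rewrite -dual_cost_inv; exact: fidelity_le (pcont_inv pB).
Qed.

Lemma invmxZ_real (a : R) (A : M) : A \in unitmx -> a != 0 ->
  invmx (a%:C *: A) = (a^-1)%:C *: invmx A.
Proof.
move=> uA a0.
have ua : a%:C *: A \in unitmx by rewrite unitmxZ// unitfE; move: a0; apply: contra => /eqP[->].
rewrite -[RHS]mulmx1 -(mulmxV ua) mulmxA -scalemxAl -scalemxAr scalerA -rmorphM mulVf//.
by rewrite scale1r mulVmx// mul1mx.
Qed.

Lemma dual_costZ G H (a : R) B : pcont B -> 0 < a ->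
  dual_cost G H (fun x => a%:C *: B x) = a * pairing G B + a^-1 * pairing H (fun x => invmx (B x)).
Proof.
move=> pB a0; rewrite /dual_cost (pairingZ _ _ (pcont_bfield pB)); congr (_ + _).
rewrite -(pairingZ _ _ (pcont_bfield (pcont_inv pB))); apply: pairing_eq => x.
by rewrite invmxZ_real ?gt_eqF// (pcont_unit _ pB).
Qed.

Lemma fidelity_le_mass G H (a : R) : 0 < a ->
  2 * fidelity G H <= a * hpm_mass G + a^-1 * hpm_mass H.
Proof.
move=> a0; have := fidelity_le G H (pcontZ a0 pcont1); rewrite (dual_costZ _ _ pcont1 a0).
by rewrite invmx1 !pairing1.
Qed.

Lemma fidelity_mass0 G H : hpm_mass G = 0 -> fidelity G H = 0.
Proof.
move=> G0; apply/eqP; rewrite eq_le fidelity_ge0 andbT.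
apply/ler_addgt0Pr => e e0; rewrite add0r.
have H0 := mass_ge0 H.
(* A large constant field: it costs nothing on [G], and its inverse makes the cost on [H] at most
   [e]. *)
have a0 : 0 < (hpm_mass H + 1) / e by rewrite divr_gt0// ltr_wpDl.
have := fidelity_le_mass G H a0; rewrite G0 mulr0 add0r invf_div.
have : e / (hpm_mass H + 1) * hpm_mass H <= e.
  by rewrite mulrAC ler_pdivrMr ?ltr_wpDl// ler_wpM2l ?(ltW e0)// lerDl.
have := fidelity_ge0 G H; move: (fidelity G H) (_ * hpm_mass H) => u v; lra.
Qed.

Lemma fidelity_le1 G H : hpm_mass G = 1 -> hpm_mass H = 1 -> fidelity G H <= 1.
Proof.
move=> G1 H1; have := fidelity_le_mass G H ltr01; rewrite G1 H1 invr1 !mulr1.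
by move: (fidelity G H) => u; lra.
Qed.

Lemma fidelity_self G : fidelity G G = hpm_mass G.
Proof.
apply/eqP; rewrite eq_le; apply/andP; split.
  have := fidelity_le_mass G G ltr01; rewrite invr1 !mul1r.
  by move: (fidelity G G) (hpm_mass G) => u v; lra.
apply: fidelity_ge => B pB; have bB := pcont_bfield pB; have bI := pcont_bfield (pcont_inv pB).
have b1 := bfield_cst (Omega := Omega) (1%:M : M).
rewrite /dual_cost -(pairingD _ bB bI) -pairing1 -(pairingZ _ _ b1).
apply: (pairing_le _ (bfieldZ _ b1) (bfieldD bB bI)) => x.
have uB := pcont_unit x pB; have hB := pcont_herm x pB.
have pI := pcont_pos x (pcont_inv pB).
(* Matrix form of b + 1/b >= 2, the difference being a manifestly positive sandwich. *)
have -> : B x + invmx (B x) - 2%:C *: 1%:M = (B x - 1%:M) *m invmx (B x) *m (B x - 1%:M)^t*.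
  rewrite adjD adjN adj_one (hermP _).1// mulmxBl mul1mx mulmxV// mulmxBr mulmx1 mulmxBl mul1mx mulVmx//.
  have -> : (2%:C *: 1%:M : M) = 1%:M + 1%:M.
    by rewrite (_ : 2%:C = 1 + 1 :> R[i]) ?scalerDl ?scale1r// -[2%R]/(1 + 1)%R rmorphD.
  by rewrite opprD addrACA opprB.
exact: pos_conj.
Qed.

End Fidelity.

(** * Fidelity 1 forces equality *)

Section FidelityOne.
Context {R : realType} {Omega : ptopologicalType} {d : nat}.
Notation M := 'M[R[i]]_d.
Notation T := (borel Omega).
Notation hpm := (hpm R Omega d).
Hypothesis metO : metrizable R Omega.
Implicit Types (F A B : Omega -> M) (G H : hpm).

Lemma lowb_perturb (s : R) (X : M) : X \is hermsymmx -> frobn X <= 1 -> `|s| <= 1 / 2 ->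
  lowb (1 / 2) (1%:M + s%:C *: X).
Proof.
move=> hX X1 s2; apply/lowbP; split; first by apply: hermD; [exact: herm1|exact: hermZ].
move=> Z; rewrite mulmxDl mul1mx -scalemxAl frobDl frobZl.
have : `|s * frob (X *m Z) Z| <= 1 / 2 * frob Z Z.
  rewrite normrM; apply: ler_pM => //.
  have nq : frob (- X *m Z) Z <= frob Z Z.
    apply: le_trans (frob_quad_le _ _) _; rewrite frobnN.
    by rewrite ler_piMl ?frob_ge0.
  have pq : frob (X *m Z) Z <= frob Z Z.
    by apply: le_trans (frob_quad_le _ _) _; rewrite ler_piMl ?frob_ge0.
  by rewrite ler_norml pq andbT lerNl -frobNl -mulNmx.
rewrite ler_norml => /andP[+ _]; move: (s * _) (frob Z Z) => u v; lra.
Qed.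

(** Exact second-order remainder of the Neumann expansion of the inverse. *)
Lemma inv_perturb (Y : M) : 1%:M + Y \in unitmx ->
  invmx (1%:M + Y) - (1%:M - Y) = Y *m invmx (1%:M + Y) *m Y.
Proof.
set B := 1%:M + Y => uB; have -> : Y = B - 1%:M by rewrite /B addrC addKr.
rewrite mulmxBl mulmxV// mul1mx mulmxBr mulmx1 mulmxBl mulVmx// mul1mx.
by rewrite [in LHS]opprB addrCA opprB.
Qed.

Lemma sandwich_bound (u x y z n : R) : u <= z * x -> z <= x * y -> x <= 1 -> 1 / 2 * y <= n ->
  0 <= x -> 0 <= y -> u <= 2 * n.
Proof.
move=> h1 h2 x1 yn x0 y0; apply: (@le_trans _ _ y); last by lra.
apply: le_trans h1 _; apply: (@le_trans _ _ (x * y * x)); first exact: ler_wpM2r.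
rewrite -[leRHS]mulr1 ler_pM ?mulr_ge0//; by rewrite ler_piMl.
Qed.

Lemma slope_bound (s p q u v : R) : u <= v ->
  2 <= 1 + s * p + (1 - s * q + u) -> 0 <= s * (p - q) + v.
Proof. by rewrite mulrBr; move: (s * p) (s * q) => p' q'; lra. Qed.

Lemma linear_dominated (a C : R) : 0 <= C ->
  (forall s, `|s| <= 1 / 2 -> 0 <= s * a + s ^+ 2 * C) -> a = 0.
Proof.
move=> C0 H; apply/eqP; rewrite -normr_le0; apply/ler_addgt0Pr => e e0; rewrite add0r.
pose s := Num.min (1 / 2) (e / (C + 1)).
have s0 : 0 < s by rewrite lt_min divr_gt0//= divr_gt0// ltr_wpDl.
have s2 : `|s| <= 1 / 2 by rewrite gtr0_norm// ge_min lexx.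
have s3 : s * C <= e.
  apply: (@le_trans _ _ (e / (C + 1) * C)); first by rewrite ler_wpM2r// ge_min lexx orbT.
  by rewrite mulrAC ler_pdivrMr ?ltr_wpDl// ler_wpM2l ?(ltW e0)// lerDl.
have h1 := H _ s2; have h2 : 0 <= - s * a + (- s) ^+ 2 * C by apply: H; rewrite normrN.
rewrite ler_norml; apply/andP; split.
  have : 0 <= s * (a + s * C) by move: h1; rewrite expr2; nra.
  by rewrite pmulr_rge0//; lra.
have : 0 <= s * (- a + s * C) by move: h2; rewrite expr2; nra.
by rewrite pmulr_rge0//; lra.
Qed.

(** When the fidelity is 1, the identity field minimises the dual cost. The first variation at
    [1 + s F] is the difference of the pairings of [G] and [H] with [F], up to a remainder of order
    s^2, so it vanishes; pairings determine the measure. *)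
Lemma fidelity_eq1 G H : hpm_mass G = 1 -> hpm_mass H = 1 -> fidelity G H = 1 -> G = H.
Proof.
move=> G1 H1 GH1; apply: (hpm_determined metO).
(* By linearity [F] may be normalised, so that [1 + s F] stays above 1/2 for [s] in [-1/2, 1/2]. *)
suff small F : Cb F -> (forall x, frobn (F x) <= 1) -> pairing G F = pairing H F.
  move=> F /[dup] cF /CbP[hF [C FC] mF].
  have C1 : 0 < `|C| + 1 by rewrite ltr_wpDl.
  have cF' : Cb (fun x => ((`|C| + 1)^-1)%:C *: F x).
    apply/CbP; split; [by move=> x; exact: hermZ|by apply: bounded_mxZ; exists C|exact: mcontZ].
  have := small _ cF'; rewrite !(pairingZ _ _ (Cb_bfield cF)) => H'.
  apply: (mulfI (x := (`|C| + 1)^-1)); first by rewrite invr_eq0 gt_eqF.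
  apply: H' => x; rewrite frobnZ gtr0_norm ?invr_gt0// mulrC ler_pdivrMr// mul1r.
  by apply: le_trans (FC x) _; apply: le_trans (ler_norm _) _; rewrite lerDl.
move=> cF F1; have /CbP[hF _ mF] := cF; have bF := Cb_bfield cF.
apply/eqP; rewrite -subr_eq0; apply/eqP.
have b1 := bfield_cst (Omega := Omega) (1%:M : M).
apply: (@linear_dominated _ (2 * frobn (1%:M : M))); first by rewrite mulr_ge0// frobn_ge0.
move=> s s2.
have pB : pcont (fun x => 1%:M + s%:C *: F x).
  split.
  - by exists (1 / 2) => // x; exact: lowb_perturb.
  - by apply: bounded_mxD; [exact: bounded_mx_cst|apply: bounded_mxZ; exists 1].
  - by apply: mcontD; [exact: mcont_cst|exact: mcontZ].
have := fidelity_le G H pB; rewrite GH1 mulr1 /dual_cost.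
have bI := pcont_bfield (pcont_inv pB); have bsF := bfieldZ s bF.
rewrite (pairingD _ b1 bsF) pairing1 G1 (pairingZ _ _ bF).
pose W x := invmx (1%:M + s%:C *: F x) - (1%:M - s%:C *: F x).
have WE x : W x = (s ^+ 2)%:C *: (F x *m invmx (1%:M + s%:C *: F x) *m F x).
  rewrite expr2 rmorphM -scalerA /W (inv_perturb (pcont_unit x pB)).
  by rewrite -!scalemxAl -scalemxAr.
have bFI := bfieldM (bfieldM bF bI) bF.
have WI : pairing H (fun x => invmx (1%:M + s%:C *: F x)) =
    pairing H (fun x => 1%:M - s%:C *: F x) + s ^+ 2 * pairing H (fun x => F x *m invmx (1%:M + s%:C *: F x) *m F x).
  rewrite -(pairingZ _ _ bFI) -pairingD.
  - by apply: pairing_eq => x; rewrite -WE /W [RHS]addrC subrK.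
  - by have := bfieldD b1 (bfieldZ (- 1) bsF); rewrite (_ : (fun x => _ + (-1)%:C *: _) = (fun x => 1%:M - s%:C *: F x))//;
      apply/funext => x; rewrite rmorphN scaleN1r.
  - exact: bfieldZ.
rewrite WI (pairingB _ b1 bsF) pairing1 H1 (pairingZ _ _ bF).
have bd : pairing H (fun x => F x *m invmx (1%:M + s%:C *: F x) *m F x) <= 2 * frobn (1%:M : M).
  apply: le_trans (ler_norm _) _.
  have := @pairing_bound R Omega d H _ (2 * frobn (1%:M : M)) bFI.1; rewrite H1 mulr1; apply => x.
  have lB := lowb_perturb (hF x) (F1 x) s2.
  have i2 := lowb_inv_frobn (divr_gt0 ltr01 (ltr0n R 2)) lB.
  exact: (sandwich_bound (frobn_mul _ _) (frobn_mul _ _) (F1 x) i2 (frobn_ge0 _) (frobn_ge0 _)).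
have : s ^+ 2 * pairing H (fun x => F x *m invmx (1%:M + s%:C *: F x) *m F x) <= s ^+ 2 * (2 * frobn (1%:M : M)).
  by rewrite ler_wpM2l ?sqr_ge0.
exact: slope_bound.
Qed.

End FidelityOne.

(** * Triangle inequality for the angle arccos of the fidelity *)

Section Triangle.
Context {R : realType} {Omega : ptopologicalType} {d : nat}.
Notation M := 'M[R[i]]_d.
Notation T := (borel Omega).
Notation hpm := (hpm R Omega d).
Implicit Types (F A B : Omega -> M) (G H : hpm).

(** The two inequalities are combined with weights sin b and sin a; the middle terms sum to sin (a +
    b), and the identity sin^2 (a + b) - sin^2 a - sin^2 b = 2 sin a sin b cos (a + b) leaves the
    claim. *)
Lemma triangle_arith (sa sb ca cb s c p q y w : R) :
  sa ^+ 2 + ca ^+ 2 = 1 -> sb ^+ 2 + cb ^+ 2 = 1 ->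
  s = sa * cb + ca * sb -> c = ca * cb - sa * sb -> 0 < sa -> 0 < sb -> 0 < s ->
  2 * ca <= (sb / s + sa / s * p) + y ->
  2 * cb <= w + (sb / s * q + sa / s) ->
  sb * y + sa * w = s -> 2 * c <= p + q.
Proof.
move=> ha hb sE cE sa0 sb0 s0 h1 h2 yw.
have s1 : s != 0 by rewrite gt_eqF.
have h1' : sb * (2 * ca) <= sb * ((sb / s + sa / s * p) + y) by rewrite ler_wpM2l// ltW.
have h2' : sa * (2 * cb) <= sa * (w + (sb / s * q + sa / s)) by rewrite ler_wpM2l// ltW.
have h3 : 2 * s <= sb * (sb / s + sa / s * p) + s + sa * (sb / s * q + sa / s).
  have -> : 2 * s = sb * (2 * ca) + sa * (2 * cb) by rewrite sE; ring.
  by rewrite -[X in _ + X + _]yw; lra.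
have h4 : s * s <= sb ^+ 2 + sa ^+ 2 + sa * sb * (p + q).
  have : s * s <= s * (sb * (sb / s + sa / s * p) + sa * (sb / s * q + sa / s)).
    by rewrite ler_wpM2l ?(ltW s0)//; lra.
  by rewrite [leRHS](_ : _ = sb ^+ 2 + sa ^+ 2 + sa * sb * (p + q))//; field.
have h5 : s * s - sb ^+ 2 - sa ^+ 2 = 2 * (sa * sb) * c.
  have -> : s * s = sa ^+ 2 * cb ^+ 2 + ca ^+ 2 * sb ^+ 2 + 2 * (sa * sb) * (ca * cb) by rewrite sE; ring.
  have -> : cb ^+ 2 = 1 - sb ^+ 2 by lra.
  have -> : ca ^+ 2 = 1 - sa ^+ 2 by lra.
  by rewrite cE; ring.
have ss : 0 < sa * sb by rewrite mulr_gt0.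
rewrite -(ler_pM2l ss).
have -> : sa * sb * (2 * c) = 2 * (sa * sb) * c by ring.
by rewrite -h5; lra.
Qed.

(** A field [B] testing the pair (G0, G2) is cut at the intermediate angle: [Y] is its sine
    interpolation with the identity there, used for (G0, G1), and the inverse of [W] is used for
    (G1, G2). At [G1] the two weighted inverses add up to the constant sin (a + b), so only the mass
    of [G1] is seen. *)
Lemma fidelity_triangle G0 G1 G2 (a b : R) :
  hpm_mass G0 = 1 -> hpm_mass G1 = 1 -> hpm_mass G2 = 1 ->
  0 < a -> 0 < b -> a + b < pi ->
  cos a <= fidelity G0 G1 -> cos b <= fidelity G1 G2 -> cos (a + b) <= fidelity G0 G2.
Proof.
move=> m0 m1 m2 a0 b0 ab f1 f2; apply: fidelity_ge => B pB.
have sa : 0 < sin a by rewrite sin_gt0_pi// a0/= (lt_trans _ ab)// ltrDl.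
have sb : 0 < sin b by rewrite sin_gt0_pi// b0/= (lt_trans _ ab)// ltrDr.
have ss : 0 < sin (a + b) by rewrite sin_gt0_pi// ab andbT addr_gt0.
set u := sin b / sin (a + b); set v := sin a / sin (a + b).
have u0 : 0 < u by rewrite divr_gt0.
have v0 : 0 < v by rewrite divr_gt0.
pose Y x := u%:C *: 1%:M + v%:C *: B x.
pose W x := u%:C *: invmx (B x) + v%:C *: 1%:M.
have pI := pcont_inv pB.
have pY : pcont Y := pcontD (pcontZ u0 pcont1) (pcontZ v0 pB).
have pW : pcont W := pcontD (pcontZ u0 pI) (pcontZ v0 pcont1).
have bB := pcont_bfield pB; have bI := pcont_bfield pI.
have b1 := bfield_cst (Omega := Omega) (1%:M : M).
have h1 := fidelity_le G0 G1 pY; have h2 := fidelity_le G1 G2 (pcont_inv pW).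
have bYI := pcont_bfield (pcont_inv pY); have bWI := pcont_bfield (pcont_inv pW).
have e1 : pairing G0 Y = u + v * pairing G0 B.
  by rewrite (pairingD _ (bfieldZ _ b1) (bfieldZ _ bB)) !(pairingZ _ _ b1) (pairingZ _ _ bB) pairing1 m0 mulr1.
have e2 : pairing G2 (fun x => invmx (invmx (W x))) = u * pairing G2 (fun x => invmx (B x)) + v.
  rewrite (@pairing_eq _ _ _ G2 _ W) => [|x]; last exact: invmxK.
  by rewrite (pairingD _ (bfieldZ _ bI) (bfieldZ _ b1)) !(pairingZ _ _ b1) (pairingZ _ _ bI) pairing1 m2 mulr1.
have e3 : sin b * pairing G1 (fun x => invmx (Y x)) + sin a * pairing G1 (fun x => invmx (W x)) = sin (a + b).
  rewrite -!pairingZ// -pairingD; [|exact: bfieldZ bYI|exact: bfieldZ bWI].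
  rewrite -[RHS]mulr1 -m1 -pairing1 -(pairingZ _ _ b1); apply: pairing_eq => x.
  have uB := pcont_unit x pB; have uY := pcont_unit x pY; have uW := pcont_unit x pW.
  (* Because [W] equals the inverse of [B] times [Y]; this is what makes the two middle terms
     recombine. *)
  have WY : invmx (W x) = B x *m invmx (Y x).
    apply: (can_inj (mulmxK uY)); rewrite mulmxKV//.
    apply: (can_inj (mulKmx uW)); rewrite mulKVmx//.
    by rewrite /W /Y mulmxDl -!scalemxAl mulVmx// mul1mx.
  rewrite WY scalemxAl -[X in X + _]mul1mx -scalemxAr scalemxAl -mulmxDl.
  have -> : (sin b)%:C *: 1%:M + (sin a)%:C *: B x = (sin (a + b))%:C *: Y x.
    by rewrite /Y scalerDr !scalerA -!rmorphM /u /v; congr (_%:C *: _ + _%:C *: _); field; rewrite gt_eqF.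
  by rewrite -scalemxAl mulmxV.
have sc (x : R) : sin x ^+ 2 + cos x ^+ 2 = 1 by rewrite addrC cos2Dsin2.
apply: (triangle_arith (sc a) (sc b) _ (cosD a b) sa sb ss _ _ e3).
- by rewrite sinD.
- by rewrite -/u -/v -e1; apply: le_trans h1; rewrite ler_pM2l.
- by rewrite -/u -/v -e2; apply: le_trans h2; rewrite ler_pM2l.
Qed.

End Triangle.

(** * Homogeneity under scaling of the measures *)

Section Scaling.
Context {R : realType} {Omega : ptopologicalType} {d : nat}.
Notation M := 'M[R[i]]_d.
Notation T := (borel Omega).
Notation hpm := (hpm R Omega d).
Implicit Types (G H : hpm).

Lemma rep_scale (a : R) (gam : {finite_measure set T -> \bar R}) k G H : 0 <= a ->
  (forall A, H A = a%:C *: G A) -> rep gam k G -> rep gam (fun x => a%:C *: k x) H.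
Proof.
move=> a0 HG rk; have [[C [mk pk tk]] GA] := rk; split.
  exists (a * C); split.
  - by apply: (mxmeasZ _ mk); exact: measurable_cst.
  - by move=> x; exact: posZ.
  - by move=> x; rewrite mxtraceZ Re_rmul ler_wpM2l.
move=> A mA X; rewrite HG frobZl GA//.
rewrite -(RintegralZl _ mA (frob_integrable gam mA (bpos_bmx (And3 mk pk tk)) (bmx_cst _))).
by apply: eq_Rintegral => x _; rewrite frobZl.
Qed.

Lemma pairing_scale (a : R) G H F : 0 <= a -> (forall A, H A = a%:C *: G A) -> bfield F ->
  pairing H F = a * pairing G F.
Proof.
move=> a0 HG bF; have [k rk] := rep_self G.
rewrite (pairing_rep rk bF.1) (pairing_rep (rep_scale a0 HG rk) bF.1).
rewrite -(RintegralZl _ measurableT (rep_integrable rk bF)).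
by apply: eq_Rintegral => x _; rewrite frobZl.
Qed.

Lemma mass_scale (a : R) G H : (forall A, H A = a%:C *: G A) -> hpm_mass H = a * hpm_mass G.
Proof. by move=> HG; rewrite /hpm_mass HG mxtraceZ Re_rmul. Qed.

Lemma hpm_scale_ex (a : R) G : metrizable R Omega -> 0 <= a ->
  exists H, forall A, H A = a%:C *: G A.
Proof.
move=> metO a0; have [k rk] := rep_self G; have [[C [mk pk tk]] GA] := rk.
have bk : bpos (fun x => a%:C *: k x) (a * C).
  split.
  - by apply: (mxmeasZ _ mk); exact: measurable_cst.
  - by move=> x; exact: posZ.
  - by move=> x; rewrite mxtraceZ Re_rmul ler_wpM2l.
have [H [_ HA]] := hpm_of (metrizable_hausdorff metO) (@trmeas_radon _ _ _ G) bk.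
exists H => A; have [mA|nmA] := pselect (measurable A); last first.
  by rewrite !hpm_out// scaler0.
apply: frob_eqP => X; rewrite frobZl GA// HA//.
rewrite -(RintegralZl _ mA (frob_integrable _ mA (bpos_bmx (And3 mk pk tk)) (bmx_cst _))).
by apply: eq_Rintegral => x _; rewrite frobZl.
Qed.

(** The substitution of [(r1 / r0) B] for [B] multiplies both terms of the cost by [r0 * r1]. This
    homogeneity is the source of the cone structure. *)
Lemma fidelity_scale (r0 r1 : R) G0 G1 H0 H1 : 0 < r0 -> 0 < r1 ->
  (forall A, H0 A = (r0 ^+ 2)%:C *: G0 A) -> (forall A, H1 A = (r1 ^+ 2)%:C *: G1 A) ->
  fidelity H0 H1 = r0 * r1 * fidelity G0 G1.
Proof.
move=> r00 r10 HG0 HG1.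
have r01 : 0 < r0 * r1 by rewrite mulr_gt0.
have cost (B : Omega -> M) : pcont B -> dual_cost H0 H1 (fun x => (r1 / r0)%:C *: B x) = r0 * r1 * dual_cost G0 G1 B.
  move=> pB; have bB := pcont_bfield pB; have bI := pcont_bfield (pcont_inv pB).
  rewrite dual_costZ// ?divr_gt0// (pairing_scale (sqr_ge0 _) HG0 bB) (pairing_scale (sqr_ge0 _) HG1 bI).
  by rewrite /dual_cost; field; rewrite !gt_eqF.
apply/eqP; rewrite eq_le; apply/andP; split.
  rewrite mulrC -ler_pdivrMr//; apply: fidelity_ge => B pB.
  rewrite mulrA ler_pdivrMr// mulrC -mulrC.
  rewrite [leRHS]mulrC -cost//; apply: fidelity_le; apply: pcontZ => //.
  by rewrite divr_gt0.
apply: fidelity_ge => B pB.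
have ri : 0 < r0 / r1 by rewrite divr_gt0.
have := cost _ (pcontZ ri pB).
have -> : (fun x => (r1 / r0)%:C *: ((r0 / r1)%:C *: B x)) = B.
  apply/funext => x; rewrite scalerA -rmorphM.
  by rewrite (_ : r1 / r0 * (r0 / r1) = 1) ?rmorph1 ?scale1r//; field; rewrite !gt_eqF.
move=> ->; rewrite mulrCA ler_pM2l//; apply: fidelity_le; exact: pcontZ.
Qed.

End Scaling.

(** * Integrals of nonnegative functions as suprema over simple functions, without measurability *)

Section LowerIntegral.
Context {R : realType} {d0 : measure_display} {T : measurableType d0}.
Variable mu : {measure set T -> \bar R}.
Local Open Scope ereal_scope.
Import HBNNSimple.

(** The integral of a nonnegative function is the supremum over the simple functions below it, hence
    monotone for arbitrary functions. *)
Lemma lower_le (D D' : set T) (f g : T -> \bar R) : (forall x, 0 <= f x) -> (forall x, 0 <= g x) ->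
  (forall x, (f \_ D) x <= (g \_ D') x) -> \int[mu]_(x in D) f x <= \int[mu]_(x in D') g x.
Proof.
move=> f0 g0 fg; rewrite !ge0_integralE//.
apply: le_ereal_sup => _ [h /= hf <-].
by exists h => //= x; exact: le_trans (hf x) (fg x).
Qed.

Lemma sintegral_le_lower (D : set T) (f : T -> \bar R) (h : {nnsfun T >-> R}) :
  (forall x, 0 <= f x) -> (forall x, (h x)%:E <= (f \_ D) x) ->
  sintegral mu h <= \int[mu]_(x in D) f x.
Proof. by move=> f0 hf; rewrite ge0_integralE//; apply: ereal_sup_ubound; exists h. Qed.

(** Simple minorants on the two pieces add up to a minorant on the union. Additivity may fail for
    nonmeasurable [f], but this direction is the one needed to sum over a partition. *)
Lemma lower_superadd (A B : set T) (f : T -> \bar R) : (forall x, 0 <= f x) ->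
  A `&` B = set0 ->
  \int[mu]_(x in A) f x + \int[mu]_(x in B) f x <= \int[mu]_(x in A `|` B) f x.
Proof.
move=> f0 AB.
set c := \int[mu]_(x in A `|` B) f x.
have c0 : 0 <= c by exact: integral_ge0.
have [->|cy] := eqVneq c +oo; first by rewrite leey.
have cf : c \is a fin_num by rewrite ge0_fin_numE// lt_neqAle cy leey.
have H (h1 h2 : {nnsfun T >-> R}) : (forall x, (h1 x)%:E <= (f \_ A) x) ->
    (forall x, (h2 x)%:E <= (f \_ B) x) -> sintegral mu h1 + sintegral mu h2 <= c.
  move=> H1 H2; rewrite -sintegralD; apply: (sintegral_le_lower (h := add_nnsfun h1 h2)) => // x.
  rewrite /= EFinD; have := H1 x; have := H2 x; rewrite !patchE in_setU.
  have [xA|xA] := boolP (x \in A); have [xB|xB] := boolP (x \in B) => //= h2x h1x.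
  - exfalso; suff : (A `&` B) x by rewrite AB.
    by split; exact: set_mem.

  - by rewrite -[leRHS]adde0; exact: leeD.
  - by rewrite -[leRHS]add0e; exact: leeD.
  - by rewrite -[leRHS]adde0; exact: leeD.
have s0 (h : {nnsfun T >-> R}) : 0 <= sintegral mu h by exact: sintegral_ge0.
rewrite ge0_integralE//.
set S := ereal_sup _.
have Sc : S <= c.
  apply: ge_ereal_sup => _ [h1 H1 <-].
  have := H h1 nnsfun0 H1; rewrite sintegral0 adde0; apply => x.
  by rewrite /= patchE; case: ifP.
have S0 : 0 <= S by apply: ereal_sup_ubound; exists nnsfun0 => //=; [move=> x; rewrite patchE; case: ifP|rewrite sintegral0].
have Sf : S \is a fin_num by rewrite ge0_fin_numE//; apply: le_lt_trans Sc _; rewrite lt_neqAle cy leey.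
rewrite addeC -leeBrDr// ge0_integralE//.
apply: ge_ereal_sup => _ [h2 H2 <-]; rewrite leeBrDr// addeC.
have h2c : sintegral mu h2 <= c.
  have := H nnsfun0 h2 _ H2; rewrite sintegral0 add0e; apply => x.
  by rewrite /= patchE; case: ifP.
have h2f : sintegral mu h2 \is a fin_num.
  by rewrite ge0_fin_numE//; apply: le_lt_trans h2c _; rewrite lt_neqAle cy leey.
rewrite -leeBrDr//; apply: ge_ereal_sup => _ [h1 H1 <-].
by rewrite leeBrDr//; exact: H.
Qed.

(** A simple minorant of [f] yields a measurable minorant of [e], after which only measurable
    functions are integrated. The set [D'] may omit a null part of [D], such as an endpoint. *)
Lemma lower_affine (D D' : set T) (f e : T -> \bar R) (C : R) :
  measurable D -> measurable D' -> D' `<=` D -> mu (D `\` D') = 0 -> (0 <= C)%R ->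
  (forall x, 0 <= f x) -> (forall x, 0 <= e x) ->
  (forall x, D' x -> f x <= (2^-1)%:E * e x + C%:E) ->
  \int[mu]_(x in D) f x <= (2^-1)%:E * \int[mu]_(x in D') e x + C%:E * mu D.
Proof.
move=> mD mD' DD mDD C0 f0 e0 fe; rewrite [leLHS]ge0_integralE//.
apply: ge_ereal_sup => _ [h /= hf <-].
(* The inequality h <= e / 2 + C solved for e and truncated at 0. *)
pose g x := (2 * Num.max (h x - C) 0)%R.
have mh : measurable_fun setT h by exact: measurable_funP.
have mg : measurable_fun setT g.
  apply: measurable_funM; first exact: measurable_cst.
  by apply: measurable_maxr => //; apply: measurable_funB => //; exact: measurable_cst.
have g0 x : (0 <= g x)%R by rewrite mulr_ge0// le_max lexx orbT.
have h0 x : (0 <= h x)%R by [].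
have ge x : D' x -> (g x)%:E <= e x.
  move=> Dx; have hx : (h x)%:E <= (2^-1)%:E * e x + C%:E.
    by apply: le_trans (fe x Dx); have := hf x; rewrite patchE mem_set//; exact: DD.
  move: hx (e0 x); case: (e x) => [r hx r0|_ _|]; [|by rewrite leey|by []].
  move: hx r0.
  rewrite -EFinM -EFinD !lee_fin /g => hx r0.
  have [_|_] := leP (h x - C)%R 0%R; first by rewrite mulr0.
  by rewrite -ler_pdivlMl//; lra.
have gle : \int[mu]_(x in D') (g x)%:E <= \int[mu]_(x in D') e x.
  apply: lower_le => // x; rewrite !patchE; case: ifPn => // xD.
  by apply: ge; exact: set_mem.
have hD x : ~ D x -> h x = 0%R.
  move=> Dx; apply/eqP; rewrite eq_le h0 andbT -lee_fin.
  by have := hf x; rewrite patchE memNset.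
have mhE : measurable_fun setT (EFin \o h) by exact/measurable_EFinP.
have mgE : measurable_fun setT (EFin \o g) by exact/measurable_EFinP.
have -> : sintegral mu h = \int[mu]_(x in D') (h x)%:E.
  rewrite -integralT_nnsfun.
  have -> : [set: T] = D' `|` ((D `\` D') `|` ~` D).
    apply/seteqP; split=> x // _; have [|] := pselect (D' x); first by left.
    by have [|] := pselect (D x); right; [left|right].
  have mDiff : measurable (D `\` D') by exact: measurableD.
  have mCD : measurable (~` D) by exact: measurableC.
  have d1 : [disjoint D' & (D `\` D') `|` ~` D] by apply/disj_setPS => x [Dx [[_ //]|]]; apply; exact: DD.
  have d2 : [disjoint D `\` D' & ~` D] by apply/disj_setPS => x [[Dx _]].
  have h0E (S : set T) x : S x -> 0 <= (EFin \o h) x by rewrite /= lee_fin.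
  rewrite (ge0_integral_setU _ mD' (measurableU _ _ mDiff mCD) (measurable_funTS mhE) (@h0E _) d1).
  rewrite (ge0_integral_setU _ mDiff mCD (measurable_funTS mhE) (@h0E _) d2).
  rewrite [X in _ + (X + _)](null_set_integral mDiff (measurable_funTS mhE) mDD).
  have -> : \int[mu]_(x in ~` D) (EFin \o h) x = 0.
    by apply: integral0_eq => x Dx /=; rewrite hD.
  by rewrite !adde0.
have mG : measurable_fun setT (fun x => (2^-1)%:E * (g x)%:E).
  by apply: (emeasurable_funM _ mgE); exact: measurable_cst.
apply: (@le_trans _ _ (\int[mu]_(x in D') ((2^-1)%:E * (g x)%:E + C%:E))).
  apply: ge0_le_integral.
  - exact: mD'.
  - by move=> x _; rewrite lee_fin.
  - exact: measurable_funTS mhE.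
  - by apply: measurable_funTS; apply: (emeasurable_funD mG); exact: measurable_cst.
  - move=> x Dx; rewrite -EFinM -EFinD lee_fin /g mulKf//.
    have [hC|hC] := leP (h x - C)%R 0%R; lra.
have gp x : D' x -> 0 <= (2^-1)%:E * (g x)%:E by rewrite -EFinM lee_fin mulr_ge0.
have cp x : D' x -> 0 <= (cst C%:E : T -> \bar R) x by rewrite /= lee_fin.
rewrite (ge0_integralD _ mD' gp (measurable_funTS mG) cp (measurable_cst _)).
have g0E x : D' x -> 0 <= (EFin \o g) x by rewrite /= lee_fin.
have half0 : (0 <= (2^-1 : R))%R by [].
rewrite [X in X + _](ge0_integralZl_EFin _ mD' g0E (measurable_funTS mgE) half0).
rewrite integral_cst//; apply: leeD; first by rewrite lee_pmul2l.
by rewrite lee_wpmul2l ?lee_fin// le_measure// inE.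
Qed.

End LowerIntegral.

(** * The action, its time integral and a one-step energy inequality *)

Section Action.
Context {R : realType} {Omega : ptopologicalType} {d : nat}.
Notation M := 'M[R[i]]_d.
Notation T := (borel Omega).
Notation hpm := (hpm R Omega d).

Lemma L2norm2_ge0 (G : hpm) (U : T -> M) : mxmeas setT U -> (0 <= L2norm2 G U)%E.
Proof.
move=> mU; have [k rk] := rep_self G; rewrite (L2norm2_rep rk mU).
by apply: integral_ge0 => x _; rewrite lee_fin; have [_] := rep_pos rk x; exact.
Qed.

Lemma half_sum_abs (a b c : R) : 2 * a <= b + c -> 2 * (- a) <= b + c -> `|a| <= 2^-1 * b + 2^-1 * c.
Proof. by move=> *; rewrite ler_norml; apply/andP; split; lra. Qed.

(** Pointwise Young inequality for both signs of [Psi], integrated. The finite action makes the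
    mixed term integrable. *)
Lemma pairing_mul_bound (G : hpm) (U : T -> M) (Psi : Omega -> M) : mxmeas setT U -> Cb Psi ->
  (L2norm2 G U < +oo)%E ->
  `|pairing_mul G U Psi| <= 2^-1 * fine (L2norm2 G U) + 2^-1 * pairing G (fun x => Psi x *m Psi x).
Proof.
move=> mU cP fL; have [k rk] := rep_self G.
have bP := Cb_bfield cP; have /CbP[hP _ _] := cP.
have [[C [mk pk tk]] _] := rk.
have bPP := bfieldM bP bP.
have mUU : measurable_fun setT (fun x => frob (k x *m U x) (U x)).
  by apply: (measurable_frob _ mU); exact: (mxmeasM mk mU).
have mUP : measurable_fun setT (fun x => frob (k x *m U x) (Psi x)).
  by apply: (measurable_frob _ bP.1); exact: (mxmeasM mk mU).
have qE x : frob (k x *m Psi x) (Psi x) = frob (k x) (Psi x *m Psi x).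
  by rewrite frob_mulr (hermP _).1.
have iUU : (trmeas G).-integrable setT (EFin \o (fun x => frob (k x *m U x) (U x))).
  apply/integrableP; split; first exact/measurable_EFinP.
  have -> : (\int[trmeas G]_x `|(EFin \o (fun x => frob (k x *m U x) (U x))) x|)%E = L2norm2 G U.
    rewrite (L2norm2_rep rk mU); apply: eq_integral => x _ /=.
    by rewrite ger0_norm//; have [_] := pk x; exact.
  exact: fL.
have iPP := rep_integrable rk bPP.
have hUU : (trmeas G).-integrable setT (EFin \o (fun x => 2^-1 * frob (k x *m U x) (U x))).
  exact: (integrableZl measurableT _ iUU).
have hPP : (trmeas G).-integrable setT (EFin \o (fun x => 2^-1 * frob (k x) (Psi x *m Psi x))).
  exact: (integrableZl measurableT _ iPP).
have hS := integrableD measurableT hUU hPP.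
have bd x : `|frob (k x *m U x) (Psi x)| <=
    2^-1 * frob (k x *m U x) (U x) + 2^-1 * frob (k x) (Psi x *m Psi x).
  apply: half_sum_abs; rewrite -qE; first exact: pos_young.
  rewrite -frobNr; apply: le_trans (pos_young _ _ (pk x)) _.
  by rewrite mulmxN frobNl frobNr opprK.
have iUP : (trmeas G).-integrable setT (EFin \o (fun x => frob (k x *m U x) (Psi x))).
  apply: (le_integrable measurableT _ _ hS); first exact/measurable_EFinP.
  move=> x _ /=; rewrite lee_fin; apply: le_trans (bd x) _.
  exact: ler_norm.
rewrite (pairing_mul_rep rk mU bP.1) (pairing_rep rk bPP.1) (L2norm2_rep rk mU).
apply: le_trans (le_normr_Rintegral measurableT iUP) _.
have -> : fine (\int[trmeas G]_x (frob (k x *m U x) (U x))%:E)%E = \int[trmeas G]_x frob (k x *m U x) (U x) by [].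
rewrite -(RintegralZl _ measurableT iUU) -(RintegralZl _ measurableT iPP).
rewrite -(RintegralD measurableT hUU hPP).
exact: (le_Rintegral measurableT (integrable_abse iUP) hS (fun x _ => bd x)).
Qed.

Lemma unit_cylinder_measurable : measurable (@unit_cylinder R Omega).
Proof.
have mi : measurable (`[0, 1]%classic : set (measurableTypeR R)) by exact: measurable_itv.
rewrite (_ : @unit_cylinder R Omega = `[0, 1]%classic `*` [set: T]).
  exact: (measurableX mi measurableT).
by apply/seteqP; split=> p //= [].
Qed.

Lemma section_mxmeas (U : R -> Omega -> M) t : t \in `[0, 1] ->
  (forall i j, measurable_fun (@unit_cylinder R Omega) (fun p => complex.Re (U p.1 p.2 i j))) ->
  (forall i j, measurable_fun (@unit_cylinder R Omega) (fun p => complex.Im (U p.1 p.2 i j))) ->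
  mxmeas setT (U t : T -> M).
Proof.
move=> t01 mR mI.
have sub : ((fun x : T => (t : measurableTypeR R, x)) @` setT) `<=` @unit_cylinder R Omega.
  by move=> _ [x _ <-].
have mp : measurable_fun setT (fun x : T => (t : measurableTypeR R, x)) := pair1_measurable _.
by move=> i j; split;
  [exact: (measurable_comp unit_cylinder_measurable sub (mR i j) mp)|
   exact: (measurable_comp unit_cylinder_measurable sub (mI i j) mp)].
Qed.

End Action.

Section Partition.
Context {R : realType}.
Notation leb := (@lebesgue_measure R).

(** Increments of [psi] telescope while the lower integrals over the pieces add up by
    superadditivity. *)
Lemma partition_bound (e : R -> \bar R) (psi : R -> R) (n : nat) : (forall x, 0 <= e x)%E ->
  (forall k, (k < n.+1)%N -> ((psi (k.+1%:R / n.+1%:R) - psi (k%:R / n.+1%:R))%R%:E <=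
     (2^-1)%:E * \int[leb]_(x in `[(k%:R / n.+1%:R)%R, (k.+1%:R / n.+1%:R)%R[) e x)%E) ->
  ((psi 1 - psi 0)%:E <= (2^-1)%:E * \int[leb]_(x in `[0%R, 1%R[) e x)%E.
Proof.
move=> e0 H; have n0 : 0 < n.+1%:R :> R by rewrite ltr0n.
suff K k : (k <= n.+1)%N -> ((psi (k%:R / n.+1%:R) - psi 0)%R%:E <=
     (2^-1)%:E * \int[leb]_(x in `[0%R, (k%:R / n.+1%:R)%R[) e x)%E.
  by have := K n.+1 (leqnn _); rewrite divff ?gt_eqF.
elim: k => [_|k IH kn].
  by rewrite mul0r subrr mule_ge0// ?lee_fin// integral_ge0.
have {}IH := IH (ltnW kn); have {}H := H k kn.
set a := k%:R / n.+1%:R in IH H *; set b := k.+1%:R / n.+1%:R in H *.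
have a0 : 0 <= a by rewrite divr_ge0.
have ab : a <= b by rewrite ler_pM2r ?invr_gt0// ler_nat.
have -> : psi b - psi 0 = (psi a - psi 0) + (psi b - psi a) by ring.
rewrite EFinD; apply: (@le_trans _ _ ((2^-1)%:E * \int[leb]_(x in `[0%R, a[) e x +
   (2^-1)%:E * \int[leb]_(x in `[a, b[) e x)%E); first exact: leeD.
rewrite -ge0_muleDr ?integral_ge0//; apply: lee_wpmul2l; first by rewrite lee_fin.
have -> : `[0%R, b[%classic = `[0%R, a[%classic `|` `[a, b[%classic :> set R.
  by rewrite -itv_bndbnd_setU.
apply: lower_superadd => //; apply/seteqP; split=> x //= [].
by rewrite !in_itv /= => /andP[_ xa] /andP[ax _]; have := le_lt_trans ax xa; rewrite ltxx.
Qed.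

End Partition.

Section MassBound.
Context {R : realType} {Omega : ptopologicalType} {d : nat}.
Notation M := 'M[R[i]]_d.
Notation T := (borel Omega).
Notation hpm := (hpm R Omega d).

(** The constant field [1%:M] divided by its norm is an admissible test. Hence total mass is
    continuous, so bounded, along a TV-continuous curve. *)
Lemma mass_tv (G H : hpm) : tv_dist G H \is a fin_num ->
  `|hpm_mass G - hpm_mass H| <= frobn (1%:M : M) * fine (tv_dist G H).
Proof.
move=> fin; set D := frobn _.
have D0 : 0 <= D by exact: frobn_ge0.
have b1 := bfield_cst (Omega := Omega) (1%:M : M).
move: D0; rewrite le_eqVlt => /predU1P[D0|D0].
  have mass0 (K : hpm) : hpm_mass K = 0.
    rewrite -pairing1; apply/eqP; rewrite -normr_le0.
    have := @pairing_bound R Omega d K _ D b1.1; rewrite -D0 mul0r; apply => x.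
    by rewrite D0.
  by rewrite !mass0 subrr normr0 -D0 mul0r.
have cb : Cb (fun _ : Omega => (D^-1)%:C *: (1%:M : M)).
  apply/CbP; split; [by move=> x; exact/hermZ/herm1|exact: bounded_mx_cst|exact: mcont_cst].
have nP : (supn (fun _ : Omega => (D^-1)%:C *: (1%:M : M)) <= 1)%E.
  by apply/supn_le => x; rewrite frobnZ gtr0_norm ?invr_gt0// mulVf// gt_eqF.
have : (`|pairing G (fun=> (D^-1)%:C *: 1%:M) - pairing H (fun=> (D^-1)%:C *: 1%:M)|%:E <= tv_dist G H)%E.
  by apply: ereal_sup_ubound; exists (fun=> (D^-1)%:C *: 1%:M).
rewrite !(pairingZ _ _ b1) !pairing1 -mulrBr normrM gtr0_norm ?invr_gt0// -(fineK fin) lee_fin.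
by rewrite ler_pdivrMl.
Qed.

Lemma mass_bounded (G : R -> hpm) : tv_continuous G ->
  exists2 K, 0 <= K & forall t, t \in `[0, 1] -> hpm_mass (G t) <= K.
Proof.
move=> cG.
have cm : {within `[0, 1], continuous (fun t => hpm_mass (G t))}.
  apply/subspace_continuousP => t t01.
  have /fine_cvgP[fin cv] := cG t t01.
  apply/cvgrPdist_le => e e0.
  have De : 0 < e / (frobn (1%:M : M) + 1) by rewrite divr_gt0// ltr_wpDl ?frobn_ge0.
  have /cvgrPdist_le/(_ _ De) := cv.
  apply: filterS2 fin => s fs; rewrite sub0r normrN => h.
  rewrite distrC; apply: le_trans (mass_tv fs) _.
  apply: (@le_trans _ _ (frobn (1%:M : M) * (e / (frobn (1%:M : M) + 1)))).
    by apply: ler_wpM2l; [exact: frobn_ge0|exact: le_trans (ler_norm _) h].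
  rewrite mulrA ler_pdivrMr ?ltr_wpDl ?frobn_ge0// mulrC.
  by apply: ler_wpM2l; [exact: ltW|rewrite lerDl].
have [c c01 H] := @EVT_max R _ 0 1 ler01 cm.
by exists (hpm_mass (G c)) => //; exact: mass_ge0.
Qed.

End MassBound.

Section Step.
Context {R : realType} {Omega : ptopologicalType} {d : nat}.
Notation M := 'M[R[i]]_d.
Notation T := (borel Omega).
Notation hpm := (hpm R Omega d).
Notation leb := (@lebesgue_measure R).
Variables (G : R -> hpm) (U : R -> Omega -> M).
Hypothesis LU : L2L2 G U.
Hypothesis wG : weak_equation G U.

(** Extended by 0 outside the time interval, so that it is nonnegative everywhere as the
    lower-integral lemmas ask. *)
Definition action_density (t : R) : \bar R :=
  if t \in `[0, 1] then L2norm2 (G t) (U t) else 0%E.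

Lemma action_density_ge0 t : (0 <= action_density t)%E.
Proof.
rewrite /action_density; case: ifP => // t01; apply: L2norm2_ge0.
by have [_ mR mI _] := LU; exact: section_mxmeas.
Qed.

Lemma energy_action : energy G U = (\int[leb]_(t in `[0%R, 1%R]) action_density t)%E.
Proof.
by apply: eq_integral => t; rewrite /action_density inE /= => ->.
Qed.

Lemma action_le (s t : R) : 0 <= s -> t <= 1 ->
  (\int[leb]_(x in `[s, t[) action_density x <= energy G U)%E.
Proof.
move=> s0 t1; rewrite energy_action; apply: lower_le => [||x].
- exact: action_density_ge0.
- exact: action_density_ge0.
rewrite !patchE; case: ifPn => xst; last by case: ifP => // _; exact: action_density_ge0.
rewrite ifT//; move: xst; rewrite !inE /= !in_itv /= => /andP[h1 h2].
by rewrite (le_trans s0 h1) (le_trans (ltW h2) t1).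
Qed.

Lemma step_real (p m q e K : R) : `|m| <= 2^-1 * e + 2^-1 * q -> p + 2^-1 * q <= 0 ->
  `|p| <= K -> q <= K -> p + m <= 2^-1 * e /\ - (p + m) <= 2^-1 * e + (K + K).
Proof. by rewrite !ler_norml => /andP[h1 h2] h3 /andP[h4 h5] h6; split; lra. Qed.

(** If [Psi] is a subsolution of the Riccati inequality against [G], the integrand of the weak
    equation is at most half the action, and so is its positive part. The bounds by [K] only serve
    to keep the negative part integrable. *)
Lemma step_bound (Psi dPsi : R -> Omega -> M) (s t K : R) : C1_Cb Psi dPsi ->
  s \in `[0, 1] -> t \in `[0, 1] -> s < t ->
  (forall r, r \in `[s, t[ -> pairing (G r) (dPsi r) +
     2^-1 * pairing (G r) (fun x => Psi r x *m Psi r x) <= 0) ->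
  (forall r, r \in `[0, 1] -> `|pairing (G r) (dPsi r)| <= K /\
     pairing (G r) (fun x => Psi r x *m Psi r x) <= K) ->
  ((pairing (G t) (Psi t) - pairing (G s) (Psi s))%:E <=
     (2^-1)%:E * \int[leb]_(x in `[s, t[) action_density x)%E.
Proof.
move=> cP s01 t01 st H1 H2; rewrite (wG cP s01 t01) /oriented_integral (ltW st).
set f := fun r => _ + _.
have [_ mR mI eU] := LU.
have s0 : 0 <= s by move: s01; rewrite in_itv /= => /andP[].
have t1 : t <= 1 by move: t01; rewrite in_itv /= => /andP[].
have K0 : 0 <= K by have [h _] := H2 _ s01; exact: le_trans (normr_ge0 _) h.
have sub r : r \in `[s, t[ -> r \in `[0, 1].
  by rewrite !in_itv /= => /andP[h1 h2]; rewrite (le_trans s0 h1) (le_trans (ltW h2) t1).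
have E1 := action_le s0 t1; set E := (\int[leb]_(x in `[s, t[) _)%E in E1 *.
have E0 : (0 <= E)%E by apply: integral_ge0 => x _; exact: action_density_ge0.
have Ef : E \is a fin_num by rewrite ge0_fin_numE//; exact: le_lt_trans E1 eU.
have mst : measurable (`[s, t]%classic : set (measurableTypeR R)) by exact: measurable_itv.
have mst' : measurable (`[s, t[%classic : set (measurableTypeR R)) by exact: measurable_itv.
have stsub : (`[s, t[%classic : set R) `<=` `[s, t]%classic.
  by move=> x /=; rewrite !in_itv /= => /andP[-> /ltW].
have stD : leb (`[s, t]%classic `\` `[s, t[%classic) = 0%E.
  rewrite (_ : _ `\` _ = [set t]) ?lebesgue_measure_set1//.
  apply/seteqP; split=> x /=; rewrite !in_itv /=.
    move=> [/andP[h1 h2]]; rewrite h1 /= => /negP; rewrite -leNgt => h3.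
    by apply/eqP; rewrite eq_le h2 h3.
  by move=> ->; split; [rewrite ltW//= lexx|rewrite ltxx andbF].
have fb r : r \in `[s, t[ -> action_density r != +oo%E -> exists2 v, action_density r = v%:E &
    0 <= v /\ (f r <= 2^-1 * v /\ - f r <= 2^-1 * v + (K + K)).
  move=> rst; have r01 := sub r rst; rewrite /action_density r01 => ny.
  have mU : mxmeas setT (U r : T -> M) by exact: section_mxmeas.
  have L0 := L2norm2_ge0 (G r) mU.
  have Ly : (L2norm2 (G r) (U r) < +oo)%E by rewrite lt_neqAle ny leey.
  have Lf : L2norm2 (G r) (U r) \is a fin_num by rewrite ge0_fin_numE.
  exists (fine (L2norm2 (G r) (U r))); first by rewrite fineK.
  split; first by rewrite fine_ge0.
  have [cPr _ _ _] := cP r r01; have [k1 k2] := H2 r r01.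
  exact: (step_real (pairing_mul_bound mU cPr Ly) (H1 r rst) k1 k2).
have Hp : (\int[leb]_(r in `[s, t]) ((EFin \o f)^\+ r) <= (2^-1)%:E * E + 0%:E * leb `[s, t])%E.
  apply: (lower_affine mst mst' stsub stD (lexx 0)); [by move=> x; exact: funepos_ge0|exact: action_density_ge0|].
  move=> r rst; rewrite adde0; have [->|ny] := eqVneq (action_density r) +oo%E.
    by rewrite gt0_muley ?lte_fin// leey.
  have [v -> [v0 [h1 h2]]] := fb r rst ny.
  by rewrite funeposE /= -EFin_max -EFinM lee_fin ge_max h1 mulr_ge0.
(* A crude bound, needed for finiteness only. *)
have Hn : (\int[leb]_(r in `[s, t]) ((EFin \o f)^\- r) <= (2^-1)%:E * E + (K + K)%:E * leb `[s, t])%E.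
  apply: (lower_affine mst mst' stsub stD (addr_ge0 K0 K0)); [by move=> x; exact: funeneg_ge0|exact: action_density_ge0|].
  move=> r rst; have [->|ny] := eqVneq (action_density r) +oo%E.
    by rewrite gt0_muley ?lte_fin// leey.
  have [v -> [v0 [h1 h2]]] := fb r rst ny.
  by rewrite funenegE /= -?EFinN -EFin_max -EFinM -EFinD lee_fin ge_max h2 addr_ge0 ?mulr_ge0 ?addr_ge0.
have lf : leb `[s, t] \is a fin_num.
  by rewrite lebesgue_measure_itv /= lte_fin st.
have Hp0 : (0 <= \int[leb]_(r in `[s, t]) ((EFin \o f)^\+ r))%E by exact: integral_ge0.
have Hn0 : (0 <= \int[leb]_(r in `[s, t]) ((EFin \o f)^\- r))%E by exact: integral_ge0.
have Hpf : (\int[leb]_(r in `[s, t]) ((EFin \o f)^\+ r))%E \is a fin_num.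
  rewrite ge0_fin_numE//; apply: le_lt_trans Hp _.
  by rewrite -ge0_fin_numE ?fin_numD ?fin_numM// adde_ge0// mule_ge0.
have Hnf : (\int[leb]_(r in `[s, t]) ((EFin \o f)^\- r))%E \is a fin_num.
  rewrite ge0_fin_numE//; apply: le_lt_trans Hn _.
  rewrite -ge0_fin_numE ?fin_numD ?fin_numM// adde_ge0// mule_ge0// lee_fin addr_ge0//.
(* [fine] would turn an infinite integral into 0; finiteness of both parts rules this out. *)
rewrite /Rintegral fineK; last by rewrite integralE fin_numB Hpf Hnf.
rewrite integralE; apply: (@le_trans _ _ (\int[leb]_(r in `[s, t]) ((EFin \o f)^\+ r))%E).
  by rewrite leeBlDr// leeDl.
by apply: le_trans Hp _; rewrite mul0e adde0.
Qed.

End Step.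

(** * Uniform convergence and difference quotients of Riccati solutions *)

Section Supn.
Context {R : realType} {Omega : ptopologicalType} {d : nat}.
Notation M := 'M[R[i]]_d.

Lemma supn_cvg0 (I : Type) (F : set_system I) {FF : Filter F} (f : I -> Omega -> M) (g : I -> R) :
  (\forall s \near F, forall x, frobn (f s x) <= g s) -> g @ F --> (0 : R) ->
  supn (f s) @[s --> F] --> 0%E.
Proof.
move=> fg g0; apply: (@squeeze_cvge _ _ _ _ (fun=> 0%E) _ (EFin \o g)).
- by apply: filterS fg => s H; rewrite supn_ge0 /=; apply/supn_le.
- exact: cvg_cst.
- by apply: cvg_EFin; [exact: nearW|exact: g0].
Qed.

(** An exact formula, obtained by multiplying by [Ys]: the error of the difference quotient is a
    combination of scalar difference-quotient errors of the coefficients, hence small uniformly in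
    space. *)
Lemma riccati_quotient (h q : R) (Ys Yt Ns Nt : M) (Psi := 2%:C *: (Nt *m invmx Yt))
   (dPsi := - ((2 * q)%:C%:M + (2^-1)%:C *: (Psi *m Psi))) :
  Ys \in unitmx -> Yt \in unitmx ->
  h%:C *: (2%:C *: (Ns *m invmx Ys) - Psi) - dPsi =
  (2%:C *: (h%:C *: (Ns - Nt) + q%:C *: Yt) - Psi *m (h%:C *: (Ys - Yt) - Nt) - dPsi *m (Ys - Yt)) *m invmx Ys.
Proof.
move=> uS uT; apply: (can_inj (mulmxK uS)); rewrite mulmxKV//.
have PY : Psi *m Yt = 2%:C *: Nt by rewrite /Psi -scalemxAl mulmxKV.
have dY : dPsi *m Yt = - ((2 * q)%:C *: Yt + Psi *m Nt).
  rewrite /dPsi mulNmx mulmxDl mul_scalar_mx -scalemxAl -mulmxA PY -scalemxAr scalerA -rmorphM mulVf//.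
  by rewrite rmorph1 scale1r.
rewrite mulmxBl -scalemxAl mulmxBl -scalemxAl mulmxKV// !mulmxBr -scalemxAr mulmxBr PY dY.
move: (Psi *m Ys) (Psi *m Nt) (dPsi *m Ys) => A1 A2 A3.
apply/matrixP => i j; rewrite !mxE rmorphM.
move: (A1 i j) (A2 i j) (A3 i j) (Ns i j) (Nt i j) (Yt i j) => a1 a2 a3 ns nt yt.
by rewrite !rmorph_nat; ring.
Qed.

Lemma diff_factor (Ps Pt Ys Yt Ns Nt : M) : Ys \in unitmx ->
  Ps *m Ys = 2%:C *: Ns -> Pt *m Yt = 2%:C *: Nt ->
  Ps - Pt = (2%:C *: (Ns - Nt) - Pt *m (Ys - Yt)) *m invmx Ys.
Proof.
move=> uS PS PT; apply: (can_inj (mulmxK uS)).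
rewrite mulmxKV// mulmxBl PS mulmxBr PT scalerBr.
by rewrite opprB addrA subrK.
Qed.

Lemma dPsi_diff (q : R) (P Q : M) :
  - ((2 * q)%:C%:M + (2^-1)%:C *: (P *m P)) - - ((2 * q)%:C%:M + (2^-1)%:C *: (Q *m Q)) =
  - ((2^-1)%:C *: ((P - Q) *m (P - Q) + (P - Q) *m Q + Q *m (P - Q))).
Proof.
rewrite -mulmxDr subrK !mulmxBl !mulmxBr addrA subrK -opprD; congr (- _).
by rewrite opprD addrACA subrr add0r -scalerBr.
Qed.

Lemma cvg0D (F : set_system R) (FF : Filter F) (f g : R -> R) : f s @[s --> F] --> (0 : R) ->
  g s @[s --> F] --> (0 : R) -> f s + g s @[s --> F] --> (0 : R).
Proof. by move=> f0 g0; rewrite -[X in _ --> X](addr0 0); exact: cvgD. Qed.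

Lemma cvg0Zl (F : set_system R) (FF : Filter F) (f : R -> R) c : f s @[s --> F] --> (0 : R) ->
  c * f s @[s --> F] --> (0 : R).
Proof. by move=> f0; rewrite -[X in _ --> X](mulr0 c); exact: cvgMr. Qed.

Lemma cvg0Zr (F : set_system R) (FF : Filter F) (f : R -> R) c : f s @[s --> F] --> (0 : R) ->
  f s * c @[s --> F] --> (0 : R).
Proof. by move=> f0; rewrite -[X in _ --> X](mul0r c); exact: cvgMl. Qed.

(** Caratheodory's slope function is continuous at [t], so its limit survives restriction to any
    punctured relative neighbourhood, including one-sided ones. *)
Lemma deriv_quotient_cvg (f : R -> R) (t f' : R) (A : set R) : is_derive t 1 f f' ->
  (s - t)^-1 * (f s - f t) @[s --> within A t^'] --> f'.
Proof.
move=> /is_derive1_caratheodory[g [fg cg <-]].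
apply: cvg_trans (_ : g @ within A t^' --> g t).
  apply: near_eq_cvg; apply: cvg_within; near=> s.
  rewrite fg mulrCA mulVf ?mulr1// subr_eq0.
  by near: s; exact: nbhs_dnbhs_neq.
apply: cvg_trans cg; apply: cvg_app; apply: cvg_trans (@nbhs_dnbhs _ t).
exact: cvg_within.
Unshelve. all: by end_near. Qed.

Lemma deriv_cvg (f : R -> R) (t f' : R) (F : set_system R) : is_derive t 1 f f' ->
  F `=>` nbhs t -> f s @[s --> F] --> f t.
Proof.
move=> df Ft; have /differentiable_continuous ct : differentiable f t.
  by apply/derivable1_diffP; exact: ex_derive.
by apply: cvg_trans ct; exact: cvg_app.
Qed.

Lemma within_dnbhs_nbhs (A : set R) (t : R) : within A t^' `=>` nbhs t.
Proof. by apply: cvg_trans (@nbhs_dnbhs _ t); exact: cvg_within. Qed.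

Lemma within_nbhs (A : set R) (t : R) : within A (nbhs t) `=>` nbhs t.
Proof. exact: cvg_within. Qed.

End Supn.

(** * The test fields: logarithmic derivatives of interpolations between the identity and [B] *)

Section Riccati.
Context {R : realType} {Omega : ptopologicalType} {d : nat}.
Notation M := 'M[R[i]]_d.
Variable B : Omega -> M.
Hypothesis pB : pcont B.

Definition aff (x y : R) (w : Omega) : M := x%:C *: 1%:M + y%:C *: B w.

Lemma affB x y x' y' w : aff x y w - aff x' y' w = aff (x - x') (y - y') w.
Proof.
by rewrite /aff !rmorphB !scalerBl opprD addrACA.
Qed.

Lemma affD x y x' y' w : aff x y w + aff x' y' w = aff (x + x') (y + y') w.
Proof. by rewrite /aff !rmorphD !scalerDl addrACA. Qed.

Lemma affZ c x y w : c%:C *: aff x y w = aff (c * x) (c * y) w.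
Proof. by rewrite /aff scalerDr !scalerA -!rmorphM. Qed.

Definition affn (m x y : R) : R := `|x| * frobn (1%:M : M) + `|y| * m.

Lemma aff_frobn m x y w : (forall w, frobn (B w) <= m) -> frobn (aff x y w) <= affn m x y.
Proof.
move=> Bm; apply: le_trans (frobnD _ _) _; apply: lerD.
  by rewrite frobnZ.
by rewrite frobnZ ler_wpM2l.
Qed.

Lemma affn_cvg0 m (F : set_system R) (FF : Filter F) (x y : R -> R) :
  x s @[s --> F] --> (0 : R) -> y s @[s --> F] --> (0 : R) ->
  affn m (x s) (y s) @[s --> F] --> (0 : R).
Proof.
move=> x0 y0.
have nx : `|x s| @[s --> F] --> `|0 : R| by exact: cvg_norm x0.
have ny : `|y s| @[s --> F] --> `|0 : R| by exact: cvg_norm y0.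
have c1 : `|x s| * frobn (1%:M : M) @[s --> F] --> `|0 : R| * frobn (1%:M : M) by exact: cvgMl.
have c2 : `|y s| * m @[s --> F] --> `|0 : R| * m by exact: cvgMl.
have := cvgD c1 c2.
rewrite normr0 !mul0r addr0; exact.
Qed.

Lemma aff_cont x y : mcont (aff x y) /\ bounded_mx (aff x y).
Proof.
have [_ [m Bm] cB] := pB; split; last by exists (affn m x y) => w; exact: aff_frobn.
by apply: mcontD; [exact: mcont_cst|exact: mcontZ].
Qed.

Lemma aff_herm x y w : aff x y w \is hermsymmx.
Proof. by apply: hermD; apply: hermZ; [exact: herm1|exact: pcont_herm]. Qed.

Lemma aff_comm x y x' y' w : aff x y w *m aff x' y' w = aff x' y' w *m aff x y w.
Proof.
rewrite /aff !mulmxDl !mulmxDr -!scalemxAl -!scalemxAr !mul1mx !mulmx1 !scalerA.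
rewrite (mulrC x%:C x'%:C) (mulrC x%:C y'%:C) (mulrC y%:C x'%:C) (mulrC y%:C y'%:C) -!addrA; congr (_ + _).
by rewrite addrCA.
Qed.

Variables (a b a' b' : R -> R) (q m0 m1 : R).
Hypothesis da : forall t : R, is_derive t 1 a (a' t).
Hypothesis db : forall t : R, is_derive t 1 b (b' t).
Hypothesis da' : forall t : R, is_derive t 1 a' (- q * a t).
Hypothesis db' : forall t : R, is_derive t 1 b' (- q * b t).
Hypothesis m00 : 0 < m0.
Hypothesis ab0 : forall t, t \in `[0, 1] -> [/\ 0 <= a t, 0 <= b t & m0 <= a t + b t].
Hypothesis ab'_bound : forall t, t \in `[0, 1] -> `|a' t| <= m1 /\ `|b' t| <= m1.

Definition ric_Y (t : R) := aff (a t) (b t).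
Definition ric_N (t : R) := aff (a' t) (b' t).
(** Twice the logarithmic derivative of [ric_Y]. Since [ric_Y] solves Y'' = - q Y, this linearises
    the Riccati equation whose right-hand side is [ric_dPsi]. *)
Definition ric_Psi (t : R) (w : Omega) : M := 2%:C *: (ric_N t w *m invmx (ric_Y t w)).
Definition ric_dPsi (t : R) (w : Omega) : M :=
  - ((2 * q)%:C%:M + (2^-1)%:C *: (ric_Psi t w *m ric_Psi t w)).

(** If [B] is bounded below by c, then a + b B is bounded below by a + b c, hence by [Num.min 1 c]
    times a + b, which is at least [m0]. *)
Lemma ric_lowb : exists2 c, 0 < c & forall t w, t \in `[0, 1] -> lowb c (ric_Y t w).
Proof.
have [[c c0 lB] _ _] := pB.
exists (Num.min 1 c * m0); first by rewrite mulr_gt0// lt_min ltr01 c0.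
move=> t w t01; have [at0 bt0 abm] := ab0 t01.
have /lowbP[hB H] := lB w; apply/lowbP; split; first exact: aff_herm.
move=> Z; rewrite /ric_Y /aff mulmxDl -!scalemxAl mul1mx frobDl !frobZl.
have Z0 := frob_ge0 Z; have HZ := H Z.
apply: (@le_trans _ _ ((a t + b t * c) * frob Z Z)); last first.
  by rewrite mulrDl lerD2l -mulrA ler_wpM2l.
apply: ler_wpM2r => //.
apply: (@le_trans _ _ (Num.min 1 c * (a t + b t))); first by rewrite ler_wpM2l// le_min ler01 ltW.
rewrite mulrDr lerD//.
  by rewrite ler_piMl// ge_min lexx.
by rewrite mulrC ler_wpM2l// ge_min lexx orbT.
Qed.

Lemma ric_pcont t : t \in `[0, 1] -> pcont (ric_Y t).
Proof.
move=> t01; have [c c0 lY] := ric_lowb; have [cY bY] := aff_cont (a t) (b t).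
by split=> //; exists c => // w; exact: lY.
Qed.

Lemma ric_inv_bound : exists2 K, 0 <= K & forall t w, t \in `[0, 1] -> frobn (invmx (ric_Y t w)) <= K.
Proof.
have [c c0 lY] := ric_lowb.
exists (c^-1 * frobn (1%:M : M)); first by rewrite mulr_ge0 ?frobn_ge0// invr_ge0 ltW.
move=> t w t01; rewrite mulrC ler_pdivlMr// mulrC.
exact: lowb_inv_frobn (lY t w t01).
Qed.

Lemma ric_Psi_bound : exists2 K, 0 <= K & forall t w, t \in `[0, 1] -> frobn (ric_Psi t w) <= K.
Proof.
have [K K0 HK] := ric_inv_bound; have [_ [m Bm] _] := pB.
have mm0 : 0 <= m by exact: le_trans (frobn_ge0 _) (Bm point).
have D0 := frobn_ge0 (1%:M : M).
pose L := m1 * frobn (1%:M : M) + m1 * m.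
have t0 : (0 : R) \in `[0, 1] by rewrite in_itv /= lexx ler01.
have m10 : 0 <= m1 by have [h _] := ab'_bound t0; exact: le_trans (normr_ge0 _) h.
have L0 : 0 <= L by rewrite addr_ge0 ?mulr_ge0.
exists (2 * (L * K)); first by rewrite mulr_ge0 ?mulr_ge0.
move=> t w t01; rewrite frobnZ ger0_norm// ler_wpM2l//.
apply: le_trans (frobn_mul _ _) _; apply: ler_pM; [exact: frobn_ge0|exact: frobn_ge0| |exact: HK].
apply: le_trans (aff_frobn _ _ w Bm) _; have [h1 h2] := ab'_bound t01.
by apply: lerD; apply: ler_wpM2r.
Qed.

Lemma ric_Psi_Cb t : t \in `[0, 1] -> Cb (ric_Psi t).
Proof.
move=> t01; have pY := ric_pcont t01; have pI := pcont_inv pY; have [_ bI cI] := pI.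
have [cN bN] := aff_cont (a' t) (b' t).
apply/CbP; split.
- move=> w; apply: hermZ; apply: herm_comm; [exact: aff_herm|exact: (pcont_herm w pI)|].
  (* [ric_N] and the inverse of [ric_Y] commute, both being functions of the single matrix [B w];
     their product is therefore Hermitian. *)
  have uY := pcont_unit w pY.
  apply: (can_inj (mulmxK uY)); rewrite mulmxKV// -mulmxA.
  by rewrite [ric_N t w *m _]aff_comm mulmxA mulVmx// mul1mx.
- by apply: bounded_mxZ; exact: bounded_mxM bN bI.
- by apply: mcontZ; exact: mcontM bN cN cI.
Qed.

Lemma ric_dPsi_Cb t : t \in `[0, 1] -> Cb (ric_dPsi t).
Proof.
move=> t01; have /CbP[hP bP cP] := ric_Psi_Cb t01.
apply/CbP; split.
- move=> w; apply: hermN; apply: hermD; first exact: herm_scal.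
  by apply: hermZ; exact: herm_comm.
- have := bounded_mxZ (-1) (bounded_mxD (bounded_mx_cst (2 * q)%:C%:M) (bounded_mxZ (2^-1) (bounded_mxM bP bP))).
  by move=> [C HC]; exists C => w; have := HC w; rewrite rmorphN scaleN1r.
- apply: mcontN; apply: mcontD; first exact: mcont_cst.
  by apply: mcontZ; exact: (mcontM bP cP cP).
Qed.

(** The right-hand side does not involve the point [w], and each [affn] term tends to 0 when [h] is
    the inverse of [s - t]. *)
Lemma ric_quotient_bound (s t h m Ki Kp Kd : R) w : s \in `[0, 1] -> t \in `[0, 1] ->
  (forall w, frobn (B w) <= m) -> frobn (invmx (ric_Y s w)) <= Ki ->
  frobn (ric_Psi t w) <= Kp -> frobn (ric_dPsi t w) <= Kd ->
  frobn (h%:C *: (ric_Psi s w - ric_Psi t w) - ric_dPsi t w) <=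
  (2 * affn m (h * (a' s - a' t) + q * a t) (h * (b' s - b' t) + q * b t) +
   Kp * affn m (h * (a s - a t) - a' t) (h * (b s - b t) - b' t) +
   Kd * affn m (a s - a t) (b s - b t)) * Ki.
Proof.
move=> s01 t01 Bm hKi hKp hKd.
have uS := pcont_unit w (ric_pcont s01); have uT := pcont_unit w (ric_pcont t01).
have -> : h%:C *: (ric_Psi s w - ric_Psi t w) - ric_dPsi t w =
   (2%:C *: (h%:C *: (ric_N s w - ric_N t w) + q%:C *: ric_Y t w) -
    ric_Psi t w *m (h%:C *: (ric_Y s w - ric_Y t w) - ric_N t w) -
    ric_dPsi t w *m (ric_Y s w - ric_Y t w)) *m invmx (ric_Y s w).
  exact: riccati_quotient.
rewrite /ric_Y /ric_N !affB !affZ affD affB.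
apply: le_trans (frobn_mul _ _) _.
have P0 := frobn_ge0 (2%:C *: aff (h * (a' s - a' t) + q * a t) (h * (b' s - b' t) + q * b t) w).
apply: ler_pM; [exact: frobn_ge0|exact: frobn_ge0| |exact: hKi].
apply: le_trans (frobnB _ _) _; apply: lerD; last first.
  apply: le_trans (frobn_mul _ _) _; apply: ler_pM; [exact: frobn_ge0|exact: frobn_ge0|exact: hKd|].
  exact: aff_frobn.
apply: le_trans (frobnB _ _) _; apply: lerD; last first.
  apply: le_trans (frobn_mul _ _) _; apply: ler_pM; [exact: frobn_ge0|exact: frobn_ge0|exact: hKp|].
  exact: aff_frobn.
by rewrite frobnZ ger0_norm// ler_wpM2l// aff_frobn.
Qed.

Lemma ric_diff (s t : R) w : s \in `[0, 1] -> t \in `[0, 1] ->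
  ric_Psi s w - ric_Psi t w =
  (2%:C *: aff (a' s - a' t) (b' s - b' t) w - ric_Psi t w *m aff (a s - a t) (b s - b t) w)
    *m invmx (ric_Y s w).
Proof.
move=> s01 t01; have uS := pcont_unit w (ric_pcont s01); have uT := pcont_unit w (ric_pcont t01).
have eA : aff (a s - a t) (b s - b t) w = ric_Y s w - ric_Y t w by rewrite /ric_Y affB.
have eN : aff (a' s - a' t) (b' s - b' t) w = ric_N s w - ric_N t w by rewrite /ric_N affB.
have PY r : r \in `[0, 1] -> ric_Psi r w *m ric_Y r w = 2%:C *: ric_N r w.
  by move=> r01; rewrite /ric_Psi -scalemxAl mulmxKV// (pcont_unit w (ric_pcont r01)).
rewrite eA eN; exact: (diff_factor uS (PY s s01) (PY t t01)).
Qed.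

Lemma ric_C1 : C1_Cb ric_Psi ric_dPsi.
Proof.
move=> t t01; have cP := ric_Psi_Cb t01; have cD := ric_dPsi_Cb t01.
have [Ki Ki0 HKi] := ric_inv_bound; have [_ [m Bm] _] := pB.
have /CbP[_ [Kp HKp] _] := cP; have /CbP[_ [Kd HKd] _] := cD.
have Kp0 : 0 <= Kp by exact: le_trans (frobn_ge0 _) (HKp point).
have m0' : 0 <= m by exact: le_trans (frobn_ge0 _) (Bm point).
have cz (F : set_system R) (FF : Filter F) (f f' : R -> R) : (forall r : R, is_derive r 1 f (f' r)) ->
    F `=>` nbhs t -> f s - f t @[s --> F] --> (0 : R).
  move=> df Ft; rewrite -[X in _ --> X](subrr (f t)); apply: cvgB; last exact: cvg_cst.
  exact: (deriv_cvg (df t) Ft).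
split.
- exact: cP.
- exact: cD.
- apply: (@supn_cvg0 R Omega d R (within `[0, 1] t^') _
   (fun s x => ((s - t)^-1)%:C *: (ric_Psi s x - ric_Psi t x) - ric_dPsi t x) (fun s =>
   (2 * affn m ((s - t)^-1 * (a' s - a' t) + q * a t) ((s - t)^-1 * (b' s - b' t) + q * b t) +
   Kp * affn m ((s - t)^-1 * (a s - a t) - a' t) ((s - t)^-1 * (b s - b t) - b' t) +
   Kd * affn m (a s - a t) (b s - b t)) * Ki)).
    apply: filterS (withinT _ _) => s s01 w.
    by apply: ric_quotient_bound => //; exact: HKi.
  have c0 (f f' : R -> R) : (forall r : R, is_derive r 1 f (f' r)) ->
      (s - t)^-1 * (f s - f t) - f' t @[s --> within `[0, 1] t^'] --> (0 : R).
    move=> df; rewrite -[X in _ --> X](subrr (f' t)); apply: cvgB; last exact: cvg_cst.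
    exact: deriv_quotient_cvg.
  have Ft := @within_dnbhs_nbhs R `[0, 1] t.
  have e2 (f f' : R -> R) : (forall r : R, is_derive r 1 f' (- q * f r)) ->
      (s - t)^-1 * (f' s - f' t) + q * f t @[s --> within `[0, 1] t^'] --> (0 : R).
    move=> df; have := c0 f' (fun r => - q * f r) df.
    by under eq_fun do rewrite mulNr opprK.
  have FF : Filter (within `[0, 1] t^') by exact: within_filter.
  have l1 := affn_cvg0 m FF (e2 _ _ da') (e2 _ _ db').
  have l2 := affn_cvg0 m FF (c0 _ _ da) (c0 _ _ db).
  have l3 := affn_cvg0 m FF (cz _ FF _ _ da Ft) (cz _ FF _ _ db Ft).
  apply: (cvg0Zr FF); apply: (cvg0D FF); last exact: (cvg0Zl FF).
  by apply: (cvg0D FF); apply: (cvg0Zl FF).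
pose dl s := (2 * affn m (a' s - a' t) (b' s - b' t) + Kp * affn m (a s - a t) (b s - b t)) * Ki.
have dlP s w : s \in `[0, 1] -> frobn (ric_Psi s w - ric_Psi t w) <= dl s.
  move=> s01; rewrite (ric_diff w s01 t01).
  apply: le_trans (frobn_mul _ _) _.
  apply: ler_pM; [exact: frobn_ge0|exact: frobn_ge0| |exact: HKi].
  apply: le_trans (frobnB _ _) _; apply: lerD.
    by rewrite frobnZ ger0_norm// ler_wpM2l// aff_frobn.
  apply: le_trans (frobn_mul _ _) _; apply: ler_pM; [exact: frobn_ge0|exact: frobn_ge0|exact: HKp|].
  exact: aff_frobn.
apply: (@supn_cvg0 R Omega d R (within `[0, 1] (nbhs t)) _
  (fun s x => ric_dPsi s x - ric_dPsi t x) (fun s => 2^-1 * (dl s * dl s + dl s * Kp + Kp * dl s))).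
  apply: filterS (withinT _ _) => s s01 w.
  have -> : ric_dPsi s w - ric_dPsi t w = - ((2^-1)%:C *:
     ((ric_Psi s w - ric_Psi t w) *m (ric_Psi s w - ric_Psi t w) +
      (ric_Psi s w - ric_Psi t w) *m ric_Psi t w + ric_Psi t w *m (ric_Psi s w - ric_Psi t w))).
    exact: dPsi_diff.
  rewrite frobnN frobnZ ger0_norm// ler_wpM2l//.
  have dls := dlP s w s01; have d0 := frobn_ge0 (ric_Psi s w - ric_Psi t w).
  apply: le_trans (frobnD _ _) _; apply: lerD.
    apply: le_trans (frobnD _ _) _; apply: lerD; apply: le_trans (frobn_mul _ _) _.
      by apply: (ler_pM d0 d0 dls dls).
    by apply: (ler_pM d0 (frobn_ge0 _) dls (HKp w)).
  by apply: le_trans (frobn_mul _ _) _; apply: (ler_pM (frobn_ge0 _) d0 (HKp w) dls).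
have Ft := @within_nbhs R `[0, 1] t.
have FF : Filter (within `[0, 1] (nbhs t)) by exact: within_filter.
have l1 := affn_cvg0 m FF (cz _ FF _ _ da' Ft) (cz _ FF _ _ db' Ft).
have l2 := affn_cvg0 m FF (cz _ FF _ _ da Ft) (cz _ FF _ _ db Ft).
have l3 : dl s @[s --> within `[0, 1] (nbhs t)] --> (0 : R).
  by apply: (cvg0Zr FF); apply: (cvg0D FF); apply: (cvg0Zl FF).
apply: (cvg0Zl FF); apply: (cvg0D FF); last exact: (cvg0Zl FF).
apply: (cvg0D FF); last exact: (cvg0Zr FF).
by have := cvgM l3 l3; rewrite mulr0; exact.
Qed.

End Riccati.

(** * The Riccati lower bound for the energy *)

Section RealBounds.
Context {R : realType}.

(** The Riccati inequality for [Psi + c I]: the shift costs c P1 + c^2 / 2, which the margin [eta]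
    absorbs when c is small. *)
Lemma shifted_nonpos (eta P1 P2 c K del : R) : `|P1| <= K -> 0 <= c -> c <= del ->
  del * K + del * del <= eta -> - (2^-1 * P2) - eta + 2^-1 * (P2 + 2 * c * P1 + c * c) <= 0.
Proof.
move=> hP c0 cd h.
have -> : - (2^-1 * P2) - eta + 2^-1 * (P2 + 2 * c * P1 + c * c) = c * P1 + 2^-1 * (c * c) - eta by field.
have h1 : c * P1 <= del * K.
  apply: (@le_trans _ _ (c * K)); first by rewrite ler_wpM2l// (le_trans (ler_norm _) hP).
  by rewrite ler_wpM2r// (le_trans (normr_ge0 _) hP).
have h2 : c * c <= del * del by apply: ler_pM.
have h3 : 0 <= c * c by rewrite mulr_ge0.
by lra.
Qed.

Lemma shifted_bound (eta kap P1 P2 c K : R) : `|P1| <= K -> 0 <= P2 -> P2 <= K * K -> `|c| <= kap ->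
  0 < eta -> eta <= kap ->
  `|- (2^-1 * P2) - eta| <= K * K + 2 * kap * K + kap * kap + kap /\
  P2 + 2 * c * P1 + c * c <= K * K + 2 * kap * K + kap * kap + kap.
Proof.
move=> hP P20 hP2 hc eta0 ek.
have K0 : 0 <= K by exact: le_trans hP.
have k0 : 0 <= kap by exact: le_trans hc.
have kK : 0 <= kap * K by rewrite mulr_ge0.
have kk : 0 <= kap * kap by rewrite mulr_ge0.
split.
  by rewrite ler_norml; apply/andP; split; lra.
have h1 : c * P1 <= kap * K.
  apply: le_trans (ler_norm _) _; rewrite normrM; exact: ler_pM.
have h2 : c * c <= kap * kap.
  apply: le_trans (ler_norm _) _; rewrite normrM; exact: ler_pM.
by have -> : 2 * c * P1 = 2 * (c * P1); [ring|lra].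
Qed.

Lemma small_step (kap K eta : R) : 0 < kap -> 0 <= K -> 0 < eta ->
  exists n, kap / n.+1%:R * K + kap / n.+1%:R * (kap / n.+1%:R) <= eta.
Proof.
move=> k0 K0 e0.
have /archi_boundP : 0 <= kap * (K + kap) / eta by rewrite divr_ge0 ?(ltW e0)// mulr_ge0 ?(ltW k0)// addr_ge0// ltW.
set n := Num.bound _ => hn.
exists n; have n0 : 0 < n.+1%:R :> R by rewrite ltr0n.
have hn' : kap * (K + kap) <= eta * n.+1%:R.
  rewrite [leRHS]mulrC -ler_pdivrMr//; apply: ltW; apply: (lt_le_trans hn).
  by rewrite ler_nat.
rewrite -mulrDr -mulrAC ler_pdivrMr//.
apply: le_trans hn'; apply: ler_wpM2l; first exact: ltW.
by rewrite lerD2l ler_pdivrMr// ler_peMr ?(ltW k0)// ler1n.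
Qed.

End RealBounds.

Section LowerBound.
Context {R : realType} {Omega : ptopologicalType} {d : nat}.
Notation M := 'M[R[i]]_d.
Notation T := (borel Omega).
Notation hpm := (hpm R Omega d).

Lemma C1_add_linear (Psi dPsi : R -> Omega -> M) (c s0 : R) : C1_Cb Psi dPsi ->
  C1_Cb (fun t x => Psi t x + (c * (t - s0))%:C *: 1%:M) (fun t x => dPsi t x + c%:C *: 1%:M).
Proof.
move=> H t t01; have [cP cD h1 h2] := H t t01.
have addc (F : Omega -> M) (r : R) : Cb F -> Cb (fun x => F x + r%:C *: 1%:M).
  move=> /CbP[hF bF cF]; apply/CbP; split.
  - by move=> x; apply: hermD => //; exact/hermZ/herm1.
  - exact: (bounded_mxD bF (bounded_mx_cst _)).
  - exact: (mcontD cF (mcont_cst _)).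
split; [exact: addc|exact: addc| |].
- apply: cvg_trans h1; apply: near_eq_cvg; apply: cvg_within; near=> s.
  have st : s - t != 0.
    by rewrite subr_eq0; near: s; exact: nbhs_dnbhs_neq.
  congr supn; apply/funext => x.
  have -> : (Psi s x + (c * (s - s0))%:C *: 1%:M) - (Psi t x + (c * (t - s0))%:C *: 1%:M) =
     (Psi s x - Psi t x) + (c * (s - t))%:C *: 1%:M.
    rewrite opprD addrACA; congr (_ + _); rewrite -scalerBl -rmorphB; congr (_%:C *: _); ring.
  rewrite [in RHS]scalerDr [in RHS]scalerA -[in RHS]rmorphM (mulrCA _ c) mulVf// mulr1.
  by rewrite [in RHS]opprD addrACA subrr addr0.
- apply: cvg_trans h2; apply: near_eq_cvg; apply: nearW => s.
  by congr supn; apply/funext => x; rewrite opprD addrACA subrr addr0.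
Unshelve. all: by end_near. Qed.

Lemma energy_fin (G : R -> hpm) U : L2L2 G U -> energy G U = (fine (energy G U))%:E.
Proof.
move=> LU; have [_ _ _ eU] := LU; rewrite fineK// ge0_fin_numE// energy_action.
by apply: integral_ge0 => t _; exact: (action_density_ge0 LU).
Qed.

(** Formally the integral of the weak equation after Young. For q > 0 the constant - 2 q cannot be
    subtracted inside a lower integral; it is moved into the test field as a multiple of the
    identity growing linearly in time, whose pairing is known because the mass is 1. *)
Lemma riccati_lower (G : R -> hpm) U (Psi dPsi : R -> Omega -> M) (q K : R) :
  tv_continuous G -> L2L2 G U -> weak_equation G U -> C1_Cb Psi dPsi ->
  (forall t x, dPsi t x = - ((2 * q)%:C%:M + (2^-1)%:C *: (Psi t x *m Psi t x))) ->
  (forall t x, t \in `[0, 1] -> frobn (Psi t x) <= K) -> 0 <= K ->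
  (q = 0 \/ 0 < q /\ forall t, t \in `[0, 1] -> hpm_mass (G t) = 1) ->
  pairing (G 1) (Psi 1) - pairing (G 0) (Psi 0) + 2 * q <= 2^-1 * fine (energy G U).
Proof.
move=> tG LU wG cP dE PK K0 qH.
have z01 : (0 : R) \in `[0, 1] by rewrite in_itv /= lexx ler01.
have o01 : (1 : R) \in `[0, 1] by rewrite in_itv /= lexx ler01.
have b1 := bfield_cst (Omega := Omega) (1%:M : M).
have bP t : t \in `[0, 1] -> bfield (Psi t).
  by move=> t01; have [cPt _ _ _] := cP t t01; exact: Cb_bfield.
have hP t x : t \in `[0, 1] -> Psi t x \is hermsymmx.
  by move=> t01; have [/CbP[h _ _] _ _ _] := cP t t01; exact: h.
have P2_ge0 t : t \in `[0, 1] -> 0 <= pairing (G t) (fun x => Psi t x *m Psi t x).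
  move=> t01; apply: pairing_ge0; first exact: (bfieldM (bP t t01) (bP t t01)).1.
  move=> x; have := pos_sqr (Psi t x); by rewrite (hermP _).1// hP.
have P2_le t : t \in `[0, 1] -> pairing (G t) (fun x => Psi t x *m Psi t x) <= K * K * hpm_mass (G t).
  move=> t01; apply: le_trans (ler_norm _) _.
  apply: pairing_bound; first exact: (bfieldM (bP t t01) (bP t t01)).1.
  move=> x; apply: le_trans (frobn_mul _ _) _.
  by apply: ler_pM; rewrite ?frobn_ge0// PK.
have pd t : t \in `[0, 1] -> pairing (G t) (dPsi t) =
    - (2 * q * hpm_mass (G t)) - 2^-1 * pairing (G t) (fun x => Psi t x *m Psi t x).
  move=> t01; have bPP := bfieldM (bP t t01) (bP t t01).
  have -> : dPsi t = (fun x => (- (2 * q))%:C *: 1%:M - (2^-1)%:C *: (Psi t x *m Psi t x)).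
    by apply/funext => x; rewrite dE -[in LHS]scalemx1 opprD rmorphN scaleNr.
  rewrite (pairingB _ (bfieldZ _ b1) (bfieldZ _ bPP)) (pairingZ _ _ b1) (pairingZ _ _ bPP) pairing1.
  by rewrite mulNr.
have eE := energy_fin LU.
have act01 : (\int[@lebesgue_measure R]_(x in `[0%R, 1%R[) action_density G U x <= energy G U)%E.
  exact: action_le.
(* For q = 0 the field is already an exact subsolution and a single step over [0, 1] suffices. *)
case: qH => [q0|[q0 m1]].
  have [Km Km0 HKm] := mass_bounded tG.
  rewrite q0 mulr0 addr0 -lee_fin; apply: (@le_trans _ _
    ((2^-1)%:E * \int[@lebesgue_measure R]_(x in `[0%R, 1%R[) action_density G U x)%E); last first.
    rewrite EFinM -eE; apply: lee_wpmul2l act01; by rewrite lee_fin.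
  have KK : 0 <= K * K * Km by rewrite mulr_ge0// mulr_ge0.
  apply: (step_bound LU wG (K := K * K * Km) cP z01 o01 ltr01).
    move=> r r01; have r01' : r \in `[0, 1].
      by move: r01; rewrite !in_itv /= => /andP[-> /ltW ->].
    by rewrite (pd r r01') q0 mulr0 mul0r oppr0 sub0r addNr.
  move=> r r01; have h : pairing (G r) (fun x => Psi r x *m Psi r x) <= K * K * Km.
    by apply: le_trans (P2_le r r01) _; rewrite ler_wpM2l ?mulr_ge0// HKm.
  split=> //; rewrite (pd r r01) q0 mulr0 mul0r oppr0 sub0r normrN ger0_norm ?mulr_ge0 ?P2_ge0//.
  apply: le_trans h; rewrite ler_piMl ?P2_ge0//; by rewrite invf_le1 ?ler1n.
set kap := 2 * q; have kap0 : 0 < kap by rewrite mulr_gt0.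
apply/ler_addgt0Pr => eta' eta'0.
(* Giving up [eta] of the slope [kap] leaves room for the quadratic error of the shift on short time
   steps. *)
pose eta := Num.min kap eta'; have eta0 : 0 < eta by rewrite lt_min kap0.
have ek : eta <= kap by rewrite ge_min lexx.
have [n Hn] := small_step kap0 K0 eta0.
have n0 : 0 < n.+1%:R :> R by rewrite ltr0n.
pose psi t := pairing (G t) (Psi t) + (kap - eta) * t.
suff : ((psi 1 - psi 0)%:E <= (2^-1)%:E * \int[@lebesgue_measure R]_(x in `[0%R, 1%R[) action_density G U x)%E.
  move=> H; have : psi 1 - psi 0 <= 2^-1 * fine (energy G U).
    by rewrite -lee_fin; apply: le_trans H _; rewrite EFinM -eE lee_wpmul2l.
  have : eta <= eta' by rewrite ge_min lexx orbT.
  rewrite /psi mulr1 mulr0 addr0.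
  by move: (pairing _ _) (pairing _ _) (fine _) => u v w; lra.
apply: (partition_bound (n := n) (action_density_ge0 LU)) => k kn.
set s := k%:R / _; set t := k.+1%:R / _.
have s0 : 0 <= s by rewrite divr_ge0.
have st : t - s = n.+1%:R^-1 by rewrite /s /t -mulrBl -natrB// subSnn mul1r.
have slt : s < t by rewrite -subr_gt0 st invr_gt0.
have t1 : t <= 1 by rewrite ler_pdivrMr// mul1r ler_nat.
have s01 : s \in `[0, 1] by rewrite in_itv /= s0 (le_trans (ltW slt)).
have t01 : t \in `[0, 1] by rewrite in_itv /= t1 andbT (le_trans s0 (ltW slt)).
(* The shift restarts from 0 on each subinterval, so it never exceeds [kap / n.+1]. *)
pose Psi' r x := Psi r x + ((kap - eta) * (r - s))%:C *: (1%:M : M).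
pose dPsi' r x := dPsi r x + (kap - eta)%:C *: (1%:M : M).
have cP' : C1_Cb Psi' dPsi' := C1_add_linear (kap - eta) s cP.
have pl r c : r \in `[0, 1] -> pairing (G r) (fun x => Psi r x + c%:C *: 1%:M) = pairing (G r) (Psi r) + c.
  move=> r01; rewrite (pairingD _ (bP r r01) (bfieldZ _ b1)) (pairingZ _ _ b1) pairing1.
  by rewrite m1// mulr1.
have -> : psi t - psi s = pairing (G t) (Psi' t) - pairing (G s) (Psi' s).
  rewrite /Psi' !pl// /psi subrr mulr0 addr0.
  by move: (pairing _ _) (pairing _ _) => u v; ring.
have pd' r : r \in `[0, 1] -> pairing (G r) (dPsi' r) =
    - (2^-1 * pairing (G r) (fun x => Psi r x *m Psi r x)) - eta.
  move=> r01; have [_ cD _ _] := cP r r01.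
  rewrite /dPsi' (pairingD _ (Cb_bfield cD) (bfieldZ _ b1)) (pairingZ _ _ b1) pairing1 (pd r r01).
  rewrite m1// -/kap.
  by move: (pairing _ _) => u; ring.
have pp' r : r \in `[0, 1] -> pairing (G r) (fun x => Psi' r x *m Psi' r x) =
    pairing (G r) (fun x => Psi r x *m Psi r x) + 2 * ((kap - eta) * (r - s)) * pairing (G r) (Psi r) +
    (kap - eta) * (r - s) * ((kap - eta) * (r - s)).
  move=> r01; set c := (kap - eta) * (r - s).
  have bPP := bfieldM (bP r r01) (bP r r01).
  have -> : (fun x => Psi' r x *m Psi' r x) =
     (fun x => (Psi r x *m Psi r x + (2 * c)%:C *: Psi r x) + (c * c)%:C *: 1%:M).
    apply/funext => x; rewrite /Psi' -/c mulmxDl !mulmxDr -!scalemxAr -!scalemxAl !mulmx1 mul1mx.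
    rewrite scalerA -rmorphM -!addrA; congr (_ + _); rewrite addrA; congr (_ + _).
    by rewrite -scalerDl -rmorphD; congr (_%:C *: _); ring.
  rewrite (pairingD _ (bfieldD bPP (bfieldZ _ (bP r r01))) (bfieldZ _ b1)).
  rewrite (pairingD _ bPP (bfieldZ _ (bP r r01))) !(pairingZ _ _ b1) (pairingZ _ _ (bP r r01)) pairing1.
  by rewrite m1// mulr1.
have P1_le r : r \in `[0, 1] -> `|pairing (G r) (Psi r)| <= K.
  move=> r01; rewrite -[leRHS]mulr1 -(m1 r r01); apply: pairing_bound; first exact: (bP r r01).1.
  by move=> x; exact: PK.
apply: (step_bound LU wG (K := K * K + 2 * kap * K + kap * kap + kap) cP' s01 t01 slt).
  move=> r rst; have /andP[sr rt] : s <= r < t by move: rst; rewrite in_itv.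
  have r01 : r \in `[0, 1] by rewrite in_itv /= (le_trans s0 sr) (le_trans (ltW rt) t1).
  rewrite pd'// pp'//; apply: (shifted_nonpos _ (P1_le r r01) _ _ Hn).
    by rewrite mulr_ge0 ?subr_ge0.
  apply: ler_pM; rewrite ?subr_ge0//; first by rewrite gerBl ltW.
  by rewrite -st lerD2r ltW.
move=> r r01; rewrite pd'// pp'//; apply: shifted_bound => //.
- exact: P1_le.
- exact: P2_ge0.
- by have := P2_le r r01; rewrite m1// mulr1.
rewrite normrM -[leRHS]mulr1; apply: ler_pM => //.
  by rewrite ger0_norm ?subr_ge0// gerBl ltW.
move: r01 s01; rewrite !in_itv /= => /andP[r0 r1] /andP[s0' s1].
by rewrite ler_norml; apply/andP; split; lra.
Qed.

End LowerBound.

Section TrigCurve.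
Context {R : realType}.
Implicit Types (w c e t : R).

Lemma is_derive_affine (c e t : R) : is_derive t 1 (fun s => c * s + e) c.
Proof.
have -> : (fun s => c * s + e) = (c \*: id) + cst e :> (R -> R) by apply/funext => s.
by apply: is_derive_eq; rewrite /= addr0 /GRing.scale /= mulr1.
Qed.

Lemma is_derive_sin_affine (k c e t : R) :
  is_derive t 1 (fun s => k * sin (c * s + e)) (k * c * cos (c * t + e)).
Proof.
have h := @is_derive1_comp _ sin (fun s : R => c * s + e) t _ _ (is_derive_sin (c * t + e)) (is_derive_affine c e t).
have -> : (fun s => k * sin (c * s + e)) = k \*: (sin \o (fun s => c * s + e)) by [].
by apply: is_derive_eq; rewrite /GRing.scale /=; ring.
Qed.

Lemma is_derive_cos_affine (k c e t : R) :
  is_derive t 1 (fun s => k * cos (c * s + e)) (- (k * c * sin (c * t + e))).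
Proof.
have h := @is_derive1_comp _ cos (fun s : R => c * s + e) t _ _ (is_derive_cos (c * t + e)) (is_derive_affine c e t).
have -> : (fun s => k * cos (c * s + e)) = k \*: (cos \o (fun s => c * s + e)) by [].
by apply: is_derive_eq; rewrite /GRing.scale /=; ring.
Qed.

Lemma sin_add_ge (x y : R) : 0 <= sin x -> 0 <= sin y -> sin (x + y) <= sin x + sin y.
Proof.
move=> x0 y0; rewrite sinD; apply: lerD; first by rewrite ler_piMr// cos_le1.
by rewrite ler_piMl// cos_le1.
Qed.

End TrigCurve.

(** * Lower bounds for the Hellinger and Fisher-Rao energies *)

Section EnergyLower.
Context {R : realType} {Omega : ptopologicalType} {d : nat}.
Notation M := 'M[R[i]]_d.
Notation hpm := (hpm R Omega d).

(** The boundary values make the interpolation equal to the identity at time 0 and to [B] at time 1,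
    so the end pairings involve only [B], its inverse and the masses. *)
Lemma riccati_energy (G0 G1 : hpm) (G : R -> hpm) U B (a b a' b' : R -> R) (q m0 m1 : R) :
  admissible G0 G1 G U -> pcont B ->
  (forall t : R, is_derive t 1 a (a' t)) -> (forall t : R, is_derive t 1 b (b' t)) ->
  (forall t : R, is_derive t 1 a' (- q * a t)) -> (forall t : R, is_derive t 1 b' (- q * b t)) ->
  0 < m0 -> (forall t : R, t \in `[0, 1] -> [/\ 0 <= a t, 0 <= b t & m0 <= a t + b t]) ->
  (forall t : R, t \in `[0, 1] -> `|a' t| <= m1 /\ `|b' t| <= m1) ->
  a 0 = 1 -> b 0 = 0 -> a 1 = 0 -> b 1 = 1 ->
  (q = 0 \/ 0 < q /\ forall t, t \in `[0, 1] -> hpm_mass (G t) = 1) ->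
  2 * (a' 1 * pairing G1 (fun x => invmx (B x)) + b' 1 * hpm_mass G1) -
  2 * (a' 0 * hpm_mass G0 + b' 0 * pairing G0 B) + 2 * q <= 2^-1 * fine (energy G U).
Proof.
move=> [tG G0E G1E LU wG] pB da db da' db' m00 ab0 ab' a0 b0 a1 b1 qH.
have C1 := ric_C1 pB da db da' db' m00 ab0.
have [K K0 PK] := ric_Psi_bound pB m00 ab0 ab'.
apply: le_trans (riccati_lower tG LU wG C1 _ PK K0 qH) => //.
have bc := bfield_cst (Omega := Omega) (1%:M : M).
have bB := pcont_bfield pB; have bI := pcont_bfield (pcont_inv pB).
rewrite G0E G1E.
have -> : pairing G0 (ric_Psi B a b a' b' 0) = 2 * (a' 0 * hpm_mass G0 + b' 0 * pairing G0 B).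
  rewrite -(pairing1 G0) -(pairingZ _ _ bc) -(pairingZ _ _ bB) -(pairingD _ (bfieldZ _ bc) (bfieldZ _ bB)).
  rewrite -(pairingZ _ _ (bfieldD (bfieldZ _ bc) (bfieldZ _ bB))); apply: pairing_eq => x.
  by rewrite /ric_Psi /ric_Y /ric_N /aff a0 b0 scale1r scale0r addr0 invmx1 mulmx1.
have -> : pairing G1 (ric_Psi B a b a' b' 1) =
   2 * (a' 1 * pairing G1 (fun x => invmx (B x)) + b' 1 * hpm_mass G1).
  rewrite -(pairing1 G1) -(pairingZ _ _ bc) -(pairingZ _ _ bI) -(pairingD _ (bfieldZ _ bI) (bfieldZ _ bc)).
  rewrite -(pairingZ _ _ (bfieldD (bfieldZ _ bI) (bfieldZ _ bc))); apply: pairing_eq => x.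
  rewrite /ric_Psi /ric_Y /ric_N /aff a1 b1 scale1r scale0r add0r mulmxDl -!scalemxAl mul1mx mulmxV//.
  exact: pcont_unit pB.
by [].
Qed.

(** Straight interpolation, q = 0: for each [B] the boundary terms are 2 (m0 + m1 - dual cost), and
    [B] is then optimised. *)
Lemma hellinger_lower (G0 G1 : hpm) (G : R -> hpm) U : admissible G0 G1 G U ->
  4 * (hpm_mass G0 + hpm_mass G1 - 2 * fidelity G0 G1) <= fine (energy G U).
Proof.
move=> adm.
suff H B : pcont B -> 4 * (hpm_mass G0 + hpm_mass G1 - dual_cost G0 G1 B) <= fine (energy G U).
  have : hpm_mass G0 / 2 + hpm_mass G1 / 2 - fine (energy G U) / 8 <= fidelity G0 G1.
    apply: fidelity_ge => B pB; move: (H B pB).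
    by move: (dual_cost _ _ _) (hpm_mass _) (hpm_mass _) (fine _) => *; lra.
  by move: (fidelity _ _) (hpm_mass _) (hpm_mass _) (fine _) => *; lra.
move=> pB.
have := @riccati_energy G0 G1 G U B (fun t => - 1 * t + 1) (fun t => 1 * t + 0) (fun=> - 1) (fun=> 1) 0 1 1
  adm pB (is_derive_affine _ _) (is_derive_affine _ _) _ _ ltr01.
have d0 (f : R -> R) (c t : R) : is_derive t 1 (fun=> c : R) (- 0 * f t : R).
  by rewrite oppr0 mul0r; exact: is_derive_cst.
move=> /(_ (d0 (fun t => - 1 * t + 1) _) (d0 (fun t => 1 * t + 0) _)) h.
have {h} : 2 * (- 1 * pairing G1 (fun x => invmx (B x)) + 1 * hpm_mass G1) -
  2 * (- 1 * hpm_mass G0 + 1 * pairing G0 B) + 2 * 0 <= 2^-1 * fine (energy G U).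
  apply: h.
  - by move=> t; rewrite in_itv /= => /andP[? ?]; split; lra.
  - by move=> t _; rewrite normrN1 normr1.
  - by rewrite mulr0 add0r.
  - by rewrite mulr0 add0r.
  - by rewrite mulr1 addNr.
  - by rewrite mulr1 addr0.
  - by left.
rewrite /dual_cost.
by move: (pairing _ _) (pairing _ _) (hpm_mass _) (hpm_mass _) (fine _) => *; lra.
Qed.

(** Sine interpolation, q = w^2: the bound is 2 (w / sin w) (2 cos w - dual cost) + 2 w^2, and
    optimising [B] makes the first term nonnegative in the limit because the fidelity is at most cos
    w. *)
Lemma fisher_rao_lower (G0 G1 : hpm) (G : R -> hpm) U (w : R) : admissible G0 G1 G U ->
  (forall t, t \in `[0, 1] -> hpm_mass (G t) = 1) -> 0 < w -> w < pi -> fidelity G0 G1 <= cos w ->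
  4 * w ^+ 2 <= fine (energy G U).
Proof.
move=> adm m1 w0 wpi Fw.
have [_ G0E G1E _ _] := adm.
have M0 : hpm_mass G0 = 1 by rewrite -G0E m1// in_itv /= lexx ler01.
have M1 : hpm_mass G1 = 1 by rewrite -G1E m1// in_itv /= lexx ler01.
have s0 : 0 < sin w by apply: sin_gt0_pi; rewrite ?w0.
have sn := lt0r_neq0 s0.
pose S := sin w; pose k := S^-1.
pose a (t : R) := k * sin (- w * t + w); pose b (t : R) := k * sin (w * t + 0).
pose a' (t : R) := k * - w * cos (- w * t + w); pose b' (t : R) := k * w * cos (w * t + 0).
have k0 : 0 < k by rewrite invr_gt0.
have ab t : t \in `[0, 1] -> [/\ 0 <= a t, 0 <= b t & 1 <= a t + b t].
  rewrite in_itv /= => /andP[t0 t1].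
  have h1 : 0 <= sin (- w * t + w).
    have e : - w * t + w = w * (1 - t) by ring.
    apply: sin_ge0_pi; rewrite e; apply/andP; split; first by rewrite mulr_ge0 ?subr_ge0// ltW.
    by apply: le_trans (ltW wpi); rewrite ler_piMr ?(ltW w0)// gerBl.
  have h2 : 0 <= sin (w * t + 0).
    rewrite addr0; apply: sin_ge0_pi; apply/andP; split; first by rewrite mulr_ge0// ltW.
    by apply: le_trans (ltW wpi); rewrite ler_piMr// ltW.
  split; rewrite ?mulr_ge0 ?(ltW k0)//.
  rewrite /a /b -mulrDr -ler_pdivrMl// invrK mulr1.
  (* The two angles add up to w, and the sine is subadditive where it is nonnegative. *)
  have -> : S = sin ((- w * t + w) + (w * t + 0)) by rewrite /S; congr sin; ring.
  exact: sin_add_ge.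
have ab' t : t \in `[0, 1] -> `|a' t| <= k * w /\ `|b' t| <= k * w.
  have H e : `|k * w * cos e| <= k * w.
    have kw : 0 <= k * w by rewrite mulr_ge0 ?(ltW k0) ?(ltW w0).
    by rewrite normrM (ger0_norm kw) ler_piMr// ler_norml cos_geN1 cos_le1.
  by move=> _; split; rewrite /a' /b' ?mulrN ?mulNr ?normrN; exact: H.
have E B : pcont B -> 2 * (w / S) * (2 * cos w - dual_cost G0 G1 B) + 2 * w ^+ 2 <= 2^-1 * fine (energy G U).
  move=> pB.
  have da (t : R) : is_derive t 1 a (a' t) by exact: is_derive_sin_affine.
  have db (t : R) : is_derive t 1 b (b' t) by exact: is_derive_sin_affine.
  have da' (t : R) : is_derive t 1 a' (- (w ^+ 2) * a t).
    by apply: is_derive_eq (is_derive_cos_affine _ _ _ _) _; rewrite /a; ring.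
  have db' (t : R) : is_derive t 1 b' (- (w ^+ 2) * b t).
    by apply: is_derive_eq (is_derive_cos_affine _ _ _ _) _; rewrite /b; ring.
  have a0 : a 0 = 1 by rewrite /a mulr0 add0r mulVf.
  have b0 : b 0 = 0 by rewrite /b mulr0 add0r sin0 mulr0.
  have a1 : a 1 = 0 by rewrite /a mulr1 addNr sin0 mulr0.
  have b1 : b 1 = 1 by rewrite /b mulr1 addr0 mulVf.
  have qH : w ^+ 2 = 0 \/ 0 < w ^+ 2 /\ forall t, t \in `[0, 1] -> hpm_mass (G t) = 1.
    by right; split=> //; rewrite exprn_gt0.
  have := riccati_energy adm pB da db da' db' ltr01 ab ab' a0 b0 a1 b1 qH.
  rewrite /a' /b' !mulr1 !mulr0 !addr0 addNr add0r cos0 M0 M1 /k /dual_cost -/S.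
  move: (pairing _ _) (pairing _ _) (cos w) (fine _) S^-1 => u v c f s.
  by have -> : 2 * (w * s) * (2 * c - (u + v)) + 2 * w ^+ 2 =
     2 * (s * - w * 1 * v + s * w * c * 1) - 2 * (s * - w * c * 1 + s * w * 1 * u) + 2 * w ^+ 2 by ring.
set e := fine _ in E *.
(* The bound for each [B], solved for the dual cost; comparison with cos w then forces the fraction
   to be nonpositive. *)
have {}E : cos w + (2 * w ^+ 2 - 2^-1 * e) / (2 * (2 * (w / S))) <= fidelity G0 G1.
  apply: fidelity_ge => B /E.
  have ws : 0 < 2 * (w / S) by rewrite mulr_gt0// divr_gt0.
  move: (2 * (w / S)) ws (dual_cost _ _ _) (cos w) => z z0 D c h.
  have -> : 2 * (c + (2 * w ^+ 2 - 2^-1 * e) / (2 * z)) = 2 * c + (2 * w ^+ 2 - 2^-1 * e) / z.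
    by field; rewrite lt0r_neq0.
  rewrite -lerBrDl ler_pdivrMr//; move: h.
  have -> : (D - 2 * c) * z = - (z * (2 * c - D)) by ring.
  by move: (z * _) (w ^+ 2) => *; lra.
have : (2 * w ^+ 2 - 2^-1 * e) / (2 * (2 * (w / S))) <= 0.
  by move: (le_trans E Fw); rewrite gerDl.
rewrite pmulr_lle0; last by rewrite invr_gt0 !mulr_gt0// invr_gt0.
by move: (w ^+ 2) => *; lra.
Qed.

End EnergyLower.

(** * Nearly optimal dual fields, pointwise *)

Section OptimalMatrix.
Context {R : realType} {d : nat}.
Notation M := 'M[R[i]]_d.
Implicit Types A B C X k : M.

Lemma lowb_addl (e : R) A : posmx A -> lowb e (A + e%:C%:M).
Proof. by move=> pA; rewrite /lowb addrK. Qed.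

Lemma pos_conj_herm A X : posmx A -> X \is hermsymmx -> posmx (X *m A *m X).
Proof. by move=> pA /hermP hX; rewrite -[X in _ *m X]hX; exact: pos_conj. Qed.

Lemma pos_square X : X \is hermsymmx -> posmx (X *m X).
Proof. by move=> /hermP hX; rewrite -[X in _ *m X]hX; exact: pos_sqr. Qed.

(** For a scalar, c - c^2 / (c + del) = del c / (c + del), rewritten as a sandwich so that
    positivity is visible for matrices. *)
Lemma resolvent_conj (del : R) C : 0 < del -> posmx C ->
  posmx (C - C *m invmx (C + del%:C%:M) *m C).
Proof.
move=> d0 pC; have hC := pC.1.
have : C + del%:C%:M = C + del%:C *: 1%:M by rewrite scalemx1.
have : lowb del (C + del%:C%:M) by exact: lowb_addl.
move: (C + del%:C%:M) => B lB BE.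
have uB := lowb_unit d0 lB; have hI := herm_inv (lowb_herm lB).
have e1 : C *m C + del%:C *: C = C *m B by rewrite BE mulmxDr -scalemxAr mulmx1.
have e2 : C *m (invmx B *m C) + del%:C *: (invmx B *m C) = C.
  by rewrite -[in X in _ + X](mul1mx (invmx B *m C)) scalemxAl -mulmxDl -BE mulmxA mulmxV// mul1mx.
have -> : C - C *m invmx B *m C = del%:C *: (invmx B *m (C *m C + del%:C *: C) *m invmx B).
  rewrite e1 -!mulmxA mulmxV// mulmx1; apply/eqP; rewrite subr_eq addrC; apply/eqP.
  exact: esym e2.
by apply: (posZ (ltW d0)); exact: (pos_conj_herm (posD (pos_square hC) (posZ (ltW d0) pC)) hI).
Qed.

Lemma combine_bounds (a b c x y z : R) : a = x + z -> b <= c -> c <= x + y ->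
  a + b <= 2 * x + y + z.
Proof. by move=> -> *; lra. Qed.

(** With k1 = C (k0 + e) C, the second term is (k0 + e) tested against C (C + del)^-1 C, which is at
    most C. Both terms are thus close to k0 : C; [del] only serves to make the dual field
    invertible. *)
Lemma dual_cost_pointwise (e del : R) k0 k1 C : 0 < e -> 0 < del -> posmx k0 -> posmx C ->
  C *m (k0 + e%:C%:M) *m C = k1 ->
  frob k0 (C + del%:C%:M) + frob k1 (invmx (C + del%:C%:M)) <=
  2 * frob k0 C + e * frobn (1%:M : M) * frobn C + del * complex.Re (\tr k0).
Proof.
move=> e0 d0 p0 pC CE; set B := C + _.
have hC : C^t* = C by apply/hermP; exact: pC.1.
have h1 : frob k1 (invmx B) <= frob (k0 + e%:C%:M) C.
  rewrite -CE frob_mulr frob_mull hC -subr_ge0 -frobBr mulmxA.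
  apply: pos_frob_ge0; last exact: resolvent_conj.
  exact: lowb_pos (ltW e0) (lowb_addl _ p0).
have h2 : frob (k0 + e%:C%:M) C <= frob k0 C + e * (frobn (1%:M : M) * frobn C).
  by rewrite frobDl -(scalemx1 _ e%:C) frobZl lerD2l ler_wpM2l ?(ltW e0)// frob_ler.
have h3 : frob k0 B = frob k0 C + del * complex.Re (\tr k0).
  by rewrite /B frobDr -(scalemx1 _ del%:C) frobZr frob1r.
rewrite mulrA in h2; exact: combine_bounds h3 h1 h2.
Qed.

(** Taking traces in the equation and using k0 + e >= e bounds the otherwise uncontrolled optimal
    field. *)
Lemma optimal_bound (e : R) k0 k1 C : 0 < e -> posmx k0 -> posmx C ->
  C *m (k0 + e%:C%:M) *m C = k1 -> e * frobn C ^+ 2 <= complex.Re (\tr k1).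
Proof.
move=> e0 p0 pC CE; have hC : C^t* = C by apply/hermP; exact: pC.1.
rewrite sqr_frobn -frob1r -CE -mulmxA frob_mull hC mulmx1.
have /lowbP[_ H] := lowb_addl e p0.
exact: H.
Qed.

(** The difference is exactly e C^2. It is the part of k1 created by the curve in addition to the
    transport of k0. *)
Lemma optimal_pos (e : R) k0 k1 C : 0 < e -> posmx C ->
  C *m (k0 + e%:C%:M) *m C = k1 -> posmx (k1 - C *m k0 *m C).
Proof.
move=> e0 pC <-; rewrite mulmxDr mulmxDl addrC addKr -(scalemx1 _ e%:C) -scalemxAr mulmx1 -scalemxAl.
by apply: posZ (ltW e0) (pos_square _); exact: pC.1.
Qed.

Lemma sandwich_cancel (r i S K : M) : i *m r = 1%:M -> r *m i = 1%:M -> S *m S = r *m K *m r ->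
  i *m S *m i *m (r *m r) *m (i *m S *m i) = K.
Proof.
move=> ir ri SS.
have -> : i *m S *m i *m (r *m r) *m (i *m S *m i) = i *m S *m (i *m r) *m (r *m i) *m S *m i.
  by rewrite !mulmxA.
rewrite ir ri !mulmx1 -(mulmxA i) SS !mulmxA ir mul1mx -mulmxA ri mulmx1 //.
Qed.

(** The matrix geometric mean of (k0 + e)^-1 and k1: with r the square root of k0 + e, it is r^-1 (r
    k1 r)^(1/2) r^-1. Measurability follows from that of roots and inverses. *)
Lemma optimal_field d0 (T : measurableType d0) (k0 k1 : T -> M) (e : R) : 0 < e ->
  mxmeas setT k0 -> mxmeas setT k1 -> (forall x, posmx (k0 x)) -> (forall x, posmx (k1 x)) ->
  exists C : T -> M, [/\ mxmeas setT C, forall x, posmx (C x) &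
    forall x, C x *m (k0 x + e%:C%:M) *m C x = k1 x].
Proof.
move=> e0 m0 m1 p0 p1.
have me : mxmeas setT (fun x => k0 x + e%:C%:M) by exact: (mxmeasD m0 (mxmeas_cst setT _)).
have lh x : lowb e (k0 x + e%:C%:M) by exact: lowb_addl.
have [r [mr pr rr]] := mxmeas_sqrt (fun x => lowb_pos (ltW e0) (lh x)) me.
have ur x : r x \in unitmx.
  by have := lowb_unit e0 (lh x); rewrite -rr unitmx_mul => /andP[].
have pt x : posmx (r x *m k1 x *m r x) by apply: pos_conj_herm (p1 x) _; exact: (pr x).1.
have mt : mxmeas setT (fun x => r x *m k1 x *m r x) by exact: (mxmeasM (mxmeasM mr m1) mr).
have [S [mS pS SS]] := mxmeas_sqrt pt mt.
have mi := mxmeas_inv ur mr.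
exists (fun x => invmx (r x) *m S x *m invmx (r x)); split.
- exact: (mxmeasM (mxmeasM mi mS) mi).
- by move=> x; apply: pos_conj_herm (pS x) _; apply: herm_inv; exact: (pr x).1.
- by move=> x; rewrite -rr; apply: (sandwich_cancel _ _ (SS x)); [exact: mulVmx|exact: mulmxV].
Qed.

End OptimalMatrix.

(** * From measurable optimal fields to continuous test fields *)

Section DualApprox.
Context {R : realType} {d : nat}.
Notation M := 'M[R[i]]_d.
Implicit Types X Y B C k : M.

Lemma gram_diff X Y (K : R) : frobn X <= K -> frobn Y <= K ->
  frobn (X *m X^t* - Y *m Y^t*) <= 2 * K * frobn (X - Y).
Proof.
move=> XK YK.
have -> : X *m X^t* - Y *m Y^t* = X *m (X - Y)^t* + (X - Y) *m Y^t*.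
  by rewrite adjD adjN mulmxBr mulmxBl addrA subrK.
have K0 : 0 <= K by exact: le_trans (frobn_ge0 _) XK.
apply: le_trans (frobnD _ _) _.
have -> : 2 * K * frobn (X - Y) = K * frobn (X - Y) + frobn (X - Y) * K by ring.
apply: lerD; apply: le_trans (frobn_mul _ _) _.
  by rewrite frobn_adj ler_wpM2r ?frobn_ge0.
by rewrite frobn_adj ler_wpM2l ?frobn_ge0.
Qed.

(** The cost is Lipschitz on fields bounded below by [del], by the resolvent identity for the
    inverse. *)
Lemma dual_cost_perturb (del : R) k0 k1 B B' : 0 < del -> frobn k0 <= 1 -> frobn k1 <= 1 ->
  lowb del B -> lowb del B' ->
  frob k0 B' + frob k1 (invmx B') <= frob k0 B + frob k1 (invmx B) +
    (1 + (del^-1 * frobn (1%:M : M)) ^+ 2) * frobn (B' - B).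
Proof.
move=> d0 n0 n1 lB lB'; set N := del^-1 * _.
have bI (A : M) : lowb del A -> frobn (invmx A) <= N.
  move=> lA; rewrite /N mulrC ler_pdivlMr// mulrC. exact: lowb_inv_frobn.
have h0 : frob k0 (B' - B) <= frobn (B' - B).
  by apply: le_trans (frob_ler _ _) _; rewrite ler_piMl ?frobn_ge0.
have h1 : frob k1 (invmx B' - invmx B) <= N ^+ 2 * frobn (B' - B).
  apply: le_trans (frob_ler _ _) _.
  apply: (@le_trans _ _ (frobn (invmx B' - invmx B))); first by rewrite ler_piMl ?frobn_ge0.
  rewrite (inv_diff (lowb_unit d0 lB) (lowb_unit d0 lB')).
  have -> : frobn (B' - B) = frobn (B - B') by rewrite -frobnN opprB.
  apply: le_trans (frobn_mul _ _) _.
  have -> : N ^+ 2 * frobn (B - B') = N * frobn (B - B') * N by ring.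
  apply: (ler_pM (frobn_ge0 _) (frobn_ge0 _) _ (bI _ lB)).
  by apply: le_trans (frobn_mul _ _) _; rewrite ler_wpM2r ?frobn_ge0 ?bI.
rewrite !frobBr in h0 h1; move: h0 h1.
move: (frob k0 _) (frob k0 _) (frob k1 _) (frob k1 _) (frobn (B' - B)) (N ^+ 2) => *; lra.
Qed.

End DualApprox.

Section FidelityOptimal.
Context {R : realType} {Omega : ptopologicalType} {d : nat}.
Notation M := 'M[R[i]]_d.
Notation T := (borel Omega).
Notation hpm := (hpm R Omega d).
Hypothesis metO : metrizable R Omega.
Variable gam : {finite_measure set T -> \bar R}.
Hypothesis rgam : radon gam.
Variables (G0 G1 : hpm) (k0 k1 : T -> M).
Hypothesis r0 : rep gam k0 G0.
Hypothesis r1 : rep gam k1 G1.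
Hypothesis t0 : forall x, complex.Re (\tr (k0 x)) <= 1.
Hypothesis t1 : forall x, complex.Re (\tr (k1 x)) <= 1.

Let n0 x : frobn (k0 x) <= 1.
Proof. exact: le_trans (pos_frobn_le (rep_pos r0 x)) (t0 x). Qed.
Let n1 x : frobn (k1 x) <= 1.
Proof. exact: le_trans (pos_frobn_le (rep_pos r1 x)) (t1 x). Qed.

(** The fidelity is defined with continuous fields, but measurable ones also give upper bounds. The
    root [X] is approximated rather than the field itself, so the continuous approximants stay
    bounded below by [del]. *)
Lemma fidelity_field (del K : R) (X : T -> M) : 0 < del -> 0 < K -> mxmeas setT X ->
  (forall x, frobn (X x) <= K) ->
  let c x := frob (k0 x) (X x *m (X x)^t* + del%:C%:M) +
     frob (k1 x) (invmx (X x *m (X x)^t* + del%:C%:M)) in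
  gam.-integrable setT (EFin \o c) /\ 2 * fidelity G0 G1 <= \int[gam]_x c x.
Proof.
move=> d0 K0 mX XK; have [C' HC'] := matrix_approx metO rgam mX K0 XK.
pose B x := X x *m (X x)^t* + del%:C%:M.
have lB x : lowb del (B x) by apply: lowb_addl; exact: pos_sqr.
pose L := (1 + (del^-1 * frobn (1%:M : M)) ^+ 2) * (2 * Num.max C' K).
have C'0 : 0 < Num.max C' K by rewrite lt_max K0 orbT.
have L0 : 0 < L by rewrite mulr_gt0 ?mulr_gt0// ltr_pwDl// sqr_ge0.
have mB : mxmeas setT B by exact: (mxmeasD (mxmeasM mX (mxmeas_adj mX)) (mxmeas_cst _ _)).
have uB x := lowb_unit d0 (lB x).
have bB : bfield B.
  split=> //; apply: bounded_mxD (bounded_mx_cst _); apply: bounded_mxM; first by exists K.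
  by exists K => x; rewrite frobn_adj.
have bI : bfield (fun x => invmx (B x)).
  split; first exact: mxmeas_inv.
  exists (del^-1 * frobn (1%:M : M)) => x; rewrite mulrC ler_pdivlMr// mulrC.
  exact: lowb_inv_frobn.
have j0 := rep_integrable r0 bB; have j1 := rep_integrable r1 bI.
have jj := integrableD measurableT j0 j1.
move=> c; split; first exact: jj.
apply/ler_addgt0Pr => e e0.
have [X' [cX' X'C' IX']] := HC' _ (divr_gt0 e0 L0).
pose B' x := X' x *m (X' x)^t* + del%:C%:M.
have lB' x : lowb del (B' x) by apply: lowb_addl; exact: pos_sqr.
have X'b : bounded_mx X' by exists C'.
have X'ab : bounded_mx (fun x => (X' x)^t*) by exists C' => x; rewrite frobn_adj.
have pB' : pcont B'.
  split; first by exists del.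
    exact: (bounded_mxD (bounded_mxM X'b X'ab) (bounded_mx_cst _)).
  exact: (mcontD (mcontM X'b cX' (mcont_adj cX')) (mcont_cst _)).
apply: le_trans (fidelity_le G0 G1 pB') _; rewrite /dual_cost.
have bB' := pcont_bfield pB'; have bI' := pcont_bfield (pcont_inv pB').
rewrite (pairing_rep r0 bB'.1) (pairing_rep r1 bI'.1).
have i0 := rep_integrable r0 bB'; have i1 := rep_integrable r1 bI'.
have mX' := mcont_mxmeas cX'.
have iX : gam.-integrable setT (EFin \o (fun x => frobn (X' x - X x))).
  apply: (@bounded_integrable _ _ _ _ _ _ (C' + K)) => //.
    exact: measurable_frobn (mxmeasB mX' mX).
  move=> x; rewrite (ger0_norm (frobn_ge0 _)); apply: le_trans (frobnB _ _) _; exact: lerD.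
rewrite -(RintegralD measurableT i0 i1).
have iL := integrableZl measurableT L iX.
apply: (@le_trans _ _ (\int[gam]_x ((frob (k0 x) (B x) + frob (k1 x) (invmx (B x))) +
    L * frobn (X' x - X x)))).
  apply: (le_Rintegral measurableT (integrableD measurableT i0 i1) (integrableD measurableT jj iL)) => x _.
  apply: le_trans (dual_cost_perturb d0 (n0 x) (n1 x) (lB x) (lB' x)) _.
  rewrite lerD2l /L -mulrA; apply: ler_wpM2l; first by rewrite addr_ge0 ?sqr_ge0.
  have -> : B' x - B x = X' x *m (X' x)^t* - X x *m (X x)^t* by rewrite /B' /B opprD addrACA subrr addr0.
  by apply: gram_diff; rewrite le_max ?X'C' ?XK ?orbT.
rewrite (RintegralD measurableT jj iL) lerD2l (RintegralZl _ measurableT iX).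
by rewrite mulrC -ler_pdivlMr.
Qed.

(** The field solving the regularised optimality equation, with its square root fed to
    [fidelity_field]; the regularisation errors are integrated over the finite measure [gam]. *)
Lemma fidelity_optimal (e : R) : 0 < e -> exists C : T -> M,
  [/\ bfield C, forall x, posmx (C x), forall x, posmx (k1 x - C x *m k0 x *m C x) &
    fidelity G0 G1 <= \int[gam]_x frob (k0 x) (C x) + e].
Proof.
move=> e0; set N := frobn (1%:M : M); set Gam := fine (gam setT).
have N0 : 0 <= N by exact: frobn_ge0.
have Gam0 : 0 <= Gam by rewrite fine_ge0.
(* The equation is regularised by s^2, so the norm of [C] is at most 1 / s, and the dual field by s.
   The pointwise errors are then at most N s and s, in total at most [e] after integration. *)
pose s := e / ((N + 1) * (Gam + 1)).
have N1 : 0 < N + 1 by rewrite ltr_wpDl.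
have Gam1 : 0 < Gam + 1 by rewrite ltr_wpDl.
have s0 : 0 < s by rewrite divr_gt0// mulr_gt0.
have ss0 : 0 < s * s by rewrite mulr_gt0.
have [C [mC pC CE]] := optimal_field ss0 (bpos_bmx (projT2 (cid r0.1))).1
   (bpos_bmx (projT2 (cid r1.1))).1 (rep_pos r0) (rep_pos r1).
have sC x : s * frobn (C x) <= 1.
  have h := le_trans (optimal_bound ss0 (rep_pos r0 x) (pC x) (CE x)) (t1 x).
  have sf : 0 <= s * frobn (C x) by rewrite mulr_ge0 ?frobn_ge0// ltW.
  by rewrite -(expr_le1 (n := 2) isT sf) exprMn [s ^+ 2]expr2.
have C_le x : frobn (C x) <= s^-1 by rewrite -[leRHS]mul1r ler_pdivlMr// mulrC.
have bC : bfield C by split=> //; exists s^-1.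
exists C; split; [exact: bC|exact: pC|by move=> x; exact: (optimal_pos ss0 (pC x) (CE x))|].
have [X [mX pX XX]] := mxmeas_sqrt pC mC.
have Xh x : (X x)^t* = X x by apply/hermP; exact: (pX x).1.
pose K := N * s^-1 + 1.
have Ns : 0 <= N * s^-1 by rewrite mulr_ge0// invr_ge0 ltW.
have K0 : 0 < K by rewrite ltr_wpDl.
have XK x : frobn (X x) <= K.
  rewrite -(@ler_pXn2r _ 2) ?nnegrE ?frobn_ge0 ?(ltW K0)//.
  have -> : frobn (X x) ^+ 2 = frob (C x) 1%:M by rewrite sqr_frobn -XX frob_mulr mul1mx Xh.
  apply: le_trans (frob_ler _ _) _; rewrite -/N mulrC.
  apply: (@le_trans _ _ (N * s^-1)); first by rewrite ler_wpM2l.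
  by rewrite /K; move: (N * _) Ns => u u0; nra.
have [iH] := fidelity_field s0 K0 mX XK.
have iC := rep_integrable r0 bC.
have i1 : gam.-integrable setT (EFin \o cst ((N + 1) * s)).
  by apply: (@bounded_integrable _ _ _ _ _ _ `|(N + 1) * s|).
have i2C := integrableZl measurableT 2 iC.
move=> H; have {}H : 2 * fidelity G0 G1 <= \int[gam]_x (2 * frob (k0 x) (C x) + (N + 1) * s).
  apply: le_trans H _; apply: (le_Rintegral measurableT iH (integrableD measurableT i2C i1)) => x _.
  rewrite Xh XX.
  apply: le_trans (dual_cost_pointwise ss0 s0 (rep_pos r0 x) (pC x) (CE x)) _.
  rewrite -addrA lerD2l mulrDl mul1r; apply: lerD.
    have -> : s * s * N * frobn (C x) = N * s * (s * frobn (C x)) by ring.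
    by rewrite ler_piMr ?sC// mulr_ge0// ltW.
  by rewrite ler_piMr ?t0// ltW.
have {}H : 2 * fidelity G0 G1 <= 2 * \int[gam]_x frob (k0 x) (C x) + (N + 1) * s * Gam.
  by move: H; rewrite (RintegralD measurableT i2C i1) (RintegralZl _ measurableT iC) Rintegral_cst.
have sG : (N + 1) * s * Gam <= e.
  have -> : (N + 1) * s * Gam = e * (Gam / (Gam + 1)).
    by rewrite /s; field; rewrite !lt0r_neq0.
  by rewrite ler_piMr ?(ltW e0)// ler_pdivrMr// mul1r lerDl.
move: H sG e0; move: (fidelity _ _) (\int[gam]_x _) (_ * Gam) => *; lra.
Qed.

End FidelityOptimal.

(** * The Lyapunov equation, giving the velocity from the derivative of the curve *)

Section Lyapunov.
Context {R : realType} {d : nat}.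
Notation M := 'M[R[i]]_d.
Implicit Types g S U X : M.

(** The operator X |-> g X + X g as a matrix on vectorised matrices: its inverse is then an explicit
    matrix inverse, which keeps the solution measurable in [g]. *)
Definition lyap_mx g : 'M[R[i]]_(d * d) := lin_mulmx g + lin_mulmxr g.

Definition lyap g S : M := vec_mx (mxvec (2%:C *: S) *m invmx (lyap_mx g)).

Lemma lyap_mxE g (u : 'rV[R[i]]_(d * d)) :
  u *m lyap_mx g = mxvec (g *m vec_mx u + vec_mx u *m g).
Proof. by rewrite mulmxDr !mul_rV_lin raddfD. Qed.

Lemma le0_of_sum (a b c : R) : a <= b -> a <= c -> b + c = 0 -> a <= 0.
Proof. by move=> *; lra. Qed.

Lemma eq_of_double (a b : R) : a + a = 2 * b -> a = b.
Proof. by move=> *; lra. Qed.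

(** Pairing the equation with [X] gives a sum of two terms, each at least c times the squared norm
    of [X]. *)
Lemma lyap_inj (c : R) g X : 0 < c -> lowb c g -> g *m X + X *m g = 0 -> X = 0.
Proof.
move=> c0 /lowbP[hg H] E.
have h1 := H X; have h2 := H (X^t*).
have e : frob (g *m X^t*) (X^t*) = frob (X *m g) X.
  by rewrite -frob_adj !adj_mul !adjK (hermP _).1.
have : frob (g *m X + X *m g) X = 0 by rewrite E frob0l.
rewrite frobDl -e => s0; apply: frob_eq0; apply/eqP; rewrite eq_le frob_ge0 andbT.
rewrite frob_adj in h2; rewrite -(pmulr_rle0 _ c0); exact: le0_of_sum h1 h2 s0.
Qed.

Lemma lyap_mx_unit (c : R) g : 0 < c -> lowb c g -> lyap_mx g \in unitmx.
Proof.
move=> c0 lg; rewrite -row_free_unit; apply: inj_row_free => v.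
rewrite lyap_mxE => /(congr1 (@vec_mx _ d d)); rewrite mxvecK linear0 => /(lyap_inj c0 lg).
by move=> /(congr1 mxvec); rewrite vec_mxK linear0.
Qed.

Lemma lyapP (c : R) g S : 0 < c -> lowb c g -> g *m lyap g S + lyap g S *m g = 2%:C *: S.
Proof.
move=> c0 lg; apply: (can_inj mxvecK); rewrite -lyap_mxE mulmxKV//.
exact: lyap_mx_unit c0 lg.
Qed.

Lemma lyap_herm (c : R) g S : 0 < c -> lowb c g -> S \is hermsymmx -> lyap g S \is hermsymmx.
Proof.
move=> c0 lg hS; have hg := (hermP _).1 (lowb_herm lg).
apply/hermP/eqP; rewrite -subr_eq0; apply/eqP; apply: (lyap_inj c0 lg).
have := lyapP S c0 lg; move: (lyap g S) => U E.
have E' : g *m U^t* + U^t* *m g = 2%:C *: S.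
  by rewrite -[in RHS]((hermP S).1 hS) -adj_scalemx -E adjD !adj_mul hg addrC.
by rewrite mulmxBr mulmxBl addrACA -opprD E' E subrr.
Qed.

(** The symmetric part of g U is [S], and a Hermitian test sees only the symmetric part. *)
Lemma lyap_frob (c : R) g S X : 0 < c -> lowb c g -> S \is hermsymmx -> X \is hermsymmx ->
  frob (g *m lyap g S) X = frob S X.
Proof.
move=> c0 lg hS hX.
have hU := (hermP _).1 (lyap_herm c0 lg hS); have hg := (hermP _).1 (lowb_herm lg).
have e : frob (lyap g S *m g) X = frob (g *m lyap g S) X.
  by rewrite -frob_adj adj_mul hU hg ((hermP X).1 hX).
have : frob (g *m lyap g S + lyap g S *m g) X = 2 * frob S X by rewrite (lyapP S c0 lg) frobZl.
by rewrite frobDl e; exact: eq_of_double.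
Qed.

End Lyapunov.

Lemma mxmeas_lyap (R : realType) (d : nat) d0 (T : measurableType d0) (D : set T)
  (g S : T -> 'M[R[i]]_d) (c : T -> R) : (forall x, 0 < c x) -> (forall x, lowb (c x) (g x)) ->
  mxmeas D g -> mxmeas D S -> mxmeas D (fun x => lyap (g x) (S x)).
Proof.
move=> c0 lg mg mS.
have mv (F : T -> 'M[R[i]]_d) : mxmeas D F -> mxmeas D (fun x => mxvec (F x)).
  move=> mF i j; case: (mxvec_indexP j) => a b.
  have -> : (fun x => mxvec (F x) i (mxvec_index a b)) = (fun x => F x a b).
    by apply/funext => x; rewrite ord1 mxvecE.
  exact: mF.
have mL : mxmeas D (fun x => lyap_mx (g x)).
  move=> i j.
  have -> : (fun x => lyap_mx (g x) i j) =
      (fun x => mxvec (g x *m vec_mx (delta_mx 0 i) + vec_mx (delta_mx 0 i) *m g x) 0 j).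
    by apply/funext => x; rewrite -lyap_mxE -rowE [in RHS]mxE.
  by apply: mv; apply: mxmeasD; apply: mxmeasM => //; exact: mxmeas_cst.
have m2S : mxmeas D (fun x => 2%:C *: S x).
  by apply: (mxmeasZ (h := fun=> 2)) mS; exact: measurable_cst.
have mP := mxmeasM (mv _ m2S) (mxmeas_inv (fun x => lyap_mx_unit (c0 x) (lg x)) mL).
move=> i j.
have -> : (fun x => lyap (g x) (S x) i j) =
   (fun x => (mxvec (2%:C *: S x) *m invmx (lyap_mx (g x))) 0 (mxvec_index i j)).
  by apply/funext => x; rewrite mxE.
exact: mP.
Qed.

(** * Fundamental theorem of calculus with derivatives relative to [0, 1] *)

Section WithinFTC.
Context {R : realType}.
Notation leb := (@lebesgue_measure R).
Notation itv01 := (`[(0 : R), 1]%classic).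

Lemma quotient_cvg0 (A : set R) (phi : R -> R) (t l : R) :
  (s - t)^-1 * (phi s - phi t) @[s --> within A t^'] --> l ->
  phi s @[s --> within A t^'] --> phi t.
Proof.
move=> H.
have c0 : s - t @[s --> within A t^'] --> (0 : R).
  rewrite -(subrr t); apply: cvgB (cvg_cst _); exact: within_dnbhs_nbhs.
have h : phi t + (s - t) * ((s - t)^-1 * (phi s - phi t)) @[s --> within A t^'] --> phi t.
  by rewrite -[X in _ --> X]addr0 -[X in _ + X](mul0r l); apply: cvgD (cvg_cst _) (cvgM c0 H).
apply: cvg_trans h; apply: near_eq_cvg; apply: cvg_within; near=> s.
have st : s - t != 0 by rewrite subr_eq0; near: s; exact: nbhs_dnbhs_neq.
by rewrite /= mulrA mulfV// mul1r addrC subrK.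
Unshelve. all: by end_near. Qed.

Lemma punctured_cvg (A : set R) (phi : R -> R) (t : R) :
  phi s @[s --> within A t^'] --> phi t -> phi s @[s --> within A (nbhs t)] --> phi t.
Proof.
move=> H U nU; have h : nbhs t (fun s => s != t -> A s -> U (phi s)) by exact: H.
suff : nbhs t (fun s => A s -> U (phi s)) by [].
apply: filterS h => s h As; have [->|st] := eqVneq s t; first exact: nbhs_singleton.
exact: h.
Qed.

Lemma is_derive_quotient (phi : R -> R) (t l : R) :
  (s - t)^-1 * (phi s - phi t) @[s --> t^'] --> l -> is_derive t 1 phi l.
Proof.
move=> H; apply/is_derive1_caratheodory.
exists (fun s => if s == t then l else (s - t)^-1 * (phi s - phi t)); split.
- move=> z; case: eqVneq => [->|zt]; first by rewrite !subrr mulr0.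
  by rewrite mulrAC mulVf ?mul1r// subr_eq0.
- apply/continuous_withinNx; rewrite /= eqxx; apply: cvg_trans H; apply: near_eq_cvg; near=> s.
  by rewrite ifN//; near: s; exact: nbhs_dnbhs_neq.
- by rewrite eqxx.
Unshelve. all: by end_near. Qed.

Lemma within_interior (t : R) : t \in `]0, 1[ -> t^' `=>` within itv01 t^'.
Proof.
move=> t01 U; rewrite /within /= => H; near=> s.
have : s \in `[0, 1].
  have : s \in `]0, 1[ by near: s; apply: nbhs_dnbhs; exact: near_in_itv.
  by rewrite !in_itv /= => /andP[/ltW -> /ltW ->].
by near: s.
Unshelve. all: by end_near. Qed.

Lemma within_le (A B : set R) (F : set_system R) (FF : Filter F) : A `<=` B -> within A F `=>` within B F.
Proof.
move=> AB U; rewrite /within /= => H.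
have : F (fun x => A x -> U x) by apply: filterS H => x h /AB; exact: h.
exact.
Qed.

Lemma right_within (x t : R) : x < t -> 0 <= x -> t <= 1 -> x^'+ `=>` within itv01 x^'.
Proof.
move=> xt x0 t1 U H.
have H' : x^'+ (fun y => y \in `[0, 1] -> U y).
  have : nbhs x (fun y => y != x -> y \in `[0, 1] -> U y) by exact: H.
  by apply: filterS => y h xy; apply: h; rewrite gt_eqF.
near=> y.
have yU : y \in `[0, 1] -> U y.
  by near: y.
apply: yU; rewrite in_itv /=; apply/andP; split; first by apply: (le_trans x0); apply: ltW.
by apply: le_trans t1; near: y; exact: nbhs_right_le.
Unshelve. all: by end_near. Qed.

Lemma left_within (x s : R) : s < x -> 0 <= s -> x <= 1 -> x^'- `=>` within itv01 x^'.
Proof.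
move=> sx s0 x1 U H.
have H' : x^'- (fun y => y \in `[0, 1] -> U y).
  have : nbhs x (fun y => y != x -> y \in `[0, 1] -> U y) by exact: H.
  by apply: filterS => y h xy; apply: h; rewrite lt_eqF.
near=> y.
have yU : y \in `[0, 1] -> U y.
  by near: y.
apply: yU; rewrite in_itv /=; apply/andP; split; last by apply: le_trans x1; apply: ltW.
by apply: (le_trans s0); near: y; exact: nbhs_left_ge.
Unshelve. all: by end_near. Qed.

(** Relative derivatives are genuine at interior points, and at the ends they still give one-sided
    continuity. Measurability of [F] on the open interval is kept for later replacement of the
    integrand. *)
Lemma FTC_within (phi F : R -> R) :
  (forall t : R, t \in `[0, 1] -> (s - t)^-1 * (phi s - phi t) @[s --> within itv01 t^'] --> F t) ->
  (forall t : R, t \in `[0, 1] -> F s @[s --> within itv01 (nbhs t)] --> F t) ->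
  forall s t : R, s \in `[0, 1] -> t \in `[0, 1] -> s < t ->
  phi t - phi s = \int[leb]_(x in `[s, t]) F x /\ measurable_fun `]s, t[ F.
Proof.
move=> Q C s t s01 t01 st.
have s0 : 0 <= s by move: s01; rewrite in_itv /= => /andP[].
have t1 : t <= 1 by move: t01; rewrite in_itv /= => /andP[].
have sub x : x \in `[s, t] -> x \in `[0, 1].
  by rewrite !in_itv /= => /andP[h1 h2]; rewrite (le_trans s0 h1) (le_trans h2 t1).
have subo x : x \in `]s, t[ -> x \in `]0, 1[.
  by rewrite !in_itv /= => /andP[h1 h2]; rewrite (le_lt_trans s0 h1) (lt_le_trans h2 t1).
have cF : {within `[s, t], continuous F}.
  apply/subspace_continuousP => x xst; have := C x (sub x xst).
  apply: cvg_trans; apply: cvg_app; exact: (within_le _ sub).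
have dphi x : x \in `]s, t[ -> is_derive x 1 phi (F x).
  move=> xst; have x01 := subo x xst; apply: is_derive_quotient.
  apply: cvg_trans (Q x _); first by apply: cvg_app; exact: within_interior.
  by move: x01; rewrite !in_itv /= => /andP[/ltW -> /ltW ->].
have pc x (x01 : x \in `[0, 1]) := quotient_cvg0 (Q x x01).
have LR : derivable_oo_LRcontinuous phi s t.
  split.
  - by move=> x /dphi h; exact: ex_derive.
  - by apply: cvg_trans (pc s s01); apply: cvg_app; exact: (right_within st).
  - by apply: cvg_trans (pc t t01); apply: cvg_app; exact: (left_within st).
have dE : {in `]s, t[, derive1 phi =1 F}.
  by move=> x /dphi h; rewrite derive1E derive_val.
split; first by rewrite /Rintegral (continuous_FTC2 st cF LR dE).
apply: measurable_funS (subspace_continuous_measurable_fun _ cF) => //.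
exact: subset_itv_oo_cc.
Qed.

End WithinFTC.

(** * Curves that are finite combinations of fixed fields with time-dependent coefficients *)

Section MomentCurve.
Context {R : realType} {Omega : ptopologicalType} {d : nat}.
Notation M := 'M[R[i]]_d.
Notation T := (borel Omega).
Notation hpm := (hpm R Omega d).
Notation leb := (@lebesgue_measure R).
Notation itv01 := (`[(0 : R), 1]%classic).
Variable gam : {finite_measure set T -> \bar R}.

Lemma near_within (D : set R) (F : set_system R) (FF : Filter F) (P : R -> Prop) : (forall s, D s -> P s) ->
  \forall s \near within D F, P s.
Proof. by move=> H; apply: filterS (@withinT _ F D FF) => s; exact: H. Qed.

Lemma bfieldB (A B : Omega -> M) : bfield A -> bfield B -> bfield (fun x => A x - B x).
Proof.
move=> bA bB; have -> : (fun x => A x - B x) = (fun x => A x + (-1)%:C *: B x).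
  by apply/funext => x; rewrite rmorphN1 scaleN1r.
exact: (bfieldD bA (bfieldZ _ bB)).
Qed.

Lemma frob_suml (I : Type) (r : seq I) (A : I -> M) (X : M) :
  frob (\sum_(j <- r) A j) X = \sum_(j <- r) frob (A j) X.
Proof. by elim/big_rec2: _ => [|j y x _ <-]; [exact: frob0l|exact: frobDl]. Qed.

Section Moment.
Variable K : T -> M.
Hypothesis bK : bfield K.

(** Pairing along such a curve is a finite sum of coefficients times moments, so continuity and
    differentiation in time reduce to scalar calculus; [K] need not be positive. *)
Definition moment (F : Omega -> M) : R := \int[gam]_x frob (K x) (F x).
Definition moment_norm : R := \int[gam]_x frobn (K x).

Lemma moment_integrable F : bfield F -> gam.-integrable setT (EFin \o (fun x => frob (K x) (F x))).
Proof.
move=> [mF [C FC]]; have [mK [C' KC']] := bK.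
exact: (frob_integrable gam measurableT (conj mK KC') (conj mF FC)).
Qed.

Lemma momentB A B : bfield A -> bfield B ->
  moment (fun x => A x - B x) = moment A - moment B.
Proof.
move=> bA bB; rewrite /moment -(RintegralB measurableT (moment_integrable bA) (moment_integrable bB)).
by apply: eq_Rintegral => x _; rewrite frobBr.
Qed.

Lemma momentZ (a : R) A : bfield A -> moment (fun x => a%:C *: A x) = a * moment A.
Proof.
move=> bA; rewrite /moment -(RintegralZl _ measurableT (moment_integrable bA)).
by apply: eq_Rintegral => x _; rewrite frobZr.
Qed.

Lemma moment_bound F C : bfield F -> (forall x, frobn (F x) <= C) -> `|moment F| <= moment_norm * C.
Proof.
move=> bF FC; have iF := moment_integrable bF; have [mK [C' KC']] := bK.
have iK : gam.-integrable setT (EFin \o (fun x => frobn (K x))).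
  apply: (@bounded_integrable _ _ _ _ _ _ C') => //; first exact: measurable_frobn.
  by move=> x; rewrite (ger0_norm (frobn_ge0 _)).
apply: le_trans (le_normr_Rintegral measurableT iF) _.
rewrite mulrC /moment_norm -(RintegralZl _ measurableT iK).
apply: (le_Rintegral measurableT (integrable_abse iF) (integrableZl measurableT _ iK)) => x _.
apply: le_trans (frob_le _ _) _; rewrite mulrC; apply: ler_wpM2r (FC x); exact: frobn_ge0.
Qed.

Lemma moment_cvg0 (I : Type) (F : set_system I) {FF : Filter F} (f : I -> Omega -> M) :
  (\forall s \near F, bfield (f s)) -> supn (f s) @[s --> F] --> 0%E ->
  moment (f s) @[s --> F] --> (0 : R).
Proof.
move=> bf /fine_cvgP[fin cv].
have h : moment_norm * fine (supn (f s)) @[s --> F] --> (0 : R).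
  by rewrite -(mulr0 moment_norm); exact: cvgMr.
have h' : - (moment_norm * fine (supn (f s))) @[s --> F] --> (0 : R).
  by rewrite -(oppr0 R); exact: cvgN.
apply: (squeeze_cvgr _ h' h); apply: filterS2 bf fin => s bs fs.
rewrite -ler_norml; apply: moment_bound => // x.
have /supn_le : (supn (f s) <= (fine (supn (f s)))%:E)%E by rewrite fineK.
exact.
Qed.

Lemma moment_quotient Psi dPsi (t : R) : C1_Cb Psi dPsi -> t \in `[0, 1] ->
  (s - t)^-1 * (moment (Psi s) - moment (Psi t)) @[s --> within itv01 t^'] --> moment (dPsi t).
Proof.
move=> C1 t01; have [cP cD q _] := C1 t t01.
have bP s : s \in `[0, 1] -> bfield (Psi s) by move=> /C1[h _ _ _]; exact: Cb_bfield.
have bD := Cb_bfield cD.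
have bQ s : s \in `[0, 1] -> bfield (fun x => ((s - t)^-1)%:C *: (Psi s x - Psi t x)).
  by move=> s01; apply: bfieldZ; exact: bfieldB (bP s s01) (bP t t01).
have H : moment (fun x => ((s - t)^-1)%:C *: (Psi s x - Psi t x) - dPsi t x)
    @[s --> within itv01 t^'] --> (0 : R).
  by apply: moment_cvg0 q; apply: near_within => s s01; exact: bfieldB (bQ s s01) bD.
have {}H : moment (fun x => ((s - t)^-1)%:C *: (Psi s x - Psi t x) - dPsi t x) + moment (dPsi t)
    @[s --> within itv01 t^'] --> moment (dPsi t).
  by rewrite -[X in _ --> X]add0r; exact: cvgD H (cvg_cst _).
apply: cvg_trans H; apply: near_eq_cvg; near=> s.
have s01 : s \in `[0, 1] by near: s; exact: withinT.
rewrite /=.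
rewrite (momentB (bQ s s01) bD) subrK (momentZ _ (bfieldB (bP s s01) (bP t t01))).
by rewrite (momentB (bP s s01) (bP t t01)).
Unshelve. all: by end_near. Qed.

Lemma moment_deriv_cvg Psi dPsi (t : R) : C1_Cb Psi dPsi -> t \in `[0, 1] ->
  moment (dPsi s) @[s --> within itv01 (nbhs t)] --> moment (dPsi t).
Proof.
move=> C1 t01; have [_ cD _ q] := C1 t t01.
have bD s : s \in `[0, 1] -> bfield (dPsi s) by move=> /C1[_ h _ _]; exact: Cb_bfield.
have H : moment (fun x => dPsi s x - dPsi t x) @[s --> within itv01 (nbhs t)] --> (0 : R).
  by apply: moment_cvg0 q; apply: near_within => s s01; exact: bfieldB (bD s s01) (bD t t01).
have {}H : moment (fun x => dPsi s x - dPsi t x) + moment (dPsi t)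
    @[s --> within itv01 (nbhs t)] --> moment (dPsi t).
  by rewrite -[X in _ --> X]add0r; exact: cvgD H (cvg_cst _).
apply: cvg_trans H; apply: near_eq_cvg; near=> s.
have s01 : s \in `[0, 1] by near: s; exact: withinT.
rewrite /=.
by rewrite (momentB (bD s s01) (bD t t01)) subrK.
Unshelve. all: by end_near. Qed.

End Moment.
Section Curve.
Variables (n : nat) (K : 'I_n -> T -> M) (c c' : 'I_n -> R -> R) (G : R -> hpm).
Hypothesis bK : forall j, bfield (K j).
Hypothesis dc : forall j (t : R), is_derive t 1 (c j) (c' j t).
Hypothesis cc' : forall j, continuous (c' j).
Hypothesis rG : forall t, rep gam (fun x => \sum_j (c j t)%:C *: K j x) (G t).

Lemma integral_moments (w : 'I_n -> R) F : bfield F ->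
  \int[gam]_x frob (\sum_j (w j)%:C *: K j x) (F x) = \sum_j w j * moment (K j) F.
Proof.
move=> bF; under eq_Rintegral do rewrite frob_suml.
have iK j : gam.-integrable setT (EFin \o (fun x => w j * frob (K j x) (F x))).
  exact: (integrableZl measurableT _ (moment_integrable (bK j) bF)).
transitivity (\int[gam]_x \sum_j (w j * frob (K j x) (F x))).
  by apply: eq_Rintegral => x _; apply: eq_bigr => j _; rewrite frobZl.
rewrite (Rint_sum (h := fun j x => w j * frob (K j x) (F x)) _ measurableT iK).
by apply: eq_bigr => j _; exact: (RintegralZl _ measurableT (moment_integrable (bK j) bF)).
Qed.

Lemma pairing_moments t F : bfield F -> pairing (G t) F = \sum_j c j t * moment (K j) F.
Proof. by move=> bF; rewrite (pairing_rep (rG t) bF.1) integral_moments. Qed.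

Lemma curve_tv_continuous : tv_continuous G.
Proof.
move=> t t01; pose h s := \sum_j `|c j s - c j t| * moment_norm (K j).
have h0 : h s @[s --> within itv01 (nbhs t)] --> (0 : R).
  rewrite [X in _ --> X](_ : 0 = \sum_(j < n) 0 :> R); last by rewrite big1.
  apply: cvg_sumr => j; rewrite -[X in _ --> X](mul0r (moment_norm (K j))); apply: cvgMl.
  have cj := deriv_cvg (dc j t) (@within_nbhs _ itv01 t).
  have {}cj : c j s - c j t @[s --> within itv01 (nbhs t)] --> (0 : R).
    by rewrite -[X in _ --> X](subrr (c j t)); exact: cvgB cj (cvg_cst _).
  by rewrite -[X in _ --> X](normr0 R); exact: cvg_norm.
have tv0 s : (0 <= tv_dist (G s) (G t))%E.
  apply: ereal_sup_ubound; exists (fun=> 0).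
    split; last by apply/supn_le => x; rewrite frobn0.
    by apply/CbP; split; [move=> x; exact: herm0|exact: bounded_mx_cst|exact: mcont_cst].
  have p0 (H : hpm) : pairing H (fun=> 0) = 0.
    by have := pairingB H (bfield_cst (Omega := Omega) (0 : M)) (bfield_cst 0); rewrite !subrr.
  by rewrite !p0 subrr normr0.
have tvh s : (tv_dist (G s) (G t) <= (h s)%:E)%E.
  apply: ge_ereal_sup => _ [Psi [cP P1] <-]; rewrite lee_fin.
  have bP := Cb_bfield cP; rewrite !pairing_moments// -sumrB.
  apply: le_trans (ler_norm_sum _ _ _) _; apply: ler_sum => j _.
  rewrite -mulrBl normrM; apply: ler_wpM2l => //; rewrite -[leRHS]mulr1.
  by apply: moment_bound => // x; move: P1 => /supn_le.
apply: (@squeeze_cvge _ _ _ _ (fun=> 0%E) _ (EFin \o h)).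
- by apply: nearW => s; apply/andP; split; [exact: tv0|exact: tvh].
- exact: cvg_cst.
- by apply: cvg_EFin => //; apply: nearW.
Qed.

(** Product rule for coefficients times moments, then the fundamental theorem of calculus. The
    velocity is prescribed at interior times only; the two endpoints do not affect the integral. *)
Lemma curve_weak_equation (U : R -> Omega -> M) :
  (forall t F, t \in `]0, 1[ -> Cb F -> pairing_mul (G t) (U t) F = \sum_j c' j t * moment (K j) F) ->
  weak_equation G U.
Proof.
move=> HU Psi dPsi C1.
pose phi t := \sum_j c j t * moment (K j) (Psi t).
pose F t := \sum_j (c' j t * moment (K j) (Psi t) + c j t * moment (K j) (dPsi t)).
have bP t : t \in `[0, 1] -> bfield (Psi t) by move=> /C1[h _ _ _]; exact: Cb_bfield.
have phiE t : t \in `[0, 1] -> pairing (G t) (Psi t) = phi t.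
  by move=> t01; rewrite pairing_moments//; exact: bP.
have Q (t : R) : t \in `[0, 1] -> (s - t)^-1 * (phi s - phi t) @[s --> within itv01 t^'] --> F t.
  move=> t01.
  have H : \sum_j ((s - t)^-1 * (c j s - c j t) * moment (K j) (Psi s) +
       c j t * ((s - t)^-1 * (moment (K j) (Psi s) - moment (K j) (Psi t))))
      @[s --> within itv01 t^'] --> F t.
    apply: cvg_sumr => j; have q := moment_quotient (bK j) C1 t01; apply: cvgD.
      apply: cvgM; first exact: (deriv_quotient_cvg itv01 (dc j t)).
      exact: quotient_cvg0 q.
    exact: cvgMr.
  apply: cvg_trans H; apply: near_eq_cvg; apply: nearW => s.
  rewrite /phi -sumrB mulr_sumr; apply: eq_bigr => j _.
  by move: (moment _ _) (moment _ _) (_^-1) => u v w; ring.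
have C (t : R) : t \in `[0, 1] -> F s @[s --> within itv01 (nbhs t)] --> F t.
  move=> t01; apply: cvg_sumr => j; have q := moment_quotient (bK j) C1 t01; apply: cvgD.
    apply: cvgM; first exact: (cvg_trans (cvg_app (c' j) (@within_nbhs _ itv01 t)) (cc' (j := j) (x := t))).
    exact: punctured_cvg (quotient_cvg0 q).
  apply: cvgM; first exact: (deriv_cvg (dc j t) (@within_nbhs _ itv01 t)).
  exact: (moment_deriv_cvg (bK j) C1 t01).
pose e t := pairing (G t) (dPsi t) + pairing_mul (G t) (U t) (Psi t).
have eF t : t \in `]0, 1[ -> e t = F t.
  move=> t01; have t01' : t \in `[0, 1] by exact: subset_itv_oo_cc t01.
  have [cP cD _ _] := C1 t t01'.
  rewrite /e HU// pairing_moments; last exact: Cb_bfield.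
  by rewrite /F big_split addrC.
have main (s t : R) : s \in `[0, 1] -> t \in `[0, 1] -> s < t ->
    phi t - phi s = \int[leb]_(x in `[s, t]) e x.
  move=> s01 t01 st; have [-> mF] := FTC_within Q C s01 t01 st.
  have eq_st x : x \in `]s, t[ -> e x = F x.
    rewrite in_itv /= => /andP[sx xt]; apply: eF; rewrite in_itv /=.
    move: s01 t01; rewrite !in_itv /= => /andP[s0 _] /andP[_ t1].
    by rewrite (le_lt_trans s0 sx) (lt_le_trans xt t1).
  have me : measurable_fun `]s, t[ e.
    apply: eq_measurable_fun mF => x; rewrite inE /= => xst; exact: esym (eq_st x xst).
  have open_itv (f : R -> R) : measurable_fun `]s, t[ f ->
      (\int[leb]_(x in `[s, t]) (f x)%:E = \int[leb]_(x in `]s, t[) (f x)%:E)%E.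
    by move=> mf; apply: integral_itv_bndoo; exact/measurable_EFinP.
  rewrite /Rintegral (open_itv F mF) (open_itv e me); apply: (congr1 (@fine R)).
  by apply: eq_integral => x; rewrite inE /= => /eq_st ->.
move=> s t s01 t01; rewrite !phiE// /oriented_integral -/e.
have [st|ts|->] := ltgtP s t.
- exact: main.
- by rewrite -(main t s)// opprB.
- by rewrite subrr set_itv1 /Rintegral integral_set1.
Qed.

End Curve.
End MomentCurve.

(** * Pointwise algebra of the nearly geodesic curve *)

Section Geodesic.
Context {R : realType} {d : nat}.
Implicit Types (p q r w : R[i]) (K L X Y Z : 'M[R[i]]_d).

(** Adds and subtracts [Z], which stands for C k0 C, to complete the square. The matrix products are
    abstract letters, so only linear bookkeeping remains. *)
Lemma geo_comb p q r K L X Y Z :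
  p *: K + q *: L + r *: (X + Y) = p *: K + r *: X + r *: Y + q *: Z + q *: (L - Z).
Proof.
rewrite scalerBr scalerDr -[in RHS]addrA (addrC (q *: Z)) subrK addrA.
by rewrite [in RHS]addrAC [in RHS](addrAC _ (r *: X)).
Qed.

Lemma dgeo_comb p q r w K L X Y Z :
  (p + p) *: K + (q + q) *: L + (r + w) *: (X + Y) =
  (p *: K + r *: X + w *: Y + q *: Z) + (p *: K + w *: X + r *: Y + q *: Z) + (q + q) *: (L - Z).
Proof.
rewrite scalerBr (addrACA _ (q *: Z)) -(scalerDl Z) -(addrA _ ((q + q) *: Z)) (addrC ((q + q) *: Z)) subrK.
rewrite (addrACA _ (w *: Y)) -(scalerDl Y) (addrC w) (addrACA _ (r *: X)) -(scalerDl K) -(scalerDl X) scalerDr addrA.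
by rewrite [in RHS]addrAC [in RHS](addrAC _ ((r + w) *: X)).
Qed.

Notation M := 'M[R[i]]_d.
Lemma real_geo_comb (K L X Y Z : M) (a b : R) :
  (a ^+ 2)%:C *: K + (b ^+ 2)%:C *: L + (a * b)%:C *: (X + Y) =
  (a * a)%:C *: K + (a * b)%:C *: X + (b * a)%:C *: Y + (b * b)%:C *: Z + (b ^+ 2)%:C *: (L - Z).
Proof. by rewrite (mulrC b a) (geo_comb _ _ _ _ _ _ _ Z) !expr2. Qed.

Lemma real_dgeo_comb (K L X Y Z : M) (a b a' b' : R) :
  (2 * a * a')%:C *: K + (2 * b * b')%:C *: L + (a' * b + a * b')%:C *: (X + Y) =
  ((a' * a)%:C *: K + (a' * b)%:C *: X + (b' * a)%:C *: Y + (b' * b)%:C *: Z) +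
  ((a * a')%:C *: K + (a * b')%:C *: X + (b * a')%:C *: Y + (b * b')%:C *: Z) +
  (2 * b * b')%:C *: (L - Z).
Proof.
have dbl (x y : R) : (2 * x * y)%:C = (x * y)%:C + (x * y)%:C by rewrite -rmorphD; congr (_%:C); ring.
by rewrite !dbl rmorphD (dgeo_comb _ _ _ _ _ _ _ _ Z) (mulrC a' a) (mulrC b' b) (mulrC b' a) (mulrC b a').
Qed.

Variables (k0 k1 C : M).
Implicit Types (a b s : R) (U : M).

(** Expanded form of (a + b C) k0 (a + b C) + b^2 (k1 - C k0 C) + s^2, see [geoE]. The sandwich form
    shows positivity; the expanded one is a combination of four fixed fields. *)
Definition geo a b s : M :=
  (a ^+ 2)%:C *: k0 + (b ^+ 2)%:C *: k1 + (a * b)%:C *: (k0 *m C + C *m k0) + (s ^+ 2)%:C *: 1%:M.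

Definition dgeo a b s a' b' s' : M :=
  (2 * a * a')%:C *: k0 + (2 * b * b')%:C *: k1 + (a' * b + a * b')%:C *: (k0 *m C + C *m k0) +
  (2 * s * s')%:C *: 1%:M.

(** The sum of a' + b' C squared against k0, b'^2 times the trace of k1 - C k0 C, and the bump term;
    the terms with C k0 C cancel, so only the masses and k0 : C remain. *)
Definition geo_speed a' b' s' : R :=
  a' ^+ 2 * complex.Re (\tr k0) + b' ^+ 2 * complex.Re (\tr k1) + 2 * a' * b' * frob k0 C +
  s' ^+ 2 * frob 1%:M (1%:M : M).

Hypothesis pk0 : posmx k0.
Hypothesis pk1 : posmx k1.
Hypothesis pC : posmx C.
Hypothesis pD : posmx (k1 - C *m k0 *m C).

Definition lin1 a b : M := a%:C *: 1%:M + b%:C *: C.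

Lemma lin1_herm a b : (lin1 a b)^t* = lin1 a b.
Proof. by apply/hermP; apply: hermD; [exact/hermZ/herm1|exact/hermZ/(proj1 pC)]. Qed.

Lemma scale_real (x y : R) (A : M) : x%:C *: (y%:C *: A) = (x * y)%:C *: A.
Proof. by rewrite scalerA -rmorphM. Qed.

Lemma lin1_sandwich a b a' b' : lin1 a b *m k0 *m lin1 a' b' =
  (a * a')%:C *: k0 + (a * b')%:C *: (k0 *m C) + (b * a')%:C *: (C *m k0) + (b * b')%:C *: (C *m k0 *m C).
Proof.
rewrite /lin1 !mulmxDl !mulmxDr -!scalemxAl -!scalemxAr !mul1mx !mulmx1 !scale_real.
exact: addrA.
Qed.

Lemma geoE a b s : geo a b s =
  lin1 a b *m k0 *m lin1 a b + (b ^+ 2)%:C *: (k1 - C *m k0 *m C) + (s ^+ 2)%:C *: 1%:M.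
Proof. by rewrite /geo lin1_sandwich (real_geo_comb k0 k1 (k0 *m C) (C *m k0) (C *m k0 *m C)). Qed.

Lemma dgeoE a b s a' b' s' : dgeo a b s a' b' s' =
  lin1 a' b' *m k0 *m lin1 a b + lin1 a b *m k0 *m lin1 a' b' +
  (2 * b * b')%:C *: (k1 - C *m k0 *m C) + (2 * s * s')%:C *: 1%:M.
Proof.
by rewrite /dgeo !lin1_sandwich (real_dgeo_comb k0 k1 (k0 *m C) (C *m k0) (C *m k0 *m C)).
Qed.

Lemma geo_lowb a b s : lowb (s ^+ 2) (geo a b s).
Proof.
rewrite /lowb geoE -(scalemx1 _ (s ^+ 2)%:C) addrK; apply: posD; last by apply: posZ pD; exact: sqr_ge0.
by rewrite -[X in _ *m X]lin1_herm; exact: pos_conj.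
Qed.

Lemma dgeo_herm a b s a' b' s' : dgeo a b s a' b' s' \is hermsymmx.
Proof.
have h0 := pk0.1; have h1 := pk1.1; have hC := pC.1.
exact: (hermD (hermD (hermD (hermZ _ h0) (hermZ _ h1)) (hermZ _ (herm_sym h0 hC))) (hermZ _ herm1)).
Qed.

Lemma young_half (k U V : M) : posmx k ->
  2 * frob (k *m U) V <= 2 * frob (k *m U) U + 2^-1 * frob (k *m V) V.
Proof.
move=> pk; have := pos_young (2%:C *: U) V pk.
rewrite -scalemxAr !frobZl frobZr.
by move: (frob _ U) (frob _ V) (frob _ V) => *; lra.
Qed.

Lemma frob_swap (X k Y U : M) : X^t* = X -> k^t* = k -> Y^t* = Y -> U^t* = U ->
  frob (X *m k *m Y) U = frob (Y *m k *m X) U.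
Proof. by move=> hX hk hY hU; rewrite -frob_adj !adj_mul hX hk hY hU mulmxA. Qed.

Lemma frob_sandwich (k Y U A : M) : A^t* = A -> frob (A *m k *m Y) U = frob (k *m Y) (A *m U).
Proof. by move=> hA; rewrite -mulmxA frob_mull hA. Qed.

(** Each of the three summands of the derivative has the form X' k X + X k X', and Young with
    weights 2 and 1/2 is applied to X' and X U. *)
Lemma action_young (k D A A' U : M) b b' s s' : posmx k -> posmx D ->
  A^t* = A -> A'^t* = A' -> U^t* = U ->
  frob (A' *m k *m A + A *m k *m A' + (2 * b * b')%:C *: D + (2 * s * s')%:C *: 1%:M) U <=
  2 * (frob (k *m A') A' + b' ^+ 2 * frob D 1%:M + s' ^+ 2 * frob 1%:M (1%:M : M)) +
  2^-1 * frob ((A *m k *m A + (b ^+ 2)%:C *: D + (s ^+ 2)%:C *: 1%:M) *m U) U.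
Proof.
move=> pk pD' hA hA' hU; have hk := (hermP k).1 pk.1.
have y1 := young_half A' (A *m U) pk.
have y2 := young_half (b'%:C *: 1%:M) (b%:C *: U) pD'.
have y3 := young_half (s'%:C *: 1%:M) (s%:C *: U) (@pos1 R d).
rewrite !mulmxDl !frobDl -!scalemxAl !frobZl mul1mx (frob_swap hA' hk hA hU) (frob_sandwich k A' U hA).
rewrite -(mulmxA (A *m k)) (frob_sandwich k (A *m U) U hA).
move: y1 y2 y3; rewrite -!scalemxAr !mulmx1 !mul1mx !frobZl !frobZr.
move: (frob (k *m A') (A *m U)) (frob (k *m A') A') (frob (k *m (A *m U)) (A *m U)) => u1 u2 u3.
move: (frob D U) (frob D 1%:M) (frob (D *m U) U) (frob 1%:M U) (frob 1%:M 1%:M) (frob U U) => u4 u5 u6 u7 u8 u9.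
rewrite !expr2; lra.
Qed.

Lemma geo_action a b s a' b' s' U : U \is hermsymmx ->
  frob (dgeo a b s a' b' s') U <= 2 * geo_speed a' b' s' + 2^-1 * frob (geo a b s *m U) U.
Proof.
move=> hU; rewrite geoE dgeoE.
have -> : geo_speed a' b' s' = frob (k0 *m lin1 a' b') (lin1 a' b') +
    b' ^+ 2 * frob (k1 - C *m k0 *m C) 1%:M + s' ^+ 2 * frob 1%:M (1%:M : M).
  have hC : C^t* = C by apply/hermP; exact: pC.1.
  rewrite /geo_speed; congr (_ + _).
  have -> : frob (k1 - C *m k0 *m C) 1%:M = complex.Re (\tr k1) - frob (k0 *m C) C.
    by rewrite frobBl !frob1r -(frob1r (C *m _ *m _)) -mulmxA frob_mull hC mulmx1.
  rewrite /lin1 mulmxDr -!scalemxAr mulmx1 !frobDl !frobDr !frobZl !frobZr frob1r.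
  have -> : frob (k0 *m C) 1%:M = frob k0 C by rewrite frob_mulr mul1mx hC.
  by move: (frob k0 C) (frob _ C) (complex.Re _) (complex.Re _) => *; ring.
exact: action_young pk0 pD (lin1_herm _ _) (lin1_herm _ _) ((hermP U).1 hU).
Qed.

End Geodesic.

Lemma mxmeas_comp (R : realType) d1 d2 (T1 : measurableType d1) (T2 : measurableType d2) n
  (F : T2 -> 'M[R[i]]_n) (f : T1 -> T2) : measurable_fun setT f -> mxmeas setT F ->
  mxmeas setT (fun x => F (f x)).
Proof.
move=> mf mF i j; have [h1 h2] := mF i j.
by split; [exact: (measurableT_comp h1 mf)|exact: (measurableT_comp h2 mf)].
Qed.

Lemma deriv_measurable (R : realType) (f f' : R -> R) : (forall t : R, is_derive t 1 f (f' t)) ->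
  measurable_fun setT f.
Proof.
move=> df; apply: continuous_measurable_fun => t.
exact: (deriv_cvg (df t) (fun _ h => h)).
Qed.

Lemma mxmeas_geo (R : realType) d0 (T : measurableType d0) n (k0 k1 C : T -> 'M[R[i]]_n) (a b s : T -> R) :
  mxmeas setT k0 -> mxmeas setT k1 -> mxmeas setT C ->
  measurable_fun setT a -> measurable_fun setT b -> measurable_fun setT s ->
  mxmeas setT (fun x => geo (k0 x) (k1 x) (C x) (a x) (b x) (s x)).
Proof.
move=> m0 m1 mC ma mb ms.
have mX := mxmeasD (mxmeasM m0 mC) (mxmeasM mC m0).
exact: (mxmeasD (mxmeasD (mxmeasD (mxmeasZ (measurable_funX 2 ma) m0) (mxmeasZ (measurable_funX 2 mb) m1))
  (mxmeasZ (measurable_funM ma mb) mX)) (mxmeasZ (measurable_funX 2 ms) (mxmeas_cst _ _))).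
Qed.

Lemma mxmeas_dgeo (R : realType) d0 (T : measurableType d0) n (k0 k1 C : T -> 'M[R[i]]_n)
    (a b s a' b' s' : T -> R) :
  mxmeas setT k0 -> mxmeas setT k1 -> mxmeas setT C ->
  measurable_fun setT a -> measurable_fun setT b -> measurable_fun setT s ->
  measurable_fun setT a' -> measurable_fun setT b' -> measurable_fun setT s' ->
  mxmeas setT (fun x => dgeo (k0 x) (k1 x) (C x) (a x) (b x) (s x) (a' x) (b' x) (s' x)).
Proof.
move=> m0 m1 mC ma mb ms ma' mb' ms'.
have mX := mxmeasD (mxmeasM m0 mC) (mxmeasM mC m0).
have m2 (f f' : T -> R) : measurable_fun setT f -> measurable_fun setT f' ->
    measurable_fun setT (fun x => 2 * f x * f' x).
  by move=> mf mf'; apply: measurable_funM mf'; apply: measurable_funM mf; exact: measurable_cst.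
have mab := measurable_funD (measurable_funM ma' mb) (measurable_funM ma mb').
exact: (mxmeasD (mxmeasD (mxmeasD (mxmeasZ (m2 _ _ ma ma') m0) (mxmeasZ (m2 _ _ mb mb') m1))
  (mxmeasZ mab mX)) (mxmeasZ (m2 _ _ ms ms') (mxmeas_cst _ _))).
Qed.

Lemma sum_ord4 (R : realType) (w : 'I_4 -> R) : \sum_j w j =
  w (@Ordinal 4 0 isT) + w (@Ordinal 4 1 isT) + w (@Ordinal 4 2 isT) + w (@Ordinal 4 3 isT).
Proof.
rewrite !big_ord_recl big_ord0 addr0 !addrA.
by congr (_ + _ + _ + _); congr w; exact: val_inj.
Qed.

Section RepUnique.
Context {R : realType} {Omega : ptopologicalType} {d : nat}.
Notation M := 'M[R[i]]_d.
Notation T := (borel Omega).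
Notation hpm := (hpm R Omega d).

Lemma rep_unique (gam : {finite_measure set T -> \bar R}) k (G H : hpm) : rep gam k G -> rep gam k H -> G = H.
Proof.
move=> [_ GA] [_ HA]; apply: hpm_ext => A mA; apply: frob_eqP => X.
by rewrite GA// HA.
Qed.

End RepUnique.

(** * The admissible curve built from the optimal field, and its energy *)

Section GeodesicCurve.
Context {R : realType} {Omega : ptopologicalType} {d : nat}.
Notation M := 'M[R[i]]_d.
Notation T := (borel Omega).
Notation hpm := (hpm R Omega d).
Notation leb := (@lebesgue_measure R).
Hypothesis metO : metrizable R Omega.
Variable gam : {finite_measure set T -> \bar R}.
Hypothesis rgam : radon gam.
Variables (G0 G1 : hpm) (k0 k1 C : T -> M).
Hypothesis r0 : rep gam k0 G0.
Hypothesis r1 : rep gam k1 G1.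
Hypothesis bC : bfield C.
Hypothesis pC : forall x, posmx (C x).
Hypothesis pD : forall x, posmx (k1 x - C x *m k0 x *m C x).
Variables a b s a' b' s' : R -> R.
Hypothesis da : forall t : R, is_derive t 1 a (a' t).
Hypothesis db : forall t : R, is_derive t 1 b (b' t).
Hypothesis ds : forall t : R, is_derive t 1 s (s' t).
Hypothesis ca' : continuous a'.
Hypothesis cb' : continuous b'.
Hypothesis cs' : continuous s'.
Hypothesis s_gt0 : forall t, t \in `]0, 1[ -> 0 < s t.
Hypothesis a0 : a 0 = 1.
Hypothesis b0 : b 0 = 0.
Hypothesis s0 : s 0 = 0.
Hypothesis a1 : a 1 = 0.
Hypothesis b1 : b 1 = 1.
Hypothesis s1 : s 1 = 0.

Let bk (k : T -> M) G : rep gam k G -> bfield k.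
Proof. by case=> -[C' /bpos_bmx[mk kC]] _; split=> //; exists C'. Qed.

(** The four fixed fields of the expanded form of [geo]; their coefficients and derivatives are
    listed in the same order. *)
Definition curve_field (j : 'I_4) : T -> M := nth (fun=> 0)
  [:: k0; k1; (fun x => k0 x *m C x + C x *m k0 x); fun=> 1%:M] j.
Definition curve_coef (j : 'I_4) : R -> R := nth (fun=> 0)
  [:: (fun t => a t ^+ 2); (fun t => b t ^+ 2); (fun t => a t * b t); fun t => s t ^+ 2] j.
Definition curve_coef' (j : 'I_4) : R -> R := nth (fun=> 0)
  [:: (fun t => 2 * a t * a' t); (fun t => 2 * b t * b' t);
      (fun t => a' t * b t + a t * b' t); fun t => 2 * s t * s' t] j.

Definition curve_geo t x : M := geo (k0 x) (k1 x) (C x) (a t) (b t) (s t).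
Definition curve_dgeo t x : M :=
  dgeo (k0 x) (k1 x) (C x) (a t) (b t) (s t) (a' t) (b' t) (s' t).

Lemma curve_field_bfield j : bfield (curve_field j).
Proof.
have h0 := bk r0; have h1 := bk r1.
case: j => -[|[|[|[|//]]]] p; rewrite /curve_field /=; [exact: h0|exact: h1| |exact: bfield_cst].
exact: (bfieldD (bfieldM h0 bC) (bfieldM bC h0)).
Qed.

Lemma curve_coef_derive j (t : R) : is_derive t 1 (curve_coef j) (curve_coef' j t).
Proof.
have sq (f f' : R -> R) : (forall t : R, is_derive t 1 f (f' t)) ->
    is_derive t 1 (fun t => f t ^+ 2) (2 * f t * f' t).
  move=> df; have h := df t.
  have -> : (fun t => f t ^+ 2) = f * f :> (R -> R) by apply/funext => r; rewrite expr2.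
  by apply: is_derive_eq; rewrite /GRing.scale /=; ring.
case: j => -[|[|[|[|//]]]] p; rewrite /curve_coef /curve_coef' /=; [exact: sq|exact: sq| |exact: sq].
have h1 := da t; have h2 := db t.
have -> : (fun t => a t * b t) = a * b :> (R -> R) by [].
by apply: is_derive_eq; rewrite /GRing.scale /=; ring.
Qed.

Lemma curve_coef_cont j : continuous (curve_coef' j).
Proof.
have cf (f f' : R -> R) : (forall t : R, is_derive t 1 f (f' t)) -> continuous f.
  by move=> df t; exact: (deriv_cvg (df t) (fun _ h => h)).
have ca := cf _ _ da; have cb := cf _ _ db; have cs := cf _ _ ds.
have pr (f g : R -> R) : continuous f -> continuous g -> continuous (fun t => f t * g t).
  by move=> hf hg t; apply: cvgM; [exact: hf|exact: hg].
have c2 (f : R -> R) : continuous f -> continuous (fun t => 2 * f t).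
  by move=> hf t; apply: cvgM; [exact: cvg_cst|exact: hf].
case: j => -[|[|[|[|//]]]] p; rewrite /curve_coef' /=.
- exact: pr (c2 _ ca) ca'.
- exact: pr (c2 _ cb) cb'.
- by move=> t; apply: cvgD; [exact: pr ca' cb t|exact: pr ca cb' t].
- exact: pr (c2 _ cs) cs'.
Qed.

Lemma curve_geoE t x : curve_geo t x = \sum_j (curve_coef j t)%:C *: curve_field j x.
Proof. by rewrite !big_ord_recl big_ord0 addr0 /curve_geo /geo !addrA. Qed.

Lemma curve_dgeoE t x : curve_dgeo t x = \sum_j (curve_coef' j t)%:C *: curve_field j x.
Proof. by rewrite !big_ord_recl big_ord0 addr0 /curve_dgeo /dgeo !addrA. Qed.

Lemma curve_geo_bfield t : bfield (curve_geo t).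
Proof.
have h0 := bk r0; have h1 := bk r1.
exact: (bfieldD (bfieldD (bfieldD (bfieldZ _ h0) (bfieldZ _ h1))
  (bfieldZ _ (bfieldD (bfieldM h0 bC) (bfieldM bC h0)))) (bfieldZ _ (bfield_cst _))).
Qed.

Lemma curve_hpm : exists G : R -> hpm, forall t, rep gam (curve_geo t) (G t).
Proof.
suff H t : exists G, rep gam (curve_geo t) G by have [G HG] := choice H; exists G.
have [mg [B gB]] := curve_geo_bfield t.
apply: (hpm_of (metrizable_hausdorff metO) rgam (C := B * frobn (1%:M : M))); split.
- exact: mg.
- by move=> x; exact: (lowb_pos (sqr_ge0 (s t)) (geo_lowb (rep_pos r0 x) (pC x) (pD x) (a t) (b t) (s t))).
- move=> x; rewrite -frob1r; apply: le_trans (frob_ler _ _) _.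
  by rewrite ler_wpM2r ?frobn_ge0.
Qed.

Definition chi01 (t : R) : R := \1_(`]0, 1[%classic) t.
(** Equal to [s] at interior times and to 1 elsewhere, hence positive at every time: the Lyapunov
    operator is invertible everywhere and joint measurability holds on the whole space. The factor
    [chi01] then sets the velocity to 0 off the open interval. *)
Definition curve_s t := s t * chi01 t + (1 - chi01 t).
Definition curve_U t x : M := (chi01 t)%:C *:
  lyap (geo (k0 x) (k1 x) (C x) (a t) (b t) (curve_s t)) (curve_dgeo t x).

Lemma chi01_in t : t \in `]0, 1[ -> chi01 t = 1.
Proof. by move=> t01; rewrite /chi01 indicE mem_set. Qed.

Lemma chi01_out t : t \notin `]0, 1[ -> chi01 t = 0.
Proof. by move=> /negP t01; rewrite /chi01 indicE memNset. Qed.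

Lemma curve_s_gt0 t : 0 < curve_s t.
Proof.
rewrite /curve_s; have [t01|t01] := boolP (t \in `]0, 1[).
  by rewrite chi01_in// mulr1 subrr addr0 s_gt0.
by rewrite chi01_out// mulr0 add0r subr0.
Qed.

Lemma curve_U_in t x : t \in `]0, 1[ -> curve_U t x = lyap (curve_geo t x) (curve_dgeo t x).
Proof. by move=> t01; rewrite /curve_U /curve_s chi01_in// scale1r mulr1 subrr addr0. Qed.

Lemma curve_U_out t x : t \notin `]0, 1[ -> curve_U t x = 0.
Proof. by move=> t01; rewrite /curve_U chi01_out// scale0r. Qed.

Lemma curve_dgeo_herm t x : curve_dgeo t x \is hermsymmx.
Proof. exact: (dgeo_herm (rep_pos r0 x) (rep_pos r1 x) (pC x) (a t) (b t) (s t) (a' t) (b' t) (s' t)). Qed.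

Lemma curve_geo_lowb t x : lowb (s t ^+ 2) (curve_geo t x).
Proof. exact: (geo_lowb (rep_pos r0 x) (pC x) (pD x) (a t) (b t) (s t)). Qed.

Lemma curve_U_herm t x : curve_U t x \is hermsymmx.
Proof.
have [t01|t01] := boolP (t \in `]0, 1[); last by rewrite curve_U_out//; exact: herm0.
rewrite curve_U_in//; apply: lyap_herm (curve_geo_lowb t x) (curve_dgeo_herm t x).
by rewrite exprn_gt0// s_gt0.
Qed.

Lemma curve_U_frob t x F : t \in `]0, 1[ -> F \is hermsymmx ->
  frob (curve_geo t x *m curve_U t x) F = frob (curve_dgeo t x) F.
Proof.
move=> t01 hF; rewrite curve_U_in//; apply: lyap_frob (curve_geo_lowb t x) (curve_dgeo_herm t x) hF.
by rewrite exprn_gt0// s_gt0.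
Qed.

(** Testing the Lyapunov equation with [curve_U] itself turns the left side into the derivative
    paired with [curve_U], and [geo_action] bounds this by twice the speed plus half of the left
    side. *)
Lemma curve_U_action t x : frob (curve_geo t x *m curve_U t x) (curve_U t x) <=
  4 * geo_speed (k0 x) (k1 x) (C x) (a' t) (b' t) (s' t).
Proof.
have hA U := geo_action (rep_pos r0 x) (pC x) (pD x) (a t) (b t) (s t) (a' t) (b' t) (s' t) (U := U).
have [t01|t01] := boolP (t \in `]0, 1[).
  have := hA _ (curve_U_herm t x); rewrite -/(curve_dgeo t x) -/(curve_geo t x).
  rewrite -(curve_U_frob x t01 (curve_U_herm t x)).
  by move: (frob _ _) (geo_speed _ _ _ _ _ _) => *; lra.
have := hA 0 (herm0); rewrite curve_U_out// !frob0r.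
by move: (geo_speed _ _ _ _ _ _) => *; lra.
Qed.

Lemma curve_U_mxmeas : mxmeas setT (fun p : measurableTypeR R * T => curve_U p.1 p.2).
Proof.
have mp (f : R -> R) : measurable_fun setT f ->
    measurable_fun setT (fun p : measurableTypeR R * T => f p.1).
  by move=> mf; exact: (measurableT_comp (mf : measurable_fun setT (f : measurableTypeR R -> R)) measurable_fst).
have mf := mxmeas_comp (measurable_snd : measurable_fun setT (snd : measurableTypeR R * T -> T)).
have m0 := mf _ _ _ (bk r0).1; have m1 := mf _ _ _ (bk r1).1; have mC := mf _ _ _ bC.1.
have mchi : measurable_fun setT chi01 by exact: measurable_indic.
have ma := mp _ (deriv_measurable da); have mb := mp _ (deriv_measurable db).
have ms := deriv_measurable ds.
have mcs : measurable_fun setT curve_s.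
  apply: measurable_funD; first exact: measurable_funM ms mchi.
  by apply: measurable_funB mchi; exact: measurable_cst.
have mg := mxmeas_geo m0 m1 mC ma mb (mp _ mcs).
have md := mxmeas_dgeo m0 m1 mC ma mb (mp _ ms) (mp _ (continuous_measurable_fun ca'))
   (mp _ (continuous_measurable_fun cb')) (mp _ (continuous_measurable_fun cs')).
have cs2 (p : measurableTypeR R * T) : 0 < curve_s p.1 ^+ 2 by rewrite exprn_gt0// curve_s_gt0.
have lg (p : measurableTypeR R * T) : lowb (curve_s p.1 ^+ 2)
    (geo (k0 p.2) (k1 p.2) (C p.2) (a p.1) (b p.1) (curve_s p.1)).
  exact: (geo_lowb (rep_pos r0 p.2) (pC p.2) (pD p.2) (a p.1) (b p.1) (curve_s p.1)).
exact: (mxmeasZ (mp _ mchi) (mxmeas_lyap cs2 lg mg md)).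
Qed.

Let f := \int[gam]_x frob (k0 x) (C x).
Let D := \int[gam]_x frob (1%:M : M) (1%:M : M).

Definition curve_speed t := a' t ^+ 2 * hpm_mass G0 + b' t ^+ 2 * hpm_mass G1 + 2 * a' t * b' t * f + s' t ^+ 2 * D.

Lemma integral_geo_speed t : let h x := geo_speed (k0 x) (k1 x) (C x) (a' t) (b' t) (s' t) in
  gam.-integrable setT (EFin \o h) /\ \int[gam]_x h x = curve_speed t.
Proof.
move=> h; have i0 := rep_tr_integrable r0; have i1 := rep_tr_integrable r1.
have iC := rep_integrable r0 bC.
have iD : gam.-integrable setT (EFin \o (fun=> frob (1%:M : M) 1%:M)).
  exact: (moment_integrable gam (bfield_cst 1%:M) (bfield_cst 1%:M)).
have j0 := integrableZl measurableT (a' t ^+ 2) i0; have j1 := integrableZl measurableT (b' t ^+ 2) i1.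
have jC := integrableZl measurableT (2 * a' t * b' t) iC.
have jD := integrableZl measurableT (s' t ^+ 2) iD.
have j01 := integrableD measurableT j0 j1; have j01C := integrableD measurableT j01 jC.
split; first exact: (integrableD measurableT j01C jD).
rewrite /h /geo_speed (RintegralD measurableT j01C jD) (RintegralD measurableT j01 jC) (RintegralD measurableT j0 j1).
rewrite (RintegralZl _ measurableT i0) (RintegralZl _ measurableT i1) (RintegralZl _ measurableT iC).
by rewrite (RintegralZl _ measurableT iD) -(mass_rep r0) -(mass_rep r1).
Qed.

Section WithCurve.
Variable G : R -> hpm.
Hypothesis rG : forall t, rep gam (curve_geo t) (G t).

Let rG' t : rep gam (fun x => \sum_j (curve_coef j t)%:C *: curve_field j x) (G t).
Proof.
have <- : curve_geo t = (fun x => \sum_j (curve_coef j t)%:C *: curve_field j x).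
  by apply/funext => x; exact: curve_geoE.
exact: rG.
Qed.

Lemma curve_moments t (F : Omega -> M) : \sum_j curve_coef j t * moment gam (curve_field j) F =
  a t ^+ 2 * moment gam k0 F + b t ^+ 2 * moment gam k1 F +
  a t * b t * moment gam (fun x => k0 x *m C x + C x *m k0 x) F + s t ^+ 2 * moment gam (fun=> 1%:M) F.
Proof. exact: sum_ord4. Qed.

Lemma curve_mass t : hpm_mass (G t) =
  a t ^+ 2 * hpm_mass G0 + b t ^+ 2 * hpm_mass G1 + 2 * a t * b t * f + s t ^+ 2 * D.
Proof.
have e := pairing_moments curve_field_bfield rG' t (bfield_cst (1%:M : M)).
rewrite -(pairing1 (G t)).
rewrite e.
rewrite curve_moments /moment.
have h0 := bk r0; have iC := rep_integrable r0 bC.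
have -> : \int[gam]_x frob (k0 x) 1%:M = hpm_mass G0.
  by rewrite (mass_rep r0); apply: eq_Rintegral => x _; exact: frob1r.
have -> : \int[gam]_x frob (k1 x) 1%:M = hpm_mass G1.
  by rewrite (mass_rep r1); apply: eq_Rintegral => x _; exact: frob1r.
have -> : \int[gam]_x frob (k0 x *m C x + C x *m k0 x) 1%:M = 2 * f.
  rewrite /f -(RintegralZl _ measurableT iC); apply: eq_Rintegral => x _.
  have hC := (hermP _).1 (pC x).1; have hk := (hermP _).1 (rep_pos r0 x).1.
  rewrite frobDl (frob_mulr (k0 x)) mul1mx hC (frob_mull (C x)) hC mulmx1; ring.
rewrite -/D; move: (hpm_mass _) (hpm_mass _) f D => *; ring.
Qed.

Lemma curve_start : G 0 = G0.
Proof.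
apply: (@rep_unique _ _ _ gam k0) r0; have := rG 0.
rewrite (_ : curve_geo 0 = k0)//; apply/funext => x.
by rewrite /curve_geo /geo a0 b0 s0 !expr0n /= expr1n mulr0 !scale0r !addr0 scale1r.
Qed.

Lemma curve_end : G 1 = G1.
Proof.
apply: (@rep_unique _ _ _ gam k1) r1; have := rG 1.
rewrite (_ : curve_geo 1 = k1)//; apply/funext => x.
by rewrite /curve_geo /geo a1 b1 s1 !expr0n /= expr1n mul0r !scale0r !addr0 add0r scale1r.
Qed.

Lemma curve_U_section t : t \in `[0, 1] -> mxmeas setT (curve_U t : T -> M).
Proof.
move=> t01; apply: (section_mxmeas t01) => i j; apply: measurable_funTS; have [h1 h2] := curve_U_mxmeas i j.
  exact: h1.
exact: h2.
Qed.

Lemma curve_L2norm2 t : t \in `[0, 1] -> (L2norm2 (G t) (curve_U t) <= (4 * curve_speed t)%:E)%E.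
Proof.
move=> t01; have mU := curve_U_section t01; rewrite (L2norm2_rep (rG t) mU).
have [iS <-] := integral_geo_speed t; have i4 := integrableZl measurableT 4 iS.
have -> : (4 * \int[gam]_x geo_speed (k0 x) (k1 x) (C x) (a' t) (b' t) (s' t))%:E =
    (\int[gam]_x (4 * geo_speed (k0 x) (k1 x) (C x) (a' t) (b' t) (s' t))%:E)%E.
  rewrite -(RintegralZl _ measurableT iS) /Rintegral fineK//.
  exact: (integrable_fin_num measurableT i4).
apply: ge0_le_integral => //.
- by move=> x _; rewrite lee_fin; have [_] := rep_pos (rG t) x; exact.
- apply/measurable_EFinP; exact: (measurable_frob (mxmeasM (curve_geo_bfield t).1 mU) mU).
- exact: (measurable_int _ i4).
- by move=> x _; rewrite lee_fin; exact: curve_U_action.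
Qed.

Lemma curve_energy (e : R) : (forall t, t \in `[0, 1] -> curve_speed t <= e) ->
  (energy G curve_U <= (4 * e)%:E)%E.
Proof.
move=> se; rewrite /energy.
pose F t := if t \in `[0, 1] then L2norm2 (G t) (curve_U t) else 0%E.
have e0 : 0 <= 4 * e.
  have t01 : (0 : R) \in `[0, 1] by rewrite in_itv /= lexx ler01.
  rewrite -lee_fin; apply: le_trans (le_trans (L2norm2_ge0 (G 0) (curve_U_section t01)) (curve_L2norm2 t01)) _.
  by rewrite lee_fin ler_wpM2l// se.
have -> : (\int[leb]_(t in `[0%R, 1%R]) L2norm2 (G t) (curve_U t) = \int[leb]_(t in `[0%R, 1%R]) F t)%E.
  by apply: eq_integral => t; rewrite inE /= /F => ->.
apply: (@le_trans _ _ (\int[leb]_(t in `[0%R, 1%R]) (4 * e)%:E)%E).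
  apply: lower_le => [t|t|t].
  - by rewrite /F; case: ifP => // t01; apply: L2norm2_ge0; exact: curve_U_section.
  - by rewrite lee_fin.
  rewrite !patchE /F; case: ifPn => //; rewrite inE /= => t01; rewrite t01.
  by apply: le_trans (curve_L2norm2 t01) _; rewrite lee_fin ler_wpM2l// se.
by rewrite integral_cst//= lebesgue_measure_itv /= lte_fin ltr01 sube0 mule1.
Qed.

Lemma curve_admissible (e : R) : (forall t, t \in `[0, 1] -> curve_speed t <= e) ->
  admissible G0 G1 G curve_U.
Proof.
move=> se; split.
- exact: (curve_tv_continuous curve_field_bfield curve_coef_derive rG').
- exact: curve_start.
- exact: curve_end.
- split.
  + by move=> t x _; exact: curve_U_herm.
  + by move=> i j; apply: measurable_funTS; exact: (curve_U_mxmeas i j).1.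
  + by move=> i j; apply: measurable_funTS; exact: (curve_U_mxmeas i j).2.
  + exact: le_lt_trans (curve_energy se) (ltry _).
apply: (curve_weak_equation curve_field_bfield curve_coef_derive curve_coef_cont rG') => t F t01 cF.
have t01' : t \in `[0, 1] by exact: subset_itv_oo_cc t01.
have bF := Cb_bfield cF; have /CbP[hF _ _] := cF.
rewrite (pairing_mul_rep (rG t) (curve_U_section t01') bF.1).
rewrite -(integral_moments _ curve_field_bfield _ bF); apply: eq_Rintegral => x _.
by rewrite (curve_U_frob x t01 (hF x)) curve_dgeoE.
Qed.

End WithCurve.

(** Scalar interface to the construction: both upper bounds now reduce to choosing coefficient
    functions of time. *)
Lemma geodesic_curve (e : R) : (forall t, t \in `[0, 1] -> curve_speed t <= e) ->
  exists G U, [/\ admissible G0 G1 G U, (energy G U <= (4 * e)%:E)%E &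
    forall t, hpm_mass (G t) =
      a t ^+ 2 * hpm_mass G0 + b t ^+ 2 * hpm_mass G1 + 2 * a t * b t * f + s t ^+ 2 * D].
Proof.
move=> se; have [G rG] := curve_hpm; exists G, curve_U.
split; [exact: curve_admissible rG _ se|exact: curve_energy rG _ se|exact: curve_mass rG].
Qed.

End GeodesicCurve.

(** * Coefficients along a tilted arc of great circle *)

Section SphericalArc.
Context {R : realType}.

Lemma is_derive_mul (f g f' g' : R -> R) (t : R) : is_derive t 1 f (f' t) -> is_derive t 1 g (g' t) ->
  is_derive t 1 (fun t => f t * g t) (f' t * g t + f t * g' t).
Proof.
move=> df dg; have -> : (fun t => f t * g t) = f * g :> (R -> R) by [].
by apply: is_derive_eq; rewrite /GRing.scale /=; ring.
Qed.

Lemma deriv_continuous (f f' : R -> R) : (forall t : R, is_derive t 1 f (f' t)) -> continuous f.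
Proof. by move=> df t; exact: (deriv_cvg (df t) (fun _ h => h)). Qed.

Lemma continuous_mul (f g : R -> R) : continuous f -> continuous g -> continuous (fun t => f t * g t).
Proof. by move=> hf hg t; apply: cvgM; [exact: hf|exact: hg]. Qed.

Lemma continuous_add (f g : R -> R) : continuous f -> continuous g -> continuous (fun t => f t + g t).
Proof. by move=> hf hg t; apply: cvgD; [exact: hf|exact: hg]. Qed.

(** A small bump vanishing at both ends; its slope is at most h in absolute value on [0, 1]. *)
Definition hump (h t : R) := h * t * (1 - t).
Definition hump' (h t : R) := h * (1 - 2 * t).

Lemma is_derive_hump (h t : R) : is_derive t 1 (hump h) (hump' h t).
Proof.
have d1 := is_derive_affine h 0 t; have d2 := is_derive_affine (-1) 1 t.
have := @is_derive_mul _ _ (fun=> h) (fun=> -1) t d1 d2.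
have -> : (fun t : R => (h * t + 0) * (-1 * t + 1)) = hump h by apply/funext => r; rewrite /hump; ring.
by have -> : h * (-1 * t + 1) + (h * t + 0) * -1 = hump' h t by rewrite /hump'; ring.
Qed.

Lemma is_derive_hump' (h t : R) : is_derive t 1 (hump' h) (- 2 * h).
Proof.
have -> : hump' h = (fun t => (- 2 * h) * t + h) by apply/funext => r; rewrite /hump'; ring.
exact: is_derive_affine.
Qed.

Lemma hump'_sqr (h t : R) : t \in `[0, 1] -> hump' h t ^+ 2 <= h ^+ 2.
Proof.
rewrite in_itv /= => /andP[t0 t1]; rewrite /hump' exprMn ler_piMr ?sqr_ge0//.
by rewrite expr2; nra.
Qed.

Lemma hump_bounds (h t : R) : 0 < h -> t \in `]0, 1[ -> 0 < hump h t <= h.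
Proof.
move=> h0; rewrite in_itv /= => /andP[t0 t1]; rewrite /hump; apply/andP; split.
  by rewrite !mulr_gt0// subr_gt0.
rewrite -mulrA ler_piMr ?(ltW h0)//; nra.
Qed.

(** Here x, y and z, c are sine and cosine of two angles, f and S the cosine and sine of their sum.
    In the plane with inner product f between the basis vectors, these say that the arc has constant
    norm and constant speed and that its velocity is orthogonal to it. *)
Lemma sphere_identities (x y z c : R) : x ^+ 2 + y ^+ 2 = 1 -> z ^+ 2 + c ^+ 2 = 1 ->
  let f := y * c - x * z in let S := x * c + y * z in
  [/\ x ^+ 2 + z ^+ 2 + 2 * f * x * z = S ^+ 2,
      y ^+ 2 + c ^+ 2 - 2 * f * y * c = S ^+ 2 &
      - (x * y) + z * c + f * (x * c - y * z) = 0].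
Proof.
move=> e1 e2 f S; split; apply/eqP; rewrite -subr_eq0.
- have -> : x ^+ 2 + z ^+ 2 + 2 * f * x * z - S ^+ 2 =
     x ^+ 2 * (1 - (z ^+ 2 + c ^+ 2)) + z ^+ 2 * (1 - (x ^+ 2 + y ^+ 2)) by rewrite /f /S; ring.
  by rewrite e1 e2 subrr !mulr0 addr0.
- have -> : y ^+ 2 + c ^+ 2 - 2 * f * y * c - S ^+ 2 =
     y ^+ 2 * (1 - (z ^+ 2 + c ^+ 2)) + c ^+ 2 * (1 - (x ^+ 2 + y ^+ 2)) by rewrite /f /S; ring.
  by rewrite e1 e2 subrr !mulr0 addr0.
- have -> : - (x * y) + z * c + f * (x * c - y * z) - 0 =
     z * c * (1 - (x ^+ 2 + y ^+ 2)) - x * y * (1 - (z ^+ 2 + c ^+ 2)) by rewrite /f; ring.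
  by rewrite e1 e2 subrr !mulr0 subr0.
Qed.

Variables (w h kap D : R).
Hypothesis w0 : 0 < w.
Hypothesis wpi : w < pi.
Hypothesis h0 : 0 < h.
Hypothesis h1 : h <= 1.
Hypothesis kD : kap ^+ 2 * D = 1.
Hypothesis kap0 : 0 < kap.

Let k := (sin w)^-1.
(** [arc_u] and [arc_v] are the coefficients of the arc of angle w between two unit vectors. The
    pair is then rotated by the small angle [hump h t] towards the identity field, normalised by
    [kap]: the mass stays exactly 1 and interior densities become invertible. *)
Definition arc_u t := k * sin (- w * t + w).
Definition arc_v t := k * sin (w * t + 0).
Definition arc_u' t := k * - w * cos (- w * t + w).
Definition arc_v' t := k * w * cos (w * t + 0).
Definition arc_a t := cos (hump h t) * arc_u t.
Definition arc_b t := cos (hump h t) * arc_v t.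
Definition arc_s t := kap * sin (hump h t).
Definition arc_c' t := - (hump' h t * sin (hump h t)).
Definition arc_a' t := arc_c' t * arc_u t + cos (hump h t) * arc_u' t.
Definition arc_b' t := arc_c' t * arc_v t + cos (hump h t) * arc_v' t.
Definition arc_s' t := kap * (hump' h t * cos (hump h t)).

Lemma is_derive_cos_hump (t : R) : is_derive t 1 (fun t => cos (hump h t)) (arc_c' t).
Proof.
have H := @is_derive1_comp _ cos (hump h) t _ _ (is_derive_cos (hump h t)) (is_derive_hump h t).
apply: is_derive_eq H _; rewrite /arc_c'; ring.
Qed.

Lemma is_derive_sin_hump (t : R) : is_derive t 1 (fun t => sin (hump h t)) (hump' h t * cos (hump h t)).
Proof.
have H := @is_derive1_comp _ sin (hump h) t _ _ (is_derive_sin (hump h t)) (is_derive_hump h t).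
apply: is_derive_eq H _; ring.
Qed.

Lemma arc_da (t : R) : is_derive t 1 arc_a (arc_a' t).
Proof. exact: (is_derive_mul (is_derive_cos_hump t) (is_derive_sin_affine k (- w) w t)). Qed.

Lemma arc_db (t : R) : is_derive t 1 arc_b (arc_b' t).
Proof. exact: (is_derive_mul (is_derive_cos_hump t) (is_derive_sin_affine k w 0 t)). Qed.

Lemma arc_ds (t : R) : is_derive t 1 arc_s (arc_s' t).
Proof.
have H := @is_derive_mul (fun=> kap) _ (fun=> 0) (fun t => hump' h t * cos (hump h t)) t (is_derive_cst kap t 1)
  (is_derive_sin_hump t).
by apply: is_derive_eq H _; rewrite mul0r add0r.
Qed.

Let cc := deriv_continuous is_derive_cos_hump.
Let cs := deriv_continuous is_derive_sin_hump.
Let cb' := deriv_continuous (is_derive_hump' h).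
Let cu := deriv_continuous (is_derive_sin_affine k (- w) w).
Let cv := deriv_continuous (is_derive_sin_affine k w 0).
Let cu' := deriv_continuous (is_derive_cos_affine (k * - w) (- w) w).
Let cv' := deriv_continuous (is_derive_cos_affine (k * w) w 0).

Let cc' : continuous arc_c'.
Proof. by move=> t; apply: cvgN; exact: (continuous_mul cb' cs). Qed.

Lemma arc_ca' : continuous arc_a'.
Proof. exact: (continuous_add (continuous_mul cc' cu) (continuous_mul cc cu')). Qed.

Lemma arc_cb' : continuous arc_b'.
Proof. exact: (continuous_add (continuous_mul cc' cv) (continuous_mul cc cv')). Qed.

Lemma arc_cs' : continuous arc_s'.
Proof. by move=> t; apply: cvgM; [exact: cvg_cst|exact: (continuous_mul cb' cc)]. Qed.

Lemma sin_w_gt0 : 0 < sin w.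
Proof. by apply: sin_gt0_pi; rewrite w0. Qed.

Let kS : k * sin w = 1.
Proof. by rewrite mulVf// gt_eqF// sin_w_gt0. Qed.

Lemma hump0 : hump h 0 = 0. Proof. by rewrite /hump mulr0 mul0r. Qed.
Lemma hump1 : hump h 1 = 0. Proof. by rewrite /hump subrr mulr0. Qed.

Lemma arc_ends : [/\ arc_a 0 = 1, arc_b 0 = 0, arc_s 0 = 0, arc_a 1 = 0 & arc_b 1 = 1] /\ arc_s 1 = 0.
Proof.
rewrite /arc_a /arc_b /arc_s hump0 hump1 cos0 sin0 !mul1r /arc_u /arc_v !mulr0 !mulr1 add0r addNr !addr0 sin0.
by rewrite !mulr0 kS.
Qed.

Lemma arc_s_gt0 t : t \in `]0, 1[ -> 0 < arc_s t.
Proof.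
move=> t01; have /andP[b0 b1] := hump_bounds h0 t01.
rewrite mulr_gt0//; apply: sin_gt0_pi; rewrite b0 /=.
apply: (le_lt_trans b1); apply: (le_lt_trans h1); have := pi_ge2 R; lra.
Qed.

Lemma arc_mass t : arc_a t ^+ 2 + arc_b t ^+ 2 + 2 * arc_a t * arc_b t * cos w + arc_s t ^+ 2 * D = 1.
Proof.
have e1 := cos2Dsin2 (- w * t + w); have e2 := cos2Dsin2 (w * t + 0); have e3 := cos2Dsin2 (hump h t).
rewrite addrC in e1; rewrite addrC in e2.
have [I1 _ _] := sphere_identities e1 e2.
have ew : w = (- w * t + w) + (w * t + 0) by ring.
rewrite -cosD -sinD -ew in I1.
rewrite /arc_a /arc_b /arc_s /arc_u /arc_v.
move: (sin (- w * t + w)) (sin (w * t + 0)) I1 => x z I1.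
have -> : (cos (hump h t) * (k * x)) ^+ 2 + (cos (hump h t) * (k * z)) ^+ 2 +
   2 * (cos (hump h t) * (k * x)) * (cos (hump h t) * (k * z)) * cos w + (kap * sin (hump h t)) ^+ 2 * D =
   cos (hump h t) ^+ 2 * k ^+ 2 * (x ^+ 2 + z ^+ 2 + 2 * cos w * x * z) + (kap ^+ 2 * D) * sin (hump h t) ^+ 2 by ring.
by rewrite I1 kD -mulrA -exprMn kS expr1n mulr1 mul1r.
Qed.

(** Spherical coordinates: squared speed w along the arc, shortened by the cosine of the tilt, plus
    the squared speed of the tilt. *)
Lemma arc_speed t : arc_a' t ^+ 2 + arc_b' t ^+ 2 + 2 * arc_a' t * arc_b' t * cos w + arc_s' t ^+ 2 * D =
  cos (hump h t) ^+ 2 * w ^+ 2 + hump' h t ^+ 2.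
Proof.
have e1 := cos2Dsin2 (- w * t + w); have e2 := cos2Dsin2 (w * t + 0); have e3 := cos2Dsin2 (hump h t).
rewrite addrC in e1; rewrite addrC in e2.
have [I1 I2 I3] := sphere_identities e1 e2.
have ew : w = (- w * t + w) + (w * t + 0) by ring.
rewrite -cosD -sinD -ew in I1 I2 I3.
rewrite /arc_a' /arc_b' /arc_s' /arc_c' /arc_u /arc_v /arc_u' /arc_v'.
move: (sin (- w * t + w)) (sin (w * t + 0)) (cos (- w * t + w)) (cos (w * t + 0)) I1 I2 I3 => x z y c I1 I2 I3.
move: (cos (hump h t)) (sin (hump h t)) (hump' h t) e3 => g s p e3.
have -> : (- (p * s) * (k * x) + g * (k * - w * y)) ^+ 2 + (- (p * s) * (k * z) + g * (k * w * c)) ^+ 2 +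
   2 * (- (p * s) * (k * x) + g * (k * - w * y)) * (- (p * s) * (k * z) + g * (k * w * c)) * cos w +
   (kap * (p * g)) ^+ 2 * D =
   p ^+ 2 * s ^+ 2 * k ^+ 2 * (x ^+ 2 + z ^+ 2 + 2 * cos w * x * z) +
   g ^+ 2 * w ^+ 2 * k ^+ 2 * (y ^+ 2 + c ^+ 2 - 2 * cos w * y * c) -
   2 * p * s * g * k ^+ 2 * w * (- (x * y) + z * c + cos w * (x * c - y * z)) +
   (kap ^+ 2 * D) * p ^+ 2 * g ^+ 2 by ring.
have kS2 : k ^+ 2 * sin w ^+ 2 = 1 by rewrite -exprMn kS expr1n.
rewrite I1 I2 I3 kD mulr0 subr0 -!(mulrA _ (k ^+ 2)) kS2 !mulr1 mul1r.
have -> : p ^+ 2 * s ^+ 2 + g ^+ 2 * w ^+ 2 + p ^+ 2 * g ^+ 2 = g ^+ 2 * w ^+ 2 + p ^+ 2 * (g ^+ 2 + s ^+ 2) by ring.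
by rewrite e3 mulr1.
Qed.

End SphericalArc.

(** * Nearly optimal curves for both distances *)

Section UpperBounds.
Context {R : realType} {Omega : ptopologicalType} {d : nat}.
Notation M := 'M[R[i]]_d.
Notation T := (borel Omega).
Notation hpm := (hpm R Omega d).
Hypothesis metO : metrizable R Omega.
Variables G0 G1 : hpm.

Lemma hellinger_budget (m0 m1 f F D e h : R) : 0 <= D -> 0 < e -> F <= f + e / 4 -> h <= 1 -> 0 <= h ->
  h * (D + 1) <= e / 2 -> m0 + m1 - 2 * f + h ^+ 2 * D <= m0 + m1 - 2 * F + e.
Proof.
move=> D0 e0 Ff h1 h0 hD; have : h ^+ 2 * D <= h * (D + 1).
  rewrite expr2 -mulrA; apply: ler_wpM2l => //.
  by apply: (@le_trans _ _ D); [rewrite ler_piMl|rewrite lerDl].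
by move: (h ^+ 2 * D) => u hu; lra.
Qed.

(** Linear coefficients 1 - t and t and a small hump: the speed is m0 + m1 - 2 times the integral of
    k0 : C, up to the slope of the hump, and that integral nearly reaches the fidelity. *)
Lemma hellinger_upper (e : R) : 0 < e -> exists G U, admissible G0 G1 G U /\
  (energy G U <= (4 * (hpm_mass G0 + hpm_mass G1 - 2 * fidelity G0 G1 + e))%:E)%E.
Proof.
move=> e0; set gam := sum_trmeas G0 G1; have rgam := sum_trmeas_radon metO G0 G1.
have [k0 [r0 t0]] := rep_sumL G0 G1; have [k1 [r1 t1]] := rep_sumR G0 G1.
have e4 : 0 < e / 4 by rewrite divr_gt0.
have [C [bC pC pD Ff]] := fidelity_optimal metO rgam r0 r1 t0 t1 e4.
set D := \int[gam]_x frob (1%:M : M) (1%:M : M).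
have D0 : 0 <= D by apply: Rintegral_ge0 => x _; exact: frob_ge0.
have D1 : 0 < D + 1 by rewrite ltr_wpDl.
pose h := Num.min 1 (e / 2 / (D + 1)).
have h0 : 0 < h by rewrite lt_min ltr01 !divr_gt0.
have h1 : h <= 1 by rewrite ge_min lexx.
have hD : h * (D + 1) <= e / 2 by rewrite -ler_pdivlMr// ge_min lexx orbT.
have da (t : R) : is_derive t 1 (fun t => -1 * t + 1) (-1) by exact: is_derive_affine.
have db (t : R) : is_derive t 1 (fun t => 1 * t + 0) 1 by exact: is_derive_affine.
have c1 (c : R) : continuous ((fun=> c) : R -> R) by move=> t; exact: cvg_cst.
have b_gt0 (t : R) : t \in `]0, 1[ -> 0 < hump h t by move=> t01; have /andP[] := hump_bounds h0 t01.
have a0 : -1 * 0 + 1 = 1 :> R by rewrite mulr0 add0r.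
have b0 : 1 * 0 + 0 = 0 :> R by rewrite mulr0 addr0.
have a1 : -1 * 1 + 1 = 0 :> R by rewrite mulr1 addNr.
have b1 : 1 * 1 + 0 = 1 :> R by rewrite mulr1 addr0.
have := geodesic_curve metO rgam r0 r1 bC pC pD da db (is_derive_hump h) (c1 (-1)) (c1 1)
  (deriv_continuous (is_derive_hump' h)) b_gt0 a0 b0 (hump0 h) a1 b1 (hump1 h).
move=> /(_ (hpm_mass G0 + hpm_mass G1 - 2 * fidelity G0 G1 + e)) [t t01|G [U [adm eU _]]].
  rewrite /curve_speed sqrrN !expr1n !mul1r mulrN1 mulr1.
  apply: le_trans (hellinger_budget _ _ D0 e0 Ff h1 (ltW h0) hD).
  rewrite mulNr lerD2l -/D; apply: ler_wpM2r => //; exact: hump'_sqr.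
by exists G, U.
Qed.

Lemma frob_one_gt0 : hpm_mass G0 = 1 -> 0 < frob (1%:M : M) 1%:M.
Proof.
move=> m0; rewrite lt_neqAle frob_ge0 andbT eq_sym; apply/eqP => /frob_eq0 E.
by move: m0; rewrite /hpm_mass -frob1r E frob0r => /esym/eqP; rewrite oner_eq0.
Qed.

(** Keeping the mass equal to 1 requires the integral of k0 : C to be exactly cos w. As the fidelity
    is reached only approximately, cos w is taken strictly below it and [C] is scaled down, or else
    cos w = 0 and [C = 0]. *)
Lemma fisher_rao_upper (w e : R) : hpm_mass G0 = 1 -> hpm_mass G1 = 1 -> 0 < w -> w < pi ->
  cos w < fidelity G0 G1 /\ 0 < cos w \/ cos w = 0 -> 0 < e ->
  exists G U, [/\ admissible G0 G1 G U, forall t, t \in `[0, 1] -> hpm_mass (G t) = 1 &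
  (energy G U <= (4 * (w ^+ 2 + e))%:E)%E].
Proof.
move=> m0 m1 w0 wpi cw e0; set gam := sum_trmeas G0 G1; have rgam := sum_trmeas_radon metO G0 G1.
have [k0 [r0 t0]] := rep_sumL G0 G1; have [k1 [r1 t1]] := rep_sumR G0 G1.
have [C [bC pC pD fC]] : exists C : T -> M, [/\ bfield C, forall x, posmx (C x),
    forall x, posmx (k1 x - C x *m k0 x *m C x) & \int[gam]_x frob (k0 x) (C x) = cos w].
  case: cw => [[cF c0]|c0].
    have eps : 0 < fidelity G0 G1 - cos w by rewrite subr_gt0.
    have [C [bC pC pD Ff]] := fidelity_optimal metO rgam r0 r1 t0 t1 eps.
    set f := \int[gam]_x frob (k0 x) (C x) in Ff.
    have cf : cos w <= f by move: Ff; move: (fidelity _ _) (cos w) f => *; lra.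
    have f0 : 0 < f by exact: lt_le_trans cf.
    pose l := cos w / f.
    have l0 : 0 <= l by rewrite divr_ge0// ltW.
    have l1 : l <= 1 by rewrite ler_pdivrMr// mul1r.
    exists (fun x => l%:C *: C x); split.
    - exact: bfieldZ bC.
    - by move=> x; exact: posZ l0 (pC x).
    - move=> x.
      (* Shrinking [C] only enlarges the positive remainder, since l is at most 1. *)
      have -> : k1 x - l%:C *: C x *m k0 x *m (l%:C *: C x) =
          (k1 x - C x *m k0 x *m C x) + (1 - l * l)%:C *: (C x *m k0 x *m C x).
        rewrite -!scalemxAl -scalemxAr scale_real rmorphB scalerBl scale1r.
        by rewrite addrA subrK.
      apply: (posD (pD x)); apply: posZ.
        by rewrite subr_ge0 mulr_ile1.
      exact: pos_conj_herm (rep_pos r0 x) (pC x).1.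
    - have iC := rep_integrable r0 bC.
      transitivity (\int[gam]_x (l * frob (k0 x) (C x))).
        by apply: eq_Rintegral => x _; exact: frobZr.
      by rewrite (RintegralZl _ measurableT iC) -/f divfK// gt_eqF.
  exists (fun=> 0); split.
  - exact: bfield_cst.
  - by move=> x; exact: pos0.
  - by move=> x; rewrite mulmx0 subr0; exact: rep_pos r1 x.
  - rewrite c0 (_ : (fun x => frob (k0 x) 0) = (fun=> 0)); last by apply/funext => x; exact: frob0r.
    by rewrite Rintegral_cst// mul0r.
set D := \int[gam]_x frob (1%:M : M) (1%:M : M).
have D0 : 0 < D.
  rewrite /D Rintegral_cst//; apply: mulr_gt0; first exact: frob_one_gt0.
  have -> : fine (gam setT) = hpm_mass G0 + hpm_mass G1 by rewrite /gam sum_trmeasE.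
  by rewrite m0 m1.
(* Makes [kap] times the identity field a unit vector, as the mass identity of the arc requires. *)
pose kap := (Num.sqrt D)^-1.
have kap0 : 0 < kap by rewrite invr_gt0 sqrtr_gt0.
have kD : kap ^+ 2 * D = 1 by rewrite /kap exprVn sqr_sqrtr ?(ltW D0)// mulVf// gt_eqF.
pose h := Num.min 1 e.
have h0 : 0 < h by rewrite lt_min ltr01.
have h1 : h <= 1 by rewrite ge_min lexx.
have he : h <= e by rewrite ge_min lexx orbT.
have [[a0 b0 s0 a1 b1] s1] := arc_ends h kap w0 wpi.
have := geodesic_curve metO rgam r0 r1 bC pC pD (arc_da w h) (arc_db w h) (arc_ds h kap)
  (@arc_ca' _ w h) (@arc_cb' _ w h) (@arc_cs' _ h kap) (arc_s_gt0 h0 h1 kap0) a0 b0 s0 a1 b1 s1.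
move=> /(_ (w ^+ 2 + e)) [t t01|G [U [adm eU mG]]].
  rewrite /curve_speed fC -/D m0 m1 !mulr1.
  have -> : arc_a' w h t ^+ 2 + arc_b' w h t ^+ 2 + 2 * arc_a' w h t * arc_b' w h t * cos w +
     arc_s' h kap t ^+ 2 * D = cos (hump h t) ^+ 2 * w ^+ 2 + hump' h t ^+ 2.
    exact: arc_speed.
  apply: lerD.
    rewrite ler_piMl ?sqr_ge0// -[leRHS](cos2Dsin2 (hump h t)) lerDl sqr_ge0//.
  apply: le_trans (hump'_sqr h t01) _; apply: le_trans he.
  by rewrite expr2 ler_piMl// ltW.
exists G, U; split=> // t _; rewrite mG fC -/D m0 m1 !mulr1.
exact: arc_mass.
Qed.

End UpperBounds.

(** * Exact formulas for the distances and metric axioms on the base *)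

Section Trig.
Context {R : realType}.

Lemma cos_le_iff (x y : R) : 0 <= x <= pi -> 0 <= y <= pi -> (cos x <= cos y) = (y <= x).
Proof. by move=> hx hy; rewrite !leNgt ltr_cos ?in_itv. Qed.

Lemma acos_le_pihalf (x : R) : 0 <= x <= 1 -> acos x <= pi / 2.
Proof.
move=> /andP[x0 x1]; have x11 : -1 <= x <= 1 by rewrite x1 andbT (le_trans _ x0)// lerN10.
have p0 := pi_ge0 R.
rewrite -cos_le_iff; first by rewrite cos_pihalf (acosK _) ?in_itv.
  by apply/andP; split; lra.
by rewrite acos_ge0 ?acos_lepi.
Qed.

Lemma ereal_inf_eq (S : set (\bar R)) (v : R) : (forall x, S x -> (v%:E <= x)%E) ->
  (forall e : R, 0 < e -> exists2 x, S x & (x <= (v + e)%:E)%E) -> ereal_inf S = v%:E.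
Proof.
move=> lo up; apply/eqP; rewrite eq_le; apply/andP; split.
  apply/lee_addgt0Pr => e e0; have [x Sx xe] := up e e0.
  by apply: le_trans (ereal_inf_lbound Sx) _; rewrite -EFinD.
exact: le_ereal_inf_tmp.
Qed.

Lemma sqrt_4 (v : R) : Num.sqrt (4 * v) = 2 * Num.sqrt v.
Proof.
have -> : 4 * v = 2 ^+ 2 * v by congr (_ * _); rewrite expr2 -natrM.
by rewrite sqrtrM ?sqr_ge0// sqrtr_sqr ger0_norm.
Qed.

Lemma angle_perturb (u e : R) : 0 <= u -> u < pi / 2 -> 0 < e -> exists2 w, u < w &
  w < pi / 2 /\ w ^+ 2 <= u ^+ 2 + e.
Proof.
move=> u0 up e0; have p0 := pi_gt0 R.
(* The first bound keeps the angle below pi / 2; the second controls the increase of the square, as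
   2 u + dl is at most pi. *)
pose dl := Num.min ((pi / 2 - u) / 2) (e / pi).
have d0 : 0 < dl by rewrite lt_min !divr_gt0// subr_gt0.
have d1 : dl <= (pi / 2 - u) / 2 by rewrite ge_min lexx.
have d2 : dl <= e / pi by rewrite ge_min lexx orbT.
have d3 : dl * pi <= e by rewrite -ler_pdivlMr.
exists (u + dl); first by rewrite ltrDl.
split; first by lra.
have -> : (u + dl) ^+ 2 = u ^+ 2 + dl * (2 * u + dl) by ring.
rewrite lerD2l; apply: le_trans d3; apply: ler_wpM2l; first exact: ltW.
by lra.
Qed.

End Trig.

Section Distances.
Context {R : realType} {Omega : ptopologicalType} {d : nat}.
Notation hpm := (hpm R Omega d).
Hypothesis metO : metrizable R Omega.

Lemma hellingerE (G0 G1 : hpm) : hellinger G0 G1 =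
  (2 * Num.sqrt (hpm_mass G0 + hpm_mass G1 - 2 * fidelity G0 G1))%:E.
Proof.
rewrite -sqrt_4 /hellinger.
rewrite (ereal_inf_eq (v := 4 * (hpm_mass G0 + hpm_mass G1 - 2 * fidelity G0 G1)))//.
- move=> _ [G [U [adm ->]]]; have [_ _ _ LU _] := adm.
  by rewrite (energy_fin LU) lee_fin; exact: hellinger_lower.
- move=> e e0; have e4 : 0 < e / 4 by rewrite divr_gt0.
  have [G [U [adm eU]]] := hellinger_upper metO G0 G1 e4.
  exists (energy G U); first by exists G, U.
  apply: le_trans eU _; rewrite lee_fin mulrDr; apply: lerD => //.
  by rewrite mulrC divfK.
Qed.

(** The lower bound applies at the angle th itself, nonnegativity of the energy covering th = 0; the
    upper bound applies at angles decreasing to th. *)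
Lemma fisher_raoE (P0 P1 : hpm1 R Omega d) : fisher_rao P0 P1 = (2 * acos (fidelity (sval P0) (sval P1)))%:E.
Proof.
case: P0 P1 => [G0 m0] [G1 m1] /=; move/eqP: m0 (m0) => m0 m0'; move/eqP: m1 (m1) => m1 m1'.
set F := fidelity G0 G1; have F0 : 0 <= F by exact: fidelity_ge0.
have F1 : F <= 1 by exact: fidelity_le1.
have F11 : -1 <= F <= 1 by rewrite F1 andbT (le_trans _ F0)// lerN10.
set th := acos F; have th0 : 0 <= th by exact: acos_ge0.
have p0 := pi_gt0 R.
have th2 : th <= pi / 2 by apply: acos_le_pihalf; rewrite F0.
have cth : cos th = F by apply: acosK; rewrite in_itv.
have -> : 2 * th = Num.sqrt (4 * th ^+ 2) by rewrite sqrt_4 sqrtr_sqr ger0_norm.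
rewrite /fisher_rao /= (ereal_inf_eq (v := 4 * th ^+ 2))//.
- move=> _ [G [U [adm mG ->]]]; have [_ _ _ LU _] := adm.
  rewrite (energy_fin LU) lee_fin; move: th0; rewrite le_eqVlt => /predU1P[<-|thp].
    rewrite expr0n mulr0 -lee_fin -(energy_fin LU) energy_action.
    by apply: integral_ge0 => t _; exact: (action_density_ge0 LU).
  apply: (fisher_rao_lower adm mG thp); last by rewrite cth.
  by apply: le_lt_trans th2 _; lra.
- move=> e e0; have e8 : 0 < e / 8 by rewrite divr_gt0.
  have [w [w0 wpi cw we]] : exists w, [/\ 0 < w, w < pi, cos w < F /\ 0 < cos w \/ cos w = 0 &
      w ^+ 2 <= th ^+ 2 + e / 8].
    (* At th = pi / 2 the fidelity is 0 and th itself is used, with zero cosine; below, a slightly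
       larger angle gives the strict inequality. *)
    move: th2; rewrite le_eqVlt => /predU1P[thE|thlt].
      exists th; split; [by rewrite thE divr_gt0|by rewrite thE; lra|right; by rewrite thE cos_pihalf|].
      by rewrite lerDl ltW.
    have [w thw [wp we]] := angle_perturb th0 thlt e8.
    have w0 : 0 < w by exact: le_lt_trans thw.
    exists w; split=> //; first by lra.
    left; split; last by apply: cos_gt0_pihalf; rewrite wp andbT; lra.
    by rewrite -cth ltr_cos ?in_itv//=; apply/andP; split; lra.
  have [G [U [adm mG eU]]] := fisher_rao_upper metO m0 m1 w0 wpi cw e8.
  exists (energy G U); first by exists G, U.
  apply: le_trans eU _; rewrite lee_fin; move: we; move: (w ^+ 2) (th ^+ 2) => *; lra.
Qed.

Let dX (P0 P1 : hpm1 R Omega d) := fine (fisher_rao P0 P1) / 2.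

Lemma fisher_rao_half P0 P1 : dX P0 P1 = acos (fidelity (sval P0) (sval P1)).
Proof. by rewrite /dX fisher_raoE /= mulrC mulKf. Qed.

Lemma fidelity_bounds (P0 P1 : hpm1 R Omega d) : 0 <= fidelity (sval P0) (sval P1) <= 1.
Proof. by rewrite fidelity_ge0 fidelity_le1//; apply/eqP; [exact: (svalP P0)|exact: (svalP P1)]. Qed.

Lemma cos_fisher_rao_half P0 P1 : cos (dX P0 P1) = fidelity (sval P0) (sval P1).
Proof.
have /andP[F0 F1] := fidelity_bounds P0 P1.
by rewrite fisher_rao_half acosK// in_itv /= F1 andbT (le_trans _ F0)// lerN10.
Qed.

Lemma fisher_rao_half_bounds P0 P1 : 0 <= dX P0 P1 <= pi / 2.
Proof.
have F01 := fidelity_bounds P0 P1; rewrite fisher_rao_half acos_le_pihalf// andbT acos_ge0//.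
by have /andP[F0 ->] := F01; rewrite andbT (le_trans _ F0)// lerN10.
Qed.

Lemma fisher_rao_metric : is_metric dX.
Proof.
have p0 := pi_gt0 R.
have bd P0 P1 : 0 <= dX P0 P1 <= pi.
  by have /andP[-> h] := fisher_rao_half_bounds P0 P1; apply: le_trans h _; lra.
have sep P0 P1 : dX P0 P1 = 0 <-> P0 = P1.
  split=> [E|->]; last first.
    by rewrite fisher_rao_half fidelity_self (eqP (svalP P1)) acos1.
  (* Angle 0 means fidelity 1, which forces equality of the underlying measures; the mass proof is
     irrelevant. *)
  apply/eq_sig_hprop; first by move=> G p q; exact: eq_irrelevance.
  have F1 : fidelity (sval P0) (sval P1) = 1 by rewrite -cos_fisher_rao_half E cos0.
  exact: (fidelity_eq1 metO (eqP (svalP P0)) (eqP (svalP P1)) F1).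
split=> [P0 P1|//|P0 P1|P0 P1 P2].
- by have /andP[] := fisher_rao_half_bounds P0 P1.
- by rewrite !fisher_rao_half fidelity_sym.
have /andP[a0 a2] := fisher_rao_half_bounds P0 P1.
have /andP[b0 b2] := fisher_rao_half_bounds P1 P2.
have /andP[c0 c2] := fisher_rao_half_bounds P0 P2.
move: a0; rewrite le_eqVlt => /predU1P[/esym/sep ->|a0].
  by rewrite lerDr; have /andP[] := fisher_rao_half_bounds P1 P1.
move: b0; rewrite le_eqVlt => /predU1P[/esym/sep ->|b0].
  by rewrite lerDl; have /andP[] := fisher_rao_half_bounds P2 P2.
(* The left side never exceeds pi / 2, so the claim is trivial once the sum reaches pi. *)
have [abpi|piab] := ltP (dX P0 P1 + dX P1 P2) pi; last first.
  by apply: le_trans piab; apply: le_trans c2 _; lra.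
rewrite -cos_le_iff ?bd//; last by rewrite addr_ge0 ?ltW.
rewrite [leRHS]cos_fisher_rao_half.
have m (P : hpm1 R Omega d) : hpm_mass (sval P) = 1 by exact/eqP/(svalP P).
apply: (fidelity_triangle (m P0) (m P1) (m P2) a0 b0 abpi).
  by rewrite -/(dX P0 P1) cos_fisher_rao_half.
by rewrite -/(dX P1 P2) cos_fisher_rao_half.
Qed.

End Distances.

(** * The cone over a metric space of diameter at most pi / 2 *)

Section ConeMetric.
Local Open Scope quotient_scope.
Context {R : realType}.

Lemma norm2_triangle (p q s t : R) :
  Num.sqrt ((p + s) ^+ 2 + (q + t) ^+ 2) <= Num.sqrt (p ^+ 2 + q ^+ 2) + Num.sqrt (s ^+ 2 + t ^+ 2).
Proof.
set A := Num.sqrt (p ^+ 2 + q ^+ 2); set B := Num.sqrt (s ^+ 2 + t ^+ 2).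
have A0 : 0 <= A by exact: sqrtr_ge0.
have B0 : 0 <= B by exact: sqrtr_ge0.
have A2 : A ^+ 2 = p ^+ 2 + q ^+ 2 by rewrite sqr_sqrtr// addr_ge0 ?sqr_ge0.
have B2 : B ^+ 2 = s ^+ 2 + t ^+ 2 by rewrite sqr_sqrtr// addr_ge0 ?sqr_ge0.
have CS : p * s + q * t <= A * B.
  apply: le_trans (ler_norm _) _.
  rewrite -(@ler_pXn2r _ 2) ?nnegrE ?mulr_ge0//.
  rewrite real_normK ?num_real// exprMn A2 B2 -subr_ge0.
  have -> : (p ^+ 2 + q ^+ 2) * (s ^+ 2 + t ^+ 2) - (p * s + q * t) ^+ 2 = (p * t - q * s) ^+ 2 by ring.
  exact: sqr_ge0.
rewrite -[leRHS]ger0_norm ?addr_ge0// -sqrtr_sqr; apply: ler_wsqrtr.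
have -> : (A + B) ^+ 2 = A ^+ 2 + B ^+ 2 + 2 * (A * B) by ring.
rewrite A2 B2; have -> : (p + s) ^+ 2 + (q + t) ^+ 2 = p ^+ 2 + q ^+ 2 + (s ^+ 2 + t ^+ 2) + 2 * (p * s + q * t) by ring.
by rewrite lerD2l ler_wpM2l.
Qed.

(** Third side of the plane triangle with sides r0, r1 and angle th, by the law of cosines. *)
Definition planar (r0 r1 th : R) := Num.sqrt (r0 ^+ 2 + r1 ^+ 2 - 2 * r0 * r1 * cos th).

Lemma planar_sym r0 r1 th : planar r0 r1 th = planar r1 r0 th.
Proof. by rewrite /planar; congr (Num.sqrt _); ring. Qed.

(** Lay the sectors of angles u and v side by side in the plane, with the middle point on the common
    ray, and use the Euclidean triangle inequality; replacing u + v by the smaller w only shortens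
    the left side. *)
Lemma planar_triangle (r0 r1 r2 u v w : R) : 0 <= r0 -> 0 <= r2 -> 0 <= w <= pi -> 0 <= u + v <= pi ->
  w <= u + v -> planar r0 r2 w <= planar r0 r1 u + planar r1 r2 v.
Proof.
move=> h0 h2 w0 uv wuv.
have c1 := cos2Dsin2 u; have c2 := cos2Dsin2 v.
apply: (@le_trans _ _ (planar r0 r2 (u + v))).
  by apply: ler_wsqrtr; rewrite lerD2l lerN2 ler_wpM2l ?mulr_ge0// cos_le_iff.
have e1 : r0 ^+ 2 + r1 ^+ 2 - 2 * r0 * r1 * cos u = (r0 * cos u - r1) ^+ 2 + (r0 * sin u) ^+ 2.
  have -> : (r0 * cos u - r1) ^+ 2 + (r0 * sin u) ^+ 2 =
     r0 ^+ 2 * (cos u ^+ 2 + sin u ^+ 2) + r1 ^+ 2 - 2 * r0 * r1 * cos u by ring.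
  by rewrite c1 mulr1.
have e2 : r1 ^+ 2 + r2 ^+ 2 - 2 * r1 * r2 * cos v = (r1 - r2 * cos v) ^+ 2 + (r2 * sin v) ^+ 2.
  have -> : (r1 - r2 * cos v) ^+ 2 + (r2 * sin v) ^+ 2 =
     r1 ^+ 2 + r2 ^+ 2 * (cos v ^+ 2 + sin v ^+ 2) - 2 * r1 * r2 * cos v by ring.
  by rewrite c2 mulr1.
rewrite /planar e1 e2; apply: le_trans (norm2_triangle _ _ _ _); apply: ler_wsqrtr.
rewrite cosD.
have -> : (r0 * cos u - r1 + (r1 - r2 * cos v)) ^+ 2 + (r0 * sin u + r2 * sin v) ^+ 2 =
  r0 ^+ 2 * (cos u ^+ 2 + sin u ^+ 2) + r2 ^+ 2 * (cos v ^+ 2 + sin v ^+ 2) -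
  2 * r0 * r2 * (cos u * cos v - sin u * sin v) by ring.
by rewrite c1 c2 !mulr1.
Qed.

(** The squared length is (r0 - r1)^2 + 2 r0 r1 (1 - cos th), a sum of nonnegative terms; the
    alternative r0 = 0 is the apex. *)
Lemma planar_eq0 (r0 r1 th : R) : 0 <= r0 -> 0 <= r1 -> 0 <= th <= pi ->
  planar r0 r1 th = 0 -> r0 = r1 /\ (r0 = 0 \/ th = 0).
Proof.
move=> h0 h1 hth /eqP; rewrite sqrtr_eq0 => H.
have c1 := cos_le1 th.
have e : r0 ^+ 2 + r1 ^+ 2 - 2 * r0 * r1 * cos th = (r0 - r1) ^+ 2 + 2 * (r0 * r1) * (1 - cos th) by ring.
have p1 : 0 <= (r0 - r1) ^+ 2 by exact: sqr_ge0.
have p2 : 0 <= 2 * (r0 * r1) * (1 - cos th) by rewrite !mulr_ge0// subr_ge0.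
have /eqP : (r0 - r1) ^+ 2 = 0 by move: H p1 p2; rewrite e; move: (_ ^+ 2) (_ * (1 - _)) => *; lra.
rewrite sqrf_eq0 subr_eq0 => /eqP rr; split=> //.
have : 2 * (r0 * r1) * (1 - cos th) = 0 by move: H p1 p2; rewrite e; move: (_ ^+ 2) (_ * (1 - _)) => *; lra.
move=> /eqP; rewrite -rr !mulf_eq0 pnatr_eq0 /= orbb => /orP[/eqP ->|]; first by left.
rewrite subr_eq0 eq_sym => /eqP ch; right; apply: (@cos_inj R); rewrite ?in_itv /= ?lexx ?pi_ge0//.
by rewrite ch cos0.
Qed.

Variables (X : Type) (dX : X -> X -> R).
Hypothesis mX : is_metric dX.
Hypothesis dX2 : forall x y, dX x y <= pi / 2.

Let rp (c : cone (R := R) X) := repr (c : {eq_quot (cone_equiv (R := R) X)}).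

Lemma cone_eqP (x y : X) (r s : {nonneg R}) : r%:num = s%:num -> (r%:num = 0 \/ x = y) ->
  cone_pt x r = cone_pt y s.
Proof.
move=> rs xy; apply/eqmodP; rewrite /= /cone_rel /=; apply/andP; split; first exact/eqP/val_inj.
by case: xy => [->|->]; rewrite eqxx ?orbT.
Qed.

(** The chosen representative may change the base point only at the apex, where every formula
    ignores it. *)
Lemma cone_reprP (x : X) (r : {nonneg R}) : (rp (cone_pt x r)).2 = r /\
  (r%:num = 0 \/ (rp (cone_pt x r)).1 = x).
Proof.
have : \pi_({eq_quot (cone_equiv (R := R) X)}) (rp (cone_pt x r)) = \pi_({eq_quot (cone_equiv (R := R) X)}) ((x : {classic X}), r).
  by rewrite reprK.
move=> /eqmodP; rewrite /= /cone_rel => /andP[/eqP h] /=; rewrite h => H; split=> //.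
by case/orP: H => [/eqP|/eqP]; [left|right].
Qed.

Lemma cone_ptK (c : cone (R := R) X) : cone_pt (rp c).1 (rp c).2 = c.
Proof. by rewrite /cone_pt -surjective_pairing reprK. Qed.

Lemma cone_distE (c0 c1 : cone X) : cone_dist dX c0 c1 =
  planar (rp c0).2%:num (rp c1).2%:num (dX (rp c0).1 (rp c1).1).
Proof. by rewrite /cone_dist /rp; case: (repr _) => x0 r0; case: (repr _). Qed.

Lemma cone_dist_pt (x y : X) (r s : {nonneg R}) : cone_dist dX (cone_pt x r) (cone_pt y s) =
  planar r%:num s%:num (dX x y).
Proof.
rewrite cone_distE; have [-> xr] := cone_reprP x r; have [-> ys] := cone_reprP y s.
rewrite /planar; case: xr => [->|->]; first by rewrite mulr0 !mul0r.
by case: ys => [->|-> //]; rewrite mulr0 !mul0r.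
Qed.

Lemma cone_metric : is_metric (cone_dist dX).
Proof.
have [d0 dsep dsym dtri] := mX; have p0 := pi_gt0 R.
have bd x y : 0 <= dX x y <= pi by rewrite d0; apply: le_trans (dX2 x y) _; lra.
split=> [c0 c1|c0 c1|c0 c1|c0 c1 c2]; rewrite !cone_distE.
- exact: sqrtr_ge0.
- split=> [|->]; last first.
    rewrite /planar (dsep _ _).2// cos0 mulr1.
    set r := (rp c1).2%:num; have -> : r ^+ 2 + r ^+ 2 - 2 * r * r = 0 by ring.
    exact: sqrtr0.
  move=> /planar_eq0[//|//|//|rr xx]; rewrite -[c0]cone_ptK -[c1]cone_ptK.
  by apply: cone_eqP rr _; case: xx => [h|/dsep h]; [left|right].
- by rewrite dsym planar_sym.
- apply: planar_triangle => //; apply/andP; split; first by rewrite addr_ge0.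
  by rewrite [leRHS]splitr lerD.
Qed.

End ConeMetric.

(** * Identification of the matrix measures with the cone *)

Section Identification.
Context {R : realType} {Omega : ptopologicalType} {d : nat}.
Notation M := 'M[R[i]]_d.
Notation T := (borel Omega).
Notation hpm := (hpm R Omega d).
Notation hpm1 := (hpm1 R Omega d).
Hypothesis metO : metrizable R Omega.

Lemma dirac_radon (a : T) : radon (@dirac _ T a R).
Proof.
move=> A e mA e0; have [aA|aA] := pselect (A a).
  exists [set (a : Omega)]; split; [exact: compact_set1|by move=> _ ->|].
  by rewrite !diracE !mem_set//= -EFinD lte_fin ltrDl.
exists set0; split; [exact: compact0|by []|].
by rewrite !diracE !memNset//= -EFinD lte_fin add0r.
Qed.

(** A Dirac mass times the identity over [d]. A base point is needed to write the apex, the image of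
    the zero measure, as a class of pairs. *)
Lemma hpm1_inhabited : (1 <= d)%N -> exists P : hpm1, True.
Proof.
move=> d1; pose k (_ : T) : M := (d%:R^-1)%:C *: 1%:M.
have d0 : d%:R != 0 :> R by rewrite pnatr_eq0 -lt0n.
have trk : complex.Re (\tr ((d%:R^-1)%:C *: 1%:M : M)) = 1.
  by rewrite mxtraceZ Re_rmul mxtrace1 -(rmorph_nat (real_complex R)) /= mulVf.
have bk : bpos k 1.
  split; [exact: mxmeas_cst| |by move=> x; rewrite /k trk].
  by move=> x; apply: posZ pos1; rewrite invr_ge0.
have [G rG] := hpm_of (gam := @dirac _ T (point : Omega) R) (metrizable_hausdorff metO) (@dirac_radon _) bk.
have mG : hpm_mass G == 1.
  rewrite (mass_rep rG) /k trk Rintegral_cst// mul1r; apply/eqP.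
  by rewrite /= /dirac indicT.
by exists (exist _ G mG).
Qed.

Lemma hpm_mass_eq0 (G : hpm) : hpm_mass G = 0 -> forall A, G A = 0.
Proof.
move=> G0 A; have [mA|nA] := pselect (measurable (A : set T)); last exact: hpm_out.
have : (trmeas G A <= trmeas G setT)%E by apply: le_measure; rewrite ?inE.
rewrite /trmeas -/(hpm_mass G) G0 lee_fin => trA; apply: frobn_eq0; apply/eqP.
by rewrite eq_le frobn_ge0 andbT; exact: le_trans (pos_frobn_le (hpm_pos G A)) trA.
Qed.

Lemma hpm_mass_eq0P (G : hpm) : (forall A, G A = 0) -> hpm_mass G = 0.
Proof. by move=> G0; rewrite /hpm_mass G0 mxtrace0. Qed.

Lemma sqr_radius (G : hpm) : (hpm_radius G)%:num ^+ 2 = hpm_mass G.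
Proof. by rewrite /= sqr_sqrtr// mass_ge0. Qed.

Lemma normalize_ex (G : hpm) : hpm_mass G != 0 ->
  exists P : hpm1, forall A, sval P A = (((hpm_radius G)%:num ^+ 2)^-1)%:C *: G A.
Proof.
move=> G0; rewrite sqr_radius.
have mi : 0 <= (hpm_mass G)^-1 by rewrite invr_ge0 mass_ge0.
have [H HG] := hpm_scale_ex G metO mi.
have mH : hpm_mass H == 1 by rewrite (mass_scale HG) mulVf.
by exists (exist _ H mH).
Qed.

Variable P0 : hpm1.

(** The zero measure is given the arbitrary base point [P0]; its radius is 0, so the cone point does
    not depend on this choice. *)
Lemma normalize_sig (G : hpm) : {P : hpm1 | hpm_mass G != 0 ->
  forall A, sval P A = (((hpm_radius G)%:num ^+ 2)^-1)%:C *: G A}.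
Proof.
apply: cid; have [G0|G0] := eqVneq (hpm_mass G) 0; first by exists P0.
by have [P HP] := normalize_ex G0; exists P.
Qed.

Definition normalize (G : hpm) : hpm1 := sval (normalize_sig G).

Definition to_cone (G : hpm) : cone (R := R) hpm1 := cone_pt (normalize G) (hpm_radius G).

Lemma normalizeE (G : hpm) : hpm_mass G != 0 ->
  forall A, sval (normalize G) A = (((hpm_radius G)%:num ^+ 2)^-1)%:C *: G A.
Proof. exact: (svalP (normalize_sig G)). Qed.

Lemma normalizeK (G : hpm) : hpm_mass G != 0 ->
  forall A, G A = ((hpm_radius G)%:num ^+ 2)%:C *: sval (normalize G) A.
Proof.
move=> G0 A; rewrite (normalizeE G0) scale_real mulfV ?scale1r//.
by rewrite sqr_radius.
Qed.

Lemma radius_eq0 (G : hpm) : ((hpm_radius G)%:num == 0) = (hpm_mass G == 0).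
Proof. by rewrite -(sqr_radius G) sqrf_eq0. Qed.

Lemma to_cone_bij : bijective to_cone.
Proof.
have ex (c : cone (R := R) hpm1) : {H : hpm | exists P r, c = cone_pt P r /\
    forall A, H A = (r%:num ^+ 2)%:C *: sval P A}.
  apply: cid; rewrite -[c]cone_ptK; set P := _.1; set r := _.2.
  have [H HE] := hpm_scale_ex (sval P) metO (sqr_ge0 r%:num).
  by exists H, P, r.
exists (fun c => sval (ex c)) => [G|c].
  case: (ex (to_cone G)) => H /= [P [r [E HE]]].
  have [e1 e2] := cone_reprP (normalize G) (hpm_radius G).
  have [e3 e4] := cone_reprP P r.
  rewrite -[cone_pt P r]E -/(to_cone G) e1 in e3 e4.
  have {}e4 : r%:num = 0 \/ P = normalize G.
    by case: e4 => [->|<-]; [left|case: e2 => [h|->]; [left; rewrite -e3|right]].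
  apply: hpm_ext => A _; rewrite HE -e3.
  have [G0|G0] := eqVneq (hpm_mass G) 0.
    by rewrite sqr_radius G0 scale0r (hpm_mass_eq0 G0).
  case: e4 => [h|->]; last by rewrite -normalizeK.
  by move: G0; rewrite -radius_eq0 e3 h eqxx.
case: (ex c) => H /= [P [r [-> HE]]].
have mH : hpm_mass H = r%:num ^+ 2 by rewrite (mass_scale HE) (eqP (svalP P)) mulr1.
have rH : (hpm_radius H)%:num = r%:num by rewrite /= mH sqrtr_sqr ger0_norm.
apply: cone_eqP => //; have [r0|r0] := eqVneq r%:num 0; first by left; rewrite rH.
right; have H0 : hpm_mass H != 0 by rewrite mH sqrf_eq0.
apply/eq_sig_hprop; first by move=> G p q; exact: eq_irrelevance.
apply: hpm_ext => A _; rewrite (normalizeE H0) rH HE scale_real mulVf ?scale1r//.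
by rewrite sqrf_eq0.
Qed.

(** Mass is the squared radius, the cosine of half the Fisher-Rao distance is the fidelity of the
    normalised measures, and homogeneity restores the radii. At the apex both cross terms vanish. *)
Lemma to_cone_dist (G H : hpm) : fine (hellinger G H) / 2 =
  cone_dist (fun P Q : hpm1 => fine (fisher_rao P Q) / 2) (to_cone G) (to_cone H).
Proof.
rewrite cone_dist_pt /planar !sqr_radius (cos_fisher_rao_half metO) (hellingerE metO) /= mulrC mulKf//.
congr (Num.sqrt (_ - _)).
have [G0|G0] := eqVneq (hpm_mass G) 0; first by rewrite fidelity_mass0// G0 sqrtr0 !mulr0 !mul0r.
have [H0|H0] := eqVneq (hpm_mass H) 0.
  by rewrite fidelity_sym fidelity_mass0// H0 sqrtr0 !mulr0 mul0r.
have pos (K : hpm) : hpm_mass K != 0 -> 0 < (hpm_radius K)%:num.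
  by move=> K0; rewrite lt_neqAle eq_sym radius_eq0 K0 /=.
rewrite (fidelity_scale (pos G G0) (pos H H0) (normalizeK G0) (normalizeK H0)) /=.
by rewrite !mulrA.
Qed.

End Identification.

Theorem theorem5 (R : realType) (Omega : ptopologicalType) (d : nat)
    (d_ge1 : (1 <= d)%N)
    (Omega_separable : separable_space Omega)
    (Omega_loc_compact : locally_compact [set: Omega])
    (Omega_metrizable : metrizable R Omega) :
  (forall G0 G1 : hpm R Omega d, hellinger G0 G1 \is a fin_num) /\
  (forall P0 P1 : hpm1 R Omega d, fisher_rao P0 P1 \is a fin_num) /\
  exists phi : hpm R Omega d -> cone (R := R) (hpm1 R Omega d),
    (forall G : hpm R Omega d, (exists A, G A <> 0) ->
       exists2 P : hpm1 R Omega d,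
         (forall A, sval P A = (((hpm_radius G)%:num ^+ 2)^-1)%:C *: G A) &
         phi G = cone_pt P (hpm_radius G)) /\
    (forall G : hpm R Omega d, (forall A, G A = 0) ->
       forall P : hpm1 R Omega d, phi G = cone_pt P 0%:nng) /\
    metric_cone_via
      (fun P0 P1 : hpm1 R Omega d => fine (fisher_rao P0 P1) / 2)
      (fun G0 G1 : hpm R Omega d => fine (hellinger G0 G1) / 2)
      phi.
Proof.
split; first by move=> G0 G1; rewrite hellingerE.
split; first by move=> P0 P1; rewrite fisher_raoE.
have [P0 _] := hpm1_inhabited Omega_metrizable d_ge1.
have mX := fisher_rao_metric (d := d) Omega_metrizable.
have dX2 (P Q : hpm1 R Omega d) : fine (fisher_rao P Q) / 2 <= pi / 2.
  by have /andP[] := fisher_rao_half_bounds Omega_metrizable P Q.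
have [c0 csep csym ctri] := cone_metric mX dX2.
have bij := to_cone_bij Omega_metrizable P0.
have dE := to_cone_dist Omega_metrizable P0.
exists (to_cone Omega_metrizable P0); split; [|split].
- move=> G [A GA]; have G0 : hpm_mass G != 0 by apply/eqP => /hpm_mass_eq0/(_ A).
  by exists (normalize Omega_metrizable P0 G) => //; exact: normalizeE.
- move=> G /hpm_mass_eq0P G0 P; have r0 : (hpm_radius G)%:num = 0 by rewrite /= G0 sqrtr0.
  by apply: cone_eqP; [exact: r0|left].
split=> //.
- split=> // P Q; apply: le_trans (dX2 P Q) _; have := pi_ge0 R; lra.
(* The axioms are pulled back from the cone; separation uses injectivity of the identification. *)
- split=> [G H|G H|G H|G H K]; rewrite !dE//; split=> [/csep|->]; last exact/csep.
  exact: (bij_inj bij).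
Qed.
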